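(* The Cesàro operator $C$ belongs to the commutator ideal of the Toeplitz algebra, and $$\|C\|_{\mathrm{ess}}=2,\qquad\operatorname{spec}_{\mathrm{ess}}(C)=\{w\in\mathbb C:|w-1|=1\}.$$ For the classical Hilbert matrix $\Gamma$, $$\|\Gamma\|_{\mathrm{ess}}=\pi,\qquad\operatorname{spec}_{\mathrm{ess}}(\Gamma)=[0,\pi].$$
   Context: $H^2$ is the Hardy space of the disc with orthonormal basis $e_n(z)=z^n$, $n\ge0$. $C$ is the bounded operator $Ce_k=\sum_{j\ge k}\frac1{j+1}e_j$, and $\Gamma$ is the bounded operator on $H^2$ with matrix $\Gamma_{jk}=\frac1{j+k+1}$, $j,k\ge0$. With $P:L^2(\mathbb T)\to H^2$ the orthogonal projection and $T_b=PM_b|_{H^2}$, the Toeplitz algebra is the norm-closed $C^*$-algebra generated by all $T_b$, $b\in L^\infty(\mathbb T)$; its commutator ideal is the closed two-sided ideal generated by all commutators of its elements. $\|A\|_{\mathrm{ess}}$ and $\operatorname{spec}_{\mathrm{ess}}(A)$ are the norm and the spectrum of the class of $A$ in the Calkin algebra $B(H^2)/\mathcal K(H^2)$, where $\mathcal K(H^2)$ is the ideal of compact operators. *)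

(* Defs.v *)
From HB Require Import structures.
From mathcomp Require Import all_boot all_order all_algebra.
From mathcomp Require Import all_classical all_reals all_analysis.
From mathcomp Require Import complex.

Set Implicit Arguments.
Unset Strict Implicit.
Unset Printing Implicit Defensive.

Import Order.TTheory GRing.Theory Num.Theory.
Import numFieldNormedType.Exports.

Local Open Scope classical_set_scope.
Local Open Scope ring_scope.
Local Open Scope complex_scope.

Notation cabs := ComplexField.Normc.normc.

Section SquareSummable.
Variable R : realType.

Definition sqsum (a : nat -> R[i]) : R^nat :=
  series (fun n => cabs (a n) ^+ 2).

Definition square_summable : {pred nat -> R[i]} := fun a => `[< cvgn (sqsum a) >].

Lemma sqsum_ge0 a n : 0 <= sqsum a n.
Proof. by rewrite /sqsum /series/=; apply: sumr_ge0 => k _; exact: sqr_ge0. Qed.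

Lemma cabs_ge0 (z : R[i]) : 0 <= cabs z.
Proof. by case: z => x y; exact: sqrtr_ge0. Qed.

Lemma sqsum_nd a : nondecreasing_seq (sqsum a).
Proof.
apply/nondecreasing_seqP => n.
by rewrite /sqsum /series/= big_nat_recr//= lerDl sqr_ge0.
Qed.

Lemma square_summableP a :
  reflect (exists M, forall n, sqsum a n <= M) (a \in square_summable).
Proof.
apply: (iffP idP) => [/asboolP ca|[M aM]].
  by exists (limn (sqsum a)) => n; exact: nondecreasing_cvgn_le (@sqsum_nd a) ca n.
apply/asboolP/nondecreasing_is_cvgn; first exact: sqsum_nd.
by exists M => _ [n _ <-].
Qed.

Lemma sqsum_lim a n : a \in square_summable -> sqsum a n <= limn (sqsum a).
Proof. by move=> /asboolP ca; exact: nondecreasing_cvgn_le (@sqsum_nd a) ca n. Qed.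

Lemma sqsum_lim_ge0 a : a \in square_summable -> 0 <= limn (sqsum a).
Proof. by move=> sa; exact: le_trans (sqsum_ge0 a 0) (sqsum_lim 0 sa). Qed.

Lemma sqsum_lim_le a M : a \in square_summable ->
  (forall n, sqsum a n <= M) -> limn (sqsum a) <= M.
Proof. by move=> /asboolP ca aM; apply: limr_le => //; apply: nearW. Qed.

Lemma sqsumD a b n :
  Num.sqrt (sqsum (a + b) n) <= Num.sqrt (sqsum a n) + Num.sqrt (sqsum b n).
Proof.
elim: n => [|n ih]; first by rewrite /sqsum /series/= !big_geq// sqrtr0 addr0.
have E c : sqsum c n.+1 = Num.sqrt (sqsum c n) ^+ 2 + cabs (c n) ^+ 2.
  by rewrite sqr_sqrtr ?sqsum_ge0// /sqsum /series/= big_nat_recr.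
rewrite !E; set p := Num.sqrt (sqsum a n); set q := Num.sqrt (sqsum b n).
apply: le_trans
  (le_normcD (p +i* cabs (a n) : Rcomplex R) (q +i* cabs (b n) : Rcomplex R)) => /=.
rewrite ler_wsqrtr//; apply: lerD; rewrite ler_sqr ?nnegrE ?addr_ge0 ?sqrtr_ge0 ?cabs_ge0//.
exact: le_normcD.
Qed.

Lemma sqsumZ (c : R[i]) a n : sqsum (c *: a) n = cabs c ^+ 2 * sqsum a n.
Proof.
rewrite /sqsum /series/= mulr_sumr; apply: eq_bigr => k _.
by rewrite -exprMn -ComplexField.Normc.normcM.
Qed.

Lemma square_summable_submod : submod_closed square_summable.
Proof.
split=> [|c a b /square_summableP[M aM] /square_summableP[N bN]].
  apply/square_summableP; exists 0 => n.
  rewrite /sqsum /series/= big1// => k _.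
  by rewrite /= ?expr0n/= addr0 sqrtr0 ?expr0n.
apply/square_summableP.
exists ((Num.sqrt (cabs c ^+ 2 * M) + Num.sqrt N) ^+ 2) => n.
rewrite -[leLHS]sqr_sqrtr ?sqsum_ge0//.
rewrite ler_sqr ?nnegrE ?addr_ge0 ?sqrtr_ge0//.
apply: (le_trans (sqsumD _ _ _)); apply: lerD; apply: ler_wsqrtr => //.
by rewrite sqsumZ ler_wpM2l ?sqr_ge0.
Qed.

HB.instance Definition _ :=
  GRing.isSubmodClosed.Build R[i] (nat -> R[i]) square_summable
    square_summable_submod.

End SquareSummable.

(* A function f(z) = \sum_n a_n z^n of the Hardy space is represented by the
   square-summable sequence of its Taylor coefficients. *)
Record H2 (R : realType) :=
  MkH2 { coef :> nat -> R[i]; _ : coef \in @square_summable R }.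

HB.instance Definition _ (R : realType) := [isSub for @coef R].
HB.instance Definition _ (R : realType) := [Choice of H2 R by <:].
HB.instance Definition _ (R : realType) :=
  [SubChoice_isSubLmodule of H2 R by <:].

Section Hardy.
Variable R : realType.
Local Notation H := (H2 R).
Implicit Types f g h u : H.

Definition h2norm f : R := Num.sqrt (limn (sqsum f)).

Lemma sqsum_cvg f : cvgn (sqsum f).
Proof. by case: f => a /= /asboolP. Qed.

Lemma h2norm_ge0 f : 0 <= h2norm f.
Proof. exact: sqrtr_ge0. Qed.

Lemma h2normD f g : h2norm (f + g) <= h2norm f + h2norm g.
Proof.
rewrite -ler_sqr ?nnegrE ?addr_ge0 ?h2norm_ge0//.
rewrite [X in X ^+ 2 <= _]/h2norm sqr_sqrtr; last first.
  by apply: sqsum_lim_ge0; exact: valP.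
apply: sqsum_lim_le => [|n]; first exact: valP.
rewrite -[leLHS]sqr_sqrtr ?sqsum_ge0// ler_sqr ?nnegrE ?addr_ge0 ?sqrtr_ge0//.
apply: (le_trans (sqsumD _ _ _)); apply: lerD;
  by apply: ler_wsqrtr; exact: sqsum_lim (valP _).
Qed.

Lemma h2normZ (c : R[i]) f : h2norm (c *: f) = cabs c * h2norm f.
Proof.
rewrite /h2norm; have -> : sqsum (c *: f) = (fun n => cabs c ^+ 2 * sqsum f n).
  by apply/funext => n; rewrite -sqsumZ.
rewrite limZr; last exact: sqsum_cvg.
by rewrite sqrtrM ?sqr_ge0// sqrtr_sqr ger0_norm// cabs_ge0.
Qed.

Lemma h2norm0_eq0 f : h2norm f = 0 -> f = 0.
Proof.
move=> /eqP; rewrite sqrtr_eq0 => l0.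
apply/val_inj/funext => n /=.
have := sqsum_lim n.+1 (valP f) => /le_trans/(_ l0).
rewrite /sqsum /series/= big_nat_recr//= => le0.
apply: ComplexField.Normc.eq0_normc; apply/eqP.
rewrite -sqrf_eq0 eq_le sqr_ge0 andbT.
apply: le_trans le0; rewrite lerDr; apply: sumr_ge0 => k _; exact: sqr_ge0.
Qed.

Definition cnorm f : R[i] := (h2norm f)%:C.

Lemma cnormD f g : cnorm (f + g) <= cnorm f + cnorm g.
Proof. by rewrite /cnorm -rmorphD lecR h2normD. Qed.

Lemma cnormZ (c : R[i]) f : cnorm (c *: f) = `|c| * cnorm f.
Proof. by rewrite /cnorm h2normZ rmorphM; congr (_ * _); case: c. Qed.

Lemma cnorm_eq0 f : cnorm f = 0 -> f = 0.
Proof. by move=> [] /h2norm0_eq0. Qed.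

HB.instance Definition _ :=
  Lmodule_isNormed.Build R[i] H cnormD cnormZ cnorm_eq0.

Lemma h2_normE f : `|f| = (h2norm f)%:C.
Proof. by []. Qed.

Definition h2ip f g : R[i] :=
  lim (series (fun n => f n * (g n)^* : R[i]^o) @ \oo).

Lemma delta_summable k :
  (fun n => (n == k)%:R : R[i]) \in @square_summable R.
Proof.
apply/square_summableP; exists 1 => n.
suff -> : sqsum (fun n => (n == k)%:R : R[i]) n = (k < n)%N%:R.
  by case: (k < n)%N.
rewrite /sqsum /series/=; elim: n => [|n ih]; first by rewrite big_geq.
rewrite big_nat_recr//= ih ltnS.
by case: ltngtP => _ /=;
  rewrite ?expr1n expr0n/= addr0 ?sqrtr1 ?sqrtr0 ?expr1n ?expr0n ?addr0 ?add0r.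
Qed.

Definition h2e (k : nat) : H := MkH2 (delta_summable k).

End Hardy.

Section Operators.
Variable R : realType.
Local Notation H := (H2 R).
Implicit Types (A B K T : H -> H) (S I : set (H -> H)).

Definition bounded_op T : Prop :=
  linear T /\ exists M : R, forall f, h2norm (T f) <= M * h2norm f.

Definition opnorm T : R := sup [set h2norm (T f) | f in [set f | h2norm f <= 1]].

Definition compact_op K : Prop :=
  bounded_op K /\ compact (closure (K @` [set f | h2norm f <= 1])).

Definition is_adjoint A B : Prop :=
  forall f g, h2ip (A f) g = h2ip f (B g).

Definition norm_closed S : Prop :=
  forall A, bounded_op A ->
    (forall e : R, 0 < e -> exists2 B, S B & opnorm (A \- B) < e) -> S A.

(* The norm and the invertible elements of the Calkin algebra B(H2)/K(H2),
   expressed on representatives: [A] = [B] iff A - B is compact. *)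
Definition essnorm A : R := inf [set opnorm (A \- K) | K in compact_op].

Definition calkin_eq A B : Prop := compact_op (A \- B).

Definition calkin_invertible A : Prop :=
  exists B, [/\ bounded_op B, calkin_eq (A \o B) id & calkin_eq (B \o A) id].

Definition spec_ess A : set R[i] :=
  [set w | ~ calkin_invertible (fun f => A f - w *: f)].

Definition cstar_subalgebra S : Prop :=
  [/\ S `<=` bounded_op,
      S (fun=> 0) /\ (forall A B, S A -> S B -> S (A \+ B)),
      (forall (c : R[i]) A, S A -> S (fun f => c *: A f)) /\
        (forall A B, S A -> S B -> S (A \o B)),
      forall A B, S A -> bounded_op B -> is_adjoint A B -> S B &
      norm_closed S].

Definition closed_ideal S I : Prop :=
  [/\ I `<=` S,
      I (fun=> 0) /\ (forall A B, I A -> I B -> I (A \+ B)),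
      forall (c : R[i]) A, I A -> I (fun f => c *: A f),
      forall A B, S A -> I B -> I (A \o B) /\ I (B \o A) &
      norm_closed I].

Definition commutator_ideal S : set (H -> H) :=
  smallest (closed_ideal S)
    [set T | exists A B, [/\ S A, S B & T = (A \o B) \- (B \o A)]].

End Operators.

(* A function on the unit circle is a function b : R[i] -> R[i], of which only
   the values b (cis t), 0 <= t <= 2 pi, are used; the circle carries the
   normalized arc length dt / (2 pi). *)
Section Toeplitz.
Variable R : realType.
Local Notation H := (H2 R).
Local Notation mu := (@lebesgue_measure R).
Implicit Types (b F G : R[i] -> R[i]) (f u : H).

Definition cis (t : R) : R[i] := cos t +i* sin t.

Definition circle : set R := `[0, 2 * pi].

Definition circle_measurable F : Prop :=
  measurable_fun circle (fun t => complex.Re (F (cis t))) /\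
  measurable_fun circle (fun t => complex.Im (F (cis t))).

Definition circle_int F : R[i] :=
  ((2 * pi)^-1 * \int[mu]_(t in circle) complex.Re (F (cis t))) +i*
  ((2 * pi)^-1 * \int[mu]_(t in circle) complex.Im (F (cis t))).

Definition in_L2 F : Prop :=
  circle_measurable F /\
  mu.-integrable circle (fun t => (cabs (F (cis t)) ^+ 2)%:E).

Definition in_Linfty b : Prop :=
  circle_measurable b /\
  exists M : R, {ae mu, forall t, circle t -> cabs (b (cis t)) <= M}.

Definition L2ip F G : R[i] := circle_int (fun z => F z * (G z)^*).

Definition L2norm F : R := Num.sqrt (complex.Re (L2ip F F)).

(* The embedding of H^2 into L^2(T): F represents \sum_n f_n z^n, the series
   converging in L^2(T). *)
Definition boundary f F : Prop :=
  in_L2 F /\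
  L2norm (fun z => F z - \sum_(0 <= n < N) f n * z ^+ n) @[N --> \oo] --> (0 : R).

(* f = P G: the difference G - f is orthogonal to every u in H^2, where the
   inner product of f and u is computed in H^2. *)
Definition is_riesz_proj G f : Prop :=
  forall u U, boundary u U -> L2ip G U = h2ip f u.

Definition is_toeplitz b (T : H -> H) : Prop :=
  bounded_op T /\
  forall f F, boundary f F -> is_riesz_proj (fun z => b z * F z) (T f).

Definition toeplitz_algebra : set (H -> H) :=
  smallest (@cstar_subalgebra R)
    [set T | exists2 b, in_Linfty b & is_toeplitz b T].

End Toeplitz.

(* Main.v *)
From HB Require Import structures.
Require Import Defs.
From mathcomp Require Import all_boot all_order all_algebra.
From mathcomp Require Import all_classical all_reals all_analysis.
From mathcomp Require Import measurable_realfun complex ring lra zify.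

(* Cesaro operator. [id - C] is a contraction and commutes with its adjoint up to a compact
   operator, so a Neumann series inverts [C - w] modulo compacts off the circle [|w - 1| = 1].
   On the circle, [1 / w] has real part [1 / 2]; the coefficients of [(1 - z)^(a - 1)], with
   [Re a] decreasing to [1 / 2], are eigenvectors of the adjoint [C^*] for [1 / a], and once
   normalized they form a Weyl sequence.

   Hilbert matrix. The same vectors satisfy [v_j = g_j(a) (Gamma v)_j], where
   [g_j(a) = a \prod_(i <= j) (1 - a^2 / i^2)] tends to [sin (pi a) / pi]. On [Re a = 1 / 2] the
   limit takes all real values at least [1 / pi], which gives Weyl sequences for a dense subset of
   the spectrum; the Schur test at [a = 1 / 2] and positivity of [Gamma] give the other inclusion.

   [C] lies in the Toeplitz algebra. The Toeplitz matrices [1 / (j - k -+ i)] have a product that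
   differs from [ln ((j + 1) / (k + 1)) / (j - k)] by an error that stays in the algebra after
   multiplication by powers of [t = ln ((j + 1) / (k + 1))]. Inductively
   [t^n t / (j - k)], then [phi(t) t / (j - k)] for Lipschitz [phi], is in the algebra, and
   off the diagonal [C_jk = mu(t) t / (j - k)] with [mu(t) = (1 - exp (- t)) / t] for [t > 0],
   [mu(t) = 0] for [t < 0].

   [C] lies in the commutator ideal. For [V = T_h], [h = (1 - z)^(i s)], and the shift [S],
   [C V - V C = i s C V S C]. Modulo the ideal this gives [V S C^2 = 0], hence [C^2 = 0] as [V]
   and [S] are left invertible. With the contraction [U = id - C], the mean of
   [id - U^k] over [k < n] is [C Q_n] for some [Q_n], whence [C = C^2 Q_n + (id - U^n) / n]
   is a norm limit of elements of the ideal. *)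

Set Implicit Arguments.
Unset Strict Implicit.
Unset Printing Implicit Defensive.

Import Order.TTheory GRing.Theory Num.Theory.
Import numFieldNormedType.Exports.
Local Open Scope classical_set_scope.
Local Open Scope complex_scope.
Local Open Scope ring_scope.

(** * Hardy space and bounded operators *)

(** Every compact remainder is built from Hilbert-Schmidt operators and diagonal operators with
    entries tending to 0, so all claims modulo compacts reduce to bounds on matrix entries. The
    membership of [C] in the Toeplitz algebra is not evident: its matrix 1 / (j + 1), cut off above
    the diagonal, depends on j / k rather than on j - k. The logarithm t appears because harmonic
    sums are logarithms up to a convergent error; it is additive along matrix products, so powers of
    t distribute over the factors. Polynomials in t are unbounded but harmless: relative to ((j +
    1)(k + 1))^(-1/2) the kernel t / (j - k) decays exponentially in |t|, and multipliers are
    approximated in the weight exp(|t| / 16). Since mu jumps at 0, it is replaced by a Lipschitz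
    ramp; the error lives on a thin strip below the diagonal and is small by the Schur test. The
    exponent of (1 - z)^(i s) is imaginary to keep the symbol bounded, and s is small so that crude
    bounds show that its mean is not 0. *)

Section ComplexModulus.
Variable R : realType.
Implicit Types (z w : R[i]) (x : R).

Lemma cabsM z w : cabs (z * w) = cabs z * cabs w.
Proof. exact: ComplexField.Normc.normcM. Qed.

Lemma cabsV z : cabs z^-1 = (cabs z)^-1.
Proof. exact: ComplexField.Normc.normcV. Qed.

Lemma cabsD z w : cabs (z + w) <= cabs z + cabs w.
Proof. exact: (@le_normcD R z w). Qed.

Lemma cabsN z : cabs (- z) = cabs z.
Proof. exact: (@normcN R z). Qed.

Lemma cabsB z w : cabs (z - w) <= cabs z + cabs w.
Proof. by rewrite -(cabsN w); exact: cabsD. Qed.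

Lemma cabs_distC z w : cabs (z - w) = cabs (w - z).
Proof. by rewrite -cabsN opprB. Qed.

Lemma cabs0 : cabs (0 : R[i]) = 0.
Proof. exact: ComplexField.Normc.normc0. Qed.

Lemma cabs1 : cabs (1 : R[i]) = 1.
Proof. exact: ComplexField.Normc.normc1. Qed.

Lemma cabs0_eq0 z : cabs z = 0 -> z = 0.
Proof. exact: ComplexField.Normc.eq0_normc. Qed.

Lemma cabs_eq0 z : (cabs z == 0) = (z == 0).
Proof. by apply/eqP/eqP => [/cabs0_eq0|->]; rewrite ?cabs0. Qed.

Lemma cabs_gt0 z : (0 < cabs z) = (z != 0).
Proof. by rewrite lt0r cabs_eq0 cabs_ge0 andbT. Qed.

Lemma cabsX z n : cabs (z ^+ n) = cabs z ^+ n.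
Proof. by elim: n => [|n ih]; rewrite ?expr0 ?cabs1// !exprS cabsM ih. Qed.

Lemma sqr_cabs z : cabs z ^+ 2 = complex.Re z ^+ 2 + complex.Im z ^+ 2.
Proof. by case: z => a b /=; rewrite sqr_sqrtr// addr_ge0 ?sqr_ge0. Qed.

Lemma cabs_real x : cabs x%:C = `|x|.
Proof. by rewrite /= expr0n/= addr0 sqrtr_sqr. Qed.

Lemma cabs_nat n : cabs (n%:R : R[i]) = n%:R.
Proof.
have -> : (n%:R : R[i]) = (n%:R : R)%:C by rewrite rmorph_nat.
by rewrite cabs_real ger0_norm.
Qed.

Lemma conjE z : z^* = conjc z.
Proof. by []. Qed.

Lemma Re_conjc z : complex.Re z^* = complex.Re z.
Proof. by case: z. Qed.

Lemma Im_conjc z : complex.Im z^* = - complex.Im z.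
Proof. by case: z. Qed.

Lemma conj_real x : (x%:C)^* = x%:C :> R[i].
Proof. exact: conjc_real. Qed.

Lemma cabs_conj z : cabs z^* = cabs z.
Proof. rewrite conjE; by case: z => a b /=; rewrite sqrrN. Qed.

Lemma mul_conj z : z * z^* = (cabs z ^+ 2)%:C.
Proof. by rewrite sqr_cabs conjE; case: z => a b /=; simpc; congr (_ +i* _); ring. Qed.

Lemma Re_le_cabs z : `|complex.Re z| <= cabs z.
Proof.
rewrite -(@ler_pXn2r _ 2)// ?nnegrE ?cabs_ge0// sqr_cabs real_normK ?num_real//.
by rewrite lerDl sqr_ge0.
Qed.

Lemma Im_le_cabs z : `|complex.Im z| <= cabs z.
Proof.
rewrite -(@ler_pXn2r _ 2)// ?nnegrE ?cabs_ge0// sqr_cabs real_normK ?num_real//.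
by rewrite lerDr sqr_ge0.
Qed.

Lemma cabs_le_ReIm z : cabs z <= `|complex.Re z| + `|complex.Im z|.
Proof.
rewrite -(@ler_pXn2r _ 2)// ?nnegrE ?cabs_ge0 ?addr_ge0// sqr_cabs.
rewrite sqrrD !real_normK ?num_real// -addrA lerD2l lerDr.
by rewrite mulrn_wge0// mulr_ge0.
Qed.

Lemma cabs_sum (I : Type) (r : seq I) (P : pred I) (F : I -> R[i]) :
  cabs (\sum_(i <- r | P i) F i) <= \sum_(i <- r | P i) cabs (F i).
Proof.
elim/big_rec2: _ => [|i x y _ ih]; first by rewrite cabs0.
by apply: le_trans (cabsD _ _) _; rewrite lerD2l.
Qed.

Lemma cabs_distD z w v : cabs (z - v) <= cabs (z - w) + cabs (w - v).
Proof. by rewrite -[z - v](subrKA w); apply: cabsD. Qed.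

Lemma cabs_ge_dist z w : cabs z - cabs w <= cabs (z - w).
Proof. by rewrite lerBlDr -{1}[z](subrK w); apply: cabsD. Qed.

Lemma cabs_dist_dist z w : `|cabs z - cabs w| <= cabs (z - w).
Proof. by rewrite ler_norml cabs_ge_dist andbT lerNl opprB (cabs_distC z) cabs_ge_dist. Qed.

Lemma Re_sum (I : Type) (r : seq I) (P : pred I) (F : I -> R[i]) :
  complex.Re (\sum_(i <- r | P i) F i) = \sum_(i <- r | P i) complex.Re (F i).
Proof. by elim/big_rec2: _ => // i x y _ <-; case: (F i) y => ? ? []. Qed.

Lemma Im_sum (I : Type) (r : seq I) (P : pred I) (F : I -> R[i]) :
  complex.Im (\sum_(i <- r | P i) F i) = \sum_(i <- r | P i) complex.Im (F i).
Proof. by elim/big_rec2: _ => // i x y _ <-; case: (F i) y => ? ? []. Qed.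

Lemma ReM_real x z : complex.Re (x%:C * z) = x * complex.Re z.
Proof. by case: z => a b /=; rewrite mul0r subr0. Qed.

Lemma ReD z w : complex.Re (z + w) = complex.Re z + complex.Re w.
Proof. by case: z w => ? ? []. Qed.

Lemma ReB z w : complex.Re (z - w) = complex.Re z - complex.Re w.
Proof. by case: z w => ? ? []. Qed.

Lemma ImB z w : complex.Im (z - w) = complex.Im z - complex.Im w.
Proof. by case: z w => ? ? []. Qed.

Lemma normr_cabs z : `|z| = (cabs z)%:C.
Proof. by case: z. Qed.

End ComplexModulus.

(** * Limits of complex sequences *)

Section ComplexLimits.
Variable R : realType.
Implicit Types (u v : nat -> R[i]) (l z : R[i]).

(** Stated with the real-valued modulus, so that estimates stay in the ordered field [R];
    [ctends_cvg] connects it with the topology used in [h2ip]. *)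
Definition ctends u l : Prop :=
  forall e : R, 0 < e -> exists N, forall n, (N <= n)%N -> cabs (u n - l) < e.

Lemma ctends_cst z : ctends (fun=> z) z.
Proof. by move=> e e0; exists 0%N => n _; rewrite subrr cabs0. Qed.

Lemma ctends_ext u v l : (forall n, u n = v n) -> ctends u l -> ctends v l.
Proof. by move=> /funext ->. Qed.

Lemma ctends_eventually u v l N :
  (forall n, (N <= n)%N -> u n = v n) -> ctends u l -> ctends v l.
Proof.
move=> uv ul e e0; have [M uM] := ul e e0; exists (maxn N M) => n.
by rewrite geq_max => /andP[? ?]; rewrite -uv// uM.
Qed.

Lemma ctends_unique u l z : ctends u l -> ctends u z -> l = z.
Proof.
move=> ul uz; apply/subr0_eq/cabs0_eq0/eqP; rewrite eq_le cabs_ge0 andbT.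
apply/ler_addgt0Pr => e e0; rewrite add0r.
have e20 : 0 < e / 2 by rewrite divr_gt0.
have [N uN] := ul _ e20; have [M uM] := uz _ e20.
apply: le_trans (cabs_distD _ (u (maxn N M)) _) _.
rewrite [e]splitr lerD ?ltW// ?uM ?leq_maxr// cabs_distC uN ?leq_maxl//.
Qed.

Lemma ctendsD u v l z : ctends u l -> ctends v z -> ctends (fun n => u n + v n) (l + z).
Proof.
move=> ul vz e e0; have e20 : 0 < e / 2 by rewrite divr_gt0.
have [N uN] := ul _ e20; have [M vM] := vz _ e20.
exists (maxn N M) => n; rewrite geq_max => /andP[Nn Mn].
rewrite opprD addrACA; apply: le_lt_trans (cabsD _ _) _.
by rewrite [e]splitr ltrD ?uN ?vM.
Qed.

Lemma ctendsZ c u l : ctends u l -> ctends (fun n => c * u n) (c * l).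
Proof.
move=> ul e e0; have c0 : 0 < cabs c + 1 by rewrite ltr_wpDl ?cabs_ge0.
have [N uN] := ul (e / (cabs c + 1)) (divr_gt0 e0 c0).
exists N => n /uN un; rewrite -mulrBr cabsM.
apply: (@le_lt_trans _ _ ((cabs c + 1) * cabs (u n - l))).
  by rewrite ler_wpM2r ?cabs_ge0// lerDl.
by rewrite mulrC -ltr_pdivlMr.
Qed.

Lemma ctendsZr c u l : ctends u l -> ctends (fun n => u n * c) (l * c).
Proof. by move=> /(ctendsZ c); rewrite mulrC; apply: ctends_ext => n; rewrite mulrC. Qed.

Lemma ctendsN u l : ctends u l -> ctends (fun n => - u n) (- l).
Proof.
by move=> /(ctendsZ (-1)); rewrite mulN1r; apply: ctends_ext => n; rewrite mulN1r.
Qed.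

Lemma ctendsB u v l z : ctends u l -> ctends v z -> ctends (fun n => u n - v n) (l - z).
Proof. by move=> ul /ctendsN; apply: ctendsD. Qed.

Lemma ctends_conj u l : ctends u l -> ctends (fun n => (u n)^*) l^*.
Proof.
move=> ul e /ul[N uN]; exists N => n /uN.
by rewrite -rmorphB /= cabs_conj.
Qed.

Lemma ctends_cabs_le u l (M : R) : (forall n, cabs (u n) <= M) -> ctends u l -> cabs l <= M.
Proof.
move=> uM ul; apply/ler_addgt0Pr => e /ul[N /(_ _ (leqnn N)) uN].
rewrite -[l](subrKC (u N)); apply: le_trans (cabsD _ _) _.
by apply: lerD => //; rewrite cabs_distC ltW.
Qed.

Lemma ctends_shift k u l : ctends u l <-> ctends (fun n => u (n + k)%N) l.
Proof.
split=> ul e /ul[N uN].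
  by exists N => n Nn; apply: uN; lia.
exists (N + k)%N => n Nn.
have -> : n = (n - k + k)%N by lia.
by apply: uN; lia.
Qed.

Lemma ctends_sum (I : Type) (r : seq I) (F : I -> nat -> R[i]) (L : I -> R[i]) :
  (forall i, ctends (F i) (L i)) ->
  ctends (fun n => \sum_(i <- r) F i n) (\sum_(i <- r) L i).
Proof.
move=> FL; elim: r => [|i r ih].
  by rewrite big_nil; apply: ctends_ext (ctends_cst _) => n; rewrite big_nil.
by rewrite big_cons; apply: ctends_ext (ctendsD (FL i) ih) => n; rewrite big_cons.
Qed.

Lemma ctends_squeeze u l (b : nat -> R) :
  (forall n, cabs (u n - l) <= b n) -> b @ \oo --> (0 : R) -> ctends u l.
Proof.
move=> ub b0 e e0.
have /cvgrPdist_lt/(_ e e0)[N _ bN] := b0; exists N => n Nn.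
apply: le_lt_trans (ub n) _; have := bN n Nn => /=.
by rewrite sub0r normrN; apply: le_lt_trans; exact: ler_norm.
Qed.

Lemma ctends_Re u l : ctends u l -> (fun n => complex.Re (u n)) @ \oo --> complex.Re l.
Proof.
move=> ul; apply/cvgrPdist_lt => e /ul[N uN]; exists N => // n /uN /=.
by rewrite cabs_distC; apply: le_lt_trans; rewrite -ReB; exact: Re_le_cabs.
Qed.

Lemma ctends_Im u l : ctends u l -> (fun n => complex.Im (u n)) @ \oo --> complex.Im l.
Proof.
move=> ul; apply/cvgrPdist_lt => e /ul[N uN]; exists N => // n /uN /=.
by rewrite cabs_distC; apply: le_lt_trans; rewrite -ImB; exact: Im_le_cabs.
Qed.

Lemma ctends_ReIm u (a b : R) : (fun n => complex.Re (u n)) @ \oo --> a ->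
  (fun n => complex.Im (u n)) @ \oo --> b -> ctends u (a +i* b).
Proof.
move=> /cvgrPdist_lt ua /cvgrPdist_lt ub e e0.
have e20 : 0 < e / 2 by rewrite divr_gt0.
have [N _ uN] := ua _ e20; have [M _ uM] := ub _ e20.
exists (maxn N M) => n; rewrite geq_max => /andP[Nn Mn].
apply: le_lt_trans (cabs_le_ReIm _) _; rewrite [e]splitr ltrD//.
  by have := uN n Nn; rewrite distrC ReB.
by have := uM n Mn; rewrite distrC ImB.
Qed.

Lemma ctends_real (u : nat -> R) (l : R) : u @ \oo --> l -> ctends (fun n => (u n)%:C) l%:C.
Proof. by move=> ul; apply: ctends_ReIm => //=; exact: cvg_cst. Qed.

(* The library topology on [R[i]^o] is that of the norm valued in [R[i]]. *)
Lemma ctends_cvg u l : ctends u l <-> (u : nat -> R[i]^o) @ \oo --> (l : R[i]^o).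
Proof.
split=> [ul|/cvgrPdist_lt ul].
  apply/cvgrPdist_lt => -[a b] /=; rewrite ltcE /= => /andP[/eqP-> a0].
  have [N uN] := ul a a0; exists N => // n /uN /=; rewrite cabs_distC normr_cabs.
  by rewrite ltcR.
move=> e e0; have [|N _ uN] := ul e%:C; first by rewrite ltcR.
by exists N => n /uN /=; rewrite cabs_distC normr_cabs ltcR.
Qed.

Lemma ctends_lim u l : ctends u l -> lim ((u : nat -> R[i]^o) @ \oo) = l.
Proof. by move=> /ctends_cvg; apply: cvg_lim; exact: norm_hausdorff. Qed.

Lemma abs_summable_ctends u (M : R) :
  (forall n, \sum_(k < n) cabs (u k) <= M) ->
  exists l, ctends (fun n => \sum_(k < n) u k) l.
Proof.
move=> uM.
have cv (f : R[i] -> R) : (forall z, `|f z| <= cabs z) ->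
    cvgn (series (fun n => f (u n))).
  move=> fz; apply: normed_cvg; apply: nondecreasing_is_cvgn.
    by apply: nondecreasing_series => n _ _; exact: normr_ge0.
  exists M => _ [n _ <-]; apply: le_trans (uM n).
  by rewrite /= /series /= big_mkord; apply: ler_sum => i _.
exists (limn (series (fun n => complex.Re (u n))) +i*
        limn (series (fun n => complex.Im (u n)))).
apply: ctends_ReIm.
  under eq_fun do rewrite Re_sum -(big_mkord xpredT (fun k => complex.Re (u k))).
  exact: (cv _ (@Re_le_cabs R)).
under eq_fun do rewrite Im_sum -(big_mkord xpredT (fun k => complex.Im (u k))).
exact: (cv _ (@Im_le_cabs R)).
Qed.

End ComplexLimits.

Arguments coef : simpl never.

(** Cauchy-Schwarz by induction: the step is the planar inequality for (p, x_n) and (q, y_n), whose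
    defect is the square of p y_n - q x_n. *)
Lemma sum_mul_le_sqrt (R : rcfType) (n : nat) (x y : nat -> R) :
  \sum_(k < n) x k * y k <=
  Num.sqrt (\sum_(k < n) x k ^+ 2) * Num.sqrt (\sum_(k < n) y k ^+ 2).
Proof.
elim: n => [|n ih]; first by rewrite !big_ord0 sqrtr0 mul0r.
rewrite !big_ord_recr /=.
set a := \sum_(k < n) x k ^+ 2 in ih *; set b := \sum_(k < n) y k ^+ 2 in ih *.
have a0 : 0 <= a by apply: sumr_ge0 => k _; exact: sqr_ge0.
have b0 : 0 <= b by apply: sumr_ge0 => k _; exact: sqr_ge0.
apply: (@le_trans _ _ (Num.sqrt a * Num.sqrt b + x n * y n)); first by rewrite lerD2r.
have Ea : a = Num.sqrt a ^+ 2 by rewrite sqr_sqrtr.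
have Eb : b = Num.sqrt b ^+ 2 by rewrite sqr_sqrtr.
rewrite {2}Ea {2}Eb; move: (Num.sqrt a) (Num.sqrt b) => p q.
rewrite -sqrtrM ?addr_ge0 ?sqr_ge0//.
apply: le_trans (ler_norm _) _; rewrite -sqrtr_sqr; apply: ler_wsqrtr.
rewrite -subr_ge0 (_ : _ - _ = (p * y n - q * x n) ^+ 2) ?sqr_ge0//.
by ring.
Qed.

(** * Inner product, truncations and completeness of the Hardy space *)

Section HardySpace.
Variable R : realType.
Local Notation H := (H2 R).
Implicit Types (f g h u : H) (c : R[i]).

Lemma sqsumE (a : nat -> R[i]) n : sqsum a n = \sum_(k < n) cabs (a k) ^+ 2.
Proof. by rewrite /sqsum /series/= big_mkord. Qed.

Lemma h2_ext f g : (forall n, f n = g n) -> f = g.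
Proof. by move=> fg; apply/val_inj/funext. Qed.

Lemma h2coefD f g n : (f + g) n = f n + g n. Proof. by []. Qed.
Lemma h2coefN f n : (- f) n = - f n. Proof. by []. Qed.
Lemma h2coefB f g n : (f - g) n = f n - g n. Proof. by []. Qed.
Lemma h2coefZ c f n : (c *: f) n = c * f n. Proof. by []. Qed.
Lemma coef_h2e k n : h2e R k n = (n == k)%:R. Proof. by []. Qed.

Lemma h2coef_sum (I : Type) (r : seq I) (P : pred I) (F : I -> H) n :
  (\sum_(i <- r | P i) F i) n = \sum_(i <- r | P i) F i n.
Proof. by elim/big_rec2: _ => // i x y _ <-; rewrite h2coefD. Qed.

Lemma sqr_h2norm f : h2norm f ^+ 2 = limn (sqsum f).
Proof. by rewrite sqr_sqrtr// sqsum_lim_ge0//; exact: valP. Qed.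

Lemma sqsum_le_h2norm f n : sqsum f n <= h2norm f ^+ 2.
Proof. by rewrite sqr_h2norm; apply: sqsum_lim; exact: valP. Qed.

Lemma sqrt_sqsum_le f n : Num.sqrt (sqsum f n) <= h2norm f.
Proof.
rewrite -(@ler_pXn2r _ 2)// ?nnegrE ?sqrtr_ge0 ?h2norm_ge0//.
by rewrite sqr_sqrtr ?sqsum_ge0// sqsum_le_h2norm.
Qed.

Lemma h2norm_le f (M : R) : 0 <= M -> (forall n, sqsum f n <= M ^+ 2) -> h2norm f <= M.
Proof.
move=> M0 fM; rewrite -(@ler_pXn2r _ 2)// ?nnegrE ?h2norm_ge0//.
by rewrite sqr_h2norm; apply: sqsum_lim_le => //; exact: valP.
Qed.

Lemma cabs_coef_le f k : cabs (f k) <= h2norm f.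
Proof.
rewrite -(@ler_pXn2r _ 2)// ?nnegrE ?cabs_ge0 ?h2norm_ge0//.
apply: le_trans (sqsum_le_h2norm f k.+1); rewrite sqsumE big_ord_recr /= lerDr.
by apply: sumr_ge0 => i _; exact: sqr_ge0.
Qed.

Lemma h2norm0 : h2norm (0 : H) = 0.
Proof.
apply/eqP; rewrite eq_le h2norm_ge0 andbT; apply: h2norm_le => // n.
rewrite sqsumE expr0n /= big1// => i _.
by have := cabs0 R => /= ->; rewrite expr0n.
Qed.

Lemma h2normN f : h2norm (- f) = h2norm f.
Proof. by rewrite -scaleN1r h2normZ cabsN cabs1 mul1r. Qed.

Lemma h2normB f g : h2norm (f - g) <= h2norm f + h2norm g.
Proof. by rewrite -(h2normN g); exact: h2normD. Qed.

Lemma h2norm_distC f g : h2norm (f - g) = h2norm (g - f).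
Proof. by rewrite -h2normN opprB. Qed.

Lemma h2norm_distD g f h : h2norm (f - h) <= h2norm (f - g) + h2norm (g - h).
Proof. by rewrite -[f - h](subrKA g); apply: h2normD. Qed.

Lemma h2norm_sum (I : Type) (r : seq I) (P : pred I) (F : I -> H) :
  h2norm (\sum_(i <- r | P i) F i) <= \sum_(i <- r | P i) h2norm (F i).
Proof.
elim/big_rec2: _ => [|i x y _ ih]; first by rewrite h2norm0.
by apply: le_trans (h2normD _ _) _; rewrite lerD2l.
Qed.

Lemma sum_cabs_mul_le f g n :
  \sum_(k < n) cabs (f k * (g k)^*) <= h2norm f * h2norm g.
Proof.
under eq_bigr do rewrite cabsM cabs_conj.
apply: le_trans (sum_mul_le_sqrt _ (fun k => cabs (f k)) (fun k => cabs (g k))) _.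
by rewrite -!sqsumE ler_pM ?sqrtr_ge0// sqrt_sqsum_le.
Qed.

Lemma h2ip_ctends f g : ctends (fun n => \sum_(k < n) f k * (g k)^*) (h2ip f g).
Proof.
have [l fl] := abs_summable_ctends (u := fun k => f k * (g k)^*) (sum_cabs_mul_le f g).
suff -> : h2ip f g = l by [].
rewrite /h2ip; apply: ctends_lim; apply: ctends_ext fl => n.
by rewrite /series /= big_mkord.
Qed.

Lemma h2ip_eqP f g l : ctends (fun n => \sum_(k < n) f k * (g k)^*) l -> h2ip f g = l.
Proof. by move=> fl; exact: ctends_unique (h2ip_ctends f g) fl. Qed.

Lemma h2ipDl f g h : h2ip (f + g) h = h2ip f h + h2ip g h.
Proof.
apply: h2ip_eqP; apply: ctends_ext (ctendsD (h2ip_ctends f h) (h2ip_ctends g h)) => n.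
by rewrite -big_split; apply: eq_bigr => k _; rewrite h2coefD mulrDl.
Qed.

Lemma h2ipZl c f g : h2ip (c *: f) g = c * h2ip f g.
Proof.
apply: h2ip_eqP; apply: ctends_ext (ctendsZ c (h2ip_ctends f g)) => n.
by rewrite mulr_sumr; apply: eq_bigr => k _; rewrite h2coefZ mulrA.
Qed.

Lemma h2ip_conj f g : (h2ip f g)^* = h2ip g f.
Proof.
apply/esym/h2ip_eqP; apply: ctends_ext (ctends_conj (h2ip_ctends f g)) => n.
by rewrite rmorph_sum; apply: eq_bigr => k _ /=; rewrite rmorphM /= conjCK mulrC.
Qed.

Lemma h2ipDr f g h : h2ip h (f + g) = h2ip h f + h2ip h g.
Proof. by rewrite -h2ip_conj h2ipDl rmorphD /= !h2ip_conj. Qed.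

Lemma h2ipZr c f g : h2ip g (c *: f) = c^* * h2ip g f.
Proof. by rewrite -h2ip_conj h2ipZl rmorphM /= h2ip_conj. Qed.

Lemma h2ipNl f g : h2ip (- f) g = - h2ip f g.
Proof. by rewrite -scaleN1r h2ipZl mulN1r. Qed.

Lemma h2ipNr f g : h2ip g (- f) = - h2ip g f.
Proof. by rewrite -h2ip_conj h2ipNl rmorphN /= h2ip_conj. Qed.

Lemma h2ipBl f g h : h2ip (f - g) h = h2ip f h - h2ip g h.
Proof. by rewrite h2ipDl h2ipNl. Qed.

Lemma h2ipBr f g h : h2ip h (f - g) = h2ip h f - h2ip h g.
Proof. by rewrite h2ipDr h2ipNr. Qed.

Lemma h2ip_norm f : h2ip f f = (h2norm f ^+ 2)%:C.
Proof.
apply: h2ip_eqP; rewrite sqr_h2norm.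
have fl : sqsum f @ \oo --> limn (sqsum f) by exact: sqsum_cvg.
apply: ctends_ext (ctends_real fl) => n.
by rewrite sqsumE rmorph_sum; apply: eq_bigr => k _; rewrite mul_conj.
Qed.

Lemma cabs_h2ip_le f g : cabs (h2ip f g) <= h2norm f * h2norm g.
Proof.
apply: ctends_cabs_le (h2ip_ctends f g) => n.
exact: le_trans (cabs_sum _ _ _) (sum_cabs_mul_le f g n).
Qed.

Lemma conj_bool (b : bool) : (b%:R : R[i])^* = b%:R.
Proof. by case: b; rewrite ?conjC1 ?conjC0. Qed.

Lemma h2ip_er f k : h2ip f (h2e R k) = f k.
Proof.
apply: h2ip_eqP; apply: (@ctends_eventually _ (fun=> f k) _ _ k.+1) (ctends_cst _) => n kn.
rewrite (bigD1 (Ordinal kn)) //= coef_h2e eqxx. rewrite conj_bool mulr1 big1 ?addr0// => i.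
by rewrite -val_eqE /= => /negbTE ik; rewrite coef_h2e ik conj_bool mulr0.
Qed.

Lemma h2ip_el f k : h2ip (h2e R k) f = (f k)^*.
Proof. by rewrite -h2ip_conj h2ip_er. Qed.

Lemma h2norm_e k : h2norm (h2e R k) = 1.
Proof.
have := h2ip_norm (h2e R k); rewrite h2ip_er coef_h2e eqxx => -[] /esym/eqP.
by rewrite sqrp_eq1 ?h2norm_ge0// => /eqP.
Qed.

Lemma sqr_h2normD f g :
  h2norm (f + g) ^+ 2 = h2norm f ^+ 2 + h2norm g ^+ 2 + 2 * complex.Re (h2ip f g).
Proof.
have := h2ip_norm (f + g); rewrite h2ipDl !h2ipDr !h2ip_norm -(h2ip_conj f g).
move: (h2norm _ ^+ 2) => a; move: (h2norm _ ^+ 2) => b; move: (h2norm _ ^+ 2) => c.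
by case: (h2ip f g) => x y /= [<- _]; ring.
Qed.

Lemma sqr_h2normB f g :
  h2norm (f - g) ^+ 2 = h2norm f ^+ 2 + h2norm g ^+ 2 - 2 * complex.Re (h2ip f g).
Proof.
by rewrite sqr_h2normD h2normN h2ipNr; case: (h2ip f g) => x y /=; rewrite mulrN.
Qed.

Definition h2trunc n f : H := \sum_(k < n) f k *: h2e R k.

Lemma coef_h2trunc n f i : h2trunc n f i = if (i < n)%N then f i else 0.
Proof.
rewrite /h2trunc h2coef_sum; case: ifP => [in_|ni].
  rewrite (bigD1 (Ordinal in_)) //= h2coefZ coef_h2e eqxx mulr1 big1 ?addr0// => k.
  by rewrite -val_eqE /= eq_sym => /negbTE ik; rewrite h2coefZ coef_h2e ik mulr0.
rewrite big1// => k _; rewrite h2coefZ coef_h2e.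
by case: eqP => [ik|]; rewrite ?mulr0//; move: ni; rewrite ik ltn_ord.
Qed.

Lemma h2norm_trunc n f : h2norm (h2trunc n f) ^+ 2 = sqsum f n.
Proof.
have /h2ip_eqP : ctends (fun m => \sum_(k < m) h2trunc n f k * (h2trunc n f k)^*)
    (sqsum f n)%:C.
  apply: (@ctends_eventually _ (fun=> (sqsum f n)%:C) _ _ n) (ctends_cst _) => m nm.
  rewrite sqsumE rmorph_sum /= (big_ord_widen _ (fun k => (cabs (f k) ^+ 2)%:C) nm).
  rewrite big_mkcond /=; apply: eq_bigr => k _; rewrite coef_h2trunc.
  by case: ifP; rewrite ?mul0r// mul_conj.
by rewrite h2ip_norm => -[].
Qed.

Lemma h2norm_trunc_le n f : h2norm (h2trunc n f) <= h2norm f.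
Proof.
rewrite -(@ler_pXn2r _ 2)// ?nnegrE ?h2norm_ge0// h2norm_trunc.
exact: sqsum_le_h2norm.
Qed.

Lemma h2ip_trunc n f g : h2ip (h2trunc n f) g = \sum_(k < n) f k * (g k)^*.
Proof.
rewrite /h2trunc; elim: n => [|n ih].
  by rewrite !big_ord0 -(scale0r (0 : H)) h2ipZl mul0r.
by rewrite !big_ord_recr /= h2ipDl ih h2ipZl h2ip_el.
Qed.

Lemma sqr_h2norm_tail n f :
  h2norm (f - h2trunc n f) ^+ 2 = h2norm f ^+ 2 - sqsum f n.
Proof.
rewrite sqr_h2normB h2norm_trunc -h2ip_conj h2ip_trunc.
have -> : \sum_(k < n) f k * (f k)^* = (sqsum f n)%:C.
  by rewrite sqsumE rmorph_sum; apply: eq_bigr => k _; rewrite mul_conj.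
by rewrite conj_real /=; ring.
Qed.

Lemma h2norm_tail_le n f : h2norm (f - h2trunc n f) <= h2norm f.
Proof.
rewrite -(@ler_pXn2r _ 2)// ?nnegrE ?h2norm_ge0// sqr_h2norm_tail.
by rewrite gerBl sqsum_ge0.
Qed.

Lemma h2trunc_cvg f (e : R) : 0 < e ->
  exists N, forall n, (N <= n)%N -> h2norm (f - h2trunc n f) < e.
Proof.
move=> e0; have e20 : 0 < e ^+ 2 by rewrite exprn_gt0.
have fl : sqsum f @ \oo --> limn (sqsum f) by exact: sqsum_cvg.
have /cvgrPdist_lt/(_ _ e20)[N _ fN] := fl; exists N => n Nn.
rewrite -(@ltr_pXn2r _ 2)// ?nnegrE ?h2norm_ge0 ?ltW// sqr_h2norm_tail sqr_h2norm.
by apply: le_lt_trans (ler_norm _) _; exact: fN.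
Qed.

Lemma mkH2 (a : nat -> R[i]) (M : R) : 0 <= M ->
  (forall n, \sum_(k < n) cabs (a k) ^+ 2 <= M ^+ 2) ->
  exists2 f : H, (forall n, f n = a n) & h2norm f <= M.
Proof.
move=> M0 aM; have sa : a \in @square_summable R.
  by apply/square_summableP; exists (M ^+ 2) => n; rewrite sqsumE.
by exists (MkH2 sa) => //; apply: h2norm_le => // n; rewrite sqsumE; exact: aM.
Qed.

(** The Cauchy modulus [e] survives as the rate of convergence: it passes to the coordinatewise
    limit on finitely many coordinates, hence to the norm. *)
Lemma h2_complete (s : nat -> H) (e : nat -> R) :
  (forall n m, (n <= m)%N -> h2norm (s m - s n) <= e n) -> e @ \oo --> (0 : R) ->
  exists f : H, forall n, h2norm (s n - f) <= e n.
Proof.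
move=> se e0.
have e_ge0 n : 0 <= e n by apply: le_trans (se n n (leqnn n)); exact: h2norm_ge0.
have [a sa] : exists a : nat -> R[i], forall k, ctends (fun n => s n k) (a k).
  suff /choice[a sa] : forall k, exists l, ctends (fun n => s n k) l by exists a.
  move=> k.
  have cv (p : R[i] -> R) : (forall z w, p (z - w) = p z - p w) ->
      (forall z, `|p z| <= cabs z) -> cvgn (fun n => p (s n k)).
    move=> pB pz; apply/cauchy_cvgP/cauchy_ballP => d d0.
    near_simpl; have d20 : 0 < d / 2 by rewrite divr_gt0.
    have /cvgrPdist_lt/(_ _ d20)[N _ eN] := e0.
    have sN m : (N <= m)%N -> `|p (s m k) - p (s N k)| < d / 2.
      move=> Nm; rewrite -pB; apply: le_lt_trans (pz _) _.
      rewrite -h2coefB; apply: le_lt_trans (cabs_coef_le _ _) _.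
      apply: le_lt_trans (se _ _ Nm) _; have := eN N (leqnn N).
      by rewrite /= sub0r normrN ger0_norm.
    exists ([set m | (N <= m)%N], [set m | (N <= m)%N]) => /=.
      by split; exists N.
    move=> [m1 m2] [/= Nm1 Nm2]; rewrite -ball_normE /ball_ /= [d]splitr.
    rewrite -[_ - _](subrKA (p (s N k))); apply: le_lt_trans (ler_normD _ _) _.
    by rewrite ltrD ?sN// distrC sN.
  exists (limn (fun n => complex.Re (s n k)) +i* limn (fun n => complex.Im (s n k))).
  by apply: ctends_ReIm; apply: cv; [exact: ReB|exact: Re_le_cabs|exact: ImB|exact: Im_le_cabs].
have tail n N : \sum_(k < N) cabs (s n k - a k) ^+ 2 <= e n ^+ 2.
  have lim_ : (fun m => \sum_(k < N) cabs (s n k - s m k) ^+ 2) @ \oo -->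
      \sum_(k < N) cabs (s n k - a k) ^+ 2.
    apply: cvg_big => [|k _]; first exact: add_continuous.
    suff c : (fun m => cabs (s n k - s m k)) @ \oo --> cabs (s n k - a k).
      by rewrite expr2; under eq_fun do rewrite expr2; exact: cvgM.
    apply/cvgrPdist_lt => d /(sa k)[M sM]; exists M => // m /sM Mm.
    apply: le_lt_trans Mm; have -> : s m k - a k = (s n k - a k) - (s n k - s m k) by ring.
    exact: cabs_dist_dist.
  rewrite -(cvg_lim _ lim_)//; apply: limr_le; first by apply/cvg_ex; eexists; exact: lim_.
  exists n => // m /= nm.
  have -> : \sum_(k < N) cabs (s n k - s m k) ^+ 2 = sqsum (s n - s m) N.
    by rewrite sqsumE.
  apply: le_trans (sqsum_le_h2norm _ _) _; rewrite h2norm_distC.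
  by rewrite ler_pXn2r ?nnegrE ?h2norm_ge0// se.
(* Only the differences from the sequence are known to be square summable, so the limit is built as
   [s 0 - f0]. *)
have [f0 f0E _] := @mkH2 (fun k => s 0%N k - a k) _ (e_ge0 0%N) (tail 0%N).
exists (s 0%N - f0) => n; apply: h2norm_le => // N; rewrite sqsumE.
apply: le_trans (tail n N); rewrite le_eqVlt; apply/orP; left; apply/eqP.
by apply: eq_bigr => k _; rewrite !h2coefB f0E subKr.
Unshelve. all: by end_near.
Qed.

End HardySpace.

#[local] Opaque h2norm h2ip.

(** * Bounded operators, their matrices and adjoints *)

Section BoundedOperators.
Variable R : realType.
Local Notation H := (H2 R).
Implicit Types (f g h u : H) (c : R[i]) (A B T : H -> H) (M : R).

Definition opbound A M : Prop := forall f, h2norm (A f) <= M * h2norm f.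

Lemma lin0 A : linear A -> A 0 = 0.
Proof. by move=> lA; have := lA (-1) 0 0; rewrite scaleN1r addNr scaleN1r addNr. Qed.

Lemma linD A f g : linear A -> A (f + g) = A f + A g.
Proof. by move=> lA; have := lA 1 f g; rewrite !scale1r. Qed.

Lemma linZ A c f : linear A -> A (c *: f) = c *: A f.
Proof. by move=> lA; have := lA c f 0; rewrite !addr0 lin0// addr0. Qed.

Lemma linN A f : linear A -> A (- f) = - A f.
Proof. by move=> lA; rewrite -scaleN1r linZ// scaleN1r. Qed.

Lemma linB A f g : linear A -> A (f - g) = A f - A g.
Proof. by move=> lA; rewrite linD// linN. Qed.

Lemma lin_sum A (I : Type) (r : seq I) (P : pred I) (F : I -> H) : linear A ->
  A (\sum_(i <- r | P i) F i) = \sum_(i <- r | P i) A (F i).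
Proof.
by move=> lA; elim/big_rec2: _ => [|i x y _ <-]; [exact: lin0|exact: linD].
Qed.

Lemma bounded_opM A : bounded_op A -> exists2 M, 0 <= M & opbound A M.
Proof.
move=> [_ [M AM]]; exists `|M| => // f; apply: le_trans (AM f) _.
by rewrite ler_wpM2r ?h2norm_ge0// ler_norm.
Qed.

Lemma bounded_op0 : bounded_op (fun=> 0 : H).
Proof.
split=> [c f g|]; first by rewrite scaler0 addr0.
by exists 0 => f; rewrite mul0r h2norm0.
Qed.

Lemma bounded_op_id : bounded_op (id : H -> H).
Proof. by split=> //; exists 1 => f; rewrite mul1r. Qed.

Lemma opboundD A B (M N : R) : opbound A M -> opbound B N -> opbound (A \+ B) (M + N).
Proof. by move=> AM BN f; rewrite mulrDl; apply: le_trans (h2normD _ _) _; rewrite lerD. Qed.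

Lemma opboundB A B (M N : R) : opbound A M -> opbound B N -> opbound (A \- B) (M + N).
Proof. by move=> AM BN f; rewrite mulrDl; apply: le_trans (h2normB _ _) _; rewrite lerD. Qed.

Lemma opboundZ c A M : opbound A M -> opbound (fun f => c *: A f) (cabs c * M).
Proof. by move=> AM f; rewrite h2normZ -mulrA ler_wpM2l ?cabs_ge0. Qed.

Lemma opbound_comp A B (M N : R) : 0 <= M ->
  opbound A M -> opbound B N -> opbound (A \o B) (M * N).
Proof.
by move=> M0 AM BN f; apply: le_trans (AM _) _; rewrite -mulrA ler_wpM2l.
Qed.

Lemma bounded_opD A B : bounded_op A -> bounded_op B -> bounded_op (A \+ B).
Proof.
move=> [lA [M AM]] [lB [N BN]]; split=> [c f g|]; last by exists (M + N); exact: opboundD.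
by rewrite /= lA lB scalerDr addrACA.
Qed.

Lemma bounded_opB A B : bounded_op A -> bounded_op B -> bounded_op (A \- B).
Proof.
move=> [lA [M AM]] [lB [N BN]]; split=> [c f g|]; last by exists (M + N); exact: opboundB.
by rewrite /= lA lB scalerBr opprD addrACA.
Qed.

Lemma bounded_opZ c A : bounded_op A -> bounded_op (fun f => c *: A f).
Proof.
move=> [lA [M AM]]; split=> [d f g|]; last by exists (cabs c * M); exact: opboundZ.
by rewrite lA scalerDr !scalerA mulrC.
Qed.

Lemma bounded_op_comp A B : bounded_op A -> bounded_op B -> bounded_op (A \o B).
Proof.
move=> bA bB; have [M M0 AM] := bounded_opM bA; have [N N0 BN] := bounded_opM bB.
split; last by exists (M * N); exact: opbound_comp.
by move=> c f g; case: bA bB => lA _ [lB _]; rewrite /= lB lA.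
Qed.

Lemma opnorm_has_sup A : bounded_op A ->
  has_sup [set h2norm (A f) | f in [set f | h2norm f <= 1]].
Proof.
move=> /bounded_opM[M M0 AM]; split.
  by exists (h2norm (A 0)); exists 0 => //=; rewrite h2norm0.
exists M => _ [f /= f1 <-]; apply: le_trans (AM f) _.
by rewrite -[leRHS]mulr1 ler_wpM2l.
Qed.

Lemma opnorm_ub A f : bounded_op A -> h2norm f <= 1 -> h2norm (A f) <= opnorm A.
Proof. by move=> bA f1; apply: (ub_le_sup (opnorm_has_sup bA).2); exists f. Qed.

Lemma opnorm_le A M : bounded_op A -> 0 <= M -> opbound A M -> opnorm A <= M.
Proof.
move=> bA M0 AM; apply: ge_sup; first by have [] := opnorm_has_sup bA.
move=> _ [f /= f1 <-]; apply: le_trans (AM f) _.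
by rewrite -[leRHS]mulr1 ler_wpM2l.
Qed.

Lemma opnorm_ge0 A : bounded_op A -> 0 <= opnorm A.
Proof.
move=> bA; apply: le_trans (h2norm_ge0 (A 0)) _; apply: opnorm_ub => //.
by rewrite h2norm0.
Qed.

(** Take [g = A f] and cancel one factor [h2norm (A f)]. *)
Lemma opbound_form A M : 0 <= M ->
  (forall f g, cabs (h2ip (A f) g) <= M * h2norm f * h2norm g) -> opbound A M.
Proof.
move=> M0 AM f; have := AM f (A f).
rewrite h2ip_norm cabs_real ger0_norm ?sqr_ge0// expr2.
have [->|Af] := eqVneq (h2norm (A f)) 0; first by rewrite mulr_ge0 ?h2norm_ge0.
by rewrite ler_pM2r// lt0r Af h2norm_ge0.
Qed.

(** Testing a bounded form on the vector that it produces bounds a squared norm by its own square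
    root; this cancels the root. *)
Lemma sqrt_le_of_le_mul (s M : R) : 0 <= s -> 0 <= M -> s <= M * Num.sqrt s -> s <= M ^+ 2.
Proof.
move=> s0 M0; set t := Num.sqrt s; have -> : s = t ^+ 2 by rewrite sqr_sqrtr.
have t0 : 0 <= t by exact: sqrtr_ge0.
have [->|tN] := eqVneq t 0; first by rewrite expr0n /= sqr_ge0.
by rewrite expr2 ler_pM2r ?lt0r ?tN// => tM; rewrite -expr2 ler_pXn2r.
Qed.

(* Rows of a bounded form are square summable, so they define an operator by [(A f)_j = <f, r_j>]. *)
Lemma form_op (E : nat -> nat -> R[i]) M : 0 <= M ->
  (forall m n (a b : nat -> R[i]),
    cabs (\sum_(j < m) \sum_(k < n) E j k * a k * (b j)^*) <=
    M * Num.sqrt (\sum_(k < n) cabs (a k) ^+ 2) * Num.sqrt (\sum_(j < m) cabs (b j) ^+ 2)) ->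
  exists A, [/\ bounded_op A, opbound A M & forall j k, A (h2e R k) j = E j k].
Proof.
move=> M0 EM.
(* The form is tested on [c] and on the vector a_k = \sum_j c_j (E j k)^*, where it takes the value
   |a|^2. *)
have colM m n (c : nat -> R[i]) :
    \sum_(k < n) cabs (\sum_(j < m) c j * (E j k)^*) ^+ 2 <=
    (M * Num.sqrt (\sum_(j < m) cabs (c j) ^+ 2)) ^+ 2.
  apply: sqrt_le_of_le_mul; first by apply: sumr_ge0 => *; exact: sqr_ge0.
    by rewrite mulr_ge0 ?sqrtr_ge0.
  have := EM m n (fun k => \sum_(j < m) c j * (E j k)^*) c.
  move=> h; rewrite [leRHS]mulrAC; apply: le_trans h; rewrite exchange_big /=.
  rewrite (_ : \sum_(k < n) _ =
    (\sum_(k < n) cabs (\sum_(j < m) c j * (E j k)^*) ^+ 2)%:C); last first.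
    rewrite rmorph_sum; apply: eq_bigr => k _ /=.
    rewrite -mul_conj rmorph_sum mulr_sumr; apply: eq_bigr => j _ /=.
    by rewrite rmorphM /= conjCK mulrAC mulrC [E j k * _]mulrC.
  by rewrite cabs_real ler_norm.
have [r rE] : exists r : nat -> H, forall j k, r j k = (E j k)^*.
  suff /choice[r rE] : forall j, exists f : H, forall k, f k = (E j k)^* by exists r.
  move=> j; have [|f fE _] := @mkH2 R (fun k => (E j k)^*) _ M0; last by exists f.
  move=> n; have := colM j.+1 n (fun i => (i == j)%:R).
  have -> : \sum_(i < j.+1) cabs ((nat_of_ord i == j)%:R : R[i]) ^+ 2 = 1.
    rewrite (bigD1 ord_max) //= eqxx cabs1 expr1n big1 ?addr0// => i.
    by rewrite -val_eqE /= => /negbTE ->; rewrite cabs0 expr0n.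
  rewrite sqrtr1 mulr1; apply: le_trans; rewrite le_eqVlt; apply/orP; left.
  apply/eqP; apply: eq_bigr => k _.
  rewrite (bigD1 ord_max) //= eqxx mul1r big1 ?addr0// => i.
  by rewrite -val_eqE /= => /negbTE ->; rewrite mul0r.
have Af f : exists2 g : H, (forall j, g j = h2ip f (r j)) & h2norm g <= M * h2norm f.
  apply: mkH2; first by rewrite mulr_ge0 ?h2norm_ge0.
  move=> m; set c := fun j => h2ip f (r j); pose g := \sum_(j < m) c j *: r j.
  have gM : h2norm g <= M * Num.sqrt (\sum_(j < m) cabs (c j) ^+ 2).
    apply: h2norm_le => [|n]; first by rewrite mulr_ge0 ?sqrtr_ge0.
    rewrite sqsumE; apply: le_trans (colM m n c); rewrite le_eqVlt; apply/orP; left.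
    apply/eqP; apply: eq_bigr => k _; rewrite /g h2coef_sum.
    by congr (cabs _ ^+ 2); apply: eq_bigr => j _; rewrite h2coefZ rE.
  apply: sqrt_le_of_le_mul; first by apply: sumr_ge0 => *; exact: sqr_ge0.
    by rewrite mulr_ge0 ?h2norm_ge0.
  have fg : h2ip f g = (\sum_(j < m) cabs (c j) ^+ 2)%:C.
    rewrite -h2ip_conj /g; elim: (m) => [|p ih].
      by rewrite !big_ord0 -(scale0r (0 : H)) h2ipZl mul0r rmorph0.
    rewrite !big_ord_recr /= h2ipDl rmorphD /= ih h2ipZl rmorphM /= h2ip_conj.
    by rewrite rmorphD /= -mul_conj mulrC.
  have := cabs_h2ip_le f g; rewrite fg cabs_real ger0_norm; last first.
    by apply: sumr_ge0 => *; exact: sqr_ge0.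
  move=> /le_trans; apply; rewrite -mulrA [leRHS]mulrCA.
  by rewrite ler_wpM2l ?h2norm_ge0.
have /choice[A AE] : forall f, exists g : H, (forall j, g j = h2ip f (r j)) /\
    h2norm g <= M * h2norm f.
  by move=> f; have [g ? ?] := Af f; exists g.
exists A; split; last by move=> j k; rewrite (AE _).1 h2ip_el rE conjCK.
  split; last by exists M => f; have [] := AE f.
  move=> c f g; apply: h2_ext => j.
  by rewrite h2coefD h2coefZ !(AE _).1 h2ipDl h2ipZl.
by move=> f; have [] := AE f.
Qed.

Lemma adjoint_sym A B : is_adjoint A B -> is_adjoint B A.
Proof. by move=> AB f g; rewrite -h2ip_conj -AB h2ip_conj. Qed.

Lemma opbound_adjoint A B M : 0 <= M -> is_adjoint A B -> opbound A M -> opbound B M.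
Proof.
move=> M0 AB AM; apply: opbound_form => // f g.
rewrite (adjoint_sym AB) ; apply: le_trans (cabs_h2ip_le _ _) _.
by rewrite -mulrA mulrCA ler_wpM2l ?h2norm_ge0.
Qed.

(** The coordinates are forced: (B f)_j = <f, A e_j>. They are square summable by testing [f]
    against [A g], with [g] the finite vector of these very coefficients. The adjoint identity holds
    on truncations and extends by density. *)
Lemma adjoint_exists A : bounded_op A -> exists2 B, bounded_op B & is_adjoint A B.
Proof.
move=> bA; have [M M0 AM] := bounded_opM bA.
have Bf f : exists g : H, forall j, g j = h2ip f (A (h2e R j)).
  have [||g gE _] := @mkH2 R (fun j => h2ip f (A (h2e R j))) (M * h2norm f).
  - by rewrite mulr_ge0 ?h2norm_ge0.
  - move=> n; set c := fun j => h2ip f (A (h2e R j)).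
    pose g := \sum_(j < n) c j *: h2e R j.
    have gn : h2norm g ^+ 2 = \sum_(j < n) cabs (c j) ^+ 2.
      have := h2ip_norm g; rewrite {1}/g.
      have -> : h2ip (\sum_(j < n) c j *: h2e R j) g = \sum_(j < n) c j * (g j)^*.
        elim: (n) => [|p ih]; first by rewrite !big_ord0 -(scale0r (0 : H)) h2ipZl mul0r.
        by rewrite !big_ord_recr /= h2ipDl ih h2ipZl h2ip_el.
      move=> /(congr1 (@complex.Re R)) /= <-; rewrite Re_sum; apply: eq_bigr => j _.
      have -> : g j = c j.
        rewrite /g h2coef_sum (bigD1 j) //= h2coefZ coef_h2e eqxx mulr1 big1 ?addr0// => i.
        by rewrite -val_eqE /= eq_sym => /negbTE ij; rewrite h2coefZ coef_h2e ij mulr0.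
      by rewrite mul_conj.
    have fg : h2ip f (A g) = (\sum_(j < n) cabs (c j) ^+ 2)%:C.
      rewrite /g lin_sum; last by case: bA.
      rewrite -h2ip_conj; elim: (n) => [|p ih].
        by rewrite !big_ord0 -(scale0r (0 : H)) h2ipZl mul0r rmorph0.
      rewrite !big_ord_recr /= h2ipDl rmorphD /= ih linZ; last by case: bA.
      rewrite h2ipZl rmorphM /= h2ip_conj.
      by rewrite rmorphD /= -mul_conj mulrC.
    apply: sqrt_le_of_le_mul; first by apply: sumr_ge0 => *; exact: sqr_ge0.
      by rewrite mulr_ge0 ?h2norm_ge0.
    have := cabs_h2ip_le f (A g); rewrite fg cabs_real ger0_norm; last first.
      by apply: sumr_ge0 => *; exact: sqr_ge0.
    move=> /le_trans; apply; rewrite -gn sqrtr_sqr ger0_norm ?h2norm_ge0//.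
    by rewrite -mulrA [leRHS]mulrCA ler_wpM2l ?h2norm_ge0.
  by exists g.
have [B BE] := choice Bf.
have BA : forall f k, h2ip (A (h2e R k)) f = h2ip (h2e R k) (B f).
  by move=> f k; rewrite h2ip_el BE h2ip_conj.
have AB : is_adjoint A B.
  move=> f g; apply/subr0_eq/cabs0_eq0/eqP; rewrite eq_le cabs_ge0 andbT.
  have tr n : h2ip (A (h2trunc n f)) g = h2ip (h2trunc n f) (B g).
    case: (bA) => lA _; rewrite /h2trunc lin_sum//.
    elim: n => [|n ih]; first by rewrite !big_ord0 -(scale0r (0 : H)) !h2ipZl !mul0r.
    by rewrite !big_ord_recr /= !h2ipDl ih linZ// !h2ipZl BA.
  apply/ler_addgt0Pr => e e0; rewrite add0r.
  pose K := M * h2norm g + h2norm (B g) + 1.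
  have K0 : 0 < K by rewrite ltr_wpDl// addr_ge0 ?mulr_ge0 ?h2norm_ge0.
  have [N /(_ N (leqnn N)) fN] := h2trunc_cvg f (divr_gt0 e0 K0).
  have -> : h2ip (A f) g - h2ip f (B g) =
      h2ip (A (f - h2trunc N f)) g - h2ip (f - h2trunc N f) (B g).
    rewrite linB; last by case: bA.
    by rewrite !h2ipBl tr opprB addrA addrNK.
  apply: le_trans (cabsB _ _) _.
  apply: (@le_trans _ _ (K * h2norm (f - h2trunc N f))); last first.
    by rewrite mulrC -ler_pdivlMr// ltW.
  rewrite /K !mulrDl; apply: (@le_trans _ _ (M * h2norm g * h2norm (f - h2trunc N f) +
    h2norm (B g) * h2norm (f - h2trunc N f))).
    apply: lerD.
      apply: le_trans (cabs_h2ip_le _ _) _.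
      by rewrite mulrAC ler_wpM2r ?h2norm_ge0.
    by rewrite mulrC cabs_h2ip_le.
  by rewrite lerDl mul1r h2norm_ge0.
exists B => //; split; last by exists M; exact: opbound_adjoint AM.
move=> c f g; apply: h2_ext => j.
by rewrite h2coefD h2coefZ !BE h2ipDl h2ipZl.
Qed.

(** The bridge from matrices to operators: the coordinate (A f)_j is <f, A^* e_j>, and the series is
    that inner product. *)
Lemma coef_op A f j : bounded_op A ->
  ctends (fun n => \sum_(k < n) f k * A (h2e R k) j) (A f j).
Proof.
move=> bA; have [B bB AB] := adjoint_exists bA.
rewrite -(h2ip_er (A f) j) AB; apply: ctends_ext (h2ip_ctends f (B (h2e R j))) => n.
apply: eq_bigr => k _; congr (_ * _).
by rewrite -h2ip_el -AB h2ip_er.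
Qed.

Lemma op_ext A B : bounded_op A -> bounded_op B ->
  (forall k, A (h2e R k) = B (h2e R k)) -> A = B.
Proof.
move=> bA bB AB; apply/funext => f; apply: h2_ext => j.
apply: ctends_unique (coef_op f j bA) _.
by apply: ctends_ext (coef_op f j bB) => n; apply: eq_bigr => k _; rewrite AB.
Qed.

Lemma coef_adjoint A B j k : is_adjoint A B -> B (h2e R k) j = (A (h2e R j) k)^*.
Proof. by move=> AB; rewrite -(h2ip_er (B _)) (adjoint_sym AB) h2ip_el. Qed.

Lemma adjoint_of_coef A B : bounded_op A -> bounded_op B ->
  (forall j k, B (h2e R k) j = (A (h2e R j) k)^*) -> is_adjoint A B.
Proof.
move=> bA bB BE; have [B' bB' AB'] := adjoint_exists bA.
suff -> : B = B' by [].
by apply: op_ext => // k; apply: h2_ext => j; rewrite BE (coef_adjoint _ _ AB').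
Qed.

End BoundedOperators.

(** * Compact operators *)

Section Compactness.
Variable R : realType.
Local Notation H := (H2 R).
Implicit Types (f g h u : H) (A B K T : H -> H) (M e : R).

Lemma exists_inv_nat_lt e : 0 < e -> exists n : nat, n.+1%:R^-1 < e.
Proof. by move=> /ltr_add_invr[n]; rewrite add0r; exists n. Qed.

Lemma h2_nbhsP f (P : set H) :
  nbhs f P <-> exists2 e : R, 0 < e & forall g, h2norm (f - g) < e -> P g.
Proof.
split=> [/nbhs_normP[[a b] /= +] fP|[e e0 fP]].
  rewrite ltcE /= => /andP[/eqP b0 a0]; exists a => // g fg; apply: fP => /=.
  by rewrite h2_normE b0 ltcR.
apply/nbhs_normP; exists e%:C; first by rewrite /= ltcR.
by move=> g /=; rewrite h2_normE ltcR; exact: fP.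
Qed.

Lemma h2_cvgP (F : nat -> H) f :
  F @ \oo --> f <-> (fun n => h2norm (F n - f)) @ \oo --> (0 : R).
Proof.
split=> [Ff|/cvgrPdist_lt Ff].
  apply/cvgrPdist_lt => e e0.
  have /Ff : nbhs f [set g | h2norm (f - g) < e] by apply/h2_nbhsP; exists e.
  by move=> [N _ FN]; exists N => // n /FN /=; rewrite sub0r normrN ger0_norm ?h2norm_ge0// h2norm_distC.
move=> P /h2_nbhsP[e e0 fP]; have [N _ FN] := Ff e e0; exists N => // n /FN /=.
by rewrite sub0r normrN ger0_norm ?h2norm_ge0// h2norm_distC; exact: fP.
Qed.

Lemma h2norm_tail_nd m n f : (m <= n)%N ->
  h2norm (f - h2trunc n f) <= h2norm (f - h2trunc m f).
Proof.
have n0 : h2norm (f - h2trunc n f) \is Num.nneg by exact: h2norm_ge0.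
have m0 : h2norm (f - h2trunc m f) \is Num.nneg by exact: h2norm_ge0.
rewrite -(ler_pXn2r (ltn0Sn 1) n0 m0) [leRHS]sqr_h2norm_tail [leLHS]sqr_h2norm_tail.
rewrite lerD2l lerN2 !sqsumE -!(big_mkord xpredT (fun k => cabs (f k) ^+ 2)) => mn.
by rewrite (big_cat_nat (leq0n m) mn) /= lerDl sumr_ge0// => k _; exact: sqr_ge0.
Qed.

Lemma h2truncD n f g : h2trunc n (f + g) = h2trunc n f + h2trunc n g.
Proof.
apply: h2_ext => k; rewrite h2coefD !coef_h2trunc h2coefD.
by case: ifP => //; rewrite addr0.
Qed.

Lemma h2truncZ n (c : R[i]) f : h2trunc n (c *: f) = c *: h2trunc n f.
Proof.
by apply: h2_ext => k; rewrite h2coefZ !coef_h2trunc h2coefZ; case: ifP => //; rewrite mulr0.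
Qed.

Definition h2tail n f : H := f - h2trunc n f.

Lemma h2tailD n f g : h2tail n (f + g) = h2tail n f + h2tail n g.
Proof. by rewrite /h2tail h2truncD opprD addrACA. Qed.

Lemma h2tailZ n c f : h2tail n (c *: f) = c *: h2tail n f.
Proof. by rewrite /h2tail h2truncZ scalerBr. Qed.

Lemma h2tail_le n f : h2norm (h2tail n f) <= h2norm f.
Proof. exact: h2norm_tail_le. Qed.

(** For bounded [A] this is norm approximation by the finite-rank truncations [h2trunc n \o A]. It
    is the working form of compactness, stable under sums and under composition on either side. *)
Definition tail_small A : Prop :=
  forall e : R, 0 < e -> exists n, forall f, h2norm (h2tail n (A f)) <= e * h2norm f.

Lemma ultra_cvg_bounded (T : Type) (F : set_system T) (x : T -> R) (M : R) :
  UltraFilter F -> F [set t | `|x t| <= M] ->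
  exists p : R, forall e, 0 < e -> F [set t | `|x t - p| < e].
Proof.
move=> UF FM.
have PF : ProperFilter F by exact: ultra_proper.
have [|p [_ pF]] := @segment_compact R (- M) M (x @ F) (fmap_proper_filter x PF).
  have FM' : F (x @^-1` `[- M, M]).
    by apply: filterS FM => t xt; rewrite /= in_itv /= -ler_norml.
  exact: FM'.
exists p => e e0.
have [//|nF] := in_ultra_setVsetC [set t | `|x t - p| < e] UF.
have [||y [/= ye]] := pF [set y | e <= `|y - p|] (ball p e).
- have nF' : F (x @^-1` [set y | e <= `|y - p|]).
    by apply: filterS nF => t /=; rewrite leNgt => /negP.
  exact: nF'.
- exact: nbhsx_ballx.
- by rewrite -ball_normE /= distrC ltNge ye.
Qed.

(** Along an ultrafilter on the closed image every coordinate converges. Uniform tails make the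
    truncations [Y n] of the coordinatewise limit close in norm to the ultrafilter, and a sequence
    of them is Cauchy, so square summability of the limit comes out of completeness. *)
Lemma tail_small_compact A : bounded_op A -> tail_small A -> compact_op A.
Proof.
move=> bA tA; split=> //; have [M M0 AM] := bounded_opM bA.
set B := A @` _; rewrite compact_ultra => F UF FB.
have PF : ProperFilter F by exact: ultra_proper.
have clB f e : closure B f -> 0 < e -> exists2 g, h2norm g <= 1 & h2norm (f - A g) < e.
  move=> /(_ [set g | h2norm (f - g) < e]) fB e0.
  have [|_ [[g /= g1 <-] /= fg]] := fB; last by exists g.
  by apply/h2_nbhsP; exists e.
have clM f : closure B f -> h2norm f <= M.
  move=> fB; apply/ler_addgt0Pr => e e0; have [g g1 fg] := clB f e fB e0.
  rewrite -[f](subrKC (A g)); apply: le_trans (h2normD _ _) _.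
  rewrite lerD ?(ltW fg)//; apply: le_trans (AM g) _.
  by rewrite -[leRHS]mulr1 ler_wpM2l.
have [y yF] : exists y : nat -> R[i], forall k e, 0 < e -> F [set f | cabs (f k - y k) < e].
  suff /choice[y yF] : forall k, exists z, forall e, 0 < e -> F [set f | cabs (f k - z) < e].
    by exists y.
  move=> k.
  have [|a aF] := @ultra_cvg_bounded _ F (fun f : H => complex.Re (f k)) M UF.
    apply: filterS FB => f /clM /= fM; apply: le_trans fM.
    by apply: le_trans (Re_le_cabs _) _; exact: cabs_coef_le.
  have [|b bF] := @ultra_cvg_bounded _ F (fun f : H => complex.Im (f k)) M UF.
    apply: filterS FB => f /clM /= fM; apply: le_trans fM.
    by apply: le_trans (Im_le_cabs _) _; exact: cabs_coef_le.
  exists (a +i* b) => e e0; have e20 : 0 < e / 2 by rewrite divr_gt0.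
  apply: filterS2 (aF _ e20) (bF _ e20) => f /= fa fb.
  by apply: le_lt_trans (cabs_le_ReIm _) _; rewrite ReB ImB /= [e]splitr ltrD.
pose Y n : H := \sum_(k < n) y k *: h2e R k.
have YF e : 0 < e -> exists n, F [set f | h2norm (f - Y n) < e].
  move=> e0; have e40 : 0 < e / 4 by rewrite divr_gt0.
  have [n nA] := tA _ e40; exists n.
  have n10 : 0 < e / 4 / n.+1%:R by rewrite divr_gt0.
  set d := _ / n.+1%:R in n10.
  have : F [set f | forall k, (k < n)%N -> cabs (f k - y k) < d].
    elim: (n) => [|m ih]; first by apply: filterS FB.
    apply: filterS2 ih (yF m _ n10) => f /= fm fmm k.
    by rewrite ltnS leq_eqVlt => /orP[/eqP->|/fm].
  apply: filterS2 FB => f fB fn /=.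
  have [g g1 fg] := clB f _ fB e40.
  have -> : f - Y n = h2tail n (f - A g) + h2tail n (A g) + (h2trunc n f - Y n).
    by rewrite -h2tailD subrK /h2tail addrA subrK.
  apply: (@le_lt_trans _ _ (e / 4 + e / 4 + e / 4)); last by lra.
  apply: le_trans (h2normD _ _) _; apply: lerD.
    apply: le_trans (h2normD _ _) _; apply: lerD.
      exact: le_trans (h2tail_le _ _) (ltW fg).
    by apply: le_trans (nA g) _; rewrite -[leRHS]mulr1 ler_wpM2l// ltW.
  rewrite /h2trunc /Y -sumrB; apply: le_trans (h2norm_sum _ _ _) _.
  apply: (@le_trans _ _ (\sum_(k < n) d)).
    apply: ler_sum => k _; rewrite -scalerBl h2normZ h2norm_e mulr1.
    exact/ltW/fn.
  rewrite sumr_const card_ord -[d *+ n]mulr_natr /d mulrAC ler_pdivrMr//.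
  by rewrite ler_wpM2l ?(ltW e40)// ler_nat leqnSn.
have [n nF] : exists n : nat -> nat, forall i,
    F [set f | h2norm (f - Y (n i)) < i.+1%:R^-1].
  suff /choice[n nF] : forall i, exists n, F [set f | h2norm (f - Y n) < i.+1%:R^-1].
    by exists n.
  by move=> i; apply: YF; rewrite invr_gt0.
have [||f fY] := @h2_complete R (fun i => Y (n i)) (fun i => 2 * i.+1%:R^-1).
- move=> i j ij.
  have [g [/= gi gj]] := filter_ex (filterI (nF i) (nF j)).
  have ji : j.+1%:R^-1 <= i.+1%:R^-1 :> R by rewrite lef_pV2 ?posrE// ler_nat.
  apply: le_trans (h2norm_distD g _ _) _; rewrite h2norm_distC.
  by apply: le_trans (lerD (ltW gj) (ltW gi)) _; rewrite mulr_natl mulr2n lerD2r.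
- rewrite -[X in _ --> X](mulr0 (2 : R)); apply: cvgMr.
  exact: cvg_harmonic.
have Ff : F --> f.
  move=> P /h2_nbhsP[e e0 fP].
  have [i ie] := exists_inv_nat_lt (divr_gt0 e0 (ltr0n _ 3)).
  apply: filterS (nF i) => g /= gi; apply: fP.
  rewrite h2norm_distC; apply: le_lt_trans (h2norm_distD (Y (n i)) _ _) _.
  move: (fY i) gi ie; move: (h2norm _) (h2norm _) (i.+1%:R^-1) => a b c; lra.
exists f; split=> //; apply: (@closed_closure _ B) => P fP.
by have [g [gB gP]] := filter_ex (filterI FB (Ff _ fP)); exists g.
Qed.

(* On bounded sequences, weak convergence is coordinatewise convergence. *)
Definition weakly_null (f : nat -> H) : Prop :=
  (forall n, h2norm (f n) <= 1) /\
  forall k (e : R), 0 < e -> exists N, forall n, (N <= n)%N -> cabs (f n k) < e.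

Lemma weakly_null_h2ip (f : nat -> H) g e : weakly_null f -> 0 < e ->
  exists N, forall n, (N <= n)%N -> cabs (h2ip (f n) g) < e.
Proof.
move=> [f1 f0] e0; have e20 : 0 < e / 2 by rewrite divr_gt0.
have [m /(_ m (leqnn m)) gm] := h2trunc_cvg g e20.
have d0 : 0 < e / 2 / (m%:R * h2norm g + 1).
  by rewrite divr_gt0// ltr_wpDl// mulr_ge0 ?h2norm_ge0.
set d := _ / (_ + 1) in d0.
have [N fN] : exists N, forall n, (N <= n)%N ->
    forall k, (k < m)%N -> cabs (f n k) < d.
  elim: (m) => [|p [N ih]]; first by exists 0%N.
  have [N' fN'] := f0 p _ d0; exists (maxn N N') => n.
  rewrite geq_max => /andP[Nn N'n] k.
  by rewrite ltnS leq_eqVlt => /orP[/eqP->|kp]; [exact: fN'|exact: ih].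
exists N => n Nn.
have -> : h2ip (f n) g = h2ip (f n) (g - h2trunc m g) + h2ip (f n) (h2trunc m g).
  by rewrite -h2ipDr subrK.
apply: le_lt_trans (cabsD _ _) _; rewrite [e]splitr ltr_leD//.
  apply: le_lt_trans (cabs_h2ip_le _ _) _; apply: le_lt_trans gm.
  by rewrite -[leRHS]mul1r ler_wpM2r ?h2norm_ge0.
rewrite -h2ip_conj h2ip_trunc cabs_conj; apply: le_trans (cabs_sum _ _ _) _.
apply: (@le_trans _ _ (\sum_(k < m) h2norm g * d)).
  apply: ler_sum => k _; rewrite cabsM cabs_conj ler_pM ?cabs_ge0 ?cabs_coef_le//.
  by rewrite ltW ?fN.
rewrite sumr_const card_ord -[_ *+ m]mulr_natl mulrA /d mulrA ler_pdivrMr; last first.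
  by rewrite ltr_wpDl// mulr_ge0 ?h2norm_ge0.
by rewrite mulrC ler_wpM2l ?(ltW e20)// lerDl.
Qed.

(** Otherwise a subsequence of images stays away from 0 and has a cluster point [p]. Its coordinates
    vanish, as <K f_n, e_k> = <f_n, K^* e_k> tends to 0. *)
Lemma compact_weakly_null K (f : nat -> H) e : compact_op K -> weakly_null f -> 0 < e ->
  exists N, forall n, (N <= n)%N -> h2norm (K (f n)) < e.
Proof.
move=> [bK cK] wf e0; apply: contrapT => nN.
have [s sK] : exists s : nat -> nat, forall N, (N <= s N)%N /\ e <= h2norm (K (f (s N))).
  suff /choice[s sK] : forall N, exists n, (N <= n)%N /\ e <= h2norm (K (f n)) by exists s.
  move=> N; apply: contrapT => nn; apply: nN; exists N => n Nn.
  by rewrite ltNge; apply/negP => en; apply: nn; exists n.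
have [B bB KB] := adjoint_exists bK.
have [|p [_ pc]] := cK ((fun N => K (f (s N))) @ \oo) _.
  exists 0%N => // N _ /=; apply: subset_closure; exists (f (s N)) => //.
  exact: wf.1.
have meets d N : 0 < d -> exists2 m, (N <= m)%N & h2norm (p - K (f (s m))) < d.
  move=> d0; have [||g [[m /= Nm <-] /= gd]] :=
    pc [set K (f (s m)) | m in [set m | (N <= m)%N]] [set g | h2norm (p - g) < d].
  - by exists N => // m /= Nm; exists m.
  - by apply/h2_nbhsP; exists d.
  - by exists m.
have p0 : p = 0.
  apply: h2_ext => k; apply/cabs0_eq0/eqP; rewrite eq_le cabs_ge0 andbT.
  apply/ler_addgt0Pr => d d0; rewrite add0r; have d20 : 0 < d / 2 by rewrite divr_gt0.
  have [N fN] := weakly_null_h2ip (B (h2e R k)) wf d20.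
  have [m Nm pm] := meets _ N d20.
  rewrite -[p k](subrK (K (f (s m)) k)) [d]splitr; apply: le_trans (cabsD _ _) _.
  apply: lerD; first by rewrite -h2coefB; apply: le_trans (cabs_coef_le _ _) (ltW pm).
  rewrite -h2ip_er KB ltW//; apply: fN; apply: leq_trans Nm _.
  by have [] := sK m.
have [m _] := meets _ 0%N e0.
by rewrite p0 sub0r h2normN ltNge; have [_ ->] := sK m.
Qed.

Lemma tail_smallD A B : tail_small A -> tail_small B -> tail_small (A \+ B).
Proof.
move=> tA tB e e0; have e20 : 0 < e / 2 by rewrite divr_gt0.
have [n nA] := tA _ e20; have [m mB] := tB _ e20; exists (maxn n m) => f.
rewrite h2tailD [e]splitr mulrDl; apply: le_trans (h2normD _ _) _; apply: lerD.
  by apply: le_trans (nA f); apply: h2norm_tail_nd; rewrite leq_maxl.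
by apply: le_trans (mB f); apply: h2norm_tail_nd; rewrite leq_maxr.
Qed.

Lemma tail_smallZ (c : R[i]) A : tail_small A -> tail_small (fun f => c *: A f).
Proof.
move=> tA e e0; have c0 : 0 < cabs c + 1 by rewrite ltr_wpDl ?cabs_ge0.
have [n nA] := tA _ (divr_gt0 e0 c0); exists n => f.
rewrite h2tailZ h2normZ.
apply: (@le_trans _ _ ((cabs c + 1) * (e / (cabs c + 1) * h2norm f))).
  by apply: ler_pM => //; rewrite ?cabs_ge0 ?h2norm_ge0// lerDl.
by rewrite mulrA [X in X * _]mulrC divfK ?gt_eqF.
Qed.

Lemma tail_small_compr A B : bounded_op B -> tail_small A -> tail_small (A \o B).
Proof.
move=> bB tA e e0; have [M M0 BM] := bounded_opM bB.
have M10 : 0 < M + 1 by rewrite ltr_wpDl.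
have [n nA] := tA _ (divr_gt0 e0 M10); exists n => f; apply: le_trans (nA _) _.
rewrite -mulrA ler_wpM2l ?(ltW e0)// mulrC ler_pdivrMr// mulrC.
by apply: le_trans (BM f) _; rewrite ler_wpM2r ?h2norm_ge0// lerDl.
Qed.

(** Split [A f] into a uniformly small tail and its first n coordinates; [B] sends the n basis
    vectors involved to vectors whose tails are small from a common index on. *)
Lemma tail_small_compl A B : bounded_op A -> bounded_op B -> tail_small A ->
  tail_small (B \o A).
Proof.
move=> bA bB tA e e0; have [M M0 AM] := bounded_opM bA; have [N N0 BN] := bounded_opM bB.
have e20 : 0 < e / 2 by rewrite divr_gt0.
have N10 : 0 < N + 1 by rewrite ltr_wpDl.
have [n nA] := tA _ (divr_gt0 e20 N10).
have d0 : 0 < e / 2 / (n%:R * M + 1) by rewrite divr_gt0// ltr_wpDl// mulr_ge0.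
set d := _ / (_ + 1) in d0.
have [m mB] : exists m, forall k, (k < n)%N -> h2norm (h2tail m (B (h2e R k))) < d.
  elim: (n) => [|p [N' ih]]; first by exists 0%N.
  have [N'' BN''] := h2trunc_cvg (B (h2e R p)) d0; exists (maxn N' N'') => k.
  rewrite ltnS leq_eqVlt => /orP[/eqP->|kp]; first by apply: BN''; rewrite leq_maxr.
  by apply: le_lt_trans (ih k kp); apply: h2norm_tail_nd; rewrite leq_maxl.
exists m => f /=; case: (bB) => lB _.
have -> : B (A f) = B (h2tail n (A f)) + B (h2trunc n (A f)).
  by rewrite -linD// /h2tail subrK.
rewrite h2tailD [e]splitr mulrDl; apply: le_trans (h2normD _ _) _; apply: lerD.
  apply: le_trans (h2tail_le _ _) _; apply: le_trans (BN _) _.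
  apply: le_trans (ler_wpM2l N0 (nA f)) _.
  rewrite mulrA ler_wpM2r ?h2norm_ge0// mulrA ler_pdivrMr//.
  by rewrite mulrC ler_wpM2l ?(ltW e20)// lerDl.
rewrite /h2trunc lin_sum//.
have -> : h2tail m (\sum_(k < n) B (A f k *: h2e R k)) =
    \sum_(k < n) A f k *: h2tail m (B (h2e R k)).
  elim/big_rec2: _ => [|k x y _ <-]; last by rewrite h2tailD linZ// h2tailZ.
  by rewrite -(scale0r (0 : H)) h2tailZ !scale0r.
apply: le_trans (h2norm_sum _ _ _) _;
apply: (@le_trans _ _ (\sum_(k < n) M * h2norm f * d)).
  apply: ler_sum => k _; rewrite h2normZ ler_pM ?cabs_ge0 ?h2norm_ge0 ?(ltW (mB _ _))//.
  exact: le_trans (cabs_coef_le _ _) (AM f).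
rewrite sumr_const card_ord -[_ *+ n]mulr_natl mulrA [X in X <= _](_ : _ = n%:R * M * d * h2norm f).
  rewrite ler_wpM2r ?h2norm_ge0// /d mulrA ler_pdivrMr; last first.
    by rewrite ltr_wpDl// mulr_ge0.
  by rewrite mulrC ler_wpM2l ?(ltW e20)// lerDl.
by ring.
Qed.

Lemma cabs_op_coef_le A (r : R) j f : bounded_op A ->
  (forall n, \sum_(k < n) cabs (A (h2e R k) j) ^+ 2 <= r) ->
  cabs (A f j) ^+ 2 <= r * h2norm f ^+ 2.
Proof.
move=> bA rn; have r0 : 0 <= r by apply: le_trans (rn 0%N); rewrite big_ord0.
have -> : r = Num.sqrt r ^+ 2 by rewrite sqr_sqrtr.
rewrite -exprMn ler_pXn2r ?nnegrE ?cabs_ge0 ?mulr_ge0 ?sqrtr_ge0 ?h2norm_ge0//.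
apply: ctends_cabs_le (coef_op f j bA) => n; apply: le_trans (cabs_sum _ _ _) _.
under eq_bigr do rewrite cabsM mulrC.
apply: le_trans (sum_mul_le_sqrt _ (fun k => cabs (A (h2e R k) j)) (fun k => cabs (f k))) _.
apply: ler_pM; rewrite ?sqrtr_ge0//; first by apply: ler_wsqrtr; exact: rn.
by rewrite -sqsumE; exact: sqrt_sqsum_le.
Qed.

Lemma h2tail_le_coef n f (s : R) : 0 <= s ->
  (forall m, \sum_(n <= j < m) cabs (f j) ^+ 2 <= s ^+ 2) -> h2norm (h2tail n f) <= s.
Proof.
move=> s0 fs; apply: h2norm_le => // m; rewrite sqsumE.
have [mn|nm] := leqP m n.
  rewrite big1 ?sqr_ge0// => k _.
  rewrite h2coefB coef_h2trunc (leq_trans (ltn_ord k) mn) subrr.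
  by rewrite cabs0 expr0n.
rewrite -(big_mkord xpredT (fun k => cabs (h2tail n f k) ^+ 2)).
rewrite (big_cat_nat (leq0n n) (ltnW nm)) /=.
rewrite [X in X + _]big_nat_cond big1 ?add0r; last first.
  move=> k /andP[/andP[_ kn] _].
  by rewrite h2coefB coef_h2trunc kn subrr cabs0 expr0n.
apply: le_trans (fs m); rewrite le_eqVlt; apply/orP; left; apply/eqP.
apply: eq_big_nat => k /andP[nk _].
by rewrite h2coefB coef_h2trunc ltnNge nk subr0.
Qed.

(** Cauchy-Schwarz on each row gives |(A f)_j|^2 <= r_j |f|^2, and the tails of the convergent
    series of the r_j are small. *)
Lemma hilbert_schmidt_tail_small A (r : nat -> R) (M : R) : bounded_op A ->
  (forall j n, \sum_(k < n) cabs (A (h2e R k) j) ^+ 2 <= r j) ->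
  (forall n, \sum_(j < n) r j <= M) -> tail_small A.
Proof.
move=> bA rn rM e e0.
have r0 j : 0 <= r j by apply: le_trans (rn j 0%N); rewrite big_ord0.
have : cvgn (series r).
  apply: nondecreasing_is_cvgn; first by apply: nondecreasing_series => n _ _.
  by exists M => _ [n _ <-]; rewrite /series /= big_mkord.
move=> /cauchy_cvgP/cauchy_seriesP/(_ (e ^+ 2) (exprn_gt0 _ e0)).
case=> -[P Q] /= [[N1 _ NP] [N2 _ NQ]] PQ.
pose n := maxn N1 N2; exists n => f.
apply: h2tail_le_coef => [|m]; first by rewrite mulr_ge0 ?h2norm_ge0// ltW.
have [mn|nm] := leqP m n; first by rewrite big_geq// sqr_ge0.
apply: (@le_trans _ _ (\sum_(n <= j < m) r j * h2norm f ^+ 2)).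
  by apply: ler_sum => j _; exact: cabs_op_coef_le.
rewrite -mulr_suml exprMn ler_wpM2r ?sqr_ge0//.
have /= := PQ (n, m); rewrite ger0_norm ?sumr_ge0// => /(_ _)/ltW; apply; split.
  by apply: NP; rewrite /= leq_maxl.
by apply: NQ; rewrite /= (leq_trans _ (ltnW nm))// leq_maxr.
Qed.

(** [B f] is the sum of the T^i f, taken vector by vector through [h2_complete]. *)
Lemma neumann T (q : R) : bounded_op T -> opbound T q -> 0 <= q < 1 ->
  exists B, [/\ bounded_op B, forall f, B f - T (B f) = f & forall f, B (f - T f) = f].
Proof.
move=> bT Tq /andP[q0 q1]; case: (bT) => lT _.
have q10 : 0 < 1 - q by rewrite subr_gt0.
have Tn n f : h2norm (iter n T f) <= q ^+ n * h2norm f.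
  elim: n => [|n ih]; first by rewrite expr0 mul1r.
  by rewrite iterS exprS -mulrA; apply: le_trans (Tq _) _; rewrite ler_wpM2l.
pose s f n := \sum_(0 <= i < n) iter i T f.
have sT f n : s f n - T (s f n) = f - iter n T f.
  rewrite /s lin_sum//; elim: n => [|n ih]; first by rewrite !big_nil !subrr.
  by rewrite !big_nat_recr //= opprD addrACA ih addrA subrK.
have geo m n : (n <= m)%N -> \sum_(n <= i < m) q ^+ i <= q ^+ n / (1 - q).
  move=> nm; rewrite ler_pdivlMr//.
  have -> : (\sum_(n <= i < m) q ^+ i) * (1 - q) = q ^+ n - q ^+ m.
    elim: m nm => [|m ih]; first by rewrite leqn0 => /eqP->; rewrite big_geq// mul0r subrr.
    rewrite leq_eqVlt => /orP[/eqP->|nm]; first by rewrite big_geq// mul0r subrr.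
    by rewrite big_nat_recr //= mulrDl ih// exprS; ring.
  by rewrite gerBl exprn_ge0.
have Bf f : exists g, forall n, h2norm (s f n - g) <= q ^+ n / (1 - q) * h2norm f.
  apply: h2_complete.
    move=> n m nm; rewrite /s (big_cat_nat (leq0n n) nm) /= [X in X - _]addrC addrK.
    apply: le_trans (h2norm_sum _ _ _) _.
    apply: (@le_trans _ _ (\sum_(n <= i < m) q ^+ i * h2norm f)).
      by apply: ler_sum => i _.
    by rewrite -mulr_suml ler_wpM2r ?h2norm_ge0// geo.
  rewrite -[X in _ --> X](mul0r ((1 - q)^-1 * h2norm f)).
  under eq_fun do rewrite -mulrA.
  by apply: cvgMl; apply: cvg_expr; rewrite ger0_norm.
have [B BE] := choice Bf.
have BT f : B f - T (B f) = f.
  apply/subr0_eq/h2norm0_eq0/eqP; rewrite eq_le h2norm_ge0 andbT.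
  apply/ler_addgt0Pr => e e0; rewrite add0r.
  pose K := ((1 + q) / (1 - q) + 1) * h2norm f + 1.
  have K0 : 0 < K.
    by rewrite ltr_wpDl// mulr_ge0 ?h2norm_ge0// addr_ge0// divr_ge0 ?(ltW q10)// addr_ge0.
  have [n qn] : exists n, q ^+ n < e / K.
    have /cvgrPdist_lt/(_ _ (divr_gt0 e0 K0))[N _ Nq] : (fun n => q ^+ n) @ \oo --> (0 : R).
      by apply: cvg_expr; rewrite ger0_norm.
    exists N; have := Nq N (leqnn N); rewrite /= sub0r normrN ger0_norm//.
    exact: exprn_ge0.
  have -> : B f - T (B f) - f = (B f - s f n) - T (B f - s f n) - iter n T f.
    have Ts : T (s f n) = s f n - f + iter n T f.
      by rewrite -[LHS](subKr (s f n)) sT opprD opprK addrA.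
    rewrite linB// Ts; apply: h2_ext => k; rewrite !(h2coefD, h2coefN); ring.
  have dn : h2norm (B f - s f n) <= q ^+ n / (1 - q) * h2norm f.
    by rewrite h2norm_distC.
  apply: (@le_trans _ _ (q ^+ n * (((1 + q) / (1 - q) + 1) * h2norm f))).
    apply: le_trans (h2normB _ _) _; rewrite mulrDl mul1r mulrDr lerD//.
    apply: le_trans (h2normB _ _) _.
    apply: (@le_trans _ _ ((1 + q) * (q ^+ n / (1 - q) * h2norm f))).
      rewrite mulrDl mul1r lerD//; apply: le_trans (Tq _) _.
      by rewrite ler_wpM2l.
    by rewrite le_eqVlt; apply/orP; left; apply/eqP; ring.
  apply: (@le_trans _ _ (q ^+ n * K)); first by rewrite ler_wpM2l ?exprn_ge0// lerDl.
  by rewrite -ler_pdivlMr// ltW.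
(* Injectivity of [id - T] yields both the linearity of [B], which was chosen pointwise, and the
   left inverse identity from the right one. *)
have inj g : g = T g -> g = 0.
  move=> gT; apply/h2norm0_eq0/eqP; rewrite eq_le h2norm_ge0 andbT.
  have : h2norm g <= q * h2norm g by rewrite {1}gT; exact: Tq.
  by rewrite -subr_ge0 -[X in _ - X]mul1r -mulrBl nmulr_rge0// subr_lt0.
have TB u : T (B u) = B u - u by rewrite -[LHS](subKr (B u)) BT.
exists B; split=> //; last first.
  move=> f; apply/subr0_eq/inj; rewrite (linB _ _ lT) TB.
  by apply: h2_ext => k; rewrite !(h2coefD, h2coefN); ring.
split.
  move=> c f g; apply/subr0_eq/inj; rewrite (linB _ _ lT) lT !TB.
  by apply: h2_ext => k; rewrite !(h2coefD, h2coefN, h2coefZ); ring.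
exists (1 - q)^-1 => f; have := BE f 0%N.
by rewrite /s big_nil sub0r h2normN expr0 mul1r.
Qed.
End Compactness.

(** * The essential spectrum of the Cesaro operator *)

Section DiagonalOperators.
Variable R : realType.
Local Notation H := (H2 R).

Lemma diag_op (d : nat -> R[i]) (M : R) : 0 <= M -> (forall j, cabs (d j) <= M) ->
  exists D : H -> H, [/\ bounded_op D, opbound D M & forall f j, D f j = d j * f j].
Proof.
move=> M0 dM.
have /choice[D DE] : forall f : H, exists g : H,
    (forall j, g j = d j * f j) /\ h2norm g <= M * h2norm f.
  move=> f; have [||g gE gM] := @mkH2 R (fun j => d j * f j) (M * h2norm f).
  - by rewrite mulr_ge0 ?h2norm_ge0.
  - move=> n; rewrite exprMn; apply: (@le_trans _ _ (M ^+ 2 * sqsum f n)).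
      rewrite sqsumE mulr_sumr; apply: ler_sum => k _.
      by rewrite cabsM exprMn ler_wpM2r ?sqr_ge0// ler_pXn2r ?nnegrE ?cabs_ge0.
    by rewrite ler_wpM2l ?sqr_ge0// sqsum_le_h2norm.
  - by exists g.
exists D; split; [split|by move=> f; have [] := DE f|by move=> f; have [] := DE f].
  move=> c f g; apply: h2_ext => j.
  by rewrite h2coefD h2coefZ !(DE _).1 h2coefD h2coefZ; ring.
by exists M => f; have [] := DE f.
Qed.

Lemma diag_tail_small (D : H -> H) (d : nat -> R[i]) :
  (forall f j, D f j = d j * f j) ->
  (forall e : R, 0 < e -> exists N, forall j, (N <= j)%N -> cabs (d j) <= e) ->
  tail_small D.
Proof.
move=> DE d0 e e0; have [N dN] := d0 e e0; exists N => f.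
apply: h2tail_le_coef => [|m]; first by rewrite mulr_ge0 ?h2norm_ge0// ltW.
rewrite exprMn; apply: (@le_trans _ _ (e ^+ 2 * sqsum f m)); last first.
  by rewrite ler_wpM2l ?sqr_ge0// sqsum_le_h2norm.
have [mN|Nm] := leqP m N.
  by rewrite big_geq// mulr_ge0 ?sqr_ge0 ?sqsum_ge0.
rewrite sqsumE -(big_mkord xpredT (fun k => cabs (f k) ^+ 2)).
rewrite (big_cat_nat (leq0n N) (ltnW Nm)) /= mulrDr.
apply: (@le_trans _ _ (e ^+ 2 * \sum_(N <= j < m) cabs (f j) ^+ 2)); last first.
  rewrite lerDr mulr_ge0 ?sqr_ge0// sumr_ge0// => k _; exact: sqr_ge0.
rewrite mulr_sumr; apply: ler_sum_nat => j /andP[Nj _].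
rewrite DE cabsM exprMn ler_wpM2r ?sqr_ge0// ler_pXn2r ?nnegrE ?cabs_ge0 ?(ltW e0)//.
exact: dN.
Qed.

End DiagonalOperators.

(** * Tails of the series of inverse squares *)

Section InverseSquares.
Variable R : realType.

Lemma sum_inv_sqr_ge (m n : nat) : (m <= n)%N ->
  (m.+1%:R : R)^-1 - n.+1%:R^-1 <= \sum_(m <= l < n) (l.+1%:R ^+ 2)^-1.
Proof.
elim: n => [|n ih]; first by rewrite leqn0 => /eqP->; rewrite subrr big_geq.
rewrite leq_eqVlt => /orP[/eqP->|mn]; first by rewrite subrr big_geq.
rewrite big_nat_recr //=; have := ih mn.
have : (n.+1%:R : R)^-1 - n.+2%:R^-1 <= (n.+1%:R ^+ 2)^-1.
  have a0 : 0 < (n.+1%:R : R) by []. have b0 : 0 < (n.+2%:R : R) by [].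
  have -> : (n.+2%:R : R) = n.+1%:R + 1 by rewrite -natr1.
  move: (n.+1%:R : R) a0 => x x0.
  have -> : x^-1 - (x + 1)^-1 = (x * (x + 1))^-1 by field; rewrite !gt_eqF ?addr_gt0.
  by rewrite lef_pV2 ?posrE ?exprn_gt0 ?mulr_gt0 ?addr_gt0// expr2 ler_wpM2l ?(ltW x0)// lerDl.
move: (\sum_(m <= i < n) _) (_^-1) (_^-1) (_^-1) (_^-1) => *; lra.
Qed.

Lemma sum_inv_sqr_le (m n : nat) :
  \sum_(m <= l < n) (l.+1%:R ^+ 2)^-1 <= (m.+1%:R : R)^-1 + (m.+1%:R ^+ 2)^-1.
Proof.
have p0 : 0 <= (m.+1%:R : R)^-1 + (m.+1%:R ^+ 2)^-1.
  by rewrite addr_ge0 ?invr_ge0 ?exprn_ge0.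
have [nm|/subnKC <-] := leqP n m; first by rewrite big_geq.
set d := (n - _)%N; suff : \sum_(m <= l < m.+1 + d) (l.+1%:R ^+ 2)^-1 <=
    (m.+1%:R : R)^-1 + (m.+1%:R ^+ 2)^-1 - (m.+1 + d)%:R^-1.
  move=> /le_trans; apply; by rewrite gerBl invr_ge0.
elim: d => [|d ih].
  by rewrite addn0 big_nat1 addrAC subrr add0r.
rewrite addnS big_nat_recr /=; last by rewrite addSn leqW// leq_addr.
set x := (m.+1 + d)%N in ih *.
have : (x.+1%:R ^+ 2)^-1 <= (x%:R : R)^-1 - x.+1%:R^-1.
  have a0 : 0 < (x%:R : R) by rewrite ltr0n /x addSn.
  have -> : (x.+1%:R : R) = x%:R + 1 by rewrite -natr1.
  move: (x%:R : R) a0 => y y0.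
  have -> : y^-1 - (y + 1)^-1 = (y * (y + 1))^-1 by field; rewrite !gt_eqF ?addr_gt0.
  rewrite lef_pV2 ?posrE ?exprn_gt0 ?mulr_gt0 ?addr_gt0// expr2 ler_wpM2r ?addr_ge0 ?(ltW y0)//.
  by rewrite lerDl.
move: ih; move: (\sum_(m <= i < x) _) (_^-1) (_^-1) (_^-1) (_^-1) (_^-1) => *; lra.
Qed.

(** Comparison with the telescoping 1 / (l + 1) leaves a remainder 1 / (n + 1); the threshold (m +
    1)^2 makes it no larger than the error already allowed. *)
Lemma sum_inv_sqr_dist (m n : nat) : (m.+1 ^ 2 <= n)%N ->
  `|\sum_(m <= l < n) (l.+1%:R ^+ 2)^-1 - (m.+1%:R : R)^-1| <= (m.+1%:R ^+ 2)^-1.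
Proof.
move=> mn; have mn' : (m <= n)%N by nia.
have := sum_inv_sqr_ge mn'; have := sum_inv_sqr_le m n.
have : (n.+1%:R : R)^-1 <= (m.+1%:R ^+ 2)^-1.
  by rewrite lef_pV2 ?posrE ?exprn_gt0// -natrX ler_nat leqW.
rewrite ler_norml.
move: (\sum_(m <= i < n) _) (_^-1) (_^-1) (_^-1) => *; apply/andP; split; lra.
Qed.

Lemma sum_inv_sqr_bound (n : nat) : \sum_(l < n) (l.+1%:R ^+ 2)^-1 <= 2 :> R.
Proof.
have := sum_inv_sqr_le 0 n; rewrite big_mkord => /le_trans; apply.
by rewrite expr1n invr1.
Qed.

End InverseSquares.

(** * Products of the Cesaro operator with its adjoint *)

Section CesaroOperator.
Variable R : realType.
Local Notation H := (H2 R).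
Implicit Types (f g h : H) (w l : R[i]).

Definition is_cesaro (C : H -> H) : Prop := bounded_op C /\
  forall j k, C (h2e R k) j = if (k <= j)%N then ((j.+1%:R : R)^-1)%:C else 0.

Lemma natrC n : ((n%:R : R)^-1)%:C = (n%:R : R[i])^-1.
Proof. by rewrite fmorphV rmorph_nat. Qed.

Lemma cesaro_of_basis (C : H -> H) : bounded_op C ->
  (forall k : nat,
    \sum_(k <= j < N) ((j.+1%:R : R[i])^-1 *: h2e R j) @[N --> \oo] --> C (h2e R k)) ->
  is_cesaro C.
Proof.
move=> bC CE; split=> // j k; have /h2_cvgP CEk := CE k.
set S := fun N => \sum_(k <= j < N) ((j.+1%:R : R[i])^-1 *: h2e R j) in CEk.
have Sj : ctends (fun N => S N j) (C (h2e R k) j).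
  apply: ctends_squeeze CEk => N; rewrite -h2coefB; exact: cabs_coef_le.
apply: ctends_unique Sj _.
apply: (@ctends_eventually _ (fun=> if (k <= j)%N then ((j.+1%:R : R)^-1)%:C else 0) _ _ j.+1).
  move=> N jN; rewrite /S h2coef_sum; case: leqP => kj.
    rewrite (bigD1_seq j) /= ?mem_index_iota ?kj ?iota_uniq//.
    rewrite h2coefZ coef_h2e eqxx mulr1 natrC big1 ?addr0// => i ij.
    by rewrite h2coefZ coef_h2e eq_sym (negbTE ij) mulr0.
  rewrite big_nat_cond big1// => i /andP[/andP[ki _] _].
  by rewrite h2coefZ coef_h2e ltn_eqF ?mulr0// (leq_trans kj).
exact: ctends_cst.
Qed.

Section Structure.
Variables C Cs D : H -> H.
Hypotheses (cC : is_cesaro C) (bCs : bounded_op Cs) (adjC : is_adjoint C Cs).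
Hypothesis (bD : bounded_op D) (DE : forall f j, D f j = ((j.+1%:R : R)^-1)%:C * f j).

Let bC : bounded_op C. Proof. by case: cC. Qed.
Let lC : linear C. Proof. by case: bC. Qed.
Let lCs : linear Cs. Proof. by case: bCs. Qed.

Lemma cesaro_coef f j : C f j = ((j.+1%:R : R)^-1)%:C * \sum_(k < j.+1) f k.
Proof.
apply: ctends_unique (coef_op f j bC) _.
apply: (@ctends_eventually _ (fun=> ((j.+1%:R : R)^-1)%:C * \sum_(k < j.+1) f k) _ _ j.+1).
  move=> n jn; rewrite mulr_sumr (big_ord_widen _ (fun k => _ * f k) jn) big_mkcond /=.
  by apply: eq_bigr => k _; rewrite cC.2 ltnS; case: ifP; rewrite ?mulr0// mulrC.
exact: ctends_cst.
Qed.

Lemma cesaro_adj_e j k :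
  Cs (h2e R k) j = if (j <= k)%N then ((k.+1%:R : R)^-1)%:C else 0.
Proof. by rewrite (coef_adjoint _ _ adjC) cC.2; case: ifP; rewrite ?conj_real ?conjC0. Qed.

Lemma cesaro_mul_adj f : C (Cs f) = C f + Cs f - D f.
Proof.
suff /(congr1 (@^~ f)) : C \o Cs = (C \+ Cs) \- D by [].
apply: op_ext; [exact: bounded_op_comp|exact/bounded_opB/bD/bounded_opD|move=> k].
apply: h2_ext => j; rewrite /= h2coefB h2coefD cesaro_coef DE coef_h2e.
rewrite cC.2 cesaro_adj_e.
under eq_bigr do rewrite cesaro_adj_e.
have -> : \sum_(i < j.+1) (if (i <= k)%N then ((k.+1%:R : R)^-1)%:C else 0) =
    ((minn j.+1 k.+1)%:R / k.+1%:R : R)%:C.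
  rewrite rmorphM /= rmorph_nat mulr_natl; have [jk|kj] := leqP j.+1 k.+1.
    rewrite (eq_bigr (fun=> ((k.+1%:R : R)^-1)%:C)) ?sumr_const ?card_ord// => i _.
    by rewrite -ltnS (leq_trans (ltn_ord i) jk).
  rewrite -big_mkcond /= -(big_ord_widen _ (fun=> ((k.+1%:R : R)^-1)%:C) (ltnW kj)).
  by rewrite sumr_const card_ord.
rewrite minnSS; have [jk|kj|<-] := ltngtP j k.
- by rewrite mulr0 subr0 add0r -rmorphM mulrA mulVf ?pnatr_eq0// mul1r.
- by rewrite mulr0 subr0 addr0 divff ?pnatr_eq0// mulr1.
by rewrite divff ?pnatr_eq0// !mulr1 addrK.
Qed.

(** The entry of C^* C is the sum of 1 / (l + 1)^2 over l >= max j k. Its partial sums satisfy the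
    bound from (m + 1)^2 on, and the bound passes to the limit. *)
Lemma cesaro_adj_mul_e j k :
  cabs (Cs (C (h2e R k)) j - ((maxn j k).+1%:R^-1)%:C) <= ((maxn j k).+1%:R ^+ 2)^-1.
Proof.
rewrite -(h2ip_er (Cs _)) (adjoint_sym adjC).
set m := maxn j k.
have := ctendsB (h2ip_ctends (C (h2e R k)) (C (h2e R j))) (ctends_cst (m.+1%:R^-1 : R)%:C).
move=> /(ctends_shift (m.+1 ^ 2)%N); apply: ctends_cabs_le => n /=.
set N := (n + _)%N.
have -> : \sum_(i < N) C (h2e R k) i * (C (h2e R j) i)^* =
    (\sum_(m <= l < N) (l.+1%:R ^+ 2)^-1)%:C.
  have mN : (m <= N)%N by rewrite /N; nia.
  rewrite -(big_mkord xpredT (fun i => C (h2e R k) i * (C (h2e R j) i)^*)).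
  rewrite (big_cat_nat (leq0n m) mN) /= [X in X + _]big_nat_cond big1 ?add0r; last first.
    move=> i /andP[/andP[_ im] _]; rewrite !cC.2.
    move: im; rewrite /m leq_max; case/orP; rewrite ltnNge => /negbTE ->.
      by rewrite conjC0 mulr0.
    by rewrite mul0r.
  rewrite rmorph_sum /=; apply: eq_big_nat => i /andP[mi _].
  move: mi; rewrite /m geq_max !cC.2 => /andP[-> ->].
  by rewrite conj_real -rmorphM /= expr2 invfM.
rewrite -rmorphB cabs_real; apply: sum_inv_sqr_dist.
exact: leq_addl.
Qed.

(** Hilbert-Schmidt: off the diagonal the squared entries are at most max^(-4) <= (j + 1)^(-2) (k +
    1)^(-2); on it [C] and [Cs] both contribute 1 / (j + 1), which costs 4 (j + 1)^(-2). The row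
    bound 6 (j + 1)^(-2) is 2 + 4, and 12 is its total. *)
Lemma cesaro_commutator_tail_small : tail_small (fun f => Cs (C f) - C f - Cs f).
Proof.
have bE : bounded_op (fun f => Cs (C f) - C f - Cs f).
  apply: (@bounded_opB _ (fun f => Cs (C f) - C f)) bCs.
  exact: (@bounded_opB _ (Cs \o C)) (bounded_op_comp _ _) _.
apply: (@hilbert_schmidt_tail_small _ _ (fun j => 6 * (j.+1%:R ^+ 2)^-1) 12) => //; last first.
  move=> n; rewrite -mulr_sumr (_ : 12 = 6 * 2) ?ler_pM2l ?sum_inv_sqr_bound//.
  by rewrite -natrM.
move=> j n; pose E := fun f => Cs (C f) - C f - Cs f.
have Ejk k : cabs (E (h2e R k) j) ^+ 2 <=
    (j.+1%:R ^+ 2)^-1 * (k.+1%:R ^+ 2)^-1 + (k == j)%:R * (4 * (j.+1%:R ^+ 2)^-1).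
  have := cesaro_adj_mul_e j k; rewrite /E !h2coefB cC.2 cesaro_adj_e.
  have sq0 (m : nat) : 0 <= (m.+1%:R ^+ 2 : R)^-1 by rewrite invr_ge0 sqr_ge0.
  have sq1 (m : nat) : (m.+1%:R ^+ 2 : R)^-1 <= m.+1%:R^-1.
    by rewrite lef_pV2 ?posrE// expr2 ler_peMr// ler1n.
  have [jk|kj|->] := ltngtP j k.
  - rewrite subr0 mul0r addr0 => h.
    apply: (@le_trans _ _ ((k.+1%:R ^+ 2)^-1 ^+ 2)).
      by rewrite ler_pXn2r ?nnegrE ?cabs_ge0.
    by rewrite expr2 ler_wpM2r// lef_pV2 ?posrE ?exprn_gt0// ler_pXn2r ?nnegrE// ler_nat ltnS ltnW.
  - rewrite subr0 mul0r addr0 => h.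
    apply: (@le_trans _ _ ((j.+1%:R ^+ 2)^-1 ^+ 2)).
      by rewrite ler_pXn2r ?nnegrE ?cabs_ge0.
    by rewrite expr2 ler_wpM2l// lef_pV2 ?posrE ?exprn_gt0// ler_pXn2r ?nnegrE// ler_nat ltnS ltnW.
  rewrite mul1r => h; apply: (@le_trans _ _ (4 * (k.+1%:R ^+ 2)^-1)); last first.
    by rewrite lerDr mulr_ge0 ?sq0.
  have -> : 4 * (k.+1%:R ^+ 2)^-1 = (2 * k.+1%:R^-1) ^+ 2 :> R.
    by rewrite exprMn exprVn; congr (_ * _); rewrite -natrX.
  rewrite ler_pXn2r ?nnegrE ?cabs_ge0 ?mulr_ge0 ?invr_ge0//.
  apply: le_trans (cabsB _ _) _; rewrite mulr_natl mulr2n; apply: lerD.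
    by apply: le_trans h _; exact: sq1.
  by rewrite cabs_real ger0_norm ?invr_ge0.
apply: (@le_trans _ _ (\sum_(k < n) ((j.+1%:R ^+ 2)^-1 * (k.+1%:R ^+ 2)^-1 +
   (nat_of_ord k == j)%:R * (4 * (j.+1%:R ^+ 2)^-1)))); first by apply: ler_sum => k _; exact: Ejk.
have j0 : 0 <= (j.+1%:R ^+ 2 : R)^-1 by rewrite invr_ge0 sqr_ge0.
rewrite big_split /= -mulr_sumr -mulr_suml.
have : \sum_(k < n) (nat_of_ord k == j)%:R <= 1 :> R.
  have [jn|nj] := ltnP j n.
    rewrite (bigD1 (Ordinal jn)) //= eqxx big1 ?addr0// => i.
    by rewrite -val_eqE /= => /negbTE ->.
  by rewrite big1// => i _; rewrite ltn_eqF// (leq_trans (ltn_ord i)).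
move=> /(ler_wpM2r (mulr_ge0 (ler0n R 4) j0)).
have := ler_wpM2l j0 (sum_inv_sqr_bound R n).
move: (\sum_(l < n) _) (\sum_(l < n) _) (_^-1) => a b c; lra.
Qed.

End Structure.
End CesaroOperator.

(** * Weyl sequences and the Calkin algebra *)

Section WeylSequences.
Variable R : realType.
Local Notation H := (H2 R).
Implicit Types (f g h : H) (A B K : H -> H) (w : R[i]).

Lemma tail_small0 : tail_small (fun=> 0 : H).
Proof.
move=> e e0; exists 0%N => f; rewrite -(scale0r (0 : H)) h2tailZ scale0r h2norm0.
by rewrite mulr_ge0 ?h2norm_ge0// ltW.
Qed.

Lemma compact_op0 : compact_op (fun=> 0 : H).
Proof. exact: tail_small_compact (bounded_op0 R) tail_small0. Qed.

Lemma bounded_op_shift A w : bounded_op A -> bounded_op (fun f => A f - w *: f).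
Proof. by move=> bA; exact: bounded_opB bA (bounded_opZ w (bounded_op_id R)). Qed.

Definition weyl_seq A (f : nat -> H) : Prop :=
  [/\ weakly_null f, forall n, h2norm (f n) = 1 &
    forall e : R, 0 < e -> exists N, forall n, (N <= n)%N -> h2norm (A (f n)) < e].

Lemma weyl_seq_exists A :
  (forall (e : R) N, 0 < e -> exists f, [/\ h2norm f = 1,
     forall k, (k < N)%N -> cabs (f k) < e & h2norm (A f) < e]) ->
  exists f : nat -> H, weyl_seq A f.
Proof.
move=> wA; have /choice[f fE] : forall n, exists f : H, [/\ h2norm f = 1,
    forall k, (k < n)%N -> cabs (f k) < n.+1%:R^-1 & h2norm (A f) < n.+1%:R^-1].
  by move=> n; apply: wA; rewrite invr_gt0.
have le_inv (N n : nat) : (N <= n)%N -> n.+1%:R^-1 <= N.+1%:R^-1 :> R.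
  by move=> Nn; rewrite lef_pV2 ?posrE// ler_nat.
exists f; split; [split|by move=> n; case: (fE n)|].
- by move=> n; case: (fE n) => ->.
- move=> k e /exists_inv_nat_lt[N Ne]; exists (maxn N k.+1) => n.
  rewrite geq_max => /andP[Nn kn]; case: (fE n) => _ /(_ _ kn) fk _.
  by apply: lt_trans fk _; apply: le_lt_trans Ne; exact: le_inv.
- move=> e /exists_inv_nat_lt[N Ne]; exists N => n Nn; case: (fE n) => _ _ Af.
  by apply: lt_trans Af _; apply: le_lt_trans Ne; exact: le_inv.
Qed.

(** If B A = id + K with [K] compact, then 1 = |f_n| <= |B A f_n| + |K f_n|, and both terms tend to
    0. *)
Lemma weyl_seq_not_invertible A (f : nat -> H) : weyl_seq A f -> ~ calkin_invertible A.
Proof.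
move=> [wf f1 Af] [B [bB _ KB]]; have [M M0 BM] := bounded_opM bB.
have e0 : 0 < (2 : R)^-1 by rewrite invr_gt0.
have [N NK] := compact_weakly_null KB wf e0.
have M10 : 0 < M + 1 by rewrite ltr_wpDl.
have [N' NA] := Af _ (divr_gt0 e0 M10).
pose n := maxn N N'; have := NK n (leq_maxl _ _); have := NA n (leq_maxr _ _).
move=> An Kn; have : 1 <= h2norm (B (A (f n))) + h2norm ((B \o A \- id) (f n)).
  rewrite -(f1 n) -[X in h2norm X <= _](subKr (B (A (f n)))) /=.
  exact: h2normB.
rewrite leNgt => /negP; apply; rewrite [ltRHS](_ : 1 = 2^-1 + 2^-1); last by field.
apply: ler_ltD Kn; apply: le_trans (BM _) _.
apply: (@le_trans _ _ (M * (2^-1 / (M + 1)))); first by rewrite ler_wpM2l// ltW.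
by rewrite mulrCA ler_piMr ?(ltW e0)// ler_pdivrMr// mul1r lerDl.
Qed.

(** Any compact [K] is asymptotically 0 on the weakly null f_n, so A - K still acts on them as
    multiplication by [w]. *)
Lemma essnorm_ge A w (f : nat -> H) : bounded_op A -> weyl_seq (fun g => A g - w *: g) f ->
  cabs w <= essnorm A.
Proof.
move=> bA [wf f1 Af]; apply: lb_le_inf.
  by exists (opnorm (A \- (fun=> 0))); exists (fun=> 0) => //; exact: compact_op0.
move=> _ [K cK <-]; apply/ler_addgt0Pr => e e0.
have e20 : 0 < e / 2 by rewrite divr_gt0.
have [N NK] := compact_weakly_null cK wf e20; have [N' NA] := Af _ e20.
pose n := maxn N N'; have := NK n (leq_maxl _ _); have := NA n (leq_maxr _ _).
move=> An Kn.
have : h2norm ((A \- K) (f n)) <= opnorm (A \- K).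
  by apply: opnorm_ub; [apply: bounded_opB bA _; case: cK|rewrite f1].
have : cabs w <= h2norm (A (f n) - w *: f n) + h2norm (A (f n)).
  have -> : cabs w = h2norm (w *: f n) by rewrite h2normZ f1 mulr1.
  rewrite addrC -[X in h2norm X <= _](subKr (A (f n))).
  exact: h2normB.
have : h2norm (A (f n)) <= h2norm ((A \- K) (f n)) + h2norm (K (f n)).
  by rewrite -[X in h2norm X <= _](subrK (K (f n))) /=; exact: h2normD.
move: (opnorm _) (h2norm _) (h2norm _) (h2norm _) (h2norm _) (cabs w) An Kn => *; lra.
Qed.

Lemma essnorm_le A (M : R) : bounded_op A -> 0 <= M -> opbound A M -> essnorm A <= M.
Proof.
move=> bA M0 AM.
apply: (@le_trans _ _ (opnorm (A \- (fun=> 0)))); last first.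
  apply: opnorm_le => //; first by apply: bounded_opB bA _; exact: bounded_op0.
  by move=> f; rewrite /= subr0.
apply: ge_inf; last by exists (fun=> 0) => //; exact: compact_op0.
exists 0 => _ [K [bK _] <-]; apply: opnorm_ge0; exact: bounded_opB.
Qed.

Lemma h2_coef_cvg0 f (e : R) : 0 < e -> exists N, forall n, (N <= n)%N -> cabs (f n) < e.
Proof.
move=> /(h2trunc_cvg f)[N fN]; exists N => n /fN; apply: le_lt_trans.
by have := cabs_coef_le (f - h2trunc n f) n; rewrite h2coefB coef_h2trunc ltnn subr0.
Qed.

End WeylSequences.

Section CesaroSpectrum.
Variable R : realType.
Local Notation H := (H2 R).
Implicit Types (f g h : H) (w l : R[i]).
Variables C Cs D : H -> H.
Hypotheses (cC : is_cesaro C) (bCs : bounded_op Cs) (adjC : is_adjoint C Cs).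
Hypothesis (bD : bounded_op D) (DE : forall f j, D f j = ((j.+1%:R : R)^-1)%:C * f j).

Let bC : bounded_op C. Proof. by case: cC. Qed.
Let lC : linear C. Proof. by case: bC. Qed.
Let lCs : linear Cs. Proof. by case: bCs. Qed.

(** By [cesaro_mul_adj], |f - C^* f|^2 = |f|^2 - <D f, f>, and [D] is positive. *)
Lemma one_sub_cesaro_adj_bound : opbound (fun f => f - Cs f) 1.
Proof.
move=> f; rewrite mul1r -(@ler_pXn2r _ 2)// ?nnegrE ?h2norm_ge0//.
rewrite sqr_h2normB.
have : h2norm (Cs f) ^+ 2 = 2 * complex.Re (h2ip f (Cs f)) - complex.Re (h2ip (D f) f).
  have /(congr1 (@complex.Re R)) /= <- := h2ip_norm (Cs f).
  rewrite -adjC (cesaro_mul_adj cC bCs adjC bD DE) h2ipBl h2ipDl adjC -(h2ip_conj f (Cs f)).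
  by case: (h2ip f _) (h2ip _ f) => a b [c d] /=; ring.
have : 0 <= complex.Re (h2ip (D f) f).
  have Re_lim := ctends_Re (h2ip_ctends (D f) f).
  rewrite -(cvg_lim _ Re_lim)//; apply: limr_ge; first by apply/cvg_ex; eexists; exact: Re_lim.
  apply: nearW => n; rewrite Re_sum; apply: sumr_ge0 => k _.
  by rewrite DE -mulrA mul_conj -rmorphM /= mulr_ge0 ?invr_ge0 ?sqr_ge0.
move: (complex.Re _) (complex.Re _) (_ ^+ 2) (_ ^+ 2) => *; lra.
Qed.

Lemma one_sub_cesaro_bound : opbound (fun f => f - C f) 1.
Proof.
apply: (@opbound_adjoint _ (fun f => f - Cs f)) one_sub_cesaro_adj_bound => //.
by move=> f g; rewrite h2ipBl h2ipBr (adjoint_sym adjC).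
Qed.

Lemma cesaro_bound : opbound C 2.
Proof.
move=> f; rewrite -[X in h2norm X <= _](subKr f).
apply: le_trans (h2normB _ _) _; rewrite mulr_natl mulr2n lerD2l.
by have := one_sub_cesaro_bound f; rewrite mul1r.
Qed.

Lemma cesaro_resolvent w : cabs (w - 1) != 1 -> calkin_invertible (fun f => C f - w *: f).
Proof.
pose l := 1 - w; have lE : cabs (w - 1) = cabs l by rewrite cabs_distC.
have bU : bounded_op (fun f => f - C f) by exact: bounded_opB (bounded_op_id R) bC.
have bUs : bounded_op (fun f => f - Cs f) by exact: bounded_opB (bounded_op_id R) bCs.
have U_Us f : f - Cs f - C (f - Cs f) = f - D f.
  rewrite linB// (cesaro_mul_adj cC bCs adjC bD DE); apply: h2_ext => k.
  by rewrite !(h2coefD, h2coefN); ring.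
rewrite lE; have [l1|l1|//] := ltgtP (cabs l) 1 => _.
- have [||B [bB BE EB]] := @neumann _ (fun f => l *: (f - Cs f)) (cabs l) (bounded_opZ l bUs).
  + by move=> f; rewrite h2normZ ler_wpM2l ?cabs_ge0//; have := one_sub_cesaro_adj_bound f; rewrite mul1r.
  + by rewrite cabs_ge0.
  case: (bB) => lB _.
  pose E f := Cs (C f) - C f - Cs f.
  have bE : bounded_op E.
    apply: (@bounded_opB _ (fun f => Cs (C f) - C f)) bCs.
    by apply: (@bounded_opB _ (Cs \o C)) bC; exact: bounded_op_comp.
  have tE : tail_small E by exact: cesaro_commutator_tail_small cC bCs adjC.
  have tD : tail_small D.
    apply: (diag_tail_small DE) => e /exists_inv_nat_lt[N Ne]; exists N => j Nj.
    rewrite cabs_real ger0_norm ?invr_ge0//; apply: le_trans (ltW Ne).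
    by rewrite lef_pV2 ?posrE// ler_nat.
  have bX : bounded_op (fun f => -1 *: B (f - Cs f)).
    by apply: bounded_opZ; exact: (bounded_op_comp bB bUs).
  exists (fun f => -1 *: B (f - Cs f)); split=> //.
    have -> : calkin_eq ((fun f => C f - w *: f) \o (fun f => -1 *: B (f - Cs f))) id =
        compact_op (fun f => -1 *: (D f + l *: D (B (f - Cs f)))).
      rewrite /calkin_eq; congr compact_op; apply/funext => f /=.
      have Ub : B (f - Cs f) - C (B (f - Cs f)) = f - D f + l *: (B (f - Cs f) - D (B (f - Cs f))).
        set b := B (f - Cs f).
        have {1 2}-> : b = (f - Cs f) + l *: (b - Cs b).
          by apply/eqP; rewrite -subr_eq BE.
        rewrite -!U_Us (linD _ _ lC) (linZ _ _ lC); apply: h2_ext => k.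
        by rewrite !(h2coefD, h2coefN, h2coefZ); ring.
      move: Ub; set b := B (f - Cs f) => Ub.
      rewrite (linZ _ _ lC); have -> : C b = b - (b - C b) by rewrite subKr.
      rewrite Ub; apply: h2_ext => k.
      by rewrite !(h2coefD, h2coefN, h2coefZ) /l; ring.
    have bDB : bounded_op (D \o (B \o (fun f => f - Cs f))).
      by apply: bounded_op_comp => //; exact: bounded_op_comp.
    apply: tail_small_compact.
      by apply: bounded_opZ; apply: (@bounded_opD _ D (fun f => l *: D (B (f - Cs f)))) bD (bounded_opZ l bDB).
    apply: tail_smallZ; apply: (@tail_smallD _ D (fun f => l *: D (B (f - Cs f)))) (tD) _.
    apply: (@tail_smallZ _ l (D \o (B \o (fun f => f - Cs f)))).
    by apply: tail_small_compr tD; exact: bounded_op_comp.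
  have -> : calkin_eq ((fun f => -1 *: B (f - Cs f)) \o (fun f => C f - w *: f)) id =
      compact_op (B \o E).
    rewrite /calkin_eq; congr compact_op; apply/funext => f /=.
    have -> : C f - w *: f - Cs (C f - w *: f) = -1 *: ((f - l *: (f - Cs f)) + E f).
      rewrite /E /l (linB _ _ lCs) (linZ _ _ lCs); apply: h2_ext => k.
      by rewrite !(h2coefD, h2coefN, h2coefZ); ring.
    rewrite (linZ _ _ lB) (linD _ _ lB) EB; apply: h2_ext => k.
    by rewrite !(h2coefD, h2coefN, h2coefZ); ring.
  apply: tail_small_compact; first exact: bounded_op_comp.
  exact: tail_small_compl.
- have l0 : l != 0 by rewrite -cabs_gt0 (lt_trans ltr01).
  have [||B [bB BE EB]] := @neumann _ (fun f => l^-1 *: (f - C f)) (cabs l)^-1 (bounded_opZ _ bU).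
  + move=> f; rewrite h2normZ cabsV ler_wpM2l ?invr_ge0 ?cabs_ge0//.
    by have := one_sub_cesaro_bound f; rewrite mul1r.
  + by rewrite invr_ge0 cabs_ge0 invf_lt1// (lt_trans ltr01).
  case: (bB) => lB _.
  have AE f : C f - w *: f = l *: (f - l^-1 *: (f - C f)).
    rewrite scalerBr scalerA divff// scale1r /l; apply: h2_ext => k.
    by rewrite !(h2coefD, h2coefN, h2coefZ); ring.
  exists (fun f => l^-1 *: B f); split; first exact: bounded_opZ.
    have -> : calkin_eq ((fun f => C f - w *: f) \o (fun f => l^-1 *: B f)) id =
        compact_op (fun=> 0 : H).
      rewrite /calkin_eq; congr compact_op; apply/funext => f /=.
      by rewrite AE (linZ _ _ lC) -!scalerBr BE scalerA divff// scale1r subrr.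
    exact: compact_op0.
  have -> : calkin_eq ((fun f => l^-1 *: B f) \o (fun f => C f - w *: f)) id =
      compact_op (fun=> 0 : H).
    rewrite /calkin_eq; congr compact_op; apply/funext => f /=.
    by rewrite AE (linZ _ _ lB) EB scalerA mulVf// scale1r subrr.
  exact: compact_op0.
Qed.

End CesaroSpectrum.

Section LimitProducts.
Variable R : realType.
Implicit Types (u v : nat -> R[i]) (l z : R[i]).

Lemma ctendsM u v l z : ctends u l -> ctends v z -> ctends (fun n => u n * v n) (l * z).
Proof.
move=> ul vz e e0; pose K := cabs l + cabs z + 1.
have K0 : 0 < K by rewrite ltr_wpDl ?addr_ge0 ?cabs_ge0.
pose d := Num.min 1 (e / K).
have d0 : 0 < d by rewrite lt_min ltr01 divr_gt0.
have dK : d * K <= e by rewrite -ler_pdivlMr// ge_min lexx orbT.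
have d1 : d <= 1 by rewrite ge_min lexx.
have [N uN] := ul _ d0; have [M vM] := vz _ d0.
exists (maxn N M) => n; rewrite geq_max => /andP[/uN un /vM vn].
have -> : u n * v n - l * z = (u n - l) * (v n - z) + l * (v n - z) + (u n - l) * z by ring.
apply: lt_le_trans dK; rewrite /K.
apply: (@le_lt_trans _ _ (cabs (u n - l) * 1 + cabs l * d + d * cabs z)).
  apply: le_trans (cabsD _ _) _; apply: lerD.
    apply: le_trans (cabsD _ _) _; rewrite !cabsM lerD// ler_wpM2l ?cabs_ge0//; last exact: ltW.
    exact: le_trans (ltW vn) d1.
  by rewrite cabsM ler_wpM2r ?cabs_ge0// ltW.
by move: (cabs (u n - l)) un => x un; rewrite mulr1; nra.
Qed.

Lemma ctends_prod (I : Type) (r : seq I) (F : I -> nat -> R[i]) (L : I -> R[i]) :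
  (forall i, ctends (F i) (L i)) ->
  ctends (fun n => \prod_(i <- r) F i n) (\prod_(i <- r) L i).
Proof.
move=> FL; elim: r => [|i r ih].
  by rewrite big_nil; apply: ctends_ext (ctends_cst _) => n; rewrite big_nil.
by rewrite big_cons; apply: ctends_ext (ctendsM (FL i) ih) => n; rewrite big_cons.
Qed.

Lemma ctends_add_inv l : ctends (fun n => l + (n.+1%:R^-1 : R)%:C) l.
Proof.
move=> e /exists_inv_nat_lt[N Ne]; exists N => n Nn.
rewrite addrC addKr cabs_real ger0_norm ?invr_ge0//; apply: le_lt_trans Ne.
by rewrite lef_pV2 ?posrE// ler_nat.
Qed.

End LimitProducts.

(** * Eigenvectors of the adjoint and their growth on the line Re a = 1/2 *)

Section Eigenvectors.
Variable R : realType.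
Local Notation H := (H2 R).
Implicit Types (f g h v : H) (a w : R[i]).

(* The Taylor coefficients of [(1 - z) ^ (a - 1)]. *)
Definition evec a (k : nat) : R[i] := \prod_(i < k) (1 - a * ((i.+1%:R : R)^-1)%:C).

Lemma evec0 a : evec a 0 = 1. Proof. by rewrite /evec big_ord0. Qed.

Lemma evecS a k : evec a k.+1 = evec a k * (1 - a * ((k.+1%:R : R)^-1)%:C).
Proof. by rewrite /evec big_ord_recr. Qed.

(** The row sums of C^* applied to [evec a] telescope by this identity, and so does row 0 of the
    Hilbert matrix. *)
Lemma evec_telescope a k :
  a * (evec a k * ((k.+1%:R : R)^-1)%:C) = evec a k - evec a k.+1.
Proof. by rewrite evecS; ring. Qed.

Lemma sqr_cabs_evecS a k : cabs (evec a k.+1) ^+ 2 =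
  cabs (evec a k) ^+ 2 *
  (1 - 2 * complex.Re a * k.+1%:R^-1 + (cabs a * k.+1%:R^-1) ^+ 2).
Proof.
rewrite evecS cabsM exprMn; congr (_ * _).
rewrite !exprMn !sqr_cabs; case: a => x y /=; move: (k.+1%:R^-1) => c.
by ring.
Qed.

(** Raabe test: with x_k = |evec a k|^2 and d = 2 Re a - 1, the difference k x_k - (k + 1) x_(k+1)
    is eventually at least (d / 2) x_k, and its sum telescopes. *)
Lemma evec_h2 a : 1 / 2 < complex.Re a -> exists v, forall k, v k = evec a k.
Proof.
move=> ha; pose d := 2 * complex.Re a - 1; have d0 : 0 < d by rewrite /d; lra.
pose x k := cabs (evec a k) ^+ 2; have x0 k : 0 <= x k by exact: sqr_ge0.
have [K Kd] : exists K : nat, (cabs a ^+ 2 + 1) * K.+1%:R^-1 < d / 2.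
  have p : 0 < cabs a ^+ 2 + 1 by rewrite ltr_wpDl ?sqr_ge0.
  have [K Kd] := exists_inv_nat_lt (divr_gt0 (divr_gt0 d0 (ltr0n _ 2)) p).
  by exists K; rewrite mulrC -ltr_pdivlMr.
have step k : (K <= k)%N -> d / 2 * x k <= k%:R * x k - k.+1%:R * x k.+1.
  move=> Kk; have k0 : 0 < k.+1%:R :> R by [].
  have -> : k.+1%:R * x k.+1 = x k * (k.+1%:R - 2 * complex.Re a + cabs a ^+ 2 * k.+1%:R^-1).
    rewrite /x sqr_cabs_evecS; move: (cabs (evec a k)) (cabs a) (complex.Re a) => p q r.
    by move: (k.+1%:R : R) k0 => c c0; field; rewrite gt_eqF.
  have -> : (k.+1%:R : R) = k%:R + 1 by rewrite -natr1.
  have : cabs a ^+ 2 * (k%:R + 1)^-1 <= d / 2.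
    rewrite natr1; apply: le_trans (ltW Kd); apply: ler_pM; rewrite ?sqr_ge0 ?invr_ge0 ?lerDl//.
    by rewrite lef_pV2 ?posrE// ler_nat.
  set c := _ / (k%:R + 1) => cd.
  have xc := ler_wpM2l (x0 k) cd.
  move: (x k) (k%:R : R) xc => y n; rewrite /d; clearbody c; clear; nra.
have sumK n : d / 2 * \sum_(K <= k < n) x k <= K%:R * x K.
  have [nK|Kn] := leqP n K; first by rewrite big_geq// mulr0 mulr_ge0.
  apply: (@le_trans _ _ (K%:R * x K - n%:R * x n)); last by rewrite gerBl mulr_ge0.
  rewrite mulr_sumr; apply: (@le_trans _ _ (\sum_(K <= k < n) (k%:R * x k - k.+1%:R * x k.+1))).
    by apply: ler_sum_nat => k /andP[Kk _]; exact: step.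
  rewrite le_eqVlt; apply/orP; left; apply/eqP.
  rewrite -opprB -(telescope_sumr (fun k => k%:R * x k) (ltnW Kn)) -sumrN.
  by apply: eq_bigr => k _; rewrite opprB.
pose M := \sum_(0 <= k < K) x k + K%:R * x K / (d / 2).
have d20 : 0 < d / 2 by rewrite divr_gt0.
have p0 : 0 <= K%:R * x K / (d / 2) by rewrite divr_ge0 ?(ltW d20)// mulr_ge0.
have s0 m n : 0 <= \sum_(m <= k < n) x k by apply: sumr_ge0 => k _.
have M0 : 0 <= M by rewrite addr_ge0.
have [|v vE _] := @mkH2 R (evec a) (Num.sqrt M) (sqrtr_ge0 _); last by exists v.
move=> n; rewrite sqr_sqrtr// -(big_mkord xpredT x).
have [nK|Kn] := leqP n K.
  apply: (@le_trans _ _ (\sum_(0 <= k < K) x k)).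
    by rewrite (big_cat_nat (leq0n n) nK) /= lerDl.
  by rewrite lerDl.
rewrite (big_cat_nat (leq0n K) (ltnW Kn)) /= lerD2l ler_pdivlMr// mulrC.
exact: sumK.
Qed.

Lemma cesaro_adj_evec (C Cs : H -> H) a v : is_cesaro C -> bounded_op Cs ->
  is_adjoint C Cs -> a != 0 -> (forall k, v k = evec a k) -> Cs v = a^-1 *: v.
Proof.
move=> cC bCs adjC a0 vE; apply: h2_ext => k; rewrite h2coefZ.
apply: ctends_unique (coef_op v k bCs) _.
have lim_ : ctends (fun n => a^-1 * (v k - v n)) (a^-1 * (v k - 0)).
  apply/ctendsZ/ctendsB; first exact: ctends_cst.
  by move=> e /(h2_coef_cvg0 v)[N vN]; exists N => n /vN; rewrite subr0.
rewrite subr0 in lim_; apply: (ctends_eventually (N := k)) lim_ => n kn.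
rewrite -(big_mkord xpredT (fun i => v i * Cs (h2e R i) k)).
rewrite (big_cat_nat (leq0n k) kn) /= [X in _ = X + _]big_nat_cond big1 ?add0r; last first.
  move=> i /andP[/andP[_ ik] _].
  by rewrite (cesaro_adj_e cC adjC) leqNgt ik mulr0.
apply: (mulfI a0); rewrite mulrA divff// mul1r mulr_sumr.
rewrite -opprB -(telescope_sumr (fun i => v i) kn) -sumrN.
apply: eq_big_nat => i /andP[ki _].
by rewrite (cesaro_adj_e cC adjC) ki !vE evec_telescope opprB.
Qed.

(** On the critical line each squared ratio is at least 1 - 1 / (k + 1), so the squared coefficients
    dominate a multiple of the harmonic series. This is what makes the norms blow up as [Re a]
    decreases to 1/2. *)
Lemma sqr_cabs_evec_ge a k : complex.Re a = 1 / 2 ->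
  cabs a ^+ 2 * k.+1%:R^-1 <= cabs (evec a k.+1) ^+ 2.
Proof.
have h2 : 2 * (1 / 2) = 1 :> R by field.
move=> ha; elim: k => [|k ih].
  by rewrite sqr_cabs_evecS evec0 cabs1 expr1n mul1r ha h2 invr1 !mulr1 subrr add0r.
rewrite sqr_cabs_evecS ha h2 mul1r.
apply: (@le_trans _ _ (cabs (evec a k.+1) ^+ 2 * (1 - k.+2%:R^-1))); last first.
  by rewrite ler_wpM2l ?sqr_ge0// lerDl sqr_ge0.
have -> : 1 - k.+2%:R^-1 = k.+1%:R / k.+2%:R :> R.
  have -> : (k.+2%:R : R) = k.+1%:R + 1 by rewrite -natr1.
  have : 0 < (k.+1%:R : R) by [].
  by move: (k.+1%:R : R) => c c0; field; rewrite gt_eqF// addr_gt0.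
rewrite mulrA ler_wpM2r ?invr_ge0//.
by rewrite -ler_pdivrMr.
Qed.

Lemma harmonic_unbounded (B : R) : exists n : nat, B <= \sum_(k < n) k.+1%:R^-1.
Proof.
apply: contrapT => nB; apply: (@dvg_harmonic R).
apply: nondecreasing_is_cvgn.
  by apply: nondecreasing_series => n _ _; rewrite /harmonic /= invr_ge0.
exists B => _ [n _ <-]; rewrite /series /= big_mkord leNgt; apply/negP => /ltW Bn.
by apply: nB; exists n.
Qed.

(* Vectors [evec a] with [Re a] decreasing to 1/2 have norms tending to infinity but bounded coefficients. *)
Lemma evec_weyl (A : H -> H) a : bounded_op A -> complex.Re a = 1 / 2 ->
  (forall e : R, 0 < e -> exists (K : R) n0, forall n v, (n0 <= n)%N ->
     (forall k, v k = evec (a + (n.+1%:R^-1 : R)%:C) k) ->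
     h2norm (A v) ^+ 2 <= K + e ^+ 2 * h2norm v ^+ 2) ->
  forall (e : R) N, 0 < e -> exists f, [/\ h2norm f = 1,
     forall k, (k < N)%N -> cabs (f k) < e & h2norm (A f) < e].
Proof.
move=> bA ha AK e N e0; pose b n := a + (n.+1%:R^-1 : R)%:C.
have bk k : ctends (fun n => evec (b n) k) (evec a k).
  apply: ctends_prod => i; apply: ctendsB; first exact: ctends_cst.
  by apply: ctendsZr; exact: ctends_add_inv.
have e20 : 0 < e / 2 by rewrite divr_gt0.
have [K [n0 Kn0]] := AK _ e20.
pose S := \sum_(k < N) (cabs (evec a k) + 1).
have S0 k : (k < N)%N -> cabs (evec a k) + 1 <= S.
  move=> kN; rewrite /S (bigD1 (Ordinal kN)) //= lerDl sumr_ge0// => i _.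
  by rewrite addr_ge0 ?cabs_ge0.
(* Once |v|^2 exceeds [B], normalization brings below [e] both the additive constant [K] and the
   first [N] coefficients, which are bounded by [S]. *)
pose B := (`|K| + S ^+ 2 + 1) / (e / 2) ^+ 2.
have a20 : 0 < cabs a ^+ 2 by rewrite sqr_cabs ha ltr_pwDl ?sqr_ge0// exprn_gt0.
have [m mB] := harmonic_unbounded ((B + 1) / cabs a ^+ 2).
have sB : B + 1 <= \sum_(k < m) cabs (evec a k.+1) ^+ 2.
  apply: (@le_trans _ _ (\sum_(k < m) cabs a ^+ 2 * k.+1%:R^-1)).
    by rewrite -mulr_sumr mulrC -ler_pdivrMr.
  by apply: ler_sum => k _; exact: sqr_cabs_evec_ge.
have [n1 n1B] : exists n1, forall n, (n1 <= n)%N ->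
    B < \sum_(k < m) cabs (evec (b n) k.+1) ^+ 2.
  have : ctends (fun n => \sum_(k < m) evec (b n) k.+1 * (evec (b n) k.+1)^*)
      (\sum_(k < m) evec a k.+1 * (evec a k.+1)^*).
    by apply: ctends_sum => k; apply: ctendsM; [exact: bk|exact/ctends_conj/bk].
  move=> /(_ 1 ltr01)[n1 n1P]; exists n1 => n /n1P.
  have sq (u : nat -> R[i]) : \sum_(k < m) u k * (u k)^* = (\sum_(k < m) cabs (u k) ^+ 2)%:C.
    by rewrite rmorph_sum; apply: eq_bigr => k _; rewrite mul_conj.
  rewrite (sq (fun k => evec (b n) k.+1)) (sq (fun k => evec a k.+1)) -rmorphB cabs_real.
  rewrite ltr_norml => /andP[+ _]; move: sB.
  move: (\sum_(k < m) _) (\sum_(k < m) _) => p q; lra.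
have [n2 n2B] : exists n2, forall n, (n2 <= n)%N ->
    forall k, (k < N)%N -> cabs (evec (b n) k) <= S.
  suff [n2 n2B] : exists n2, forall n, (n2 <= n)%N ->
      forall k, (k < N)%N -> cabs (evec (b n) k) < cabs (evec a k) + 1.
    by exists n2 => n n2n k kN; apply: le_trans (S0 k kN); apply/ltW/n2B.
  elim: (N) => [|p [n2 ih]]; first by exists 0%N.
  have [n3 n3P] := bk p 1 ltr01; exists (maxn n2 n3) => n.
  rewrite geq_max => /andP[n2n n3n] k.
  rewrite ltnS leq_eqVlt => /orP[/eqP->|kp]; last exact: ih.
  have := n3P n n3n; have := cabs_ge_dist (evec (b n) p) (evec a p).
  move: (cabs _) (cabs _) (cabs _) => x y z; lra.
pose n := maxn n0 (maxn n1 n2).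
have [|v vE] := @evec_h2 (b n).
  rewrite /b; case: (a) ha => x y /= ->; rewrite ltrDl invr_gt0//.
have vB : B < h2norm v ^+ 2.
  apply: lt_le_trans (n1B n _) _; first by rewrite /n !leq_max leqnn orbT.
  apply: le_trans (sqsum_le_h2norm v m.+1); rewrite sqsumE big_ord_recl /=.
  apply: (@le_trans _ _ (\sum_(i < m) cabs (v (lift ord0 i)) ^+ 2)).
    by apply: ler_sum => k _; rewrite vE.
  by rewrite lerDr sqr_ge0.
have B0 : 0 <= B by rewrite divr_ge0 ?sqr_ge0// !addr_ge0// sqr_ge0.
have v0 : 0 < h2norm v.
  rewrite lt0r h2norm_ge0 andbT; apply/eqP => v0.
  by move: vB; rewrite v0 expr0n /= ltNge B0.
have vB' : `|K| + S ^+ 2 < (e / 2) ^+ 2 * h2norm v ^+ 2.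
  rewrite mulrC -ltr_pdivrMr ?exprn_gt0//; apply: le_lt_trans vB.
  by rewrite /B ler_wpM2r ?invr_ge0 ?sqr_ge0// lerDl.
have vi0 : 0 <= (h2norm v)^-1 by rewrite invr_ge0 h2norm_ge0.
exists (((h2norm v)^-1 : R)%:C *: v); split.
- by rewrite h2normZ cabs_real ger0_norm// mulVf ?gt_eqF.
- move=> k kN; rewrite h2coefZ cabsM cabs_real ger0_norm// mulrC ltr_pdivrMr//.
  apply: (@le_lt_trans _ _ S); first by rewrite vE n2B// /n !leq_max leqnn !orbT.
  have Sge0 : 0 <= S by apply: le_trans (S0 k kN); rewrite addr_ge0 ?cabs_ge0.
  rewrite -(@ltr_pXn2r _ 2)// ?nnegrE ?mulr_ge0 ?h2norm_ge0 ?(ltW e0)//.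
  rewrite exprMn; apply: (@le_lt_trans _ _ (`|K| + S ^+ 2)); first by rewrite lerDr.
  apply: lt_le_trans vB' _; rewrite ler_wpM2r ?sqr_ge0//.
  by rewrite ler_pXn2r ?nnegrE ?(ltW e0) ?(ltW e20)//; lra.
rewrite linZ; last by case: bA.
rewrite h2normZ cabs_real ger0_norm// mulrC ltr_pdivrMr//.
rewrite -(@ltr_pXn2r _ 2)// ?nnegrE ?mulr_ge0 ?h2norm_ge0 ?(ltW e0)//.
apply: le_lt_trans (Kn0 n v _ vE) _; first by rewrite /n leq_max leqnn.
rewrite [ltRHS]exprMn; have := mulr_ge0 (sqr_ge0 e) (sqr_ge0 (h2norm v)).
have := ler_norm K; have := sqr_ge0 S; move: vB'.
move: (h2norm v) (S ^+ 2 : R) (`|K| : R) => x y z; lra.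
Qed.

End Eigenvectors.

Section CesaroEssentialSpectrum.
Variable R : realType.
Local Notation H := (H2 R).
Implicit Types (w : R[i]).
Variable C : H -> H.
Hypothesis cC : is_cesaro C.

Let bC : bounded_op C. Proof. by case: cC. Qed.
Let lC : linear C. Proof. by case: bC. Qed.

Lemma inv_nat_diag_op : exists D : H -> H, bounded_op D /\
  forall f j, D f j = ((j.+1%:R : R)^-1)%:C * f j.
Proof.
have [|D [bD _ DE]] := @diag_op R (fun j => ((j.+1%:R : R)^-1)%:C) 1 ler01; last by exists D.
by move=> j; rewrite cabs_real ger0_norm ?invr_ge0// invf_le1// ler1n.
Qed.

Lemma Re_invC_circle w : cabs (w - 1) = 1 -> w != 0 -> complex.Re w^-1 = 1 / 2.
Proof.
case: w => x y wE w0; have := congr1 (fun t => t ^+ 2) wE.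
rewrite sqr_cabs expr1n => E.
have xy : x ^+ 2 + y ^+ 2 != 0.
  apply: contraNneq w0 => /eqP; rewrite paddr_eq0 ?sqr_ge0// !sqrf_eq0.
  by move=> /andP[/eqP-> /eqP->].
have {}E : x ^+ 2 + y ^+ 2 = 2 * x by move: E; rewrite ReB ImB /= subr0; lra.
have -> : complex.Re (x +i* y)^-1 = x / (x ^+ 2 + y ^+ 2) by [].
rewrite E.
have x0 : x != 0 by apply: contraNneq xy => x0; rewrite E x0 mulr0.
by rewrite invfM mulrCA divff// mulr1 div1r.
Qed.

Lemma cesaro_weyl w : cabs (w - 1) = 1 ->
  exists f : nat -> H, weyl_seq (fun g => C g - w *: g) f.
Proof.
move=> wE; have [Cs bCs adjC] := adjoint_exists bC.
have [D [bD DE]] := inv_nat_diag_op; have lCs : linear Cs by case: bCs.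
(* At w = 0 there is no 1 / w; the basis vectors serve, since |C e_n|^2 is a diagonal entry of C^*
   C, at most 2 / (n + 1). *)
have [->|w0] := eqVneq w 0.
  have CeE n : h2norm (C (h2e R n)) ^+ 2 <= 2 * n.+1%:R^-1.
    have -> : h2norm (C (h2e R n)) ^+ 2 = cabs (Cs (C (h2e R n)) n).
      by rewrite -(h2ip_er (Cs _)) (adjoint_sym adjC) h2ip_norm cabs_real ger0_norm ?sqr_ge0.
    have := cesaro_adj_mul_e cC adjC n n; rewrite maxnn => h.
    have := le_trans (cabs_ge_dist _ _) h; rewrite cabs_real ger0_norm ?invr_ge0// => {}h.
    have : (n.+1%:R ^+ 2 : R)^-1 <= n.+1%:R^-1.
      by rewrite lef_pV2 ?posrE// expr2 ler_peMr// ler1n.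
    move: h; move: (cabs _) (_^-1) (_^-1) => *; lra.
  exists (fun n => h2e R n); split; [split|by move=> n; exact: h2norm_e|].
  - by move=> n; rewrite h2norm_e.
  - move=> k e e0; exists k.+1 => n kn; rewrite coef_h2e ltn_eqF//.
    by have := cabs0 R; rewrite /= => ->.
  - move=> e e0; have [N Ne] := exists_inv_nat_lt (divr_gt0 (exprn_gt0 2 e0) (ltr0n R 2)).
    exists N => n Nn; rewrite scale0r subr0.
    rewrite -(@ltr_pXn2r _ 2)// ?nnegrE ?h2norm_ge0 ?(ltW e0)//.
    apply: le_lt_trans (CeE n) _; rewrite mulrC -ltr_pdivlMr//.
    by apply: le_lt_trans Ne; rewrite lef_pV2 ?posrE// ler_nat.
(* The conjugate enters because [evec a] is an eigenvector of the adjoint, whose eigenvalue 1 / a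
   has to be [w^*]. *)
pose a := (w^*)^-1.
have wc0 : w^* != 0 by rewrite conjC_eq0.
have a0 : a != 0 by rewrite invr_eq0.
have Ra : complex.Re a = 1 / 2.
  apply: Re_invC_circle => //; rewrite -wE.
  by rewrite -(cabs_conj (w - 1)) rmorphB rmorph1.
have bA : bounded_op (fun g => Cs g - w^* *: g) by exact: bounded_op_shift.
have [|f [wf f1 fA]] := @weyl_seq_exists R (fun g => Cs g - w^* *: g).
  apply: (evec_weyl bA Ra) => e e0.
  have : ctends (fun n => ((a + (n.+1%:R^-1 : R)%:C)^-1 - w^*)) 0.
    move=> d d0; pose c := cabs a; have c0 : 0 < c by rewrite cabs_gt0.
    have [N Nd] := exists_inv_nat_lt (mulr_gt0 (divr_gt0 c0 (ltr0n R 2)) (mulr_gt0 c0 d0)).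
    have [N' N'd] := ctends_add_inv a (divr_gt0 c0 (ltr0n R 2)).
    exists (maxn N N') => n; rewrite geq_max => /andP[Nn /N'd].
    set b := a + _ => ba; rewrite subr0.
    have b2 : c / 2 < cabs b.
      have := cabs_ge_dist a b; rewrite cabs_distC -/c; move: ba; move: (cabs _) (cabs _) => *; lra.
    have b0 : b != 0 by rewrite -cabs_gt0 (lt_trans _ b2)// divr_gt0.
    have -> : b^-1 - w^* = (a - b) * (a^-1 * b^-1).
      by rewrite -[w^*]invrK -/a; field; rewrite a0 b0.
    have -> : a - b = - (n.+1%:R^-1 : R)%:C by rewrite /b opprD addrA subrr add0r.
    rewrite mulNr cabsN !cabsM (cabsV a) (cabsV b) cabs_real ger0_norm ?invr_ge0// -invfM.
    rewrite ltr_pdivrMr ?mulr_gt0 ?cabs_gt0//.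
    apply: (@lt_trans _ _ (c / 2 * (c * d))).
      by apply: le_lt_trans Nd; rewrite lef_pV2 ?posrE// ler_nat.
    have -> : c / 2 * (c * d) = d * (c * (c / 2)) by ring.
    by rewrite -/c ltr_pM2l// ltr_pM2l.
  move=> /(_ e e0)[N Nn]; exists 0, N => n v Nn' vE; rewrite add0r.
  have {}Nn := Nn n Nn'; rewrite subr0 in Nn.
  set b := a + _ in vE Nn.
  have b0 : b != 0.
    apply/eqP => b0; have := congr1 (@complex.Re R) b0.
    have ni : 0 < n.+1%:R^-1 :> R by rewrite invr_gt0.
    by rewrite /b ReD Ra /=; move: (_^-1) ni => x; lra.
  rewrite (cesaro_adj_evec cC bCs adjC b0 vE) -scalerBl h2normZ exprMn.
  by rewrite ler_wpM2r ?sqr_ge0// ler_pXn2r ?nnegrE ?cabs_ge0 ?(ltW e0)// ltW.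
exists f; split; [exact: wf|exact: f1|move=> e e0].
(* [C] is essentially normal: [C - w] and [Cs - w^*] have asymptotically the same norm on [f]. *)
pose E g := Cs (C g) - C (Cs g).
have bE : bounded_op E.
  by apply: (@bounded_opB _ (Cs \o C) (C \o Cs)); exact: bounded_op_comp.
have cE : compact_op E.
  have -> : E = (fun g => Cs (C g) - C g - Cs g) \+ D.
    apply/funext => g; rewrite /E (cesaro_mul_adj cC bCs adjC bD DE) /=.
    by apply: h2_ext => k; rewrite !(h2coefD, h2coefN); ring.
  apply: tail_small_compact.
    apply: bounded_opD; last exact: bD.
    apply: (@bounded_opB _ (fun g => Cs (C g) - C g)); last exact: bCs.
    by apply: (@bounded_opB _ (Cs \o C)); [exact: bounded_op_comp|exact: bC].
  apply: tail_smallD (cesaro_commutator_tail_small cC bCs adjC) _.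
  apply: (diag_tail_small DE) => d /exists_inv_nat_lt[N Nd]; exists N => j Nj.
  rewrite cabs_real ger0_norm ?invr_ge0//; apply: le_trans (ltW Nd).
  by rewrite lef_pV2 ?posrE// ler_nat.
have e20 : 0 < e ^+ 2 / 2 by rewrite divr_gt0 ?exprn_gt0.
have [N1 N1E] := compact_weakly_null cE wf e20.
have d0 : 0 < Num.sqrt (e ^+ 2 / 2) by rewrite sqrtr_gt0.
have [N2 N2A] := fA _ d0.
exists (maxn N1 N2) => n; rewrite geq_max => /andP[/N1E En /N2A An].
rewrite -(@ltr_pXn2r _ 2)// ?nnegrE ?h2norm_ge0 ?(ltW e0)//.
have key : h2norm (C (f n) - w *: f n) ^+ 2 =
    h2norm (Cs (f n) - w^* *: f n) ^+ 2 + complex.Re (h2ip (E (f n)) (f n)).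
  have sq g : h2norm g ^+ 2 = complex.Re (h2ip g g) by rewrite h2ip_norm.
  rewrite [LHS]sq [X in _ = X + _]sq.
  have e1 : h2ip (Cs (f n)) (f n) = h2ip (f n) (C (f n)) by exact: adjoint_sym adjC _ _.
  have e2 : h2ip (f n) (Cs (f n)) = h2ip (C (f n)) (f n) by rewrite adjC.
  have e3 : h2ip (Cs (C (f n))) (f n) = h2ip (C (f n)) (C (f n)).
    exact: adjoint_sym adjC _ _.
  have e4 : h2ip (C (Cs (f n))) (f n) = h2ip (Cs (f n)) (Cs (f n)) by rewrite adjC.
  rewrite /E !(h2ipBl, h2ipBr, h2ipZl, h2ipZr) e1 e2 e3 e4 conjCK -ReD.
  by congr complex.Re; ring.
have h1 : complex.Re (h2ip (E (f n)) (f n)) <= h2norm (E (f n)).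
  apply: le_trans (ler_norm _) _; apply: le_trans (Re_le_cabs _) _.
  by apply: le_trans (cabs_h2ip_le _ _) _; rewrite f1 mulr1.
have h2 : h2norm (Cs (f n) - w^* *: f n) ^+ 2 < e ^+ 2 / 2.
  rewrite -[ltRHS]sqr_sqrtr ?(ltW e20)//.
  by rewrite ltr_pXn2r ?nnegrE ?h2norm_ge0 ?(ltW d0).
rewrite [ltLHS]key [ltRHS]splitr; apply: ltrD h2 _.
exact: le_lt_trans h1 En.
Qed.

Theorem cesaro_spec_ess : spec_ess C = [set w : R[i] | `|w - 1| = 1].
Proof.
have [Cs bCs adjC] := adjoint_exists bC; have [D [bD DE]] := inv_nat_diag_op.
have nE w : (`|w - 1| = 1) <-> cabs (w - 1) = 1.
  by rewrite normr_cabs; split=> [[]//|->].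
apply/seteqP; split=> w /= wS.
  apply/nE; apply: contrapT => /eqP w1; apply: wS.
  exact: (cesaro_resolvent cC bCs adjC bD DE).
have [f ff] := cesaro_weyl ((nE w).1 wS).
exact: weyl_seq_not_invertible ff.
Qed.

(** The point 2 of the circle attains the bound |C| <= |id| + |id - C| <= 2. *)
Theorem cesaro_essnorm : essnorm C = 2.
Proof.
have [Cs bCs adjC] := adjoint_exists bC; have [D [bD DE]] := inv_nat_diag_op.
apply/eqP; rewrite eq_le; apply/andP; split.
  by apply: essnorm_le => //; exact: (cesaro_bound cC bCs adjC bD DE).
have [|f ff] := @cesaro_weyl 2.
  by rewrite (_ : 2 - 1 = 1) ?cabs1//; ring.
by have := essnorm_ge bC ff; rewrite cabs_nat.
Qed.

End CesaroEssentialSpectrum.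

(** * The Hilbert matrix *)

Section RealIntegrals.
Variable R : realType.
Local Notation mu := (@lebesgue_measure R).
Implicit Types (F f g : R -> R) (a b x : R).

Lemma derD f g x (a b : R) : is_derive x 1 f a -> is_derive x 1 g b ->
  is_derive x 1 (fun y => f y + g y) (a + b).
Proof. by move=> fa gb; exact: is_deriveD. Qed.

Lemma derB f g x (a b : R) : is_derive x 1 f a -> is_derive x 1 g b ->
  is_derive x 1 (fun y => f y - g y) (a - b).
Proof. by move=> fa gb; exact: is_deriveB. Qed.

Lemma derM f g x (a b : R) : is_derive x 1 f a -> is_derive x 1 g b ->
  is_derive x 1 (fun y => f y * g y) (a * g x + f x * b).
Proof.
move=> fa gb; have -> : a * g x + f x * b = f x *: b + g x *: a.
  by rewrite addrC [a * _]mulrC.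
exact: is_deriveM.
Qed.

Lemma derZ f (c : R) x (a : R) : is_derive x 1 f a -> is_derive x 1 (fun y => c * f y) (c * a).
Proof. by move=> fa; exact: is_deriveZ. Qed.

Lemma derX f n x (a : R) : is_derive x 1 f a ->
  is_derive x 1 (fun y => f y ^+ n.+1) (n.+1%:R * f x ^+ n * a).
Proof.
move=> fa; have := is_deriveX n.+1 fa.
by rewrite (_ : f ^+ n.+1 = fun y => f y ^+ n.+1)//; apply/funext => y; rewrite exprfctE.
Qed.

Lemma der_comp f g x (a b : R) : is_derive (g x) 1 f a -> is_derive x 1 g b ->
  is_derive x 1 (fun y => f (g y)) (a * b).
Proof. by move=> fa gb; exact: is_derive1_comp. Qed.

Lemma integrable_itv_continuous f a b : {in `[a, b], continuous f} ->
  mu.-integrable `[a, b] (EFin \o f).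
Proof.
move=> cf; apply: continuous_compact_integrable; first exact: segment_compact.
by apply: continuous_in_subspaceT => x; rewrite inE => /cf.
Qed.

Lemma Rintegral_FTC F f a b : a < b ->
  (forall x, x \in `[a, b] -> is_derive x 1 F (f x)) -> {in `[a, b], continuous f} ->
  \int[mu]_(x in `[a, b]) f x = F b - F a.
Proof.
move=> ab dF cf.
have cF x : x \in `[a, b] -> {for x, continuous F}.
  by move=> /dF h; apply: differentiable_continuous; apply/derivable1_diffP; case: h.
rewrite /Rintegral (@continuous_FTC2 _ f F)//.
- by apply: continuous_in_subspaceT => x; rewrite inE => /cf.
- split.
  + by move=> x /subset_itv_oo_cc /dF [].
  + by apply: cvg_at_right_filter; apply: cF; rewrite in_itv /= lexx ltW.
  + by apply: cvg_at_left_filter; apply: cF; rewrite in_itv /= lexx ltW.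
- by move=> x /subset_itv_oo_cc /dF h; rewrite derive1E; exact: derive_val.
Qed.

End RealIntegrals.

(** * Wallis products from integrals of powers of the cosine *)

Section Wallis.
Variable R : realType.
Local Notation mu := (@lebesgue_measure R).

Let W n : R := \int[mu]_(x in `[0, pi / 2]) cos x ^+ n.

Let pi20 : 0 < pi / 2 :> R. Proof. by rewrite divr_gt0// pi_gt0. Qed.

Let cos_continuousX n : continuous (fun x : R => cos x ^+ n).
Proof.
move=> x; apply: (@continuous_comp _ _ _ cos (fun y => y ^+ n)); first exact: continuous_cos.
exact: exprn_continuous.
Qed.

Let cos_ge0 (x : R) : x \in `[0, pi / 2] -> 0 <= cos x <= 1.
Proof.
rewrite in_itv /= => /andP[x0 x2]; rewrite cos_le1 andbT; apply: cos_ge0_pihalf.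
by rewrite x2 andbT (le_trans _ x0)// oppr_le0 ltW.
Qed.

Let W0 : W 0 = pi / 2.
Proof.
by rewrite /W (@Rintegral_FTC _ (fun x => x)) ?subr0//.
Qed.

Let W1 : W 1 = 1.
Proof.
rewrite /W (@Rintegral_FTC _ sin)//.
by rewrite sin_pihalf sin0 subr0.
Qed.

Let W_int n : mu.-integrable `[0, pi / 2] (EFin \o (fun x : R => cos x ^+ n)).
Proof. by apply: integrable_itv_continuous => x _; exact: cos_continuousX. Qed.

(** The integral of the derivative of sin x cos^(n+1) x, which vanishes at 0 and at pi / 2. *)
Let W_rec n : n.+2%:R * W n.+2 = n.+1%:R * W n.
Proof.
have c0 (k : nat) (c : R) : continuous (fun x : R => c * cos x ^+ k).
  by move=> x; apply: cvgM; [exact: cvg_cst|exact: cos_continuousX].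
pose f x : R := n.+2%:R * cos x ^+ n.+2 - n.+1%:R * cos x ^+ n.
have dF (x : R) : x \in `[0, pi / 2] -> is_derive x 1 (fun x => sin x * cos x ^+ n.+1) (f x).
  move=> _; have := derM (is_derive_sin x) (derX n (is_derive_cos x)).
  have s2 : sin x ^+ 2 = 1 - cos x ^+ 2 by rewrite -(cos2Dsin2 x) [X in X - _]addrC addrK.
  have -> : f x = cos x * cos x ^+ n.+1 + sin x * (n.+1%:R * cos x ^+ n * - sin x).
    have -> : sin x * (n.+1%:R * cos x ^+ n * - sin x) = - (n.+1%:R * cos x ^+ n * sin x ^+ 2).
      by ring.
    by rewrite s2 /f !exprS -natr1; ring.
  by [].
have cf : {in `[0, pi / 2], continuous f} by move=> x _; apply: cvgB; exact: c0.
have := Rintegral_FTC pi20 dF cf; rewrite cos_pihalf sin0 mul0r expr0n /= mulr0 subrr /f.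
rewrite RintegralB//; last 2 first.
- by apply: integrable_itv_continuous => x _; exact: c0.
- by apply: integrable_itv_continuous => x _; exact: c0.
by rewrite !RintegralZl// => /eqP; rewrite subr_eq0 => /eqP.
Qed.

Let W_nd n : W n.+1 <= W n.
Proof.
apply: le_Rintegral => // x /cos_ge0 /andP[c0 c1].
by rewrite exprS ler_piMl ?exprn_ge0.
Qed.

(* [wallis j = ((1/2)(3/2)...(j-1/2) / j!)^2]. *)
Definition wallis (j : nat) : R := \prod_(i < j) ((i%:R + 1 / 2) / i.+1%:R).

Lemma wallisS j : wallis j.+1 = wallis j * ((j%:R + 1 / 2) / j.+1%:R).
Proof. by rewrite /wallis big_ord_recr. Qed.

Lemma wallis_gt0 j : 0 < wallis j.
Proof. by apply: prodr_gt0 => i _; rewrite divr_gt0// ltr_wpDl. Qed.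

Let W_even j : W (j.*2) = pi / 2 * wallis j.
Proof.
elim: j => [|j ih]; first by rewrite W0 /wallis big_ord0 mulr1.
have := W_rec j.*2; rewrite -doubleS ih wallisS.
have -> : j.*2.+1%:R = 2 * (j%:R + 1 / 2) :> R.
  by rewrite -addn1 natrD -mul2n natrM; field.
have -> : j.*2.+2%:R = 2 * j.+1%:R :> R by rewrite -doubleS -mul2n natrM.
have : 0 < j.+1%:R :> R by [].
move: (j.+1%:R : R) (j%:R : R) (W _) (wallis j) => c d w p c0 E.
have c0' : c != 0 by rewrite gt_eqF.
have c20 : 2 * c != 0 by rewrite mulf_neq0// pnatr_eq0.
by apply: (mulfI c20); rewrite E; field.
Qed.

Let W_odd j : W (j.*2.+1) * (2 * (j%:R + 1 / 2) * wallis j) = 1.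
Proof.
elim: j => [|j ih]; first by rewrite W1 /wallis big_ord0; field.
have := W_rec j.*2.+1; rewrite -doubleS wallisS.
have -> : j.*2.+3%:R = 2 * (j.+1%:R + 1 / 2) :> R.
  by rewrite -doubleS -addn1 natrD -mul2n natrM; field.
have -> : j.*2.+2%:R = 2 * j.+1%:R :> R by rewrite -doubleS -mul2n natrM.
have : 0 < j.+1%:R :> R by [].
move: ih; move: (j.+1%:R : R) (j%:R : R) (W _) (W _) (wallis j) => c d w' w p ih c0 E.
have c0' : c != 0 by rewrite gt_eqF.
have -> : w' * (2 * (c + 1 / 2) * (p * ((d + 1 / 2) / c))) =
    (2 * (c + 1 / 2) * w') * (p * ((d + 1 / 2) / c)) by ring.
by rewrite E; apply: (etrans _ ih); field.
Qed.

(** The chain W_(2j+2) <= W_(2j+1) <= W_(2j), where the even integrals are (pi / 2) [wallis] and the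
    odd ones are reciprocals of 2 (j + 1/2) [wallis]. *)
Lemma wallis_bounds j :
  pi^-1 <= (j%:R + 1 / 2) * wallis j ^+ 2 <= pi^-1 * (j.+1%:R / (j%:R + 1 / 2)).
Proof.
have pi0 : 0 < pi :> R by exact: pi_gt0.
have w0 := wallis_gt0 j; have d0 : 0 < j%:R + 1 / 2 :> R by rewrite ltr_wpDl.
have := W_odd j; have := W_nd j.*2; have := W_nd j.*2.+1.
rewrite -doubleS !W_even wallisS.
have j0 : 0 < j.+1%:R :> R by [].
move: (j.+1%:R : R) (j%:R + 1 / 2 : R) (wallis j) (W _) d0 w0 j0 => c d p w d0 p0 c0 h1 h2 h3.
have dp : 0 < 2 * d * p by rewrite !mulr_gt0.
apply/andP; split.
  rewrite -div1r ler_pdivrMr// -h3.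
  apply: le_trans (ler_wpM2r (ltW dp) h2) _.
  by rewrite le_eqVlt; apply/orP; left; apply/eqP; field.
rewrite [leRHS]mulrC ler_pdivlMr// ler_pdivlMr//.
have := ler_wpM2r (ltW dp) h1; rewrite h3 => h4.
have -> : d * p ^+ 2 * pi * d = (pi / 2 * (p * (d / c)) * (2 * d * p)) * c.
  by field; rewrite gt_eqF.
by rewrite -[leRHS]mul1r ler_wpM2r// ltW.
Qed.

End Wallis.

(** * Partial products of the sine product *)

Section ReflectionProduct.
Variable R : realType.
Implicit Types (a z : R[i]) (A : R).

(** With S the sum of the |z_i| and P the product of the 1 + |z_i|, the left side is at most P - 1,
    while P (1 - S) <= 1; for S <= 1/2 this gives P - 1 <= 2 S. *)
Lemma prod_sub1_le (z : nat -> R[i]) (m n : nat) :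
  \sum_(m <= i < n) cabs (z i) <= 1 / 2 ->
  cabs (\prod_(m <= i < n) (1 + z i) - 1) <= 2 * \sum_(m <= i < n) cabs (z i).
Proof.
have aux1 (q s x : R) : 0 <= q -> 0 <= s -> 0 <= x -> q * (1 - s) <= 1 ->
    q * (1 + x) * (1 - (s + x)) <= 1.
  move=> q0 s0 x0 h; have := mulr_ge0 (mulr_ge0 q0 x0) s0.
  by have := mulr_ge0 (mulr_ge0 q0 x0) x0; lra.
have aux2 (q s : R) : 0 <= q -> 0 <= s -> s <= 1 / 2 -> q * (1 - s) <= 1 ->
    q - 1 <= 2 * s.
  move=> q0 s0 s1 h; have q2 : 0 <= 2 - q.
    have s2 : 0 <= 1 / 2 - s by lra.
    by have := mulr_ge0 q0 s2; lra.
  by have := mulr_ge0 s0 q2; lra.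
set S := \sum_(m <= i < n) cabs (z i) => S2.
pose P := \prod_(m <= i < n) (1 + cabs (z i)).
have [h1 h2] : cabs (\prod_(m <= i < n) (1 + z i) - 1) <= P - 1 /\ P * (1 - S) <= 1.
  rewrite /P /S in S2 *.
  have [nm|/subnKC <-] := leqP n m.
    by rewrite !big_geq// !subrr cabs0 subr0 mulr1.
  rewrite addSnnS; set d := (n - m.+1).+1.
  have dS k : \sum_(m <= i < m + k) cabs (z i) <= \sum_(m <= i < m + k.+1) cabs (z i).
    by rewrite addnS big_nat_recr ?leq_addr//= lerDl cabs_ge0.
  elim: d => [|d [ih1 ih2]]; first by rewrite addn0 !big_geq// !subrr cabs0 subr0 mulr1.
  rewrite addnS !(big_nat_recr _ _ _ (leq_addr d m)) /=.
  set p := \prod_(_ <= _ < _) (1 + z _) in ih1 *; set q := \prod_(_ <= _ < _) _ in ih1 ih2 *.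
  set s := \sum_(_ <= _ < _) _ in ih2 *.
  have x0 := cabs_ge0 (z (m + d)%N); set x := cabs (z _) in x0 *.
  have q0 : 0 <= q by apply: prodr_ge0 => i _; rewrite addr_ge0 ?cabs_ge0.
  split.
    have -> : p * (1 + z (m + d)%N) - 1 = (p - 1) * (1 + z (m + d)%N) + z (m + d)%N by ring.
    apply: le_trans (cabsD _ _) _; rewrite -/x cabsM.
    have x1 : cabs (1 + z (m + d)%N) <= 1 + x by apply: le_trans (cabsD _ _) _; rewrite cabs1.
    have := ler_pM (cabs_ge0 _) (cabs_ge0 _) ih1 x1.
    move: (cabs _ * _) => t; lra.
  have s0 : 0 <= s by apply: sumr_ge0 => i _; exact: cabs_ge0.
  exact: aux1.
apply: le_trans h1 _.
have S0 : 0 <= S by apply: sumr_ge0 => i _; exact: cabs_ge0.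
have P0 : 0 <= P by apply: prodr_ge0 => i _; rewrite addr_ge0 ?cabs_ge0.
exact: aux2.
Qed.

Definition gfac a (i : nat) : R[i] := 1 - a ^+ 2 * ((i.+1%:R : R)^-1 ^+ 2)%:C.

Definition gprod a (j : nat) : R[i] := a * \prod_(0 <= i < j) gfac a i.

Lemma gprod0 a : gprod a 0 = a. Proof. by rewrite /gprod big_geq// mulr1. Qed.

Lemma gprodS a j : gprod a j.+1 = gprod a j * gfac a j.
Proof. by rewrite /gprod big_nat_recr //= mulrA. Qed.

Lemma gprod_bound A a j : 0 <= A -> cabs a <= A -> cabs (gprod a j) <= A * (1 + A ^+ 2) ^+ j.
Proof.
move=> A0 aA; elim: j => [|j ih]; first by rewrite gprod0 expr0 mulr1.
rewrite gprodS cabsM exprSr mulrA ler_pM ?cabs_ge0//.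
apply: le_trans (cabsB _ _) _; rewrite cabs1 lerD2l cabsM cabsX.
rewrite cabs_real ger0_norm ?sqr_ge0//.
apply: (@le_trans _ _ (cabs a ^+ 2)); last by rewrite ler_pXn2r ?nnegrE ?cabs_ge0.
by rewrite ler_piMr ?sqr_ge0// expr_le1 ?invr_ge0// invf_le1// ler1n.
Qed.

(** Uniformity in [a] is the point: in the Weyl sequence of the Hilbert matrix [a] moves with n, and
    all coordinates j >= J must be controlled for all these [a] at once. *)
Lemma gprod_unif A : 0 <= A -> exists K J0, 0 <= K /\ forall a, cabs a <= A ->
  forall J j, (J0 <= J)%N -> (J <= j)%N -> cabs (gprod a j - gprod a J) <= K / J.+1%:R.
Proof.
move=> A0.
have p : 0 < 1 / 2 / (A ^+ 2 * 2 + 1) by rewrite !divr_gt0// ltr_wpDl// mulr_ge0 ?sqr_ge0.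
have [J0 J0A] := exists_inv_nat_lt p.
have sumle a J j : cabs a <= A ->
    \sum_(J <= i < j) cabs (- (a ^+ 2 * ((i.+1%:R : R)^-1 ^+ 2)%:C)) <= A ^+ 2 * 2 * J.+1%:R^-1.
  move=> aA; apply: (@le_trans _ _ (A ^+ 2 * \sum_(J <= i < j) (i.+1%:R ^+ 2)^-1)).
    rewrite mulr_sumr; apply: ler_sum => i _.
    rewrite cabsN cabsM cabsX cabs_real ger0_norm ?sqr_ge0// exprVn.
    by rewrite ler_wpM2r ?invr_ge0 ?sqr_ge0// ler_pXn2r ?nnegrE ?cabs_ge0.
  rewrite -mulrA ler_wpM2l ?sqr_ge0//; apply: le_trans (sum_inv_sqr_le R J j) _.
  rewrite mulr_natl mulr2n lerD2l lef_pV2 ?posrE ?exprn_gt0// expr2 ler_peMr//.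
  by rewrite ler1n.
have small J : (J0 <= J)%N -> A ^+ 2 * 2 * J.+1%:R^-1 <= 1 / 2.
  move=> J0J; apply: (@le_trans _ _ ((A ^+ 2 * 2 + 1) * J0.+1%:R^-1)).
    rewrite ler_pM ?invr_ge0 ?mulr_ge0 ?sqr_ge0 ?lerDl//.
    by rewrite lef_pV2 ?posrE// ler_nat.
  by rewrite mulrC -ler_pdivlMr ?(ltW J0A)// ltr_wpDl// mulr_ge0 ?sqr_ge0.
have split_ a J j : (J <= j)%N ->
    gprod a j - gprod a J = gprod a J * (\prod_(J <= i < j) gfac a i - 1).
  by move=> Jj; rewrite /gprod (big_cat_nat (leq0n J) Jj) /= mulrBr mulr1 mulrA.
have diff a J j : cabs a <= A -> (J0 <= J)%N -> (J <= j)%N ->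
    cabs (gprod a j - gprod a J) <= cabs (gprod a J) * (A ^+ 2 * 4 * J.+1%:R^-1).
  move=> aA J0J Jj; rewrite split_// cabsM ler_wpM2l ?cabs_ge0//.
  have := sumle a J j aA; have := small J J0J => h1 h2.
  apply: le_trans (prod_sub1_le (le_trans h2 h1)) _.
  by move: h2; move: (\sum_(_ <= _ < _) _) (_^-1) (A ^+ 2 : R) => *; lra.
pose B := A * (1 + A ^+ 2) ^+ J0.
have B0 : 0 <= B by rewrite mulr_ge0 ?exprn_ge0 ?addr_ge0 ?sqr_ge0.
exists (B * 2 * (A ^+ 2 * 4)), J0; split.
  by apply: mulr_ge0; [exact: mulr_ge0|rewrite mulr_ge0 ?sqr_ge0].
move=> a aA J j J0J Jj; apply: le_trans (diff _ _ _ aA J0J Jj) _.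
rewrite -[leRHS]mulrA ler_wpM2r ?mulr_ge0 ?invr_ge0 ?sqr_ge0//.
rewrite -[gprod a J](subrK (gprod a J0)); apply: le_trans (cabsD _ _) _.
rewrite mulr_natr mulr2n; apply: lerD; last exact: gprod_bound.
apply: le_trans (diff _ _ _ aA (leqnn _) J0J) _; apply: le_trans (_ : _ <= B * 1) _; last by rewrite mulr1.
apply: ler_pM; rewrite ?cabs_ge0 ?mulr_ge0 ?invr_ge0 ?sqr_ge0//; first exact: gprod_bound.
by have := small J0 (leqnn _); move: (_^-1) (A ^+ 2 : R) => *; lra.
Qed.

(** Completeness of [R[i]] is read off that of [H2] by embedding scalars as multiples of e_0. *)
Lemma cauchy_ctends (u : nat -> R[i]) (e : nat -> R) :
  (forall n m, (n <= m)%N -> cabs (u m - u n) <= e n) -> e @ \oo --> (0 : R) ->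
  exists l, forall n, cabs (u n - l) <= e n.
Proof.
move=> ue e0; have [|f fE] := @h2_complete R (fun n => u n *: h2e R 0) e _ e0.
  by move=> n m nm; rewrite -scalerBl h2normZ h2norm_e mulr1 ue.
exists (f 0%N) => n; apply: le_trans (fE n).
have := cabs_coef_le (u n *: h2e R 0 - f) 0.
by rewrite h2coefB h2coefZ coef_h2e eqxx mulr1.
Qed.

Lemma glim_exists A : 0 <= A -> exists K J0, 0 <= K /\ forall a, cabs a <= A ->
  exists l, forall J, (J0 <= J)%N -> cabs (gprod a J - l) <= K / J.+1%:R.
Proof.
move=> A0; have [K [J0 [K0 h]]] := gprod_unif A0; exists K, J0; split=> // a aA.
have [n m nm||l lE] := @cauchy_ctends (fun n => gprod a (n + J0)) (fun n => K / (n + J0).+1%:R).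
- by apply: h => //; [exact: leq_addl|rewrite leq_add2r].
- rewrite -[X in _ --> X](mulr0 K); apply: cvgMr.
  apply/cvgrPdist_lt => e /exists_inv_nat_lt[N Ne]; exists N => // n /= Nn.
  rewrite sub0r normrN ger0_norm ?invr_ge0//; apply: le_lt_trans Ne.
  by rewrite lef_pV2 ?posrE// ler_nat ltnS (leq_trans Nn)// leq_addr.
- by exists l => J J0J; have := lE (J - J0)%N; rewrite subnK.
Qed.

(* The limit of [gprod a] is [sin (pi a) / pi]; on the line [Re a = 1/2] it is real. *)
Definition gline (x : R) : R[i] := (1 / 2) +i* x.

Lemma cabs_gline x : cabs (gline x) <= 1 / 2 + `|x|.
Proof. by apply: le_trans (cabs_le_ReIm _) _; rewrite /= [`|1 / 2|]ger0_norm. Qed.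

Definition lineprod (x : R) (j : nat) : R :=
  \prod_(i < j) (((i%:R + 1 / 2) ^+ 2 + x ^+ 2) / i.+1%:R ^+ 2).

Lemma lineprodS x j : lineprod x j.+1 =
  lineprod x j * (((j%:R + 1 / 2) ^+ 2 + x ^+ 2) / j.+1%:R ^+ 2).
Proof. by rewrite /lineprod big_ord_recr. Qed.

(** In a \prod_m (m - a)(m + a) / m^2 with a = 1/2 + i x, the factor m + a is conjugate to the next
    factor (m + 1) - a, and [a] itself to 1 - a. The pairs give the positive numbers (i + 1/2)^2 +
    x^2, and only the last factor j + 1/2 + i x remains unpaired. *)
Lemma gprod_gline x j :
  gprod (gline x) j = ((j%:R + 1 / 2) * lineprod x j) +i* (x * lineprod x j).
Proof.
elim: j => [|j ih]; first by rewrite gprod0 /lineprod big_ord0 !mulr1 add0r.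
rewrite gprodS ih lineprodS /gfac.
have j0 : 0 < j.+1%:R :> R by []. have jE : j.+1%:R = j%:R + 1 :> R by rewrite natr1.
rewrite jE in j0 *; move: (j%:R : R) (lineprod x j) j0 => c p c0.
have cN : c + 1 != 0 by rewrite gt_eqF.
rewrite /gline; apply/eqP; rewrite eq_complex /=; apply/andP; split; apply/eqP; field.
all: exact: cN.
Qed.

Lemma lineprod_wallis j : lineprod 0 j = wallis R j ^+ 2.
Proof.
rewrite /lineprod /wallis -prodrXl; apply: eq_bigr => i _.
by rewrite expr0n addr0 expr_div_n.
Qed.

Lemma lineprod_ge0 x j : 0 <= lineprod x j.
Proof. by apply: prodr_ge0 => i _; rewrite divr_ge0 ?addr_ge0 ?sqr_ge0. Qed.

(** The first factor alone has ratio (1/4 + x^2) / (1/4) = 1 + 4 x^2; the others do not decrease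
    with x^2. *)
Lemma lineprod_ge x j : lineprod 0 j.+1 * (1 + 4 * x ^+ 2) <= lineprod x j.+1.
Proof.
elim: j => [|j ih].
  rewrite /lineprod !big_ord_recr !big_ord0 /= !mul1r; move: (x ^+ 2 : R) => y.
  by rewrite !expr0n /= !addr0 mulr0n !add0r !expr1n !invr1 !mulr1; lra.
rewrite (lineprodS 0) (lineprodS x) mulrAC; apply: ler_pM; [| |exact: ih|].
- by rewrite mulr_ge0 ?lineprod_ge0// addr_ge0// mulr_ge0// sqr_ge0.
- by rewrite divr_ge0 ?addr_ge0 ?sqr_ge0.
- by rewrite ler_wpM2r ?invr_ge0 ?sqr_ge0// lerD2l expr0n /= sqr_ge0.
Qed.

End ReflectionProduct.

(** * The limit of the product on the critical line *)

Section LineLimit.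
Variable R : realType.
Implicit Types (x A : R).

(** This is cosh (pi x) / pi. What is extracted from it is the value 1 / pi at 0, a quadratic lower
    bound and continuity. *)
Definition lineL x : R := limn (fun j => (j%:R + 1 / 2) * lineprod x j).

Let inv_half : (fun j : nat => (j%:R + 1 / 2 : R)^-1) @ \oo --> (0 : R).
Proof.
apply/cvgrPdist_lt => e /exists_inv_nat_lt[N Ne]; exists N.+1 => // n /= Nn.
have n0 : 0 < n%:R + 1 / 2 :> R by rewrite ltr_wpDl.
rewrite sub0r normrN ger0_norm ?invr_ge0 ?(ltW n0)//; apply: le_lt_trans Ne.
rewrite lef_pV2 ?posrE//; apply: (@le_trans _ _ n%:R); first by rewrite ler_nat.
by rewrite lerDl.
Qed.

(** The limit is real because the imaginary part of [gprod] is x / (j + 1/2) times its real part,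
    which converges. *)
Lemma lineL_unif A : 0 <= A -> exists K J0, 0 <= K /\ forall x, `|x| <= A ->
  forall J, (J0 <= J)%N -> cabs (gprod (gline x) J - (lineL x)%:C) <= K / J.+1%:R.
Proof.
move=> A0; have A10 : 0 <= 1 / 2 + A by rewrite addr_ge0.
have [K [J0 [K0 h]]] := glim_exists A10; exists K, J0; split=> // x xA.
have [|l lE] := h (gline x).
  by apply: le_trans (cabs_gline x) _; rewrite lerD2l.
have cl : ctends (gprod (gline x)) l.
  apply/(ctends_shift J0); apply: (ctends_squeeze (b := fun n => K / (n + J0).+1%:R)).
    by move=> n; apply: lE; exact: leq_addl.
  rewrite -[X in _ --> X](mulr0 K); apply: cvgMr.
  apply/cvgrPdist_lt => e /exists_inv_nat_lt[N Ne]; exists N => // n /= Nn.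
  rewrite sub0r normrN ger0_norm ?invr_ge0//; apply: le_lt_trans Ne.
  by rewrite lef_pV2 ?posrE// ler_nat ltnS (leq_trans Nn)// leq_addr.
have cR : (fun j => (j%:R + 1 / 2) * lineprod x j) @ \oo --> complex.Re l.
  by have := ctends_Re cl; under eq_fun do rewrite gprod_gline /=.
have cI : (fun j => x * lineprod x j) @ \oo --> complex.Im l.
  by have := ctends_Im cl; under eq_fun do rewrite gprod_gline /=.
have I0 : complex.Im l = 0.
  rewrite -(cvg_lim _ cI)//; apply/cvg_lim => //.
  have -> : (fun j => x * lineprod x j) =
      (fun j => x * ((j%:R + 1 / 2)^-1 * ((j%:R + 1 / 2) * lineprod x j))).
    apply/funext => j; rewrite mulKf// gt_eqF// ltr_wpDl//.
  rewrite -[X in _ --> X](mulr0 x); apply: cvgMr.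
  by rewrite -[X in _ --> X](mul0r (complex.Re l)); exact: cvgM.
have RL : complex.Re l = lineL x by rewrite /lineL; apply/esym/cvg_lim.
by case: l I0 RL lE {h cl cR cI} => a b /= -> ->.
Qed.

Lemma gprod_gline_cvg x : ctends (gprod (gline x)) (lineL x)%:C.
Proof.
have [K [J0 [K0 h]]] := lineL_unif (normr_ge0 x).
apply/(ctends_shift J0); apply: (ctends_squeeze (b := fun n => K / (n + J0).+1%:R)).
  by move=> n; apply: h; rewrite ?leq_addl.
rewrite -[X in _ --> X](mulr0 K); apply: cvgMr.
apply/cvgrPdist_lt => e /exists_inv_nat_lt[N Ne]; exists N => // n /= Nn.
rewrite sub0r normrN ger0_norm ?invr_ge0//; apply: le_lt_trans Ne.
by rewrite lef_pV2 ?posrE// ler_nat ltnS (leq_trans Nn)// leq_addr.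
Qed.

Lemma lineprod_cvg x : (fun j => (j%:R + 1 / 2) * lineprod x j) @ \oo --> lineL x.
Proof. by have := ctends_Re (gprod_gline_cvg x); under eq_fun do rewrite gprod_gline /=. Qed.

Lemma lineL0 : lineL 0 = pi^-1.
Proof.
apply/cvg_lim => //.
have up : (fun j : nat => pi^-1 * (j.+1%:R / (j%:R + 1 / 2)) : R) @ \oo --> (pi^-1 : R).
  rewrite -[X in _ --> X]mulr1; apply: cvgMr.
  have -> : (fun j : nat => j.+1%:R / (j%:R + 1 / 2) : R) =
      (fun j : nat => 1 + 1 / 2 * (j%:R + 1 / 2)^-1).
    apply/funext => j; rewrite -natr1; have : 0 < j%:R + 1 / 2 :> R by rewrite ltr_wpDl.
    move=> j0; have jN : j%:R + 1 / 2 != 0 :> R by rewrite gt_eqF.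
    apply: (mulIf jN); rewrite divfK// mulrDl mulfVK//; lra.
  rewrite -[X in _ --> X]addr0; apply: cvgD; first exact: cvg_cst.
  by rewrite -[X in _ --> X](mulr0 (1 / 2)); apply: cvgMr.
apply: (squeeze_cvgr _ (cvg_cst (pi^-1 : R)) up).
by apply: nearW => j; rewrite lineprod_wallis; exact: wallis_bounds.
Qed.

Lemma lineL_ge x : pi^-1 * (1 + 4 * x ^+ 2) <= lineL x.
Proof.
have lx : (fun j => (j%:R + 1 / 2) * lineprod x j) @ \oo --> lineL x by exact: lineprod_cvg.
rewrite -(cvg_lim _ lx)//; apply: limr_ge; first by apply/cvg_ex; exists (lineL x).
exists 1%N => // -[//|j] _ /=.
have /andP[w _] := wallis_bounds R j.+1; rewrite -lineprod_wallis in w.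
apply: (@le_trans _ _ ((j.+1%:R + 1 / 2) * lineprod 0 j.+1 * (1 + 4 * x ^+ 2))).
  by rewrite ler_wpM2r// addr_ge0// mulr_ge0// sqr_ge0.
by rewrite -mulrA ler_wpM2l ?lineprod_ge ?addr_ge0.
Qed.

(** A locally uniform limit of polynomials in x. *)
Lemma lineL_continuous : continuous lineL.
Proof.
move=> x; apply/cvgrPdist_le => e e0.
have A0 : 0 <= `|x| + 1 by rewrite addr_ge0.
have [K [J0 [K0 h]]] := lineL_unif A0.
have K10 : 0 < K + 1 by rewrite ltr_wpDl.
have [J1 J1e] := exists_inv_nat_lt (divr_gt0 (divr_gt0 e0 (ltr0n R 3)) K10).
pose J := maxn J0 J1.
have KJ : K / J.+1%:R <= e / 3.
  apply: (@le_trans _ _ ((K + 1) * J1.+1%:R^-1)).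
    by rewrite ler_pM ?invr_ge0 ?lerDl// lef_pV2 ?posrE// ler_nat ltnS leq_maxr.
  by rewrite mulrC -ler_pdivlMr// ltW.
pose y (t : R) : R := (J%:R + 1 / 2) * lineprod t J.
have yL (t : R) : `|t| <= `|x| + 1 -> `|y t - lineL t| <= e / 3.
  move=> tA; apply: le_trans KJ; apply: le_trans (h t tA J (leq_maxl _ _)).
  by rewrite gprod_gline; apply: le_trans (Re_le_cabs _); rewrite ReB.
have cy : {for x, continuous y}.
  apply: cvgM; first exact: cvg_cst.
  rewrite /lineprod; apply: cvg_big; first exact: mul_continuous.
  move=> i _; apply: cvgMl; apply: cvgD; first exact: cvg_cst.
  exact: exprn_continuous.
have e30 : 0 < e / 3 by rewrite divr_gt0.
have near_x : \forall t \near x, `|x - t| < 1.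
  by apply/nbhs_ballP; exists 1 => //= t; rewrite -ball_normE.
have /cvgrPdist_le/(_ _ e30) near_y := cy.
apply: filterS2 near_x near_y => t xt yt; have tA : `|t| <= `|x| + 1.
  rewrite -[t](subrK x) addrC; apply: le_trans (ler_normD _ _) _.
  by rewrite lerD2l distrC ltW.
have xA : `|x| <= `|x| + 1 by rewrite lerDl.
have := yL x xA; have := yL t tA; rewrite !ler_norml => /andP[a1 a2] /andP[b1 b2].
move: yt; rewrite ler_norml => /andP[c1 c2].
by move: (lineL x) (lineL t) (y x) (y t) a1 a2 b1 b2 c1 c2 => *; apply/andP; split; lra.
Qed.

Lemma lineL_surj (l : R) : 0 < l <= pi -> exists x, lineL x = l^-1.
Proof.
move=> /andP[l0 lpi]; have pi0 : 0 < pi :> R by exact: pi_gt0.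
(* At x = pi / l the bound (1 + 4 x^2) / pi of [lineL_ge] already exceeds 1 / l = x / pi, which
   brackets the value for the intermediate value theorem. *)
pose M := pi / l; have M0 : 0 <= M by rewrite divr_ge0 ?ltW.
have LM : l^-1 <= lineL M.
  apply: le_trans (lineL_ge M).
  have -> : l^-1 = pi^-1 * M by rewrite /M mulrA mulVf ?mul1r ?gt_eqF.
  by rewrite ler_wpM2l ?invr_ge0 ?(ltW pi0)//; move: M M0 => m m0; nra.
have L0l : lineL 0 <= l^-1 by rewrite lineL0 lef_pV2 ?posrE.
have [||c _ cE] := @IVT R lineL 0 M l^-1 M0; last by exists c.
- by apply: continuous_subspaceT; exact: lineL_continuous.
- have LL := le_trans L0l LM.
  by rewrite (min_idPl LL) (max_idPr LL) L0l LM.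
Qed.

End LineLimit.

(** * The Schur test *)

Section SchurTest.
Variable R : realType.

(** The optimum is t = Q / P; the shift of both by [d] keeps t defined and positive when [P] or [Q]
    is 0. *)
Lemma le_mul_of_amgm (X P Q : R) : 0 <= P -> 0 <= Q ->
  (forall t, 0 < t -> 2 * X <= t * P ^+ 2 + t^-1 * Q ^+ 2) -> X <= P * Q.
Proof.
move=> P0 Q0 h; apply/ler_addgt0Pr => e e0.
pose d := e / (P + Q + 1).
have s0 : 0 < P + Q + 1 by rewrite ltr_wpDl ?addr_ge0.
have d0 : 0 < d by rewrite divr_gt0.
have p0 : 0 < P + d by rewrite ltr_wpDl.
have q0 : 0 < Q + d by rewrite ltr_wpDl.
have := h ((Q + d) / (P + d)) (divr_gt0 q0 p0).
have h1 : (Q + d) / (P + d) * P ^+ 2 <= (Q + d) * P.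
  rewrite -mulrA ler_wpM2l ?(ltW q0)// mulrC ler_pdivrMr// expr2 ler_wpM2l//.
  by rewrite lerDl ltW.
have h2 : ((Q + d) / (P + d))^-1 * Q ^+ 2 <= (P + d) * Q.
  rewrite invf_div -mulrA ler_wpM2l ?(ltW p0)// mulrC ler_pdivrMr// expr2 ler_wpM2l//.
  by rewrite lerDl ltW.
have h3 : d * (P + Q) <= e.
  rewrite /d mulrAC ler_pdivrMr// ler_wpM2l ?(ltW e0)// lerDl//.
move=> hX; have : 2 * X <= (Q + d) * P + (P + d) * Q by apply: le_trans hX _; exact: lerD.
have := mulr_ge0 P0 Q0; move: h3; clear -d0 e0; lra.
Qed.

(** Each term obeys 2 |E| x y <= t |E| (p_j / p_k) x^2 + t^(-1) |E| (p_k / p_j) y^2; column and row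
    sums bound the two halves, and the free parameter t is removed by [le_mul_of_amgm]. *)
Lemma schur_test (E : nat -> nat -> R[i]) (p : nat -> R) (M : R) : 0 <= M ->
  (forall j, 0 < p j) ->
  (forall j n, \sum_(k < n) cabs (E j k) * p k <= M * p j) ->
  (forall k m, \sum_(j < m) cabs (E j k) * p j <= M * p k) ->
  exists A : H2 R -> H2 R, [/\ bounded_op A, opbound A M & forall j k, A (h2e R k) j = E j k].
Proof.
move=> M0 p0 rowM colM; apply: form_op => // m n a b.
pose X := \sum_(j < m) \sum_(k < n) cabs (E j k) * cabs (a k) * cabs (b j).
apply: (@le_trans _ _ X).
  apply: le_trans (cabs_sum _ _ _) _; apply: ler_sum => j _.
  apply: le_trans (cabs_sum _ _ _) _; apply: ler_sum => k _.
  by rewrite !cabsM cabs_conj.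
have -> : M * Num.sqrt (\sum_(k < n) cabs (a k) ^+ 2) * Num.sqrt (\sum_(j < m) cabs (b j) ^+ 2) =
    (Num.sqrt M * Num.sqrt (\sum_(k < n) cabs (a k) ^+ 2)) *
    (Num.sqrt M * Num.sqrt (\sum_(j < m) cabs (b j) ^+ 2)).
  by rewrite mulrACA -expr2 sqr_sqrtr// mulrA.
apply: le_mul_of_amgm; rewrite ?mulr_ge0 ?sqrtr_ge0// => t t0.
rewrite !exprMn !sqr_sqrtr//; try by apply: sumr_ge0 => *; exact: sqr_ge0.
apply: (@le_trans _ _ (\sum_(j < m) \sum_(k < n)
   (t * (cabs (E j k) * p j) * ((p k)^-1 * cabs (a k) ^+ 2) +
    t^-1 * (cabs (E j k) * p k) * ((p j)^-1 * cabs (b j) ^+ 2)))).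
  rewrite /X mulr_sumr; apply: ler_sum => j _; rewrite mulr_sumr; apply: ler_sum => k _.
  move: (cabs (E j k)) (cabs (a k)) (cabs (b j)) (p j) (p k) (cabs_ge0 (E j k)) (p0 j) (p0 k).
  move=> e x y pj pk e0 pj0 pk0.
  rewrite -subr_ge0.
  have -> : t * (e * pj) * (pk^-1 * x ^+ 2) + t^-1 * (e * pk) * (pj^-1 * y ^+ 2) -
      2 * (e * x * y) = e / (t * pj * pk) * (t * pj * x - pk * y) ^+ 2.
    by field; rewrite !gt_eqF.
  by rewrite mulr_ge0 ?sqr_ge0// divr_ge0// !mulr_ge0// ltW.
under eq_bigr do rewrite big_split /=.
rewrite big_split /= exchange_big /=; apply: lerD.
  rewrite [leRHS]mulrA mulr_sumr; apply: ler_sum => k _.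
  rewrite -mulr_suml -mulr_sumr.
  have -> : t * M * cabs (a k) ^+ 2 = t * (M * p k) * ((p k)^-1 * cabs (a k) ^+ 2).
    by field; rewrite gt_eqF.
  apply: ler_wpM2r; first by rewrite mulr_ge0 ?sqr_ge0// invr_ge0 ltW.
  by apply: ler_wpM2l (colM k m); exact: ltW.
rewrite [leRHS]mulrA mulr_sumr; apply: ler_sum => j _.
rewrite -mulr_suml -mulr_sumr.
have -> : t^-1 * M * cabs (b j) ^+ 2 = t^-1 * (M * p j) * ((p j)^-1 * cabs (b j) ^+ 2).
  by field; rewrite !gt_eqF.
apply: ler_wpM2r; first by rewrite mulr_ge0 ?sqr_ge0// invr_ge0 ltW.
by apply: ler_wpM2l (rowM j n); rewrite invr_ge0 ltW.
Qed.

End SchurTest.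

Section ResolventDisc.
Variable R : realType.
Local Notation H := (H2 R).

(** A - w = - d (id - (A - c) / d) with d = w - c, and the Neumann series converges as r < |d|. *)
Lemma resolvent_disc (A : H -> H) (c w : R[i]) (r : R) : bounded_op A ->
  opbound (fun f => A f - c *: f) r -> 0 <= r < cabs (w - c) ->
  calkin_invertible (fun f => A f - w *: f).
Proof.
move=> bA Ar /andP[r0 rd]; pose d := w - c; have lA : linear A by case: bA.
have d0 : 0 < cabs d by exact: le_lt_trans r0 rd.
have dN : d != 0 by rewrite -cabs_gt0.
have bAc := bounded_op_shift c bA.
have [||B [bB BE EB]] := @neumann _ (fun f => d^-1 *: (A f - c *: f)) (r / cabs d) (bounded_opZ _ bAc).
- by move=> f; rewrite h2normZ cabsV mulrC ler_pdivrMr// mulrAC divfK ?gt_eqF.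
- by rewrite divr_ge0 ?(ltW d0)// ltr_pdivrMr// mul1r.
have lB : linear B by case: bB.
have AE f : A f - w *: f = - d *: (f - d^-1 *: (A f - c *: f)).
  rewrite scalerBr scalerA mulNr divff// scaleN1r opprK /d; apply: h2_ext => k.
  by rewrite !(h2coefD, h2coefN, h2coefZ); ring.
have dNN : - d != 0 by rewrite oppr_eq0.
exists (fun f => (- d)^-1 *: B f); split; first exact: bounded_opZ.
  have -> : calkin_eq ((fun f => A f - w *: f) \o (fun f => (- d)^-1 *: B f)) id =
      compact_op (fun=> 0 : H).
    rewrite /calkin_eq; congr compact_op; apply/funext => f /=.
    rewrite AE (linZ _ _ lA) [c *: _]scalerA mulrC -scalerA -scalerBr [d^-1 *: _]scalerA.
    by rewrite mulrC -scalerA -scalerBr BE scalerA divff// scale1r subrr.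
  exact: compact_op0.
have -> : calkin_eq ((fun f => (- d)^-1 *: B f) \o (fun f => A f - w *: f)) id =
    compact_op (fun=> 0 : H).
  rewrite /calkin_eq; congr compact_op; apply/funext => f /=.
  by rewrite AE (linZ _ _ lB) EB scalerA mulVf// scale1r subrr.
exact: compact_op0.
Qed.

Lemma sqr_h2norm_le (f : H) (S : R) : 0 <= S -> (forall n, sqsum f n <= S) -> h2norm f ^+ 2 <= S.
Proof.
move=> S0 fS; have sS : h2norm f <= Num.sqrt S.
  by apply: h2norm_le => [|n]; rewrite ?sqrtr_ge0// sqr_sqrtr.
by rewrite -[leRHS]sqr_sqrtr// ler_pXn2r ?nnegrE ?h2norm_ge0 ?sqrtr_ge0.
Qed.

End ResolventDisc.

(** * Norm, positivity and Weyl sequences of the Hilbert matrix *)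

Section HilbertMatrix.
Variable R : realType.
Local Notation H := (H2 R).
Local Notation r m := (((m.+1%:R : R)^-1)%:C).

Definition is_hilbert (G : H -> H) : Prop := bounded_op G /\
  forall j k, G (h2e R k) j = r (j + k)%N.

Lemma hilbert_of_matrix (G : H -> H) : bounded_op G ->
  (forall j k : nat, h2ip (G (h2e R k)) (h2e R j) = ((j + k + 1)%:R : R[i])^-1) -> is_hilbert G.
Proof. by move=> bG GE; split=> // j k; rewrite -h2ip_er GE natrC addn1. Qed.

(** As 1 / (j + k + 1) is the integral of t^(j+k) over [0, 1], the form is the integral of the
    square of \sum_k p_k t^k. *)
Lemma sum_inv_psd (p : nat -> R) n :
  0 <= \sum_(j < n) \sum_(k < n) p j * p k * ((j + k)%N.+1%:R)^-1.
Proof.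
pose F (t : R) := \sum_(j < n) \sum_(k < n) p j * p k * ((j + k)%N.+1%:R)^-1 * t ^+ (j + k).+1.
pose s (t : R) := \sum_(k < n) p k * t ^+ k.
have derS (h dh : nat -> R -> R) (m : nat) (t : R) : (forall i : nat, is_derive t 1 (h i) (dh i t)) ->
    is_derive t 1 (fun y => \sum_(i < m) h i y) (\sum_(i < m) dh i t).
  move=> hd; elim: m => [|m ih].
    rewrite big_ord0 (_ : (fun y => _) = cst 0); first exact: is_derive_cst.
    by apply/funext => y; rewrite big_ord0.
  rewrite big_ord_recr (_ : (fun y => _) = (fun y => \sum_(i < m) h i y + h m y)).
    exact: derD.
  by apply/funext => y; rewrite big_ord_recr.
have dF (t : R) : is_derive t 1 F (s t ^+ 2).
  have -> : s t ^+ 2 = \sum_(j < n) \sum_(k < n) p j * p k * t ^+ (j + k).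
    rewrite expr2 /s mulr_suml; apply: eq_bigr => j _; rewrite mulr_sumr.
    by apply: eq_bigr => k _; rewrite exprD; ring.
  apply: (derS (fun j y => \sum_(k < n) p j * p k * ((j + k)%N.+1%:R)^-1 * y ^+ (j + k).+1)
    (fun j t => \sum_(k < n) p j * p k * t ^+ (j + k))) => j.
  apply: (derS (fun k y => p j * p k * ((j + k)%N.+1%:R)^-1 * y ^+ (j + k).+1)
    (fun k t => p j * p k * t ^+ (j + k))) => k.
  have := derZ (p j * p k * ((j + k)%N.+1%:R)^-1) (derX (j + k) (is_derive_id t 1)).
  by rewrite mulr1 mulrA divfK// pnatr_eq0.
have cs : continuous (fun t => s t ^+ 2).
  move=> t; apply: (@continuous_comp _ _ _ s (fun y => y ^+ 2)); last exact: exprn_continuous.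
  rewrite /continuous_at /s; apply: cvg_big; first exact: add_continuous.
  by move=> k _; apply: cvgMr; exact: exprn_continuous.
have := Rintegral_FTC (@ltr01 R) (fun x _ => dF x) (fun x _ => cs x).
have -> : F 0 = 0.
  by rewrite /F big1// => j _; rewrite big1// => k _; rewrite expr0n mulr0.
have -> : F 1 = \sum_(j < n) \sum_(k < n) p j * p k * ((j + k)%N.+1%:R)^-1.
  by apply: eq_bigr => j _; apply: eq_bigr => k _; rewrite expr1n mulr1.
by rewrite subr0 => <-; apply: Rintegral_ge0 => x _; exact: sqr_ge0.
Qed.

Section Gamma.
Variable G : H -> H.
Hypothesis hG : is_hilbert G.

Let bG : bounded_op G. Proof. by case: hG. Qed.
Let lG : linear G. Proof. by case: bG. Qed.

Lemma hilbert_sa : is_adjoint G G.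
Proof. by apply: adjoint_of_coef => // j k; rewrite !hG.2 conj_real addnC. Qed.

(** The right side telescopes in k with vanishing limit, so that summation turns the matrix product
    into the first-order recursion [hilbert_evec_step]. *)
Lemma hilbert_telescope a j k :
  evec a k * (j.+1%:R * r (j + k)%N - (j.+1%:R + a) * r (j + k).+1) =
  k.+1%:R * evec a k.+1 * r (j + k).+1 - k%:R * evec a k * r (j + k)%N.
Proof.
rewrite evecS !natrC.
have N0 m : (m.+1%:R : R[i]) != 0 by rewrite pnatr_eq0.
have E1 : (j + k).+1%:R = j%:R + k%:R + 1 :> R[i] by rewrite -addn1 !natrD.
have E2 : (j + k).+2%:R = j%:R + k%:R + 2 :> R[i] by rewrite -addn2 !natrD.
have n1 := N0 (j + k)%N; have n2 := N0 (j + k).+1; have n3 := N0 k.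
rewrite E1 in n1 *; rewrite E2 in n2 *.
have E3 : k.+1%:R = k%:R + 1 :> R[i] by rewrite -natr1.
have E4 : j.+1%:R = j%:R + 1 :> R[i] by rewrite -natr1.
rewrite E3 E4 in n3 *.
by field; rewrite n1 n2 n3.
Qed.

Section Evec.
Variables (a : R[i]) (v : H).
Hypotheses (a0 : a != 0) (vE : forall k, v k = evec a k).

Let v0 : ctends (fun n => v n) 0.
Proof. by move=> e /(h2_coef_cvg0 v)[N vN]; exists N => n /vN; rewrite subr0. Qed.

Lemma hilbert_evec_step j : j.+1%:R * G v j = (j.+1%:R + a) * G v j.+1.
Proof.
apply/eqP; rewrite -subr_eq0; apply/eqP.
have c1 := ctendsB (ctendsZ j.+1%:R (coef_op v j bG)) (ctendsZ (j.+1%:R + a) (coef_op v j.+1 bG)).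
apply: ctends_unique c1 _.
apply: (@ctends_ext _ (fun n => n%:R * evec a n * r (j + n)%N)).
  move=> n; rewrite !mulr_sumr -sumrB.
  transitivity (\sum_(k < n) (k.+1%:R * evec a k.+1 * r (j + k).+1 - k%:R * evec a k * r (j + k)%N)).
    elim: n => [|n ih]; first by rewrite big_ord0 !mul0r.
    by rewrite big_ord_recr /= -ih addnS; ring.
  apply: eq_bigr => k _; rewrite -hilbert_telescope vE !hG.2 addSn; ring.
move=> e /v0[N vN]; exists N => n /vN; apply: le_lt_trans; rewrite !subr0 vE.
rewrite mulrAC cabsM ler_piMl ?cabs_ge0// cabsM cabs_nat cabs_real ger0_norm ?invr_ge0//.
by rewrite ler_pdivrMr// mul1r ler_nat; lia.
Qed.

Lemma hilbert_evec0 : G v 0%N = a^-1.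
Proof.
apply: ctends_unique (coef_op v 0 bG) _.
apply: (@ctends_ext _ (fun n => a^-1 * (1 - v n))); last first.
  by rewrite -[X in ctends _ X]mulr1 -[X in _ * X]subr0; apply/ctendsZ/ctendsB/v0/ctends_cst.
move=> n; apply: (mulfI a0); rewrite mulrA divff// mul1r mulr_sumr vE.
elim: n => [|n ih]; first by rewrite evec0 big_ord0 subrr.
rewrite big_ord_recr /= -ih hG.2 add0n vE evec_telescope; ring.
Qed.

(** [v] has successive ratios 1 - a / (j + 1), and [G v] has (j + 1) / (j + 1 + a); their quotient
    is the factor 1 - a^2 / (j + 1)^2 of [gprod]. *)
Lemma hilbert_evec j : v j = gprod a j * G v j.
Proof.
elim: j => [|j ih]; first by rewrite gprod0 hilbert_evec0 divff// vE evec0.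
rewrite vE evecS -vE ih gprodS /gfac.
have := hilbert_evec_step j; rewrite natrC rmorphXn /= fmorphV rmorph_nat.
have j0 : j.+1%:R != 0 :> R[i] by rewrite pnatr_eq0.
move: (j.+1%:R : R[i]) (G v j) (G v j.+1) (gprod a j) j0 => c x y g c0 E.
have -> : x = (c + a) * y / c by rewrite -E mulrAC divff// mul1r.
by field.
Qed.

(** The moduli start at 1 / |a| <= 2 and decrease, as |j + 1 + a| >= j + 1. The bound is independent
    of |v|, so finitely many coordinates become negligible after normalization. *)
Lemma hilbert_evec_bound j : 1 / 2 <= complex.Re a -> cabs (G v j) <= 2.
Proof.
move=> ha; have ca : 1 / 2 <= cabs a.
  by apply: le_trans ha _; apply: le_trans (ler_norm _) _; exact: Re_le_cabs.
elim: j => [|j ih].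
  rewrite hilbert_evec0 cabsV (_ : 2 = (1 / 2)^-1 :> R); last by rewrite invf_div divr1.
  by rewrite lef_pV2 ?posrE// (lt_le_trans _ ca).
apply: le_trans ih; have j0 : 0 < j.+1%:R :> R by [].
have := congr1 (fun z : R[i] => cabs z) (hilbert_evec_step j); rewrite /= !cabsM cabs_nat => h.
have ja : j.+1%:R <= cabs (j.+1%:R + a).
  apply: le_trans (Re_le_cabs _); apply: le_trans (ler_norm _); rewrite ReD.
  have -> : complex.Re (j.+1%:R : R[i]) = j.+1%:R by rewrite -(rmorph_nat (real_complex R)).
  by rewrite lerDl (le_trans _ ha).
have : j.+1%:R * cabs (G v j.+1) <= j.+1%:R * cabs (G v j).
  by rewrite h ler_wpM2r ?cabs_ge0.
by rewrite ler_pM2l.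
Qed.

End Evec.

(** Schur test with the weights [wallis], which are [evec] at 1/2. These are not square summable, so
    the recursion for [G v] is replaced by an inequality on partial row sums [S], whose remainder n
    V_n / (j + n + 1) has the right sign. It gives S_j (j + 1/2) V_j <= 1, and the lower Wallis
    bound turns this into S_j <= pi V_j. *)
Lemma hilbert_bound : opbound G pi.
Proof.
pose V k := wallis R k; have pi0 : 0 < pi :> R by exact: pi_gt0.
pose S j n := \sum_(k < n) V k * ((j + k).+1%:R)^-1.
have V0 k : 0 < V k by exact: wallis_gt0.
have S0 j n : 0 <= S j n.
  by apply: sumr_ge0 => k _; rewrite divr_ge0// ltW.
have Sstep j n : (j%:R + 1 + 1 / 2) * S j.+1 n <= (j%:R + 1) * S j n.
  rewrite -subr_ge0.
  have -> : (j%:R + 1) * S j n - (j%:R + 1 + 1 / 2) * S j.+1 n = n%:R * V n / (j + n).+1%:R.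
    rewrite /S; elim: n => [|n ih]; first by rewrite !big_ord0 !mulr0 subrr !mul0r.
    rewrite !big_ord_recr /= !mulrDr opprD addrACA ih /V wallisS addSn addnS.
    have -> : (j + n).+2%:R = j%:R + n%:R + 2 :> R by rewrite -addn2 !natrD.
    have -> : (j + n).+1%:R = j%:R + n%:R + 1 :> R by rewrite -addn1 !natrD.
    have -> : n.+1%:R = n%:R + 1 :> R by rewrite -natr1.
    have jn : 0 <= j%:R + n%:R :> R by []. have n0 : 0 <= n%:R :> R by [].
    move: (j%:R : R) (n%:R : R) (wallis R n) jn n0 => x y w xy y0; field.
    by rewrite !gt_eqF//; lra.
  by rewrite divr_ge0// mulr_ge0// ltW.
have Sle j n : S j n * ((j%:R + 1 / 2) * V j) <= 1.
  elim: j => [|j ih].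
    have -> : S 0%N n = 2 * (1 - V n).
      rewrite /S; elim: n => [|n ih]; first by rewrite big_ord0 /V /wallis big_ord0 subrr mulr0.
      rewrite big_ord_recr /= ih add0n /V wallisS.
      have : n.+1%:R != 0 :> R by rewrite pnatr_eq0.
      rewrite -natr1; move: (n%:R : R) (wallis R n) => x w x0; field.
      exact: x0.
    have := V0 n; rewrite /V /wallis big_ord0; move: (\prod_(_ < _) _) => x x0.
    by rewrite mulr0n; lra.
  apply: le_trans ih; rewrite /V wallisS -natr1.
  have j0 : 0 < j%:R + 1 :> R by rewrite natr1.
  have -> : S j.+1 n * ((j%:R + 1 + 1 / 2) * (wallis R j * ((j%:R + 1 / 2) / (j%:R + 1)))) =
      (j%:R + 1 + 1 / 2) * S j.+1 n / (j%:R + 1) * ((j%:R + 1 / 2) * wallis R j).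
    by field; rewrite gt_eqF.
  apply: ler_wpM2r; first by rewrite mulr_ge0 ?addr_ge0// ltW// V0.
  by rewrite ler_pdivrMr// [leRHS]mulrC.
have rowE j n : \sum_(k < n) cabs (r (j + k)%N : R[i]) * V k <= pi * V j.
  have -> : \sum_(k < n) cabs (r (j + k)%N : R[i]) * V k = S j n.
    by apply: eq_bigr => k _; rewrite cabs_real ger0_norm ?invr_ge0// mulrC.
  have /andP[w _] := wallis_bounds R j.
  have d0 : 0 < (j%:R + 1 / 2) * V j by rewrite mulr_gt0// ltr_wpDl.
  rewrite -(ler_pM2r d0); apply: le_trans (Sle j n) _.
  have -> : pi * V j * ((j%:R + 1 / 2) * V j) = pi * ((j%:R + 1 / 2) * V j ^+ 2) by ring.
  by rewrite -ler_pdivrMl// mulr1.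
have [|||A [bA AM AE]] := @schur_test R (fun j k => r (j + k)%N) V pi (ltW pi0).
- by move=> j; exact: wallis_gt0.
- exact: rowE.
- move=> k m; apply: le_trans (rowE k m); rewrite le_eqVlt; apply/orP; left; apply/eqP.
  by apply: eq_bigr => j _; rewrite addnC.
suff -> : G = A by [].
by apply: op_ext => // k; apply: h2_ext => j; rewrite hG.2 AE.
Qed.

(** The matrix being real and symmetric, real and imaginary parts of a finite vector decouple into
    two forms as in [sum_inv_psd]; truncation and boundedness give the general case. *)
Lemma hilbert_psd f : 0 <= complex.Re (h2ip (G f) f).
Proof.
have fin n : 0 <= complex.Re (h2ip (G (h2trunc n f)) (h2trunc n f)).
  rewrite -h2ip_conj Re_conjc h2ip_trunc.
  have Gf j : G (h2trunc n f) j = \sum_(k < n) f k * r (j + k)%N.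
    rewrite /h2trunc (lin_sum _ _ _ lG) h2coef_sum; apply: eq_bigr => k _.
    by rewrite (linZ _ _ lG) h2coefZ hG.2.
  have -> : complex.Re (\sum_(j < n) f j * (G (h2trunc n f) j)^*) =
      \sum_(j < n) \sum_(k < n) complex.Re (f j) * complex.Re (f k) * ((j + k)%N.+1%:R)^-1 +
      \sum_(j < n) \sum_(k < n) complex.Im (f j) * complex.Im (f k) * ((j + k)%N.+1%:R)^-1.
    rewrite Re_sum -big_split; apply: eq_bigr => j _ /=.
    rewrite Gf rmorph_sum mulr_sumr Re_sum -big_split; apply: eq_bigr => k _ /=.
    rewrite conjE.
    by case: (f j) (f k) => x y [x' y'] /=; ring.
  apply: addr_ge0; first exact: (sum_inv_psd (fun k => complex.Re (f k))).
  exact: (sum_inv_psd (fun k => complex.Im (f k))).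
rewrite leNgt; apply/negP => neg; set x := complex.Re _ in neg.
have K0 : 0 < 2 * pi * h2norm f + 1 by rewrite ltr_wpDl// !mulr_ge0 ?h2norm_ge0 ?pi_ge0.
have e0 : 0 < - x / (2 * pi * h2norm f + 1) by rewrite divr_gt0// oppr_gt0.
have [N /(_ N (leqnn N)) fN] := h2trunc_cvg f e0.
have := fin N; set g := h2trunc N f.
have d1 : cabs (h2ip (G f) f - h2ip (G g) g) <= 2 * pi * h2norm f * h2norm (f - g).
  have -> : h2ip (G f) f - h2ip (G g) g = h2ip (G (f - g)) f + h2ip (G g) (f - g).
    by rewrite (linB _ _ lG) h2ipBl h2ipBr addrA subrK.
  apply: le_trans (cabsD _ _) _.
  apply: (@le_trans _ _ (pi * h2norm (f - g) * h2norm f + pi * h2norm f * h2norm (f - g))).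
    apply: lerD; apply: le_trans (cabs_h2ip_le _ _) _; rewrite ler_wpM2r ?h2norm_ge0//.
      exact: hilbert_bound.
    apply: le_trans (hilbert_bound _) _; rewrite ler_wpM2l ?pi_ge0//.
    exact: h2norm_trunc_le.
  by rewrite le_eqVlt; apply/orP; left; apply/eqP; ring.
have d2 : 2 * pi * h2norm f * h2norm (f - g) < - x.
  apply: (@le_lt_trans _ _ ((2 * pi * h2norm f + 1) * h2norm (f - g))).
    by rewrite ler_wpM2r ?h2norm_ge0// lerDl.
  by rewrite mulrC -ltr_pdivlMr.
have := le_lt_trans (le_trans (Re_le_cabs _) d1) d2; rewrite ReB -/x.
by rewrite ltr_norml => /andP[h1 h2] h3; lra.
Qed.

(** The inequality G^2 <= pi G. It follows without a square root of [G] by testing positivity on f -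
    G f / pi and bounding <G G f, G f> by pi |G f|^2. *)
Lemma hilbert_sqr_norm_le f : h2norm (G f) ^+ 2 <= pi * complex.Re (h2ip (G f) f).
Proof.
have pi0 : 0 < pi :> R by exact: pi_gt0.
have := hilbert_psd (f - (pi^-1)%:C *: G f).
set X := complex.Re (h2ip (G f) f); set Y := complex.Re (h2ip (G (G f)) (G f)).
have -> : complex.Re (h2ip (G (f - (pi^-1)%:C *: G f)) (f - (pi^-1)%:C *: G f)) =
    X - 2 * pi^-1 * h2norm (G f) ^+ 2 + pi^-1 ^+ 2 * Y.
  rewrite (linB _ _ lG) (linZ _ _ lG) !(h2ipBl, h2ipBr, h2ipZl, h2ipZr) (hilbert_sa (G f) f).
  rewrite conj_real !ReB !ReM_real -/X -/Y h2ip_norm /=; ring.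
have Yle : Y <= pi * h2norm (G f) ^+ 2.
  apply: le_trans (ler_norm _) _; apply: le_trans (Re_le_cabs _) _.
  apply: le_trans (cabs_h2ip_le _ _) _; rewrite expr2 mulrA ler_wpM2r ?h2norm_ge0//.
  exact: hilbert_bound.
have := ler_wpM2l (sqr_ge0 pi^-1) Yle.
have -> : pi^-1 ^+ 2 * (pi * h2norm (G f) ^+ 2) = pi^-1 * h2norm (G f) ^+ 2.
  by rewrite expr2 mulrA divfK ?gt_eqF.
move=> h1 h2; rewrite -ler_pdivrMl//; move: h1 h2.
have -> : X - 2 * pi^-1 * h2norm (G f) ^+ 2 + pi^-1 ^+ 2 * Y = X - 2 * (pi^-1 * h2norm (G f) ^+ 2) + pi^-1 ^+ 2 * Y.
  by rewrite mulrA.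
by move: (pi^-1 ^+ 2 * Y) (pi^-1 * h2norm (G f) ^+ 2) => u w h1 h2; lra.
Qed.

(** If Re c = pi / 2, then |G f - c f|^2 = |c|^2 |f|^2 + (|G f|^2 - pi <G f, f>), because <G f, f>
    is real. *)
Lemma hilbert_shift_bound (t : R) :
  opbound (fun f => G f - ((pi / 2) -i* t) *: f) (Num.sqrt ((pi / 2) ^+ 2 + t ^+ 2)).
Proof.
move=> f; set c := (pi / 2) -i* t.
have q0 : 0 <= (pi / 2) ^+ 2 + t ^+ 2 :> R by rewrite addr_ge0 ?sqr_ge0.
have cE : cabs c ^+ 2 = (pi / 2) ^+ 2 + t ^+ 2 by rewrite sqr_cabs /= sqrrN.
rewrite -(@ler_pXn2r _ 2)// ?nnegrE ?mulr_ge0 ?sqrtr_ge0 ?h2norm_ge0//.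
have -> : (Num.sqrt ((pi / 2) ^+ 2 + t ^+ 2) * h2norm f) ^+ 2 = cabs c ^+ 2 * h2norm f ^+ 2.
  by rewrite cE exprMn sqr_sqrtr.
rewrite [leLHS]sqr_h2normB h2normZ (exprMn _ (cabs c)) h2ipZr.
have X0 : complex.Im (h2ip (G f) f) = 0.
  have := congr1 (@complex.Im R) (h2ip_conj (G f) f); rewrite -(hilbert_sa f f) Im_conjc.
  by move: (complex.Im _) => x h; lra.
have -> : complex.Re (c^* * h2ip (G f) f) = pi / 2 * complex.Re (h2ip (G f) f).
  by rewrite conjE; case: (h2ip _ _) X0 => x y /= ->; ring.
have := hilbert_sqr_norm_le f; move: (h2norm (G f) ^+ 2) (complex.Re _) => x y; lra.
Qed.

(** The disc of centre pi / 2 - i t and radius |pi / 2 - i t| passes through 0 and pi, and these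
    discs meet exactly in the segment. For y nonzero the choice of t makes 2 y t = pi^2 / 4, which
    is the part (pi / 2)^2 of the squared radius. *)
Lemma hilbert_resolvent w : ~ (exists2 x, x \in `[0, pi] & w = x%:C) ->
  calkin_invertible (fun f => G f - w *: f).
Proof.
have pi0 : 0 < pi :> R by exact: pi_gt0.
case: w => x y wS; pose t := if y == 0 then 0 else pi ^+ 2 / (8 * y) : R.
apply: (resolvent_disc bG (hilbert_shift_bound t)); rewrite sqrtr_ge0 /=.
have d0 : 0 < (x - pi / 2) ^+ 2 + (y - - t) ^+ 2 /\ (pi / 2) ^+ 2 + t ^+ 2 < (x - pi / 2) ^+ 2 + (y - - t) ^+ 2.
  have h : (pi / 2) ^+ 2 + t ^+ 2 < (x - pi / 2) ^+ 2 + (y - - t) ^+ 2.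
    rewrite opprK /t; have [y0|yN] := eqVneq y 0.
      rewrite y0 addr0 expr0n /= !addr0 ltNge; apply/negP => h.
      apply: wS; exists x; last by rewrite y0.
      have q0 : 0 < pi / 2 :> R by rewrite divr_gt0.
      move: h; rewrite -[(x - _) ^+ 2]real_normK ?num_real// ler_pXn2r ?nnegrE ?normr_ge0 ?(ltW q0)//.
      by rewrite ler_norml in_itv /= => /andP[h1 h2]; apply/andP; split; lra.
    have -> : (y + pi ^+ 2 / (8 * y)) ^+ 2 = y ^+ 2 + (pi / 2) ^+ 2 + (pi ^+ 2 / (8 * y)) ^+ 2.
      by field.
    have y2 : 0 < y ^+ 2 by rewrite exprn_even_gt0.
    by have := sqr_ge0 (x - pi / 2); lra.
  by split=> //; apply: le_lt_trans h; rewrite addr_ge0 ?sqr_ge0.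
by rewrite ltr_sqrt; case: d0.
Qed.

(** For l > 0, (G v - l v)_j = (G v)_j (1 - l g_j), and [a] is chosen on the line so that g_j tends
    to 1 / l. The factor is small for all j >= J and all late n at once; the first J coordinates
    contribute a bounded amount. *)
Lemma hilbert_weyl (l : R) : 0 <= l <= pi ->
  exists f : nat -> H, weyl_seq (fun g => G g - l%:C *: g) f.
Proof.
have pi0 : 0 < pi :> R by exact: pi_gt0.
rewrite le_eqVlt => /andP[/orP[/eqP <- _|l0 lpi]].
  (* At l = 0 the value 1 / l is out of reach; the basis vectors serve, as the columns of [G] tend
     to 0 in norm. *)
  have GeE n : h2norm (G (h2e R n)) ^+ 2 <= 2 * n.+1%:R^-1.
    have sq1 : (n.+1%:R ^+ 2 : R)^-1 <= n.+1%:R^-1.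
      by rewrite lef_pV2 ?posrE// expr2 ler_peMr// ler1n.
    apply: sqr_h2norm_le => [|m]; first by rewrite mulr_ge0 ?invr_ge0.
    rewrite sqsumE; apply: (@le_trans _ _ (\sum_(n <= i < n + m) (i.+1%:R ^+ 2)^-1)).
      have -> : \sum_(n <= i < n + m) (i.+1%:R ^+ 2 : R)^-1 = \sum_(k < m) ((k + n).+1%:R ^+ 2)^-1.
        by rewrite -{1}[n]add0n big_addn addKn big_mkord.
      rewrite le_eqVlt; apply/orP; left; apply/eqP; apply: eq_bigr => i _.
      by rewrite hG.2 cabs_real ger0_norm ?invr_ge0// exprVn.
    apply: le_trans (sum_inv_sqr_le R n (n + m)) _.
    by rewrite mulr_natl mulr2n lerD2l.
  exists (fun n => h2e R n); split; [split|by move=> n; exact: h2norm_e|].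
  - by move=> n; rewrite h2norm_e.
  - move=> k e e0; exists k.+1 => n kn; rewrite coef_h2e ltn_eqF//.
    by have := cabs0 R; rewrite /= => ->.
  - move=> e e0; have [N Ne] := exists_inv_nat_lt (divr_gt0 (exprn_gt0 2 e0) (ltr0n R 2)).
    exists N => n Nn; rewrite scale0r subr0.
    rewrite -(@ltr_pXn2r _ 2)// ?nnegrE ?h2norm_ge0 ?(ltW e0)//.
    apply: le_lt_trans (GeE n) _; rewrite mulrC -ltr_pdivlMr//.
    by apply: le_lt_trans Ne; rewrite lef_pV2 ?posrE// ler_nat.
have [x xl] : exists x, lineL x = l^-1 by apply: lineL_surj; rewrite l0.
pose a := gline x; have Ra : complex.Re a = 1 / 2 by [].
have bA := bounded_op_shift l%:C bG.
apply: weyl_seq_exists; apply: (evec_weyl bA Ra) => e e0.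
pose A := cabs a + 1; have A0 : 0 <= A by rewrite addr_ge0 ?cabs_ge0.
have [K [J0 [K0 Ku]]] := gprod_unif A0.
(* Chosen so that l d |G v| <= e |v|, given |G v| <= pi |v|. *)
pose d := e / (pi + 1) / l; have pi1 : 0 < pi + 1 :> R by rewrite addr_gt0.
have d0 : 0 < d by apply: divr_gt0 => //; exact: divr_gt0.
have d30 : 0 < d / 3 by rewrite divr_gt0.
have [J1 J1g] := gprod_gline_cvg x d30.
have K10 : 0 < K + 1 by rewrite ltr_wpDl.
have [J2 J2K] := exists_inv_nat_lt (divr_gt0 d30 K10).
pose J := maxn J0 (maxn J1 J2).
have KJ : K / J.+1%:R <= d / 3.
  apply: (@le_trans _ _ ((K + 1) * J2.+1%:R^-1)).
    by rewrite ler_pM ?invr_ge0 ?lerDl// lef_pV2 ?posrE// ler_nat ltnS !leq_max leqnn !orbT.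
  by rewrite mulrC -ler_pdivlMr// ltW.
pose b n := a + (n.+1%:R^-1 : R)%:C.
have bJ : ctends (fun n => gprod (b n) J) (gprod a J).
  apply: ctendsM; first exact: ctends_add_inv.
  apply: ctends_prod => i; apply: ctendsB; first exact: ctends_cst.
  apply: ctendsZr; rewrite !expr2; apply: ctends_ext (ctendsM (ctends_add_inv a) (ctends_add_inv a)) => n.
  by rewrite expr2.
have [n0 n0J] := bJ _ d30.
have bA1 n : cabs (b n) <= A.
  apply: le_trans (cabsD _ _) _; rewrite lerD2l cabs_real ger0_norm ?invr_ge0//.
  by rewrite invf_le1// ler1n.
have near_l n j : (n0 <= n)%N -> (J <= j)%N -> cabs (gprod (b n) j - (l^-1)%:C) <= d.
  move=> n0n Jj; have h1 := Ku _ (bA1 n) J j (leq_maxl _ _) Jj.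
  have h2 := n0J n n0n; have h3 : cabs (gprod a J - (l^-1)%:C) < d / 3.
    by rewrite -xl; apply: J1g; rewrite /J !leq_max leqnn orbT.
  have := cabs_distD (gprod (b n) j) (gprod (b n) J) (l^-1)%:C.
  have := cabs_distD (gprod (b n) J) (gprod a J) (l^-1)%:C.
  move: (le_trans h1 KJ) h2 h3.
  move: (cabs _) (cabs _) (cabs _) (cabs _) (cabs _) => *; lra.
pose B := 2 * (1 + l * (A * (1 + A ^+ 2) ^+ J)).
exists (J%:R * B ^+ 2), n0 => n v n0n vE.
have Rb : 1 / 2 <= complex.Re (b n).
  by rewrite /b ReD Ra lerDl /= invr_ge0.
have b0 : b n != 0.
  by apply: contraTneq Rb => ->; rewrite /= -ltNge divr_gt0.
have vG := hilbert_evec b0 vE; have GB j := hilbert_evec_bound b0 vE j Rb.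
have ep0 : 0 <= e / (pi + 1) by exact: ltW (divr_gt0 e0 pi1).
have pe : (e / (pi + 1) * pi) ^+ 2 <= e ^+ 2.
  rewrite ler_pXn2r ?nnegrE ?(ltW e0) ?(mulr_ge0 ep0 (ltW pi0))//.
  by rewrite mulrAC ler_pdivrMr// ler_wpM2l ?(ltW e0)// lerDl.
have B1 : 0 <= l * (A * (1 + A ^+ 2) ^+ J).
  by apply: mulr_ge0; [exact: ltW|apply: mulr_ge0 => //; apply: exprn_ge0; rewrite addr_ge0 ?sqr_ge0].
have B0 : 0 <= B by rewrite mulr_ge0// addr_ge0.
have GE j : (G v - l%:C *: v) j = G v j * (1 - l%:C * gprod (b n) j).
  by rewrite h2coefB h2coefZ vG; ring.
apply: (@le_trans _ _ (J%:R * B ^+ 2 + (e / (pi + 1)) ^+ 2 * h2norm (G v) ^+ 2)); last first.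
  rewrite lerD2l; apply: (@le_trans _ _ ((e / (pi + 1) * pi) ^+ 2 * h2norm v ^+ 2)); last first.
    by rewrite ler_wpM2r ?sqr_ge0.
  have -> : (e / (pi + 1) * pi) ^+ 2 * h2norm v ^+ 2 = (e / (pi + 1)) ^+ 2 * (pi * h2norm v) ^+ 2 by ring.
  rewrite ler_wpM2l ?sqr_ge0// ler_pXn2r ?nnegrE ?h2norm_ge0 ?(mulr_ge0 (ltW pi0) (h2norm_ge0 v))//.
  exact: hilbert_bound.
have s0 : 0 <= (e / (pi + 1)) ^+ 2 * h2norm (G v) ^+ 2 by rewrite mulr_ge0 ?sqr_ge0.
apply: sqr_h2norm_le => [|m]; first by rewrite addr_ge0// mulr_ge0 ?sqr_ge0.
rewrite sqsumE; apply: (@le_trans _ _ (\sum_(j < m) ((j < J)%N%:R * B ^+ 2 +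
   (e / (pi + 1)) ^+ 2 * cabs (G v j) ^+ 2))).
  apply: ler_sum => j _; rewrite GE cabsM exprMn; have [jJ|Jj] := ltnP j J.
    rewrite mul1r; apply: (@le_trans _ _ (B ^+ 2)); last first.
      by rewrite lerDl mulr_ge0 ?sqr_ge0.
    rewrite -exprMn ler_pXn2r ?nnegrE ?mulr_ge0 ?cabs_ge0 ?(addr_ge0 ler01 B1)//.
    apply: ler_pM; rewrite ?cabs_ge0 ?GB//.
    apply: le_trans (cabsB _ _) _; rewrite cabs1 lerD2l cabsM cabs_real ger0_norm ?(ltW l0)//.
    rewrite ler_wpM2l ?(ltW l0)//; apply: le_trans (gprod_bound j A0 (bA1 n)) _.
    by rewrite ler_wpM2l// ler_weXn2l ?(ltnW jJ)// lerDl sqr_ge0.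
  rewrite mul0r add0r mulrC ler_wpM2r ?sqr_ge0//.
  rewrite ler_pXn2r ?nnegrE ?cabs_ge0//.
  have -> : 1 - l%:C * gprod (b n) j = - l%:C * (gprod (b n) j - (l^-1)%:C).
    have lN : l%:C != 0 :> R[i] by rewrite eq_complex /= eqxx andbT gt_eqF.
    by rewrite fmorphV mulrBr mulNr mulNr divff// opprK addrC.
  rewrite cabsM cabsN cabs_real ger0_norm ?(ltW l0)//.
  apply: le_trans (ler_wpM2l (ltW l0) (near_l n j n0n Jj)) _.
  by rewrite /d mulrC divfK ?gt_eqF.
rewrite big_split /= -mulr_suml -mulr_sumr; apply: lerD.
  rewrite ler_wpM2r ?sqr_ge0//.
  have [mJ|Jm] := leqP m J.
    rewrite (eq_bigr (fun=> 1)) ?sumr_const ?card_ord ?ler_nat// => j _.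
    by rewrite (leq_trans (ltn_ord j) mJ).
  rewrite (eq_bigr (fun j : 'I_m => if (j < J)%N then 1 else 0 : R)); last first.
    by move=> j _; case: ifP.
  by rewrite -big_mkcond -(big_ord_widen _ (fun=> 1 : R) (ltnW Jm)) sumr_const card_ord.
by rewrite ler_wpM2l ?sqr_ge0// -sqsumE sqsum_le_h2norm.
Qed.

Theorem hilbert_spec_ess : spec_ess G = [set x%:C | x in `[0, (pi : R)]].
Proof.
apply/seteqP; split=> w /=.
  move=> wS; apply: contrapT => nw; apply: wS; apply: hilbert_resolvent => -[x xI wE].
  by apply: nw; exists x.
case=> x; rewrite in_itv /= => xI <-.
have [f ff] := hilbert_weyl xI; exact: weyl_seq_not_invertible ff.
Qed.

Theorem hilbert_essnorm : essnorm G = pi.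
Proof.
have pi0 : 0 < pi :> R by exact: pi_gt0.
apply/eqP; rewrite eq_le; apply/andP; split.
  by apply: essnorm_le hilbert_bound => //; exact: ltW.
have [|f ff] := @hilbert_weyl pi; first by rewrite lexx ltW.
by have := essnorm_ge bG ff; rewrite cabs_real ger0_norm ?(ltW pi0).
Qed.

End Gamma.
End HilbertMatrix.

(** * Toeplitz operators and the Toeplitz algebra *)

Section CircleIntegral.
Variable R : realType.
Local Notation mu := (@lebesgue_measure R).
Local Notation circle := (@circle R).
Implicit Types (f g : R -> R) (phi psi : R -> R[i]) (c : R[i]).

Let mcircle : measurable circle.
Proof. exact: measurable_itv. Qed.

Let pi20 : 0 < (2 * pi)^-1 :> R.
Proof. by rewrite invr_gt0 mulr_gt0// pi_gt0. Qed.

Definition rint f : Prop := mu.-integrable circle (EFin \o f).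

Lemma rint_dom f g : measurable_fun circle f -> (forall t, circle t -> `|f t| <= g t) ->
  rint g -> rint f.
Proof.
move=> mf fg; apply: le_integrable => //; first exact/measurable_EFinP.
move=> t ct /=; rewrite lee_fin; apply: le_trans (fg t ct) _; exact: ler_norm.
Qed.

Lemma rintD f g : rint f -> rint g -> rint (fun t => f t + g t).
Proof. by rewrite /rint => hf hg; have h := integrableD _ hf hg; apply: h; exact: measurable_itv. Qed.

Lemma rintZ (r : R) f : rint f -> rint (fun t => r * f t).
Proof. by rewrite /rint => hf; have h := integrableZl _ r hf; apply: h; exact: measurable_itv. Qed.

Lemma rint_cst (r : R) : rint (fun=> r).
Proof.
apply: (@integrable_itv_continuous R (fun=> r) 0 (2 * pi)) => x _; exact: cst_continuous.
Qed.

(** [circle_int] in the angle variable, so that functions given by a formula in t can be integrated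
    directly. *)
Definition avg phi : R[i] :=
  ((2 * pi)^-1 * \int[mu]_(t in circle) complex.Re (phi t)) +i*
  ((2 * pi)^-1 * \int[mu]_(t in circle) complex.Im (phi t)).

Definition cmeas phi : Prop := measurable_fun circle (fun t => complex.Re (phi t)) /\
  measurable_fun circle (fun t => complex.Im (phi t)).

Definition avgable phi : Prop := rint (fun t => complex.Re (phi t)) /\
  rint (fun t => complex.Im (phi t)).

Definition sqint phi : Prop := cmeas phi /\ rint (fun t => cabs (phi t) ^+ 2).

Lemma eq_avg phi psi : (forall t, circle t -> phi t = psi t) -> avg phi = avg psi.
Proof.
move=> e; congr (_ * _ +i* (_ * _)); apply: eq_Rintegral => t; rewrite inE => /e -> //.
Qed.

Lemma cmeasD phi psi : cmeas phi -> cmeas psi -> cmeas (fun t => phi t + psi t).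
Proof.
move=> [a b] [c d]; split.
  rewrite (_ : (fun t => _) = (fun t => complex.Re (phi t)) \+ (fun t => complex.Re (psi t))).
    exact: measurable_funD.
  by apply/funext => t; rewrite ReD.
rewrite (_ : (fun t => _) = (fun t => complex.Im (phi t)) \+ (fun t => complex.Im (psi t))).
  exact: measurable_funD.
by apply/funext => t /=; case: (phi t) (psi t) => ? ? [].
Qed.

Lemma cmeasM phi psi : cmeas phi -> cmeas psi -> cmeas (fun t => phi t * psi t).
Proof.
move=> [a b] [c d]; split.
  rewrite (_ : (fun t => _) = ((fun t => complex.Re (phi t)) \* (fun t => complex.Re (psi t))) \-
     ((fun t => complex.Im (phi t)) \* (fun t => complex.Im (psi t)))).
    by apply: measurable_funB; exact: measurable_funM.
  by apply/funext => t /=; case: (phi t) (psi t) => ? ? [].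
rewrite (_ : (fun t => _) = ((fun t => complex.Re (phi t)) \* (fun t => complex.Im (psi t))) \+
     ((fun t => complex.Im (phi t)) \* (fun t => complex.Re (psi t)))).
  by apply: measurable_funD; exact: measurable_funM.
by apply/funext => t /=; case: (phi t) (psi t) => ? ? [? ?] /=; rewrite addrC mulrC [X in _ + X]mulrC addrC.
Qed.

Lemma cmeas_conj phi : cmeas phi -> cmeas (fun t => (phi t)^*).
Proof.
move=> [a b]; split.
  by rewrite (_ : (fun t => _) = (fun t => complex.Re (phi t)))//; apply/funext => t; rewrite Re_conjc.
rewrite (_ : (fun t => _) = \- (fun t => complex.Im (phi t))); first exact: measurableT_comp.
by apply/funext => t; rewrite Im_conjc.
Qed.

Lemma cmeas_cst c : cmeas (fun=> c).
Proof. by split; exact: measurable_cst. Qed.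

Lemma cmeas_sum (n : nat) (phi : nat -> R -> R[i]) : (forall k, cmeas (phi k)) ->
  cmeas (fun t => \sum_(k < n) phi k t).
Proof.
move=> h; elim: n => [|n ih].
  rewrite (_ : (fun t => _) = fun=> 0); first exact: cmeas_cst.
  by apply/funext => t; rewrite big_ord0.
rewrite (_ : (fun t => _) = (fun t => \sum_(k < n) phi k t + phi n t)); first exact: cmeasD.
by apply/funext => t; rewrite big_ord_recr.
Qed.

Lemma avgable_dom phi g : cmeas phi -> (forall t, circle t -> cabs (phi t) <= g t) ->
  rint g -> avgable phi.
Proof.
move=> [a b] h hg; split.
  by apply: (rint_dom a) hg => t /h; apply: le_trans; exact: Re_le_cabs.
by apply: (rint_dom b) hg => t /h; apply: le_trans; exact: Im_le_cabs.
Qed.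

Lemma avgableD phi psi : avgable phi -> avgable psi -> avgable (fun t => phi t + psi t).
Proof.
move=> [a b] [c d]; split.
  by rewrite (_ : (fun t => _) = (fun t => complex.Re (phi t) + complex.Re (psi t))); [exact: rintD|apply/funext => t; rewrite ReD].
rewrite (_ : (fun t => _) = (fun t => complex.Im (phi t) + complex.Im (psi t))); first exact: rintD.
by apply/funext => t; case: (phi t) (psi t) => ? ? [].
Qed.

Lemma avgD phi psi : avgable phi -> avgable psi ->
  avg (fun t => phi t + psi t) = avg phi + avg psi.
Proof.
move=> [a b] [c d]; rewrite /avg.
under eq_Rintegral do rewrite ReD.
have -> : \int[mu]_(t in circle) complex.Im (phi t + psi t) =
    \int[mu]_(t in circle) (complex.Im (phi t) + complex.Im (psi t)).
  by apply: eq_Rintegral => t _; case: (phi t) (psi t) => ? ? [].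
by rewrite !RintegralD// !mulrDr.
Qed.

Lemma avgableZ c phi : avgable phi -> avgable (fun t => c * phi t).
Proof.
case: c => x y [a b]; split.
  rewrite (_ : (fun t => _) = (fun t => x * complex.Re (phi t) + (- y) * complex.Im (phi t))).
    by apply: rintD; exact: rintZ.
  by apply/funext => t /=; case: (phi t) => p q /=; ring.
rewrite (_ : (fun t => _) = (fun t => x * complex.Im (phi t) + y * complex.Re (phi t))).
  by apply: rintD; exact: rintZ.
by apply/funext => t /=; case: (phi t) => p q /=; ring.
Qed.

Lemma avgZ c phi : avgable phi -> avg (fun t => c * phi t) = c * avg phi.
Proof.
case: c => x y [a b]; rewrite /avg.
have -> : \int[mu]_(t in circle) complex.Re ((x +i* y) * phi t) =
    \int[mu]_(t in circle) (x * complex.Re (phi t) + (- y) * complex.Im (phi t)).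
  by apply: eq_Rintegral => t _; case: (phi t) => p q /=; ring.
have -> : \int[mu]_(t in circle) complex.Im ((x +i* y) * phi t) =
    \int[mu]_(t in circle) (x * complex.Im (phi t) + y * complex.Re (phi t)).
  by apply: eq_Rintegral => t _; case: (phi t) => p q /=; ring.
rewrite !RintegralD// ?RintegralZl//; try exact: rintZ.
by apply/eqP; rewrite eq_complex /=; apply/andP; split; apply/eqP; ring.
Qed.

Lemma avgable0 : avgable (fun=> 0).
Proof. by split; exact: rint_cst. Qed.

Lemma avg0 : avg (fun=> 0) = 0.
Proof.
by rewrite -[RHS](mul0r (avg (fun=> 0))) -avgZ; [apply: eq_avg => t _; rewrite mul0r|exact: avgable0].
Qed.

Lemma avg_sum (n : nat) (phi : nat -> R -> R[i]) : (forall k, avgable (phi k)) ->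
  avgable (fun t => \sum_(k < n) phi k t) /\
  avg (fun t => \sum_(k < n) phi k t) = \sum_(k < n) avg (phi k).
Proof.
move=> h; elim: n => [|n [ih1 ih2]].
  rewrite (_ : (fun t => _) = fun=> 0) ?big_ord0; last by apply/funext => t; rewrite big_ord0.
  by split; [exact: avgable0|exact: avg0].
rewrite (_ : (fun t => _) = (fun t => \sum_(k < n) phi k t + phi n t)); last first.
  by apply/funext => t; rewrite big_ord_recr.
by split; [exact: avgableD|rewrite avgD// ih2 big_ord_recr].
Qed.

(** Multiplication by the unimodular [c] makes the average equal to its modulus, and the real part
    can be compared pointwise. *)
Lemma avg_le phi g : avgable phi -> (forall t, circle t -> cabs (phi t) <= g t) -> rint g ->
  cabs (avg phi) <= (2 * pi)^-1 * \int[mu]_(t in circle) g t.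
Proof.
move=> hphi hg ig; have [z0|z0] := eqVneq (avg phi) 0.
  rewrite z0 cabs0 mulr_ge0 ?(ltW pi20)//; apply: Rintegral_ge0 => t /hg.
  exact: le_trans (cabs_ge0 _).
have n0 : 0 < cabs (avg phi) by rewrite cabs_gt0.
pose c := ((cabs (avg phi))^-1)%:C * (avg phi)^*.
have c1 : cabs c = 1.
  by rewrite cabsM cabs_conj cabs_real ger0_norm ?invr_ge0 ?cabs_ge0// mulVf ?gt_eqF.
have cE : complex.Re (c * avg phi) = cabs (avg phi).
  rewrite /c -mulrA [_^* * _]mulrC mul_conj -rmorphM /= expr2 mulrA mulVf ?gt_eqF// mul1r.
  by [].
rewrite -cE -avgZ//= ler_pM2l//.
have [h1 _] := avgableZ c hphi.
apply: le_Rintegral => // t ct; apply: le_trans (ler_norm _) _; apply: le_trans (Re_le_cabs _) _.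
by rewrite cabsM c1 mul1r hg.
Qed.

Lemma cabs_sqr_meas phi : cmeas phi -> measurable_fun circle (fun t => cabs (phi t) ^+ 2).
Proof.
move=> [a b]; rewrite (_ : (fun t => _) = ((fun t => complex.Re (phi t)) \* (fun t => complex.Re (phi t))) \+
     ((fun t => complex.Im (phi t)) \* (fun t => complex.Im (phi t)))).
  by apply: measurable_funD; exact: measurable_funM.
by apply/funext => t /=; rewrite sqr_cabs !expr2.
Qed.

Lemma sqint_dom phi g : cmeas phi -> (forall t, circle t -> cabs (phi t) ^+ 2 <= g t) ->
  rint g -> sqint phi.
Proof.
move=> mp h hg; split=> //; apply: rint_dom (hg); first exact: cabs_sqr_meas.
by move=> t /h; rewrite ger0_norm ?sqr_ge0.
Qed.

Lemma sqintD phi psi : sqint phi -> sqint psi -> sqint (fun t => phi t + psi t).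
Proof.
move=> [a b] [c d]; apply: (@sqint_dom _ (fun t => 2 * cabs (phi t) ^+ 2 + 2 * cabs (psi t) ^+ 2)).
- exact: cmeasD.
- move=> t _; have := cabsD (phi t) (psi t); have := cabs_ge0 (phi t + psi t).
  have := sqr_ge0 (cabs (phi t) - cabs (psi t)).
  move: (cabs (phi t)) (cabs (psi t)) (cabs _) => x y z; nra.
- by apply: rintD; exact: rintZ.
Qed.

Lemma sqintM_bounded phi psi (M : R) : cmeas phi -> (forall t, circle t -> cabs (phi t) <= M) ->
  sqint psi -> sqint (fun t => phi t * psi t).
Proof.
move=> a hM [c d]; apply: (@sqint_dom _ (fun t => M ^+ 2 * cabs (psi t) ^+ 2)).
- exact: cmeasM.
- move=> t /hM h; rewrite cabsM exprMn ler_wpM2r ?sqr_ge0//.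
  by rewrite ler_pXn2r ?nnegrE ?cabs_ge0// (le_trans (cabs_ge0 _) h).
- exact: rintZ.
Qed.

Lemma sqint_cst c : sqint (fun=> c).
Proof. by split; [exact: cmeas_cst|exact: rint_cst]. Qed.

Lemma sqint_bounded phi (M : R) : cmeas phi -> (forall t, circle t -> cabs (phi t) <= M) -> sqint phi.
Proof.
move=> mp h; have := sqintM_bounded mp h (sqint_cst 1).
by rewrite (_ : (fun t => _) = phi)//; apply/funext => t; rewrite mulr1.
Qed.

Lemma sqint_mul phi psi : sqint phi -> sqint psi -> avgable (fun t => phi t * (psi t)^*).
Proof.
move=> [a b] [c d]; apply: (@avgable_dom _ (fun t => cabs (phi t) ^+ 2 + cabs (psi t) ^+ 2)).
- by apply: cmeasM => //; exact: cmeas_conj.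
- move=> t _; rewrite cabsM cabs_conj; have := sqr_ge0 (cabs (phi t) - cabs (psi t)).
  have := mulr_ge0 (cabs_ge0 (phi t)) (cabs_ge0 (psi t)); move: (cabs _) (cabs _) => x y; nra.
- exact: rintD.
Qed.

Definition nrm2 phi : R := (2 * pi)^-1 * \int[mu]_(t in circle) (cabs (phi t) ^+ 2).

Lemma nrm2_ge0 phi : 0 <= nrm2 phi.
Proof. by rewrite mulr_ge0 ?(ltW pi20)//; apply: Rintegral_ge0 => t _; exact: sqr_ge0. Qed.

Lemma avg_norm phi : avg (fun t => phi t * (phi t)^*) = (nrm2 phi)%:C.
Proof.
rewrite /avg /nrm2; congr (_ * _ +i* _).
  by apply: eq_Rintegral => t _; rewrite mul_conj.
rewrite (_ : \int[mu]_(t in circle) _ = \int[mu]_(t in circle) 0).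
  by rewrite Rintegral_cst// mul0r mulr0.
by apply: eq_Rintegral => t _; rewrite mul_conj.
Qed.

Lemma weighted_amgm (t x y : R) : 0 < t -> x * y <= t / 2 * x ^+ 2 + t^-1 / 2 * y ^+ 2.
Proof.
move=> t0; rewrite -(ler_pM2l (mulr_gt0 (ltr0n R 2) t0)).
have -> : 2 * t * (t / 2 * x ^+ 2 + t^-1 / 2 * y ^+ 2) = t ^+ 2 * x ^+ 2 + y ^+ 2.
  by field; rewrite gt_eqF.
have := sqr_ge0 (t * x - y); nra.
Qed.

(** The weighted arithmetic-geometric inequality is integrated and then optimized in t by
    [le_mul_of_amgm]. *)
Lemma avg_cauchy_schwarz phi psi : sqint phi -> sqint psi ->
  cabs (avg (fun t => phi t * (psi t)^*)) <= Num.sqrt (nrm2 phi) * Num.sqrt (nrm2 psi).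
Proof.
move=> hp hq; apply: le_mul_of_amgm; rewrite ?sqrtr_ge0// => t t0.
rewrite !sqr_sqrtr ?nrm2_ge0//; case: (hp) (hq) => [a b] [c d].
pose g s := t / 2 * cabs (phi s) ^+ 2 + t^-1 / 2 * cabs (psi s) ^+ 2.
have gi : rint g by apply: rintD; exact: rintZ.
have := avg_le (sqint_mul hp hq) _ gi.
have -> : \int[mu]_(s in circle) g s = t / 2 * \int[mu]_(s in circle) (cabs (phi s) ^+ 2) +
    t^-1 / 2 * \int[mu]_(s in circle) (cabs (psi s) ^+ 2).
  by rewrite RintegralD// ?RintegralZl//; exact: rintZ.
rewrite /nrm2; have h s : circle s -> cabs (phi s * (psi s)^*) <= g s.
  move=> _; rewrite cabsM cabs_conj /g.
  exact: weighted_amgm.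
move=> /(_ h); move: (cabs _) => z.
move: (\int[mu]_(s in _) _) (\int[mu]_(s in _) _) => x y; lra.
Qed.

End CircleIntegral.

(** * Exponentials on the circle and their averages *)

Section Cis.
Variable R : realType.
Implicit Types (t x y : R).

Lemma cisD x y : cis (x + y) = cis x * cis y.
Proof. by rewrite /cis cosD sinD; apply/eqP; rewrite eq_complex /= eqxx /=; apply/eqP; ring. Qed.

Lemma cis0 : cis (0 : R) = 1.
Proof. by rewrite /cis cos0 sin0. Qed.

Lemma cis_conj t : (cis t)^* = cis (- t).
Proof. by rewrite conjE /cis cosN sinN. Qed.

Lemma cabs_cis t : cabs (cis t) = 1.
Proof. by apply/eqP; rewrite -(@eqrXn2 _ 2) ?cabs_ge0// sqr_cabs /= cos2Dsin2 expr1n. Qed.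

Lemma cisX t n : cis t ^+ n = cis (n%:R * t).
Proof.
elim: n => [|n ih]; first by rewrite mul0r cis0.
by rewrite exprSr ih -cisD -natr1 mulrDl mul1r.
Qed.

Lemma cis_2pin n : cis (n%:R * (2 * pi)) = 1 :> R[i].
Proof.
rewrite -cisX (_ : cis (2 * pi) = 1) ?expr1n// /cis.
by rewrite mulr_natl cos2pi sin2pi.
Qed.

Lemma cisX_conj t j k : cis t ^+ k * (cis t ^+ j)^* = cis (- (j%:R - k%:R) * t).
Proof. by rewrite !cisX cis_conj -cisD; congr cis; ring. Qed.

Lemma cis_2piB j k : cis (- (j%:R - k%:R) * (2 * pi)) = 1 :> R[i].
Proof. by rewrite -cisX_conj !cisX !cis_2pin rmorph1 mulr1. Qed.

Lemma continuous_cis_Re : continuous (fun t => complex.Re (cis t)).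
Proof. by move=> t; exact: continuous_cos. Qed.

Lemma continuous_cis_Im : continuous (fun t => complex.Im (cis t)).
Proof. by move=> t; exact: continuous_sin. Qed.

Lemma cmeas_cis : cmeas (@cis R).
Proof.
split; apply: measurable_funTS; apply: continuous_measurable_fun.
  exact: continuous_cis_Re.
exact: continuous_cis_Im.
Qed.

Lemma cmeas_cisX n : cmeas (fun t => cis t ^+ n).
Proof.
elim: n => [|n ih]; first exact: cmeas_cst.
rewrite (_ : (fun t => _) = fun t => cis t ^+ n * cis t).
  by apply: cmeasM => //; exact: cmeas_cis.
by apply/funext => t; rewrite exprSr.
Qed.

Lemma cabs_cisX t n : cabs (cis t ^+ n) = 1.
Proof. by rewrite cisX cabs_cis. Qed.

Definition cder (Phi : R -> R[i]) t (d : R[i]) : Prop :=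
  is_derive t 1 (fun y => complex.Re (Phi y)) (complex.Re d) /\
  is_derive t 1 (fun y => complex.Im (Phi y)) (complex.Im d).

Lemma cder_eq Phi Psi t d d' : Phi =1 Psi -> d = d' -> cder Phi t d -> cder Psi t d'.
Proof. by move=> /funext <- <-. Qed.

Lemma cderM Phi Psi t d d' : cder Phi t d -> cder Psi t d' ->
  cder (fun y => Phi y * Psi y) t (d * Psi t + Phi t * d').
Proof.
move=> [a b] [a' b']; split.
  have := derB (derM a a') (derM b b').
  rewrite (_ : (fun y => _ - _) = fun y => complex.Re (Phi y * Psi y)); last first.
    by apply/funext => y; case: (Phi y) (Psi y) => ? ? [].
  congr is_derive; case: (d) (d') (Phi t) (Psi t) => ? ? [? ?] [? ?] [? ?] /=; ring.
have := derD (derM a b') (derM b a').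
rewrite (_ : (fun y => _ + _) = fun y => complex.Im (Phi y * Psi y)); last first.
  by apply/funext => y; case: (Phi y) (Psi y) => ? ? [? ?] /=; ring.
congr is_derive; case: (d) (d') (Phi t) (Psi t) => ? ? [? ?] [? ?] [? ?] /=; ring.
Qed.

Lemma cder_real (f : R -> R) t (d : R) : is_derive t 1 f d -> cder (fun y => (f y)%:C) t d%:C.
Proof. by move=> h; split=> //=; exact: is_derive_cst. Qed.

Lemma cder_cis (f : R -> R) t (d : R) : is_derive t 1 f d ->
  cder (fun y => cis (f y)) t ('i * d%:C * cis (f t)).
Proof.
move=> h; split.
  have := der_comp (is_derive_cos (f t)) h; rewrite /cis /=; congr is_derive; ring.
have := der_comp (is_derive_sin (f t)) h; rewrite /cis /=; congr is_derive; ring.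
Qed.

Local Notation mu := (@lebesgue_measure R).

Definition cintg (a b : R) (phi : R -> R[i]) : R[i] :=
  (\int[mu]_(t in `[a, b]) complex.Re (phi t)) +i* (\int[mu]_(t in `[a, b]) complex.Im (phi t)).

Lemma cintg_FTC a b (Phi phi : R -> R[i]) : a < b ->
  (forall t, t \in `[a, b] -> cder Phi t (phi t)) ->
  {in `[a, b], continuous (fun t => complex.Re (phi t))} ->
  {in `[a, b], continuous (fun t => complex.Im (phi t))} ->
  cintg a b phi = Phi b - Phi a.
Proof.
move=> ab h cR cI; rewrite /cintg.
rewrite (Rintegral_FTC ab (fun t tI => (h t tI).1) cR) (Rintegral_FTC ab (fun t tI => (h t tI).2) cI).
by case: (Phi b) (Phi a) => ? ? [].
Qed.

Lemma avg_cintg phi : avg phi = ((2 * pi)^-1)%:C * cintg 0 (2 * pi) phi.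
Proof. by rewrite /avg /cintg; apply/eqP; rewrite eq_complex /=; apply/andP; split; apply/eqP; ring. Qed.

Let pi2 : 0 < 2 * pi :> R. Proof. by rewrite mulr_gt0// pi_gt0. Qed.

(** Integration by an explicit primitive. The hypothesis on [cis] says that r is an integer, so only
    the real exponential changes between the ends; s = 0 gives the orthogonality of the
    characters. *)
Lemma avg_expcis (s r : R) : s%:C + 'i * r%:C != 0 ->
  cis (- r * (2 * pi)) = 1 ->
  avg (fun t => (expR (s * (pi - t)))%:C * cis (- r * t)) =
  ((2 * pi)^-1 * (expR (s * pi) - expR (- (s * pi))))%:C / (s%:C + 'i * r%:C).
Proof.
move=> sr0 c1; set l := s%:C + 'i * r%:C in sr0 *.
have dP t : cder (fun t => (- l^-1) * ((expR (s * (pi - t)))%:C * cis (- r * t))) t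
    ((expR (s * (pi - t)))%:C * cis (- r * t)).
  have dl : is_derive t 1 (fun y => s * (pi - y)) (- s).
    by have := derZ s (derB (is_derive_cst pi t 1) (is_derive_id t 1)); congr is_derive; ring.
  have dr : is_derive t 1 (fun y => - r * y) (- r).
    by have := derZ (- r) (is_derive_id t 1); rewrite mulr1.
  have dE := @der_comp R expR (fun y => s * (pi - y)) t _ _ (is_derive_expR (s * (pi - t))) dl.
  have := cderM (cder_real dE) (cder_cis dr).
  set E := (expR _)%:C; set K := cis _ => h.
  have cc : cder (fun=> - l^-1) t 0 by split; exact: is_derive_cst.
  apply: cder_eq (cderM cc h) => //; rewrite mul0r add0r.
  have -> : (expR (s * (pi - t)) * - s)%:C = - E * s%:C by rewrite rmorphM rmorphN mulrN mulNr.
  rewrite rmorphN; have -> : - E * s%:C * K + E * ('i * - r%:C * K) = - l * (E * K) by rewrite /l; ring.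
  by rewrite mulrA mulrNN mulVf// mul1r.
have cE : continuous (fun t => expR (s * (pi - t)) : R).
  move=> t; apply: (@continuous_comp _ _ _ (fun t => s * (pi - t)) expR); last exact: continuous_expR.
  by apply: cvgMr; apply: cvgB; [exact: cvg_cst|exact: cvg_id].
have cr : continuous (fun t => - r * t : R) by move=> t; apply: cvgMr; exact: cvg_id.
rewrite avg_cintg (cintg_FTC pi2 (fun t _ => dP t)).
- rewrite c1 mulr0 cis0 subr0 !mulr1 (_ : pi - 2 * pi = - pi); last by ring.
  by rewrite mulrN rmorphM rmorphB; ring.
- move=> t _; rewrite (_ : (fun t => _) = fun t => expR (s * (pi - t)) * cos (- r * t)).
    apply: cvgM; first exact: cE.
    by apply: (@continuous_comp _ _ _ (fun t => - r * t) cos); [exact: cr|exact: continuous_cos].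
  by apply/funext => y /=; ring.
- move=> t _; rewrite (_ : (fun t => _) = fun t => expR (s * (pi - t)) * sin (- r * t)).
    apply: cvgM; first exact: cE.
    by apply: (@continuous_comp _ _ _ (fun t => - r * t) sin); [exact: cr|exact: continuous_sin].
  by apply/funext => y /=; ring.
Qed.

Lemma avg_cis_eq0 (r : R) : r != 0 -> cis (- r * (2 * pi)) = 1 -> avg (fun t => cis (- r * t)) = 0.
Proof.
move=> r0 c1; have := @avg_expcis 0 r; rewrite add0r !mul0r oppr0 subrr mulr0 mul0r.
move=> <-//; last by rewrite mulf_eq0 negb_or neq0Ci /= eq_complex /= eqxx andbT.
by apply: eq_avg => t _; rewrite mul0r expR0 mul1r.
Qed.

Lemma avg_cst (c : R[i]) : avg (fun=> c) = c.
Proof.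
have h : avg (fun=> 1 : R[i]) = 1.
  have := avg_norm (fun=> 1 : R[i]); rewrite rmorph1 mulr1 => ->; rewrite /nrm2.
  rewrite cabs1 expr1n (@Rintegral_FTC R id (fun=> 1) 0 (2 * pi) pi2).
  - by rewrite subr0 mulVf ?gt_eqF.
  - by move=> t _; exact: cst_continuous.
rewrite -[RHS]mulr1 -h -avgZ; first by apply: eq_avg => t _; rewrite mulr1.
by split; exact: rint_cst.
Qed.

Lemma avg_cisX j k : avg (fun t => cis t ^+ k * (cis t ^+ j)^*) = (j == k)%:R.
Proof.
under [X in avg X]eq_fun do rewrite cisX_conj.
have [->|jk] := eqVneq j k.
  by rewrite -[RHS]avg_cst; apply: eq_avg => t _; rewrite subrr oppr0 mul0r cis0.
rewrite avg_cis_eq0 ?cis_2piB// subr_eq0 eqr_nat//.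
Qed.

End Cis.

(** * Toeplitz operators from their matrices *)

Section ToeplitzOperators.
Variable R : realType.
Local Notation H := (H2 R).
Implicit Types (b F G : R[i] -> R[i]) (f u : H) (a c : nat -> R[i]).
Local Notation circle := (@circle R).

Let Z (F : R[i] -> R[i]) := fun t : R => F (cis t).

Definition fcoef b j k := avg (fun t : R => b (cis t) * (cis t ^+ k * (cis t ^+ j)^*)).

Definition tpoly n a := fun t : R => \sum_(k < n) a k * cis t ^+ k.

Lemma tpoly_sqint n a : sqint (tpoly n a).
Proof.
apply: (@sqint_bounded _ _ (\sum_(k < n) cabs (a k))).
  apply: (@cmeas_sum _ _ (fun k t => a k * cis t ^+ k)) => k.
  by apply: cmeasM; [exact: cmeas_cst|exact: cmeas_cisX].
move=> t _; apply: le_trans (cabs_sum _ _ _) _; apply: ler_sum => k _.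
by rewrite cabsM cabs_cisX mulr1.
Qed.

Definition bsym b (M : R) : Prop := cmeas (Z b) /\ forall t, circle t -> cabs (b (cis t)) <= M.

Lemma sqint_sym b M phi : bsym b M -> sqint phi -> sqint (fun t => b (cis t) * phi t).
Proof. by move=> [mb hb] hp; exact: (sqintM_bounded mb hb hp). Qed.

Lemma fcoef_avgable b M j k : bsym b M ->
  avgable (fun t : R => b (cis t) * (cis t ^+ k * (cis t ^+ j)^*)).
Proof.
move=> [mb hb]; apply: (avgable_dom (g := fun=> M)); last exact: rint_cst.
  by apply: cmeasM => //; apply: cmeasM; [|apply: cmeas_conj]; exact: cmeas_cisX.
by move=> t /hb; rewrite !cabsM cabs_conj !cabs_cisX !mulr1.
Qed.

Lemma avg_tpoly b M m n a c : bsym b M ->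
  avg (fun t => b (cis t) * tpoly n a t * (tpoly m c t)^*) =
  \sum_(j < m) \sum_(k < n) fcoef b j k * a k * (c j)^*.
Proof.
move=> hb; pose phi j k t := (a k * (c j)^*) * (b (cis t) * (cis t ^+ k * (cis t ^+ j)^*)).
have h j k : avgable (phi j k) by apply: avgableZ; exact: fcoef_avgable hb.
have h1 j := avg_sum n (h j); have [_ h2] := avg_sum m (fun j => (h1 j).1).
transitivity (avg (fun t => \sum_(j < m) \sum_(k < n) phi j k t)).
  apply: eq_avg => t _; rewrite /tpoly rmorph_sum mulr_sumr; apply: eq_bigr => j _.
  rewrite mulr_sumr mulr_suml; apply: eq_bigr => k _; rewrite /phi rmorphM /=.
  by move: (a k) (c j)^* (b _) (cis t ^+ k) ((cis t ^+ j)^*) => *; ring.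
rewrite h2; apply: eq_bigr => j _; rewrite (h1 j).2; apply: eq_bigr => k _.
by rewrite /phi avgZ ?mulrA 1?mulrC ?mulrA//; exact: fcoef_avgable hb.
Qed.

Lemma bsym1 : bsym (fun=> 1) 1.
Proof. by split=> [|t _]; [exact: cmeas_cst|rewrite cabs1]. Qed.

Lemma nrm2_tpoly n a : nrm2 (tpoly n a) = \sum_(k < n) cabs (a k) ^+ 2.
Proof.
have := avg_tpoly n n a a bsym1; under [X in avg X]eq_fun do rewrite mul1r.
rewrite avg_norm => E; apply: (@complexI R); rewrite E rmorph_sum; apply: eq_bigr => j _.
rewrite (bigD1 j)//= big1 ?addr0 => [|k kj].
  by rewrite /fcoef; under [X in avg X]eq_fun do rewrite mul1r; rewrite avg_cisX eqxx mul1r mul_conj.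
rewrite /fcoef; under [X in avg X]eq_fun do rewrite mul1r.
by rewrite avg_cisX eq_sym -val_eqE in kj *; rewrite (negbTE kj) !mul0r.
Qed.

Lemma nrm2_sym b M phi : 0 <= M -> bsym b M -> sqint phi ->
  Num.sqrt (nrm2 (fun t => b (cis t) * phi t)) <= M * Num.sqrt (nrm2 phi).
Proof.
move=> M0 [mb hb] hp; have -> : M * Num.sqrt (nrm2 phi) = Num.sqrt (M ^+ 2 * nrm2 phi).
  by rewrite (@sqrtrM _ (M ^+ 2) (nrm2 phi) (sqr_ge0 M)) sqrtr_sqr ger0_norm.
apply: ler_wsqrtr; have [_ h1] := sqintM_bounded mb hb hp; have [_ h2] := hp.
have -> : M ^+ 2 * nrm2 phi = (2 * pi)^-1 * Rintegral lebesgue_measure circle (fun t => M ^+ 2 * cabs (phi t) ^+ 2).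
  by rewrite RintegralZl//; [rewrite /nrm2; ring|exact: measurable_itv].
rewrite ler_pM2l ?invr_gt0 ?mulr_gt0 ?pi_gt0//; apply: le_Rintegral => //.
- exact: measurable_itv.
- exact: rintZ.
move=> t /hb h; rewrite cabsM exprMn ler_wpM2r ?sqr_ge0//.
by rewrite ler_pXn2r ?nnegrE ?cabs_ge0.
Qed.

(** The double sum is the average of b p q^* for trigonometric polynomials p and q, whose norms are
    the two square roots. *)
Lemma toeplitz_form b M m n a c : 0 <= M -> bsym b M ->
  cabs (\sum_(j < m) \sum_(k < n) fcoef b j k * a k * (c j)^*) <=
  M * Num.sqrt (\sum_(k < n) cabs (a k) ^+ 2) * Num.sqrt (\sum_(j < m) cabs (c j) ^+ 2).
Proof.
move=> M0 hb; rewrite -(avg_tpoly m n a c hb) -!nrm2_tpoly.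
apply: le_trans (avg_cauchy_schwarz (sqint_sym hb (tpoly_sqint n a)) (tpoly_sqint m c)) _.
by rewrite ler_wpM2r ?sqrtr_ge0// nrm2_sym//; exact: tpoly_sqint.
Qed.

(** The defining relation concerns all boundary functions, the matrix only polynomials. Both <b F,
    U> and <T f, u> are limits of the same averages of truncations, the first by convergence in L^2,
    the second by boundedness of [T]. *)
Lemma is_toeplitz_of_matrix b M T : 0 <= M -> bsym b M -> bounded_op T ->
  (forall j k, T (h2e R k) j = fcoef b j k) -> is_toeplitz b T.
Proof.
move=> M0 hb bT TE; split=> // f F [F2 cF] u U [U2 cU].
have lT : linear T by case: bT.
have [K K0 TK] := bounded_opM bT.
pose fN N := tpoly N (fun k => f k); pose uN N := tpoly N (fun k => u k).
have L2E (V : R[i] -> R[i]) : L2norm V = Num.sqrt (nrm2 (Z V)).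
  by rewrite /L2norm /L2ip -[circle_int _]/(avg (fun t => Z V t * (Z V t)^*)) avg_norm.
pose dF N : R := Num.sqrt (nrm2 (fun t => F (cis t) - fN N t)).
pose dU N : R := Num.sqrt (nrm2 (fun t => U (cis t) - uN N t)).
have tp (g : H) N : (fun z : R[i] => \sum_(0 <= n < N) g n * z ^+ n) \o (@cis R) = tpoly N (fun k => g k).
  by apply/funext => t; rewrite /= big_mkord.
have small (g : H) (V : R[i] -> R[i]) : L2norm (fun z => V z - \sum_(0 <= n < N) g n * z ^+ n) @[N --> \oo] --> (0 : R) ->
    forall e : R, 0 < e -> exists N, forall n, (N <= n)%N ->
      Num.sqrt (nrm2 (fun t => V (cis t) - tpoly n (fun k => g k) t)) < e.
  move=> cV e e0; have /cvgrPdist_lt /(_ e e0)[N _ Nh] := cV; exists N => n /Nh /=.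
  rewrite sub0r normrN L2E ger0_norm ?sqrtr_ge0// /Z.
  by under [X in nrm2 X]eq_fun do rewrite big_mkord.
have sF : sqint (Z F) by case: F2 => h1 h2; split.
have sU : sqint (Z U) by case: U2 => h1 h2; split.
have sN (phi : R -> R[i]) n (g : H) : sqint phi -> sqint (fun t => phi t - tpoly n (fun k => g k) t).
  move=> hp; have h1 : sqint (fun t => (- 1) * tpoly n (fun k => g k) t).
    apply: (@sqintM_bounded _ (fun=> -1) _ 1); [exact: cmeas_cst| |exact: tpoly_sqint].
    by move=> t _; rewrite cabsN cabs1.
  by have := sqintD hp h1; rewrite (_ : (fun t => _ + _) = fun t => phi t - tpoly n (fun k => g k) t)//; apply/funext => t; rewrite mulN1r.
have cv1 : ctends (fun N => avg (fun t => b (cis t) * fN N t * (uN N t)^*)) (L2ip (fun z => b z * F z) U).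
  pose Q := Num.sqrt (nrm2 (Z U)) + h2norm f + 1.
  have Q0 : 0 < Q by rewrite ltr_wpDl// addr_ge0 ?sqrtr_ge0 ?h2norm_ge0.
  move=> e e0; have d0 : 0 < e / (M + 1) / Q / 2.
    by rewrite !divr_gt0// ltr_wpDl.
  have [N1 h1] := small _ _ cF _ d0; have [N2 h2] := small _ _ cU _ d0.
  exists (maxn N1 N2) => n; rewrite geq_max => /andP[n1 n2].
  have {}h1 := h1 n n1; have {}h2 := h2 n n2.
  set d := e / (M + 1) / Q / 2 in h1 h2 d0.
  have E : L2ip (fun z => b z * F z) U = avg (fun t => b (cis t) * fN n t * (uN n t)^*) +
     (avg (fun t => (b (cis t) * (F (cis t) - fN n t)) * (U (cis t))^*) +
      avg (fun t => (b (cis t) * fN n t) * (U (cis t) - uN n t)^*)).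
    have i1 := sqint_mul (sqint_sym hb (sN _ n f sF)) sU.
    have i2 := sqint_mul (sqint_sym hb (tpoly_sqint n (fun k => f k))) (sN _ n u sU).
    have i3 := sqint_mul (sqint_sym hb (tpoly_sqint n (fun k => f k))) (tpoly_sqint n (fun k => u k)).
    rewrite -avgD// -avgD//; last exact: avgableD.
    apply: eq_avg => t _; rewrite rmorphB /=.
    by move: (b _) (F _) (fN n t) ((uN n t)^*) ((U _)^*) => *; ring.
  rewrite cabs_distC E [X in cabs X](_ : _ = avg (fun t => (b (cis t) * (F (cis t) - fN n t)) * (U (cis t))^*) +
      avg (fun t => (b (cis t) * fN n t) * (U (cis t) - uN n t)^*)); last by ring.
  apply: le_lt_trans (cabsD _ _) _.
  have b1 := avg_cauchy_schwarz (sqint_sym hb (sN _ n f sF)) sU.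
  have b2 := avg_cauchy_schwarz (sqint_sym hb (tpoly_sqint n (fun k => f k))) (sN _ n u sU).
  have b1' := nrm2_sym M0 hb (sN _ n f sF).
  have b2' := nrm2_sym M0 hb (tpoly_sqint n (fun k => f k)).
  have b3 : Num.sqrt (nrm2 (tpoly n (fun k => f k))) <= h2norm f by rewrite nrm2_tpoly -sqsumE; exact: sqrt_sqsum_le.
  apply: (@le_lt_trans _ _ (M * d * Q + M * Q * d)).
    apply: lerD.
      apply: le_trans b1 _; apply: ler_pM; rewrite ?sqrtr_ge0//.
        by apply: le_trans b1' _; rewrite ler_wpM2l// ltW.
      by rewrite /Q -addrA lerDl addr_ge0// h2norm_ge0.
    apply: le_trans b2 _; apply: ler_pM; rewrite ?sqrtr_ge0//; last exact: ltW.
    apply: le_trans b2' _; rewrite ler_wpM2l//; apply: le_trans b3 _.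
    by rewrite /Q -addrA addrCA lerDl addr_ge0// sqrtr_ge0.
  have -> : M * d * Q + M * Q * d = M * (d * 2 * Q) by ring.
  have -> : d * 2 * Q = e / (M + 1) by rewrite /d divfK// divfK// gt_eqF.
  by rewrite mulrCA gtr_pMr// ltr_pdivrMr ?mul1r ?ltrDl// ltr_wpDl.
have cv2 : ctends (fun N => avg (fun t => b (cis t) * fN N t * (uN N t)^*)) (h2ip (T f) u).
  apply: (@ctends_ext _ (fun N => h2ip (T (h2trunc N f)) (h2trunc N u))).
    move=> N; rewrite (avg_tpoly N N (fun k => f k) (fun k => u k) hb).
    rewrite -h2ip_conj h2ip_trunc rmorph_sum; apply: eq_bigr => j _.
    rewrite rmorphM /= conjCK mulrC {1}/h2trunc (lin_sum _ _ _ lT) h2coef_sum mulr_suml.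
    by apply: eq_bigr => k _; rewrite (linZ _ _ lT) h2coefZ TE [f k * _]mulrC.
  move=> e e0; pose Q := h2norm u + h2norm f + 1.
  have Q0 : 0 < Q by rewrite ltr_wpDl// addr_ge0 ?h2norm_ge0.
  have d0 : 0 < e / (K + 1) / Q / 2 by rewrite !divr_gt0// ltr_wpDl.
  have [N1 h1] := h2trunc_cvg f d0; have [N2 h2] := h2trunc_cvg u d0.
  exists (maxn N1 N2) => n; rewrite geq_max => /andP[n1 n2].
  have {}h1 := h1 n n1; have {}h2 := h2 n n2.
  set d := e / (K + 1) / Q / 2 in h1 h2 d0.
  rewrite cabs_distC.
  have -> : h2ip (T f) u - h2ip (T (h2trunc n f)) (h2trunc n u) =
      h2ip (T (f - h2trunc n f)) u + h2ip (T (h2trunc n f)) (u - h2trunc n u).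
    by rewrite (linB _ _ lT) h2ipBl h2ipBr addrA subrK.
  apply: le_lt_trans (cabsD _ _) _.
  apply: (@le_lt_trans _ _ (K * d * Q + K * Q * d)).
    apply: lerD; apply: le_trans (cabs_h2ip_le _ _) _.
      apply: ler_pM; rewrite ?h2norm_ge0//.
        by apply: le_trans (TK _) _; rewrite ler_wpM2l// ltW.
      by rewrite /Q -addrA lerDl addr_ge0// h2norm_ge0.
    apply: ler_pM; rewrite ?h2norm_ge0//; last exact: ltW.
    apply: le_trans (TK _) _; rewrite ler_wpM2l//; apply: le_trans (h2norm_trunc_le _ _) _.
    by rewrite /Q -addrA addrCA lerDl addr_ge0// h2norm_ge0.
  have -> : K * d * Q + K * Q * d = K * (d * 2 * Q) by ring.
  have -> : d * 2 * Q = e / (K + 1) by rewrite /d divfK// divfK// gt_eqF.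
  by rewrite mulrCA gtr_pMr// ltr_pdivrMr ?mul1r ?ltrDl// ltr_wpDl.
exact: ctends_unique cv1 cv2.
Qed.

Lemma toeplitz_exists b M : 0 <= M -> bsym b M ->
  exists T : H -> H, [/\ is_toeplitz b T, in_Linfty b & forall j k, T (h2e R k) j = fcoef b j k].
Proof.
move=> M0 hb; have [|T [bT _ TE]] := @form_op _ (fcoef b) M M0.
  by move=> m n a c; exact: toeplitz_form.
exists T; split=> //; first exact: is_toeplitz_of_matrix hb bT TE.
case: hb => mb hb; split=> //; exists M.
by apply: aeW => t /hb.
Qed.

End ToeplitzOperators.

(** * Closure properties of the Toeplitz algebra, on matrices *)

Section ToeplitzAlgebra.
Variable R : realType.
Local Notation H := (H2 R).
Local Notation TT := (@toeplitz_algebra R).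
Implicit Types (A B T : H -> H) (E F : nat -> nat -> R[i]).

Lemma bounded_cstar : cstar_subalgebra (@bounded_op R).
Proof.
split=> //; split.
- exact: bounded_op0.
- by move=> A B; exact: bounded_opD.
- by move=> c A; exact: bounded_opZ.
- by move=> A B; exact: bounded_op_comp.
Qed.

Lemma TT_bounded A : TT A -> bounded_op A.
Proof.
move=> h; apply: (h (@bounded_op R)); split; first exact: bounded_cstar.
by move=> T [b _ []].
Qed.

Lemma TT_toeplitz b T : in_Linfty b -> is_toeplitz b T -> TT T.
Proof. by move=> hb hT S [_]; apply; exists b. Qed.

Lemma TT0 : TT (fun=> 0).
Proof. by move=> S [[_ [S0 _] _ _ _] _]. Qed.

Lemma TTD A B : TT A -> TT B -> TT (A \+ B).
Proof. by move=> hA hB S hS; have [[_ [_ SD] _ _ _] _] := hS; apply: SD; [exact: hA|exact: hB]. Qed.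

Lemma TTZ c A : TT A -> TT (fun f => c *: A f).
Proof. by move=> hA S hS; have [[_ _ [SZ _] _ _] _] := hS; apply: SZ; exact: hA. Qed.

Lemma TT_comp A B : TT A -> TT B -> TT (A \o B).
Proof. by move=> hA hB S hS; have [[_ _ [_ SC] _ _] _] := hS; apply: SC; [exact: hA|exact: hB]. Qed.

Lemma TT_adj A B : TT A -> bounded_op B -> is_adjoint A B -> TT B.
Proof. by move=> hA bB AB S hS; have [[_ _ _ SA _] _] := hS; apply: (SA A) => //; exact: hA. Qed.

Lemma norm_closed_opbound (I : set (H -> H)) A : norm_closed I -> I `<=` @bounded_op R ->
  bounded_op A ->
  (forall e : R, 0 < e -> exists2 B, I B & opbound (fun f => A f - B f) e) -> I A.
Proof.
move=> cI Ib bA h; apply: cI => // e e0; have e20 : 0 < e / 2 by rewrite divr_gt0.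
have [B IB AB] := h _ e20; exists B => //.
apply: (@le_lt_trans _ _ (e / 2)); last by rewrite ltr_pdivrMr// ltr_pMr// ltr1n.
by apply: opnorm_le (ltW e20) AB; apply: bounded_opB => //; exact: Ib.
Qed.

Lemma TT_lim A : bounded_op A ->
  (forall e : R, 0 < e -> exists2 B, TT B & opbound (fun f => A f - B f) e) -> TT A.
Proof.
move=> bA h; apply: norm_closed_opbound => //; last exact: TT_bounded.
move=> B bB hB S hS; have [[_ _ _ _ SN] _] := hS; apply: SN => // e /hB[T hT]; exists T => //.
exact: hT.
Qed.

Lemma TT_sym b (M : R) : 0 <= M -> bsym b M ->
  exists2 T, TT T & forall j k, T (h2e R k) j = fcoef b j k.
Proof.
move=> M0 hb; have [T [h1 h2 h3]] := toeplitz_exists M0 hb.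
by exists T => //; exact: TT_toeplitz h2 h1.
Qed.

(** Membership is phrased for matrices: the entries are explicit throughout, and boundedness of the
    operator is part of what membership delivers. *)
Definition inT E : Prop := exists2 A, TT A & forall j k, A (h2e R k) j = E j k.

Lemma inT_ext E F : (forall j k, E j k = F j k) -> inT E -> inT F.
Proof. by move=> e [A hA AE]; exists A => // j k; rewrite AE e. Qed.

Lemma inT0 : inT (fun _ _ => 0).
Proof. by exists (fun=> 0); [exact: TT0|]. Qed.

Lemma inTD E F : inT E -> inT F -> inT (fun j k => E j k + F j k).
Proof.
by move=> [A hA AE] [B hB BE]; exists (A \+ B) => [|j k]; [exact: TTD|rewrite /= h2coefD AE BE].
Qed.

Lemma inTZ c E : inT E -> inT (fun j k => c * E j k).
Proof.
by move=> [A hA AE]; exists (fun f => c *: A f) => [|j k]; [exact: TTZ|rewrite h2coefZ AE].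
Qed.

Lemma inTB E F : inT E -> inT F -> inT (fun j k => E j k - F j k).
Proof. by move=> hE hF; apply: inT_ext (inTD hE (inTZ (-1) hF)) => j k; rewrite mulN1r. Qed.

Lemma inT_sum (n : nat) (E : nat -> nat -> nat -> R[i]) : (forall i, (i < n)%N -> inT (E i)) ->
  inT (fun j k => \sum_(i < n) E i j k).
Proof.
elim: n => [|n ih] h; first by apply: inT_ext inT0 => j k; rewrite big_ord0.
apply: inT_ext (inTD (ih (fun i ni => h i (ltnW ni))) (h n (ltnSn n))) => j k.
by rewrite big_ord_recr.
Qed.

Lemma inT_mul E F P : inT E -> inT F ->
  (forall j k, ctends (fun n => \sum_(m < n) E j m * F m k) (P j k)) -> inT P.
Proof.
move=> [A hA AE] [B hB BE] h; exists (A \o B); first exact: TT_comp.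
move=> j k; apply: ctends_unique (coef_op (B (h2e R k)) j (TT_bounded hA)) _.
by apply: ctends_ext (h j k) => n; apply: eq_bigr => m _; rewrite AE BE mulrC.
Qed.

Lemma inT_op E A : inT E -> bounded_op A -> (forall j k, A (h2e R k) j = E j k) -> TT A.
Proof.
move=> [B hB BE] bA AE; suff -> : A = B by [].
apply: op_ext => //; first exact: TT_bounded.
by move=> k; apply: h2_ext => j; rewrite AE BE.
Qed.

Lemma inT_id : inT (fun j k => (j == k)%:R).
Proof.
have [T hT TE] := TT_sym ler01 (bsym1 R); exists T => // j k; rewrite TE /fcoef.
by under [X in avg X]eq_fun do rewrite mul1r; rewrite avg_cisX.
Qed.

Lemma TT_id : TT id.
Proof. by apply: inT_op inT_id (bounded_op_id _) _ => j k; rewrite coef_h2e. Qed.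

Lemma shift_exists : exists2 S, TT S & forall j k, S (h2e R k) j = (j == k.+1)%:R.
Proof.
have hz : bsym (fun z : R[i] => z) 1.
  by split=> [|t _]; [exact: cmeas_cis|rewrite cabs_cis].
have [T hT TE] := TT_sym ler01 hz; exists T => // j k; rewrite TE /fcoef.
under [X in avg X]eq_fun do rewrite mulrA -exprS.
by rewrite avg_cisX.
Qed.

End ToeplitzAlgebra.

(** * Symbols given as functions of the angle *)

Section Symbols.
Variable R : realType.
Implicit Types (g : R -> R[i]).
Local Notation circle := (@circle R).
Local Notation mu := (@lebesgue_measure R).

(** Symbols are functions of the point z; this inverts [cis] on [0, 2 pi), by [acos] on the upper
    half circle and its reflection on the lower. At t = 2 pi the value is that of t = 0. *)
Definition csym g (z : R[i]) : R[i] :=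
  g (if 0 <= complex.Im z then acos (complex.Re z) else 2 * pi - acos (complex.Re z)).

Lemma csymE g t : 0 <= t < 2 * pi -> csym g (cis t) = g t.
Proof.
move=> /andP[t0 t2]; rewrite /csym /=; congr g; have [tp|pt] := leP t pi.
  by rewrite sin_ge0_pi ?t0// cosK// in_itv /= t0.
have s0 : sin t < 0.
  have := @sin_gt0_pi R (t - pi); rewrite subr_gt0 pt /= sinB sinpi cospi mulrN1 mulr0 subr0.
  by rewrite oppr_gt0; apply; lra.
have ct : cos (2 * pi - t) = cos t by rewrite cosB mulr_natl cos2pi sin2pi mul1r mul0r addr0.
rewrite leNgt s0 /= -ct cosK; first by ring.
by rewrite in_itv /=; apply/andP; split; lra.
Qed.

Lemma csym_ext g t : circle t -> csym g (cis t) = if t == 2 * pi then g 0 else g t.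
Proof.
rewrite /circle /= in_itv /= => /andP[t0 t2]; case: eqVneq => [->|tN].
  have -> : cis (2 * pi : R) = cis 0 by rewrite cis0 -(cis_2pin R 1) mul1r.
  by rewrite csymE// lexx mulr_gt0// pi_gt0.
by rewrite csymE// t0 lt_neqAle tN.
Qed.

Lemma measurable_modify (f h : R -> R) : measurable_fun circle f ->
  (forall t, 0 <= t < 2 * pi -> h t = f t) -> measurable_fun circle h.
Proof.
move=> mf hf; have pi2 : 0 <= 2 * pi :> R by rewrite mulr_ge0// pi_ge0.
have E : circle = (`[0, 2 * pi[%classic `|` [set 2 * pi])%classic by rewrite setUitv1.
rewrite E in mf *; have m1 : measurable (`[0, 2 * pi[%classic : set R) by exact: measurable_itv.
have m2 : measurable ([set 2 * pi] : set R) by exact: measurable_set1.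
move/(measurable_funU f m1 m2): mf => [f1 _].
apply/(measurable_funU h m1 m2); split; last exact: measurable_fun_set1.
by apply: eq_measurable_fun f1 => t; rewrite inE /= in_itv /= => /hf.
Qed.

Lemma csym_bsym g (M : R) : cmeas g -> (forall t, circle t -> cabs (g t) <= M) -> bsym (csym g) M.
Proof.
move=> [m1 m2] gM; split.
  by split; [apply: (measurable_modify m1)|apply: (measurable_modify m2)] => t t2; rewrite csymE.
move=> t ct; rewrite csym_ext//; case: ifP => _; last exact: gM.
by apply: gM; rewrite /circle /= in_itv /= lexx mulr_ge0// pi_ge0.
Qed.

Lemma rint_oo (f : R -> R) : rint f ->
  \int[mu]_(t in circle) f t = \int[mu]_(t in `]0, 2 * pi[) f t.
Proof.
move=> hf; rewrite /circle -Rintegral_itv_obnd_cbnd; last first.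
  apply: integrableS hf; [exact: measurable_itv|exact: measurable_itv|].
  by move=> x; rewrite /circle /= !in_itv /= => /andP[/ltW -> ->].
rewrite -Rintegral_itv_bndo_bndc//.
apply: integrableS hf; [exact: measurable_itv|exact: measurable_itv|].
by move=> x; rewrite /circle /= !in_itv /= => /andP[/ltW -> /ltW ->].
Qed.

Lemma avg_oo (phi psi : R -> R[i]) : avgable phi -> avgable psi ->
  (forall t, 0 < t < 2 * pi -> phi t = psi t) -> avg phi = avg psi.
Proof.
move=> [a b] [c d] h; rewrite /avg !rint_oo//.
by congr (_ * _ +i* (_ * _)); apply: eq_Rintegral => t; rewrite inE /= in_itv /= => /h ->.
Qed.

Lemma fcoef_csym g (M : R) j k : cmeas g -> (forall t, circle t -> cabs (g t) <= M) ->
  fcoef (csym g) j k = avg (fun t => g t * cis (- (j%:R - k%:R) * t)).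
Proof.
move=> mg gM; rewrite /fcoef.
have mc : cmeas (fun t : R => cis (- (j%:R - k%:R) * t)).
  rewrite (_ : (fun t => _) = fun t => cis t ^+ k * (cis t ^+ j)^*).
    by apply: cmeasM; [|apply: cmeas_conj]; exact: cmeas_cisX.
  by apply/funext => t; rewrite cisX_conj.
apply: avg_oo.
- exact: fcoef_avgable (csym_bsym mg gM).
- apply: (avgable_dom (g := fun=> M)); [exact: cmeasM| |exact: rint_cst].
  by move=> t /gM; rewrite cabsM cabs_cis mulr1.
- by move=> t /andP[t0 t2]; rewrite csymE ?(ltW t0)// cisX_conj.
Qed.

Lemma cmeas_continuous g : continuous (fun t => complex.Re (g t)) ->
  continuous (fun t => complex.Im (g t)) -> cmeas g.
Proof. by move=> c1 c2; split; apply: measurable_funTS; exact: continuous_measurable_fun. Qed.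

(** The symbol exp (s (pi - t)) has Fourier coefficients proportional to 1 / (s + i (j - k)), and j
    - k - i s = - i (s + i (j - k)). *)
Lemma inT_cauchy (s : R) : s != 0 -> inT (fun j k => (j%:R - k%:R - 'i * s%:C)^-1 : R[i]).
Proof.
move=> s0; pose g (t : R) := (expR (s * (pi - t)))%:C : R[i].
have mg : cmeas g.
  apply: cmeas_continuous; last by move=> t; exact: cst_continuous.
  move=> t; apply: (@continuous_comp _ _ _ (fun t => s * (pi - t)) expR); last exact: continuous_expR.
  by apply: cvgMr; apply: cvgB; [exact: cvg_cst|exact: cvg_id].
have gM t : circle t -> cabs (g t) <= expR (`|s| * pi).
  move=> ct; rewrite (etrans (cabs_real _) (ger0_norm (expR_ge0 _)) : cabs (g t) = expR (s * (pi - t))) ler_expR.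
  move: ct; rewrite /circle /= in_itv /= => /andP[t0 t2].
  apply: le_trans (ler_norm _) _; rewrite normrM ler_wpM2l// ler_norml; apply/andP; split; lra.
have [T hT TE] := TT_sym (expR_ge0 _) (csym_bsym mg gM).
pose c : R := (2 * pi)^-1 * (expR (s * pi) - expR (- (s * pi))).
have c0 : c != 0.
  have p2 : (2 * pi)^-1 != 0 :> R by rewrite invr_eq0 gt_eqF// mulr_gt0// pi_gt0.
  apply: mulf_neq0 => //; rewrite subr_eq0; apply/eqP => /expR_inj h.
  have : s * pi = 0 by lra.
  by move/eqP; rewrite mulf_eq0 (negbTE s0) gt_eqF ?pi_gt0.
have cC : c%:C != 0 :> R[i] by rewrite eq_complex /= eqxx andbT.
have hT2 : inT (fun j k => fcoef (csym g) j k) by exists T.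
apply: inT_ext (inTZ ('i / c%:C) hT2) => j k.
have dN : s%:C + 'i * (j%:R - k%:R : R)%:C != 0.
  apply: contraNneq s0 => /eqP; rewrite eq_complex => /andP[/eqP + _]; rewrite /= => h.
  by apply/eqP; lra.
rewrite (fcoef_csym _ _ mg gM) avg_expcis// ?cis_2piB// -/c.
have E : (j%:R - k%:R - 'i * s%:C : R[i]) = - 'i * (s%:C + 'i * (j%:R - k%:R : R)%:C).
  have ii : 'i * 'i = -1 :> R[i] by rewrite -expr2 sqrCi.
  rewrite (_ : - 'i * _ = - ('i * 'i) * (j%:R - k%:R : R)%:C - 'i * s%:C); last by ring.
  by rewrite ii opprK mul1r rmorphB !rmorph_nat.
rewrite E; set w := s%:C + _ in dN *.
have iN : 'i != 0 :> R[i] by exact: neq0Ci.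
rewrite invfM invrN (_ : ('i)^-1 = - 'i :> R[i]); last by rewrite invCi.
by rewrite opprK -!mulrA [c%:C / w]mulrC [c%:C^-1 * _]mulrC -!mulrA divff// mulr1.
Qed.

End Symbols.

(** * The Cesaro operator in the Toeplitz algebra *)

Section CompactInToeplitz.
Variable R : realType.
Local Notation H := (H2 R).
Local Notation TT := (@toeplitz_algebra R).
Implicit Types (A B T : H -> H) (E F : nat -> nat -> R[i]).

Lemma inT_adj E : inT E -> inT (fun j k => (E k j)^*).
Proof.
move=> [A hA AE]; have [B bB AB] := adjoint_exists (TT_bounded hA).
by exists B => [|j k]; [exact: TT_adj hA bB AB|rewrite (coef_adjoint _ _ AB) AE].
Qed.

Lemma ctends_fin (u : nat -> R[i]) (j : nat) (l : R[i]) :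
  (forall n, (j < n)%N -> \sum_(m < n) u m = l) -> ctends (fun n => \sum_(m < n) u m) l.
Proof.
move=> h; apply: (@ctends_eventually _ (fun=> l) _ _ j.+1); last exact: ctends_cst.
by move=> n /h.
Qed.

Lemma inT_shift_row E : inT E -> inT (fun j k => if j is j'.+1 then E j' k else 0).
Proof.
move=> hE; have [S hS SE] := shift_exists R.
have hS' : inT (fun j k => (j == k.+1)%:R : R[i]) by exists S.
apply: (inT_mul hS' hE) => j k; apply: (@ctends_fin (fun m => (j == m.+1)%:R * E m k) j) => n jn.
case: j jn => [|j] jn; first by rewrite big1// => m _; rewrite mul0r.
rewrite (bigD1 (Ordinal (ltnW jn)))//= eqxx mul1r big1 ?addr0// => m mj.
by rewrite eqSS eq_sym -val_eqE /= in mj *; rewrite (negbTE mj) mul0r.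
Qed.

(** The projection id - S S^* onto e_0; shifting its rows and columns gives all matrix units. *)
Lemma inT_unit00 : inT (fun j k => ((j == 0) && (k == 0))%N%:R : R[i]).
Proof.
have [S hS SE] := shift_exists R; have hS' : inT (fun j k => (j == k.+1)%:R : R[i]) by exists S.
have h := inT_mul hS' (inT_adj hS') (P := fun j k => ((j == k) && (0 < j)%N)%:R).
have {}h : inT (fun j k => ((j == k) && (0 < j)%N)%:R : R[i]).
  apply: h => j k; apply: (@ctends_fin (fun m => (j == m.+1)%:R * ((k == m.+1)%:R : R[i])^*) j) => n jn; case: j jn => [|j] jn.
    by rewrite andbF big1// => m _; rewrite mul0r.
  rewrite andbT (bigD1 (Ordinal (ltnW jn)))//= eqxx mul1r conj_bool big1 ?addr0 1?eq_sym// => m mj.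
  by rewrite eqSS eq_sym -val_eqE /= in mj *; rewrite (negbTE mj) mul0r.
apply: inT_ext (inTB (inT_id R) h) => j k; case: j k => [|j] [|k] //=; rewrite ?subr0 ?subrr//.
by rewrite andbT subrr.
Qed.

Lemma inT_unit a b : inT (fun j k => ((j == a) && (k == b))%:R : R[i]).
Proof.
have h c : inT (fun j k => ((j == c) && (k == 0))%N%:R : R[i]).
  elim: c => [|c ih]; first exact: inT_unit00.
  by apply: inT_ext (inT_shift_row ih) => -[|j] k.
have {}h : inT (fun j k => ((j == 0) && (k == b))%N%:R : R[i]).
  by apply: inT_ext (inT_adj (h b)) => j k; rewrite conj_bool andbC.
elim: a => [|a ih]; first exact: h.
by apply: inT_ext (inT_shift_row ih) => -[|j] k.
Qed.

Lemma bounded_rank1 a (v : H) : bounded_op (fun f => h2ip f v *: h2e R a).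
Proof.
split; first by move=> c f g; rewrite h2ipDl h2ipZl scalerDl scalerA.
exists (h2norm v) => f; rewrite h2normZ h2norm_e mulr1 mulrC; exact: cabs_h2ip_le.
Qed.

Lemma TT_rank1 a (v : H) : TT (fun f => h2ip f v *: h2e R a).
Proof.
apply: TT_lim; first exact: bounded_rank1.
move=> e /(h2trunc_cvg v)[n /(_ n (leqnn n)) vn].
exists (fun f => h2ip f (h2trunc n v) *: h2e R a); last first.
  move=> f; rewrite -scalerBl -h2ipBr h2normZ h2norm_e mulr1.
  apply: le_trans (cabs_h2ip_le _ _) _; rewrite mulrC ler_wpM2r ?h2norm_ge0//; exact: ltW.
have h : inT (fun j k => \sum_(i < n) (v i)^* * ((j == a) && (k == i))%:R).
  apply: (@inT_sum _ n (fun i j k => (v i)^* * ((j == a) && (k == i))%:R)) => i _.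
  by apply: inTZ; exact: inT_unit.
apply: inT_op h (bounded_rank1 _ _) _ => j k.
rewrite h2coefZ coef_h2e h2ip_el coef_h2trunc.
have [ja|ja] := eqVneq j a; last by rewrite mulr0 big1// => i _; rewrite mulr0.
rewrite mulr1; case: ifP => kn.
  rewrite (bigD1 (Ordinal kn))//= eqxx mulr1 big1 ?addr0// => i ik.
  by rewrite eq_sym -val_eqE /= in ik *; rewrite (negbTE ik) mulr0.
rewrite rmorph0 big1// => i _; case: eqP => [E|]; rewrite ?mulr0//.
by rewrite E ltn_ord in kn.
Qed.

(** Small tails approximate [A] in norm by its first n rows, a sum of the rank one operators <., A^*
    e_j> e_j. *)
Lemma TT_tail_small A : bounded_op A -> tail_small A -> TT A.
Proof.
move=> bA tA; have [B bB AB] := adjoint_exists bA; apply: TT_lim => // e /tA[n An].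
exists (fun f => h2trunc n (A f)) => //.
have TS m : TT (fun f => \sum_(j < m) h2ip f (B (h2e R j)) *: h2e R j).
  elim: m => [|m ih].
    by rewrite (_ : (fun f => _) = fun=> 0); [exact: TT0|apply/funext => f; rewrite big_ord0].
  rewrite (_ : (fun f => _) = (fun f => \sum_(j < m) h2ip f (B (h2e R j)) *: h2e R j) \+
     (fun f => h2ip f (B (h2e R m)) *: h2e R m)); last by apply/funext => f; rewrite big_ord_recr.
  by apply: TTD => //; exact: TT_rank1.
rewrite (_ : (fun f => _) = fun f => \sum_(j < n) h2ip f (B (h2e R j)) *: h2e R j)//.
by apply/funext => f; rewrite /h2trunc; apply: eq_bigr => j _; rewrite -AB h2ip_er.
Qed.

Lemma inT_diag (d : nat -> R[i]) : ctends d 0 -> inT (fun j k => if j == k then d j else 0).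
Proof.
move=> d0; have [N dN] := d0 1 ltr01.
have [||D [bD _ DE]] := @diag_op _ d (1 + \sum_(i < N) cabs (d i)).
- by rewrite addr_ge0// sumr_ge0// => i _; exact: cabs_ge0.
- move=> j; have [jN|/dN] := ltnP j N.
    rewrite (bigD1 (Ordinal jN))//= addrCA lerDl addr_ge0// sumr_ge0// => i _; exact: cabs_ge0.
  rewrite subr0 => /ltW /le_trans; apply; rewrite lerDl sumr_ge0// => i _; exact: cabs_ge0.
exists D; last by move=> j k; rewrite DE coef_h2e; case: eqP => _; rewrite ?mulr1 ?mulr0.
apply: TT_tail_small => //; apply: diag_tail_small DE _ => e /d0[M dM]; exists M => j /dM.
by rewrite subr0 => /ltW.
Qed.

Lemma hilbert_schmidt_form E (r : nat -> R) (M : R) : 0 <= M ->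
  (forall j n, \sum_(k < n) cabs (E j k) ^+ 2 <= r j) -> (forall n, \sum_(j < n) r j <= M ^+ 2) ->
  forall m n (a b : nat -> R[i]),
    cabs (\sum_(j < m) \sum_(k < n) E j k * a k * (b j)^*) <=
    M * Num.sqrt (\sum_(k < n) cabs (a k) ^+ 2) * Num.sqrt (\sum_(j < m) cabs (b j) ^+ 2).
Proof.
move=> M0 rn rM m n a b; set P := Num.sqrt _; set Q := Num.sqrt _.
have r0 j : 0 <= r j by apply: le_trans (rn j 0%N); rewrite big_ord0.
have P0 : 0 <= P by exact: sqrtr_ge0.
apply: (@le_trans _ _ (\sum_(j < m) Num.sqrt (r j) * P * cabs (b j))).
  apply: le_trans (cabs_sum _ _ _) _; apply: ler_sum => j _.
  rewrite -mulr_suml cabsM cabs_conj ler_wpM2r ?cabs_ge0//.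
  apply: le_trans (cabs_sum _ _ _) _.
  under eq_bigr do rewrite cabsM.
  apply: le_trans (sum_mul_le_sqrt n (fun k => cabs (E j k)) (fun k => cabs (a k))) _.
  by rewrite ler_wpM2r// ler_wsqrtr.
have -> : \sum_(j < m) Num.sqrt (r j) * P * cabs (b j) = P * \sum_(j < m) Num.sqrt (r j) * cabs (b j).
  by rewrite mulr_sumr; apply: eq_bigr => j _; rewrite mulrCA mulrA.
rewrite [M * P]mulrC -mulrA ler_wpM2l//.
apply: le_trans (sum_mul_le_sqrt m (fun j => Num.sqrt (r j)) (fun j => cabs (b j))) _.
rewrite ler_wpM2r ?sqrtr_ge0// -[leRHS]ger0_norm// -sqrtr_sqr ler_wsqrtr//.
by apply: le_trans (rM m); apply: ler_sum => j _; rewrite sqr_sqrtr.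
Qed.

Lemma inT_hilbert_schmidt E (r : nat -> R) (M : R) : 0 <= M ->
  (forall j n, \sum_(k < n) cabs (E j k) ^+ 2 <= r j) -> (forall n, \sum_(j < n) r j <= M) ->
  inT E.
Proof.
move=> M0 rn rM; have [||A [bA _ AE]] := @form_op _ E (Num.sqrt M).
- exact: sqrtr_ge0.
- apply: (hilbert_schmidt_form _ rn) => [|n]; first exact: sqrtr_ge0.
  by rewrite sqr_sqrtr.
exists A => //; apply: TT_tail_small => //; apply: (@hilbert_schmidt_tail_small _ A r M) => // j n.
by under eq_bigr do rewrite AE.
Qed.

(** Telescoping against 2 / sqrt (m + 1), the primitive of the summand up to sign. *)
Lemma sum_inv_pow32 n : \sum_(d < n) (d.+1%:R * Num.sqrt d.+1%:R)^-1 <= 3 :> R.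
Proof.
have h m : \sum_(d < m.+1) (d.+1%:R * Num.sqrt d.+1%:R)^-1 <= 3 - 2 * (Num.sqrt m.+1%:R)^-1 :> R.
  elim: m => [|m ih]; first by rewrite big_ord_recr big_ord0 /= sqrtr1; lra.
  rewrite big_ord_recr /=; apply: le_trans (lerD ih (lexx _)) _.
  have p0 : 0 < Num.sqrt m.+1%:R :> R by rewrite sqrtr_gt0.
  have q0 : 0 < Num.sqrt m.+2%:R :> R by rewrite sqrtr_gt0.
  have pq : Num.sqrt m.+1%:R <= Num.sqrt m.+2%:R :> R by rewrite ler_wsqrtr// ler_nat.
  have p2 : Num.sqrt m.+1%:R ^+ 2 = m.+1%:R :> R by rewrite sqr_sqrtr.
  have q2 : Num.sqrt m.+2%:R ^+ 2 = m.+1%:R + 1 :> R by rewrite sqr_sqrtr// -[in LHS]addn1 natrD.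
  have -> : m.+2%:R = Num.sqrt m.+2%:R ^+ 2 :> R by rewrite sqr_sqrtr.
  rewrite (_ : Num.sqrt (Num.sqrt m.+2%:R ^+ 2) = Num.sqrt m.+2%:R :> R); last first.
    by rewrite sqrtr_sqr ger0_norm// ltW.
  have e : Num.sqrt m.+2%:R ^+ 2 = Num.sqrt m.+1%:R ^+ 2 + 1 :> R by rewrite p2 q2.
  move: (Num.sqrt m.+1%:R : R) (Num.sqrt m.+2%:R : R) p0 q0 pq e => p q p0 q0 pq e.
  rewrite -subr_ge0.
  have -> : 3 - 2 * q^-1 - (3 - 2 * p^-1 + (q ^+ 2 * q)^-1) = (2 * q ^+ 2 * (q - p) - p) / (p * q ^+ 3).
    by field; rewrite !gt_eqF.
  rewrite divr_ge0//; last by rewrite mulr_ge0 ?exprn_ge0// ltW.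
  have : (q - p) * (q + p) = 1 by rewrite -subr_sqr e; ring.
  nra.
case: n => [|n]; first by rewrite big_ord0.
apply: le_trans (h n) _; rewrite lerBlDr lerDl mulr_ge0// invr_ge0 sqrtr_ge0.
Qed.

End CompactInToeplitz.

(** * The logarithmic distance and negligible matrices *)

Section LogKernel.
Variable R : realType.
Implicit Types (E F : nat -> nat -> R[i]).

Definition lnS (j : nat) : R := ln (j.+1%:R).
Definition dln (j k : nat) : R := lnS j - lnS k.

Lemma expR_lnS j : expR (lnS j) = j.+1%:R.
Proof. by rewrite lnK// posrE. Qed.

Lemma lnS_le j k : (j <= k)%N -> lnS j <= lnS k.
Proof. by move=> jk; rewrite ler_ln ?posrE// ler_nat. Qed.

Lemma dln_sym j k : dln k j = - dln j k.
Proof. by rewrite /dln opprB. Qed.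

(** exp |t| is (max + 1) / (min + 1). With truncated subtraction, [(j - k) + (k - j)] is |j - k|,
    here and below. *)
Lemma expR_abs_dln j k : (j != k)%N ->
  expR `|dln j k| = 1 + ((j - k) + (k - j))%N%:R / (minn j k).+1%:R.
Proof.
wlog jk : j k / (k < j)%N => [hw|_].
  move=> jk; have /orP[h|h] : ((k < j) || (j < k))%N by lia.
    exact: hw.
  by rewrite -normrN -dln_sym addnC minnC; apply: hw => //; rewrite eq_sym.
rewrite ger0_norm ?subr_ge0 ?lnS_le 1?ltnW// /dln expRD expRN !expR_lnS.
rewrite (eqP (ltnW jk : (k - j == 0)%N)) addn0 (minn_idPr (ltnW jk)) natrB 1?ltnW//.
have k0 : k.+1%:R != 0 :> R by rewrite pnatr_eq0.
rewrite -[j.+1%:R]natr1; move: k0; rewrite -[k.+1%:R]natr1 => k0.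
by field.
Qed.

Lemma pow_le_expR (x : R) n : 0 <= x -> x ^+ n <= n`!%:R * expR x.
Proof.
move=> x0; case: n => [|n]; first by rewrite expr0 mul1r -[leLHS]expR0 ler_expR.
have := expR_ge1Dxn n x0; have f0 : 0 < (n.+1)`!%:R :> R by rewrite ltr0n fact_gt0.
by rewrite -ler_pdivrMl// mulrC => h; apply: le_trans h; rewrite lerDr.
Qed.

Lemma sum_sum_exchange_le (a c : nat -> R) (Ca Cc : R) N : (forall k, 0 <= a k) -> (forall k, 0 <= c k) ->
  0 <= Cc -> (forall n, \sum_(k < n) a k <= Ca) -> (forall n, \sum_(k < n) c k <= Cc) ->
  \sum_(j < N) \sum_(k < j) a k * c (j - k).-1 <= Ca * Cc.
Proof.
move=> a0 c0 Cc0 hA hC.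
apply: (@le_trans _ _ (\sum_(k < N) a k * Cc)); last by rewrite -mulr_suml ler_wpM2r.
have -> : \sum_(j < N) \sum_(k < j) a k * c (j - k).-1 =
    \sum_(k < N) \sum_(k.+1 <= j < N) a k * c (j - k).-1.
  elim: N => [|N ih]; first by rewrite !big_ord0.
  rewrite big_ord_recr /= ih [RHS]big_ord_recr /= [X in _ = _ + X]big_geq// addr0.
  rewrite -big_split /=; apply: eq_bigr => k _.
  by rewrite big_nat_recr.
apply: ler_sum => k _; rewrite -mulr_sumr ler_wpM2l//.
apply: le_trans (hC (N - k.+1)%N).
rewrite -{1}[k.+1]add0n big_addn big_mkord le_eqVlt; apply/orP; left; apply/eqP.
by apply: eq_bigr => i _; rewrite addnS subSn ?leq_addl// addnK.
Qed.

(** Hilbert-Schmidt for every power of t. Write d = |j - k|: exp |t| <= 1 + d <= 4 d, so t^(2n) <=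
    2^(2n) (2n)! exp (|t| / 2) costs only a factor sqrt d. What remains of the squared entry,
    d^(-3/2) (min + 1)^(-2), is summable in d and in min. *)
Lemma inT_offdiag E (K : R) n : 0 <= K -> (forall j, E j j = 0) ->
  (forall j k, (j != k)%N ->
    cabs (E j k) <= K / (((j - k) + (k - j))%N%:R * (minn j k).+1%:R)) ->
  inT (fun j k => (dln j k ^+ n)%:C * E j k).
Proof.
move=> K0 E0 EK.
pose C := (2 ^+ (2 * n) * ((2 * n)`!)%:R : R).
have C0 : 0 <= C by rewrite mulr_ge0// exprn_ge0.
pose a k : R := (k.+1%:R ^+ 2)^-1; pose c d : R := (d.+1%:R * Num.sqrt d.+1%:R)^-1.
have a0 k : 0 <= a k by rewrite invr_ge0 exprn_ge0.
have c0 k : 0 <= c k by rewrite invr_ge0 mulr_ge0// sqrtr_ge0.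
pose Q := C * 2 * K ^+ 2; have Q0 : 0 <= Q by rewrite !mulr_ge0 ?sqr_ge0.
have bnd j k : (j != k)%N -> cabs ((dln j k ^+ n)%:C * E j k) ^+ 2 <=
    Q * (a (minn j k) * c ((j - k) + (k - j)).-1).
  move=> jk; have := EK j k jk; set d := (_ + _)%N; set m := minn j k => Ejk.
  have d0 : (0 < d)%N by rewrite /d; move: jk; lia.
  have dR : 1 <= d%:R :> R by rewrite ler1n.
  have tl : dln j k ^+ (2 * n) <= C * (2 * Num.sqrt d%:R).
    have -> : dln j k ^+ (2 * n) = 2 ^+ (2 * n) * (`|dln j k| / 2) ^+ (2 * n).
      by rewrite -exprMn mulrC divfK// !exprM real_normK ?num_real.
    rewrite /C -mulrA ler_wpM2l ?exprn_ge0//.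
    apply: le_trans (pow_le_expR _ _) _; first by rewrite divr_ge0.
    rewrite ler_wpM2l//.
    rewrite -(@ler_pXn2r _ 2)// ?nnegrE ?expR_ge0 ?mulr_ge0 ?sqrtr_ge0//.
    rewrite -expRM_natl exprMn sqr_sqrtr// (_ : 2%:R * _ = `|dln j k|); last by lra.
    rewrite expR_abs_dln// -/d -/m; apply: (@le_trans _ _ (1 + d%:R)).
      by rewrite lerD2l ler_pdivrMr// ler_peMr// ler1n.
    by rewrite expr2; lra.
  rewrite cabsM exprMn cabs_real real_normK ?num_real// -exprM mulnC.
  apply: le_trans (ler_pM _ (sqr_ge0 _) tl (_ : _ <= (K / (d%:R * m.+1%:R)) ^+ 2)) _.
  - by rewrite exprM exprn_ge0// sqr_ge0.
  - by rewrite ler_pXn2r ?nnegrE ?cabs_ge0 ?divr_ge0 ?mulr_ge0.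
  rewrite /a /c prednK//.
  have s0 : 0 < Num.sqrt d%:R :> R by rewrite sqrtr_gt0 (lt_le_trans _ dR).
  have dE : d%:R = Num.sqrt d%:R ^+ 2 :> R by rewrite sqr_sqrtr.
  have m0 : m.+1%:R != 0 :> R by rewrite pnatr_eq0.
  rewrite le_eqVlt; apply/orP; left; apply/eqP; rewrite /Q.
  rewrite [X in K / (X * _)]dE [X in (X * Num.sqrt _)^-1]dE.
  by move: (Num.sqrt d%:R : R) (m.+1%:R : R) s0 m0 => x y x0 y0; field; rewrite y0 gt_eqF.
pose r j := Q * (\sum_(k < j) a k * c (j - k).-1 + a j * 3).
have r0 j : 0 <= r j.
  rewrite mulr_ge0// addr_ge0 ?mulr_ge0// sumr_ge0// => k _; exact: mulr_ge0.
apply: (@inT_hilbert_schmidt _ _ r (Q * (2 * 3 + 2 * 3))).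
- by rewrite mulr_ge0.
- move=> j N; have c3 M : \sum_(d < M) c d <= 3 by exact: sum_inv_pow32.
  apply: (@le_trans _ _ (\sum_(k < maxn N j.+1) cabs ((dln j k ^+ n)%:C * E j k) ^+ 2)).
    rewrite (big_ord_widen _ (fun k => cabs ((dln j k ^+ n)%:C * E j k) ^+ 2) (leq_maxl N j.+1)).
    rewrite big_mkcond; apply: ler_sum => k _; case: ifP => _ //; exact: sqr_ge0.
  rewrite -(big_mkord xpredT (fun k => cabs ((dln j k ^+ n)%:C * E j k) ^+ 2)).
  have jN : (j < maxn N j.+1)%N by rewrite leq_max ltnSn orbT.
  rewrite (@big_cat_nat _ _ _ j)//=; last exact: ltnW.
  rewrite (big_ltn jN) E0 mulr0 cabs0 expr0n /= add0r /r mulrDr; apply: lerD.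
    rewrite big_mkord mulr_sumr; apply: ler_sum => k _.
    have kj := ltn_ord k; apply: le_trans (bnd _ _ _) _; first by rewrite gt_eqF.
    rewrite (minn_idPr (ltnW kj)) (eqP (ltnW kj : (k - j == 0)%N)) addn0.
    exact: lexx.
  apply: (@le_trans _ _ (Q * (a j * \sum_(d < (maxn N j.+1 - j.+1)) c d))); last first.
    by rewrite ler_wpM2l// ler_wpM2l.
  rewrite -{1}[j.+1]add0n big_addn big_mkord !mulr_sumr; apply: ler_sum => i _.
  have ji : (j != i + j.+1)%N by lia.
  apply: le_trans (bnd _ _ ji) _.
  rewrite (minn_idPl _); last by rewrite addnS leqW// leq_addl.
  rewrite (eqP (_ : (j - (i + j.+1) == 0)%N)); last by rewrite addnS subn_eq0 leqW// leq_addl.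
  by rewrite add0n addnS subSn ?leq_addl// addnK.
- move=> N; rewrite -mulr_sumr ler_wpM2l// big_split /=; apply: lerD.
    by apply: sum_sum_exchange_le => //; [move=> M; exact: sum_inv_sqr_bound|move=> M; exact: sum_inv_pow32].
  by rewrite -mulr_suml ler_wpM2r//; exact: sum_inv_sqr_bound.
Qed.

(** The diagonal enters only at n = 0, as a compact diagonal matrix; for n > 0 the factor t^n
    vanishes there. *)
Lemma inT_almost_diag E (K : R) n : 0 <= K -> ctends (fun j => E j j) 0 ->
  (forall j k, (j != k)%N ->
    cabs (E j k) <= K / (((j - k) + (k - j))%N%:R * (minn j k).+1%:R)) ->
  inT (fun j k => (dln j k ^+ n)%:C * E j k).
Proof.
move=> K0 E0 EK; pose E1 j k := if j == k then 0 else E j k.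
have h1 : inT (fun j k => (dln j k ^+ n)%:C * E1 j k).
  apply: (@inT_offdiag _ K) => // [j|j k jk]; rewrite /E1 ?eqxx//.
  by rewrite (negbTE jk) EK.
case: n h1 => [|n] h1.
  apply: inT_ext (inTD h1 (inT_diag E0)) => j k; rewrite /E1 expr0.
  by case: eqP => [->|_]; rewrite ?mul1r ?add0r ?addr0.
apply: inT_ext h1 => j k; rewrite /E1; case: eqP => [->|//].
by rewrite /dln subrr expr0n /= rmorph0 !mul0r.
Qed.

End LogKernel.

(** * The product of two Cauchy matrices *)

Section CauchyMatrices.
Variable R : realType.
Implicit Types (E F P : nat -> nat -> R[i]).

Local Notation u j m := ((j%:R - m%:R - 'i : R[i])^-1).

(* Off the diagonal, the Cesaro matrix is [mu (dln j k) * logmx j k], where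
   [mu x = (1 - exp (- x)) / x] for [0 < x] and [mu x = 0] for [x < 0]. *)
Definition logmx j k : R[i] := if j == k then 0 else (dln R j k)%:C / (j%:R - k%:R).

Lemma inT_cauchy_pos : inT (fun j m => u j m).
Proof. by apply: inT_ext (inT_cauchy (oner_neq0 R)) => j k; rewrite mulr1. Qed.

Lemma inT_cauchy_neg : inT (fun m k => - u k m).
Proof.
have n1 : (-1 : R) != 0 by rewrite oppr_eq0 oner_eq0.
apply: inT_ext (inT_cauchy n1) => j k; rewrite -invrN; congr (_^-1).
by rewrite rmorphN rmorph1; ring.
Qed.

Lemma ReI : complex.Re ('i : R[i]) = 0. Proof. by []. Qed.
Lemma ImI : complex.Im ('i : R[i]) = 1. Proof. by []. Qed.

Lemma Re_cauchy j m : complex.Re (j%:R - m%:R - 'i : R[i]) = j%:R - m%:R.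
Proof.
have h n : complex.Re (n%:R : R[i]) = n%:R by rewrite -(rmorph_nat (real_complex R)).
by rewrite !ReB !h ReI subr0.
Qed.

Lemma Im_cauchy j m : complex.Im (j%:R - m%:R - 'i : R[i]) = -1.
Proof.
have h n : complex.Im (n%:R : R[i]) = 0 by rewrite -(rmorph_nat (real_complex R)).
by rewrite !ImB !h ImI subrr sub0r.
Qed.

Lemma sqr_cabs_cauchy j m : cabs (u j m) ^+ 2 = ((j%:R - m%:R) ^+ 2 + 1)^-1.
Proof. by rewrite cabsV exprVn sqr_cabs Re_cauchy Im_cauchy sqrrN expr1n. Qed.

Lemma cauchy_neq0 j m : j%:R - m%:R - 'i != 0 :> R[i].
Proof.
apply/eqP => h; have := congr1 (fun z => complex.Im z) h; rewrite /= Im_cauchy /=.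
by move/eqP; rewrite oppr_eq0 oner_eq0.
Qed.

Lemma cabs_cauchy_le j m (x : R) : 0 < x -> x <= `|j%:R - m%:R| -> cabs (u j m) <= x^-1.
Proof.
move=> x0 h; rewrite cabsV lef_pV2 ?posrE ?cabs_gt0 ?cauchy_neq0//.
by apply: le_trans h _; rewrite -Re_cauchy; exact: Re_le_cabs.
Qed.

Lemma cauchy_ctends0 j : ctends (fun m => u j m) 0.
Proof.
move=> e e0; have [N Ne] := exists_inv_nat_lt e0.
exists (j + N.+1)%N => m jm; rewrite subr0; apply: le_lt_trans Ne.
apply: cabs_cauchy_le => //; rewrite distrC ger0_norm; last by rewrite subr_ge0 ler_nat; lia.
by rewrite -natrB ?ler_nat; lia.
Qed.

Lemma cauchy_shift j m : u j.+1 m.+1 = u j m.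
Proof. by congr (_^-1); rewrite -![_.+1%:R]natr1; ring. Qed.

(** A harmonic sum with the pole moved off the axis: the sum of 1 / (n - i), with i the imaginary
    unit, over 1 <= n <= j. Its differences are logarithms up to O(1 / min). *)
Definition cauchyA j : R[i] := \sum_(i < j) u i.+1 0%N.

(** [u] depends only on j - m, so raising j by one shifts the sum: one new term enters at m = 0 and
    the one lost at the far end tends to 0. Subtracting the row j = 0 matters for p = 1, where the
    series of a single row diverges. *)
Lemma cauchy_sum_ctends (p : nat) j : (0 < p)%N ->
  ctends (fun n => \sum_(m < n) u j m ^+ p - \sum_(m < n) u 0%N m ^+ p) (\sum_(i < j) u i.+1 0%N ^+ p).
Proof.
move=> p0; elim: j => [|j ih].
  by rewrite big_ord0; apply: ctends_ext (ctends_cst 0) => n; rewrite subrr.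
have h0 : ctends (fun m => u j m ^+ p) 0.
  move=> e e0; have e1 : 0 < Num.min e 1 by rewrite lt_min e0 ltr01.
  have [N hN] := cauchy_ctends0 j e1; exists N => n /hN; rewrite !subr0 lt_min cabsX => /andP[h1 h2].
  apply: le_lt_trans h1; rewrite -{2}[cabs _]expr1; apply: ler_wiXn2l => //; [exact: cabs_ge0|exact: ltW].
rewrite big_ord_recr /=; apply/(@ctends_shift _ 1).
have ih1 := (iffLR (@ctends_shift _ 1 _ _) ih).
have := ctendsB (ctendsD ih1 (ctends_cst (u j.+1 0%N ^+ p))) h0.
rewrite (subr0 (_ + u j.+1 0%N ^+ p)); apply: ctends_ext => n; rewrite !addn1.
rewrite [X in _ = X - _]big_ord_recl /= [X in X - _ + _ - _ = _]big_ord_recr /=.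
have -> : \sum_(i < n) u j.+1 (bump 0 i) ^+ p = \sum_(i < n) u j i ^+ p.
  by apply: eq_bigr => i _; rewrite /bump add1n cauchy_shift.
by ring.
Qed.

(** Partial fractions: - u_jm u_km = (u_jm - u_km) / (j - k). *)
Lemma cauchy_gram_ctends j k : j != k ->
  ctends (fun n => \sum_(m < n) u j m * - u k m) ((cauchyA j - cauchyA k) / (j%:R - k%:R)).
Proof.
move=> jk; have d0 : j%:R - k%:R != 0 :> R[i] by rewrite subr_eq0 eqr_nat.
have := ctendsZ ((j%:R - k%:R)^-1) (ctendsB (cauchy_sum_ctends j (ltn0Sn 0)) (cauchy_sum_ctends k (ltn0Sn 0))).
rewrite mulrC; apply: ctends_ext => n.
rewrite opprB addrA subrK -sumrB mulr_sumr; apply: eq_bigr => m _; rewrite !expr1.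
have := cauchy_neq0 j m; have := cauchy_neq0 k m; move: d0.
move: (j%:R : R[i]) (k%:R : R[i]) (m%:R : R[i]) => x y z d0 y0 x0.
by field; rewrite d0 x0 y0.
Qed.

(** Partial fractions do not apply on the diagonal. It is enough that the diagonal entries converge
    to some c0, as their difference from c0 id is then a compact diagonal. *)
Lemma cauchy_diag : exists (dd : nat -> R[i]) (c0 : R[i]),
  (forall j, ctends (fun n => \sum_(m < n) u j m * - u j m) (dd j)) /\ ctends dd c0.
Proof.
have sq j m : cabs (u j m ^+ 2) = ((j%:R - m%:R) ^+ 2 + 1)^-1 by rewrite cabsX sqr_cabs_cauchy.
have [|V0 hV0] := @abs_summable_ctends R (fun m => u 0%N m ^+ 2) 4.
  move=> n; apply: (@le_trans _ _ (2 * \sum_(m < n) (m.+1%:R ^+ 2)^-1)); last first.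
    by have := sum_inv_sqr_bound R n; lra.
  rewrite mulr_sumr; apply: ler_sum => m _; rewrite sq sub0r sqrrN -[m.+1%:R]natr1.
  have m0 : 0 <= m%:R :> R by []; move: (m%:R : R) m0 => x x0.
  rewrite -[2 * _]invrK invfM invrK lef_pV2 ?posrE; [|by nra|by nra].
  have := sqr_ge0 (x - 1); nra.
have [|W hW] := @abs_summable_ctends R (fun i => u i.+1 0%N ^+ 2) 2.
  move=> n; apply: le_trans (sum_inv_sqr_bound R n); apply: ler_sum => i _.
  rewrite sq subr0 lef_pV2 ?posrE ?exprn_gt0//; first by rewrite lerDl.
exists (fun j => - V0 - \sum_(i < j) u i.+1 0%N ^+ 2), (- V0 - W); split; last first.
  by apply: ctendsB hW; exact: ctends_cst.
move=> j; have := ctendsN (ctendsD (cauchy_sum_ctends j (ltn0Sn 1)) hV0).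
rewrite opprD addrC; apply: ctends_ext => n; rewrite subrK -sumrN; apply: eq_bigr => m _.
by rewrite mulrN expr2.
Qed.

Lemma abs_dln_le j k : (j != k)%N -> `|dln R j k| <= ((j - k) + (k - j))%N%:R / (minn j k).+1%:R.
Proof.
move=> jk; rewrite -(lerD2l 1) -expR_abs_dln//; exact: expR_ge1Dx.
Qed.

Lemma normr_natB j k : `|j%:R - k%:R| = ((j - k) + (k - j))%N%:R :> R.
Proof.
have [jk|/ltnW kj] := leqP j k.
  rewrite distrC ger0_norm ?subr_ge0 ?ler_nat// -natrB//.
  by rewrite (eqP (jk : (j - k == 0)%N)) add0n.
rewrite ger0_norm ?subr_ge0 ?ler_nat// -natrB//.
by rewrite (eqP (kj : (k - j == 0)%N)) addn0.
Qed.

Lemma cabs_natB j k : cabs (j%:R - k%:R : R[i]) = ((j - k) + (k - j))%N%:R.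
Proof. by rewrite -normr_natB -cabs_real rmorphB !rmorph_nat. Qed.

Lemma dist_gt0 j k : (j != k)%N -> 0 < ((j - k) + (k - j))%N%:R :> R.
Proof. by move=> jk; rewrite ltr0n; lia. Qed.

(** The difference is i t u / (j - k), with |u| <= 1 / |j - k| and |t| <= |j - k| / (min + 1). *)
Lemma cauchy_sub_logmx_bound j k : (j != k)%N ->
  cabs ((dln R j k)%:C * u j k - logmx j k) <= 1 / (((j - k) + (k - j))%N%:R * (minn j k).+1%:R).
Proof.
move=> jk; rewrite /logmx (negbTE jk).
have d0 : j%:R - k%:R != 0 :> R[i] by rewrite subr_eq0 eqr_nat.
have -> : (dln R j k)%:C * u j k - (dln R j k)%:C / (j%:R - k%:R) =
    (dln R j k)%:C * 'i * (u j k / (j%:R - k%:R)).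
  have := cauchy_neq0 j k; move: d0; move: (j%:R : R[i]) (k%:R : R[i]) => x y d0 x0.
  by field; rewrite d0 x0.
rewrite !cabsM (cabsV (j%:R - k%:R)) cabs_natB cabs_real.
have -> : cabs ('i : R[i]) = 1.
  by apply/eqP; rewrite -(@eqrXn2 _ 2) ?cabs_ge0// sqr_cabs ReI ImI expr0n add0r.
rewrite mulr1 div1r invfM; have d1 := dist_gt0 jk; have := abs_dln_le jk.
have : cabs (u j k) <= (((j - k) + (k - j))%N%:R)^-1.
  by apply: cabs_cauchy_le => //; rewrite normr_natB.
have := cabs_ge0 (u j k); have := normr_ge0 (dln R j k).
move: (((j - k) + (k - j))%N%:R : R) (cabs _) `|_| ((minn j k).+1%:R^-1 : R) d1 => d c t m d1 t0 c0 cd tm.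
apply: (@le_trans _ _ (d * m * (d^-1 / d))).
  by apply: ler_pM => //; [rewrite mulr_ge0 ?invr_ge0 ?(ltW d1)|rewrite ler_wpM2r ?invr_ge0 ?(ltW d1)].
by rewrite (_ : d * m * (d^-1 / d) = d^-1 * m)//; field; rewrite gt_eqF.
Qed.

Lemma lnS_step i : (i.+2%:R)^-1 <= lnS R i.+1 - lnS R i <= (i.+1%:R)^-1.
Proof.
have x0 : 0 < i.+1%:R :> R by [].
rewrite /lnS -ln_div ?posrE// -[i.+2%:R]natr1; move: (i.+1%:R : R) x0 => x x0.
apply/andP; split; last first.
  have -> : (x + 1) / x = 1 + x^-1 by field; rewrite gt_eqF.
  by apply: le_ln1Dx; rewrite (lt_trans _ (_ : 0 < x^-1)) ?invr_gt0// ltrN10.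
have := @le_ln1Dx R (- (x + 1)^-1); rewrite (_ : 1 + - (x + 1)^-1 = (((x + 1) / x))^-1); last first.
  by field; rewrite !gt_eqF//; lra.
rewrite lnV ?posrE ?divr_gt0 ?addr_gt0// lerN2; apply.
by rewrite ltrN2 invf_lt1 ?addr_gt0// ltrDr.
Qed.

(** Both replacing 1 / (i + 1 - 'i) by 1 / (i + 1) and replacing that by the logarithmic increment,
    which lies between 1 / (i + 2) and 1 / (i + 1), cost at most (i + 1)^(-2). *)
Lemma harmonic_log_step i :
  cabs (u i.+1 0%N - (lnS R i.+1 - lnS R i)%:C) <= 2 * (i.+1%:R ^+ 2)^-1.
Proof.
have x0 : 0 < i.+1%:R :> R by [].
have -> : u i.+1 0%N - (lnS R i.+1 - lnS R i)%:C =
   (u i.+1 0%N - ((i.+1%:R : R)^-1)%:C) + ((i.+1%:R : R)^-1 - (lnS R i.+1 - lnS R i))%:C.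
  by rewrite !rmorphB; ring.
apply: le_trans (cabsD _ _) _; rewrite (_ : 2 * _ = (i.+1%:R ^+ 2)^-1 + (i.+1%:R ^+ 2)^-1 :> R); last by ring.
apply: lerD.
  have -> : u i.+1 0%N - ((i.+1%:R : R)^-1)%:C = 'i * (u i.+1 0%N * ((i.+1%:R : R)^-1)%:C).
    have := cauchy_neq0 i.+1 0; rewrite natrC subr0; have : i.+1%:R != 0 :> R[i] by rewrite pnatr_eq0.
    by move: (i.+1%:R : R[i]) => x x1 x2; field; rewrite x1 x2.
  rewrite !cabsM cabs_real ger0_norm ?invr_ge0//.
  have -> : cabs ('i : R[i]) = 1.
    by apply/eqP; rewrite -(@eqrXn2 _ 2) ?cabs_ge0// sqr_cabs ReI ImI expr0n add0r.
  rewrite mul1r expr2 invfM ler_wpM2r ?invr_ge0//; apply: cabs_cauchy_le => //.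
  by rewrite subr0 ger0_norm.
have /andP[] := lnS_step i; move: (lnS R i.+1 - lnS R i) => y; rewrite -[i.+2%:R]natr1 cabs_real.
move: (i.+1%:R : R) x0 => x x0 h2 h1.
rewrite ger0_norm ?subr_ge0//; apply: (@le_trans _ _ (x^-1 - (x + 1)^-1)); first by rewrite lerD2l lerN2.
have -> : x^-1 - (x + 1)^-1 = (x * (x + 1))^-1 by field; rewrite !gt_eqF//; lra.
by rewrite lef_pV2 ?posrE ?exprn_gt0 ?mulr_gt0 ?addr_gt0// expr2 ler_pM2l// lerDl.
Qed.

Lemma harmonic_log_dist j k :
  cabs (cauchyA j - cauchyA k - (dln R j k)%:C) <= 4 / (minn j k).+1%:R.
Proof.
wlog kj : j k / (k <= j)%N => [hw|].
  have /orP[/hw//|h] := leq_total k j; rewrite minnC -cabsN; apply: le_trans (hw _ _ h).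
  rewrite le_eqVlt; apply/orP; left; apply/eqP; congr cabs.
  by rewrite (dln_sym R j k) rmorphN; ring.
rewrite (minn_idPr kj) -(subnKC kj); move: (j - k)%N => d {kj j}.
have E : cauchyA (k + d) - cauchyA k - (dln R (k + d) k)%:C =
    \sum_(k <= i < k + d) (u i.+1 0%N - (lnS R i.+1 - lnS R i)%:C).
  elim: d => [|d ih]; first by rewrite addn0 big_geq// /dln !subrr.
  rewrite addnS big_nat_recr ?leq_addr//= -ih /cauchyA big_ord_recr /= /dln !rmorphB; ring.
rewrite E; apply: le_trans (_ : _ <= \sum_(k <= i < k + d) 2 * (i.+1%:R ^+ 2)^-1) _.
  elim: d {E} => [|d ih]; first by rewrite addn0 !big_geq// cabs0.
  rewrite addnS !big_nat_recr ?leq_addr//=; apply: le_trans (cabsD _ _) _.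
  by apply: lerD => //; exact: harmonic_log_step.
rewrite -mulr_sumr; apply: le_trans (ler_wpM2l _ (sum_inv_sqr_le R k (k + d))) _ => //.
have : (k.+1%:R ^+ 2)^-1 <= (k.+1%:R)^-1 :> R.
  by rewrite lef_pV2 ?posrE ?exprn_gt0// expr2 ler_peMr// ler1n.
by move: (_^-1) (_^-1) => x y; lra.
Qed.

Lemma cauchy_gram_sub_logmx_bound j k : (j != k)%N ->
  cabs ((cauchyA j - cauchyA k) / (j%:R - k%:R) - logmx j k) <=
  4 / (((j - k) + (k - j))%N%:R * (minn j k).+1%:R).
Proof.
move=> jk; rewrite /logmx (negbTE jk) -mulrBl cabsM cabsV cabs_natB invfM mulrCA [leRHS]mulrC.
by rewrite ler_wpM2r ?invr_ge0//; exact: harmonic_log_dist.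
Qed.

Lemma inT_mul_exists E F : inT E -> inT F ->
  exists2 Q, inT Q & forall j k, ctends (fun n => \sum_(m < n) E j m * F m k) (Q j k).
Proof.
move=> [A hA AE] [B hB BE]; exists (fun j k => A (B (h2e R k)) j).
  by exists (A \o B) => //; exact: TT_comp.
move=> j k; apply: ctends_ext (coef_op (B (h2e R k)) j (TT_bounded hA)) => n.
by apply: eq_bigr => m _; rewrite AE BE mulrC.
Qed.

Lemma inT_sum_mul (N : nat) (E F : nat -> nat -> nat -> R[i]) P :
  (forall i, (i < N)%N -> inT (E i)) -> (forall i, (i < N)%N -> inT (F i)) ->
  (forall j k, ctends (fun n => \sum_(m < n) \sum_(i < N) E i j m * F i m k) (P j k)) -> inT P.
Proof.
move=> hE hF hP.
have [Q hQ QE] : exists2 Q, inT Q &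
    forall j k, ctends (fun n => \sum_(i < N) \sum_(m < n) E i j m * F i m k) (Q j k).
  elim: N hE hF {hP} => [|N ih] hE hF.
    exists (fun _ _ => 0); first exact: inT0.
    by move=> j k; apply: ctends_ext (ctends_cst 0) => n; rewrite big_ord0.
  have [Q hQ QE] := ih (fun i iN => hE i (ltnW iN)) (fun i iN => hF i (ltnW iN)).
  have [Q' hQ' QE'] := inT_mul_exists (hE N (ltnSn N)) (hF N (ltnSn N)).
  exists (fun j k => Q j k + Q' j k); first exact: inTD.
  by move=> j k; apply: ctends_ext (ctendsD (QE j k) (QE' j k)) => n; rewrite big_ord_recr.
apply: inT_ext hQ => j k; apply: ctends_unique (QE j k) _.
by apply: ctends_ext (hP j k) => n; rewrite exchange_big.
Qed.

(** [P] is the product of the two Cauchy matrices. As t_jk = t_jm + t_mk, the binomial formula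
    writes t^n P as a sum of products of t^(n-i) u and t^i times the second factor. Finally [P] is
    [logmx] plus c0 id up to an error covered by [inT_almost_diag]. *)
Lemma inT_pow_logmx n : inT (fun j k => (dln R j k ^+ n)%:C * logmx j k).
Proof.
elim/ltn_ind: n => n ih.
have [dd [c0 [hdd hc0]]] := cauchy_diag.
pose P j k := if j == k then dd j else (cauchyA j - cauchyA k) / (j%:R - k%:R).
have hP j k : ctends (fun M => \sum_(m < M) u j m * - u k m) (P j k).
  by rewrite /P; case: eqVneq => [<-//|jk]; exact: cauchy_gram_ctends.
(* For i > 0 one power of t is spent on turning u into [logmx], which leaves t^(i-1) and hence an
   instance of the induction hypothesis; i = 0 is the Cauchy matrix itself. *)
have hu i : (i <= n)%N -> inT (fun j m => (dln R j m ^+ i)%:C * u j m).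
  case: i => [_|i iN].
    by apply: inT_ext inT_cauchy_pos => j m; rewrite expr0 mul1r.
  have h1 := ih i iN.
  have h2 := @inT_almost_diag R (fun j k => (dln R j k)%:C * u j k - logmx j k) 1 i ler01.
  have {}h2 : inT (fun j k => (dln R j k ^+ i)%:C * ((dln R j k)%:C * u j k - logmx j k)).
    apply: h2; last by move=> j k; exact: cauchy_sub_logmx_bound.
    by apply: ctends_ext (ctends_cst 0) => j; rewrite /logmx eqxx /dln subrr mul0r subrr.
  apply: inT_ext (inTD h1 h2) => j k; rewrite -mulrDr addrCA subrr addr0 mulrA -rmorphM.
  by rewrite -exprSr.
have hv i : (i <= n)%N -> inT (fun m k => (dln R m k ^+ i)%:C * - u k m).
  case: i => [_|i iN].
    by apply: inT_ext inT_cauchy_neg => j m; rewrite expr0 mul1r.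
  have h1 := ih i iN.
  have h2 := @inT_almost_diag R (fun j k => (dln R j k)%:C * - u k j - logmx j k) 1 i ler01.
  have {}h2 : inT (fun j k => (dln R j k ^+ i)%:C * ((dln R j k)%:C * - u k j - logmx j k)).
    apply: h2 => [|j k jk].
      by apply: ctends_ext (ctends_cst 0) => j; rewrite /logmx eqxx /dln subrr mul0r subrr.
    have kj : (k != j)%N by rewrite eq_sym.
    have := cauchy_sub_logmx_bound kj; rewrite minnC addnC; congr (cabs _ <= _).
    rewrite /logmx (negbTE jk) (negbTE kj).
    have -> : (dln R k j)%:C = - (dln R j k)%:C by rewrite (dln_sym R j k) rmorphN.
    rewrite -[k%:R - j%:R]opprB invrN; ring.
  apply: inT_ext (inTD h1 h2) => j k; rewrite -mulrDr addrCA subrr addr0 mulrA -rmorphM.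
  by rewrite -exprSr.
have hnP : inT (fun j k => (dln R j k ^+ n)%:C * P j k).
  apply: (@inT_sum_mul n.+1 (fun i j m => ('C(n, i)%:R : R[i]) * ((dln R j m ^+ (n - i))%:C * u j m))
     (fun i m k => (dln R m k ^+ i)%:C * - u k m)).
  - by move=> i _; apply: inTZ; apply: hu; exact: leq_subr.
  - by move=> i iN; exact: hv.
  move=> j k; apply: ctends_ext (ctendsZ (dln R j k ^+ n)%:C (hP j k)) => M.
  rewrite mulr_sumr; apply: eq_bigr => m _.
  have -> : dln R j k = dln R j m + dln R m k by rewrite /dln addrA subrK.
  rewrite exprDn rmorph_sum mulr_suml; apply: eq_bigr => i _ /=.
  rewrite -mulr_natl rmorphM rmorphM rmorph_nat; ring.
have hd : inT (fun j k => (dln R j k ^+ n)%:C * (c0 * (j == k)%:R)).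
  case: n {ih hu hv hnP} => [|n].
    by apply: inT_ext (inTZ c0 (inT_id R)) => j k; rewrite expr0 mul1r.
  apply: inT_ext (inT0 R) => j k; case: eqVneq => [->|_]; last by rewrite !mulr0.
  by rewrite /dln subrr expr0n /= mul0r.
have hE : inT (fun j k => (dln R j k ^+ n)%:C * (P j k - c0 * (j == k)%:R - logmx j k)).
  apply: (@inT_almost_diag R _ 4 n) => // [|j k jk].
    have := ctendsB hc0 (ctends_cst c0); rewrite subrr; apply: ctends_ext => j.
    by rewrite /P /logmx eqxx mulr1 subr0.
  by rewrite /P (negbTE jk) mulr0 subr0; exact: cauchy_gram_sub_logmx_bound.
by apply: inT_ext (inTB (inTB hnP hd) hE) => j k; ring.
Qed.

End CauchyMatrices.

(** * Multipliers of the logarithmic kernel *)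

Section SchurKernel.
Variable R : realType.
Local Notation H := (H2 R).
Implicit Types (E F : nat -> nat -> R[i]).
Local Notation L := (lnS R).
Local Notation t := (dln R).

(** This is ((j + 1)(k + 1))^(-1/2) exp (- |t| / 8), of Hilbert type with extra decay in t; it
    dominates bounded operators entrywise. *)
Definition schur_weight j k : R := expR (- (L j + L k) / 2 - `|t j k| / 8).

Let c : R := 1 / 8.
Let c0 : 0 < c. Proof. by rewrite divr_gt0. Qed.

(** The summand is (k + 1)^(c - 1) with c = 1/8. The induction compares it with increments of 16 (k
    + 1)^c, using 16 (1 - exp (- d / 8)) >= d for d <= 1, where d is the logarithmic step, at least
    1 / (j + 2). *)
Lemma schur_sum_low j : \sum_(k < j.+1) expR (c * L k) * (k.+1%:R)^-1 <= 16 * expR (c * L j).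
Proof.
elim: j => [|j ih].
  by rewrite big_ord_recr big_ord0 /= add0r invr1 mulr1 ler_peMl ?expR_ge0//; lra.
rewrite big_ord_recr /=; apply: le_trans (lerD ih (lexx _)) _.
have /andP[h1 h2] := lnS_step R j; set d := L j.+1 - L j in h1 h2.
have d1 : d <= 1 by apply: le_trans h2 _; rewrite invf_le1// ler1n.
have d0 : 0 < d by apply: lt_le_trans h1; rewrite invr_gt0.
have -> : L j = L j.+1 - d by rewrite /d subKr.
rewrite mulrBr expRD expRN; set X := expR (c * L j.+1); have X0 : 0 < X by exact: expR_gt0.
have y1 : 1 + c * d <= expR (c * d) by exact: expR_ge1Dx.
have y0 : 0 < expR (c * d) by exact: expR_gt0.
rewrite -subr_ge0 (_ : 16 * X - _ = X * (16 - 16 * (expR (c * d))^-1 - (j.+2%:R)^-1)); last by ring.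
rewrite mulr_ge0 ?(ltW X0)//; move: (expR (c * d)) y1 y0 => y y1 y0.
have : y^-1 <= 1 - d / 16.
  rewrite -(ler_pM2l y0) divff ?gt_eqF//; move: y1; rewrite /c => y1; nra.
move: ((j.+2%:R)^-1 : R) (y^-1) h1 => p q; lra.
Qed.

Lemma schur_sum_high j n :
  \sum_(j.+1 <= k < n) expR (- (c * L k)) * (k.+1%:R)^-1 <= 8 * expR (- (c * L j)).
Proof.
have [nj|jn] := leqP n j.+1.
  by rewrite big_geq// mulr_ge0 ?expR_ge0.
suff h d : \sum_(j.+1 <= k < j.+1 + d) expR (- (c * L k)) * (k.+1%:R)^-1 <=
    8 * expR (- (c * L j)) - 8 * expR (- (c * L (j + d)%N)).
  rewrite -(subnKC (ltnW jn)); apply: le_trans (h _) _.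
  by rewrite lerBlDr lerDl mulr_ge0 ?expR_ge0.
elim: d => [|d ih]; first by rewrite addn0 big_geq// addn0 subrr.
rewrite addnS big_nat_recr; last exact: leq_addr.
apply: le_trans (lerD ih (lexx _)) _.
rewrite addSn addnS; set m := (j + d)%N.
have /andP[h1 h2] := lnS_step R m; set e := L m.+1 - L m in h1 h2.
have -> : L m = L m.+1 - e by rewrite /e subKr.
rewrite [- (c * (_ - e))](_ : _ = - (c * L m.+1) + c * e); last by ring.
rewrite expRD; set X := expR (- (c * L m.+1)); have X0 : 0 < X by exact: expR_gt0.
have := expR_ge1Dx (c * e); move: (expR (c * e)) => y y1.
set a := 8 * expR (- (c * L j)).
rewrite -subr_ge0 (_ : _ - (_ + _) = X * (8 * y - 8 - (m.+2%:R)^-1)); last by ring.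
rewrite mulr_ge0 ?(ltW X0)//; move: y1; rewrite /c; move: ((m.+2%:R)^-1 : R) h1 => p h1 y1; lra.
Qed.

Lemma schur_kernel_row j n : \sum_(k < n) expR (- L k) * expR (- (`|t j k| / 8)) <= 24.
Proof.
have tE k : `|t j k| / 8 = if (k <= j)%N then c * L j - c * L k else c * L k - c * L j.
  rewrite /c /dln; case: leqP => h.
    by rewrite ger0_norm ?subr_ge0 ?lnS_le//; lra.
  by rewrite distrC ger0_norm ?subr_ge0 ?lnS_le 1?ltnW//; lra.
apply: (@le_trans _ _ (\sum_(0 <= k < maxn n j.+1) expR (- L k) * expR (- (`|t j k| / 8)))).
  rewrite big_mkord (big_ord_widen _ (fun k => expR (- L k) * expR (- (`|t j k| / 8))) (leq_maxl n j.+1)).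
  by rewrite big_mkcond; apply: ler_sum => k _; case: ifP => _ //; rewrite mulr_ge0 ?expR_ge0.
have jN : (j.+1 <= maxn n j.+1)%N by rewrite leq_maxr.
rewrite (@big_cat_nat _ _ _ j.+1)//= (_ : 24 = 16 + 8 :> R); last by ring.
apply: lerD.
  rewrite big_mkord; apply: le_trans (_ : _ <= expR (- (c * L j)) * \sum_(k < j.+1) expR (c * L k) * (k.+1%:R)^-1) _.
    rewrite mulr_sumr; apply: ler_sum => k _; rewrite tE -ltnS ltn_ord opprB expRD expRN expR_lnS.
    move: (expR (c * L k)) (expR (- (c * L j))) (k.+1%:R^-1 : R) => x y z.
    by rewrite (_ : z * (x * y) = y * (x * z))//; ring.
  rewrite -ler_pdivlMl ?expR_gt0// -expRN opprK mulrC; exact: schur_sum_low.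
apply: le_trans (_ : _ <= expR (c * L j) * \sum_(j.+1 <= k < maxn n j.+1) expR (- (c * L k)) * (k.+1%:R)^-1) _.
  rewrite mulr_sumr big_nat_cond [leRHS]big_nat_cond; apply: ler_sum => k /andP[/andP[jk _] _].
  rewrite tE leqNgt jk /= opprB expRD [expR (- L k)]expRN expR_lnS.
  by rewrite mulrC -mulrA.
rewrite -ler_pdivlMl ?expR_gt0// -expRN mulrC; exact: schur_sum_high.
Qed.

Lemma schur_weight_sym j k : schur_weight k j = schur_weight j k.
Proof. by rewrite /schur_weight (dln_sym R j k) normrN [L k + L j]addrC. Qed.

(** Schur test with weights (k + 1)^(-1/2); the constant 24 is 16 + 8 from the two sides of the
    diagonal. *)
Lemma schur_weight_op E (M : R) : 0 <= M -> (forall j k, cabs (E j k) <= M * schur_weight j k) ->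
  exists A : H -> H, [/\ bounded_op A, opbound A (M * 24) & forall j k, A (h2e R k) j = E j k].
Proof.
move=> M0 EM; pose p k := expR (- (L k / 2)).
have row j n : \sum_(k < n) schur_weight j k * p k <= 24 * p j.
  apply: (@le_trans _ _ (p j * \sum_(k < n) expR (- L k) * expR (- (`|t j k| / 8)))).
    rewrite mulr_sumr; apply: ler_sum => k _; rewrite /schur_weight /p -!expRD ler_expR; lra.
  by rewrite mulrC ler_wpM2r ?expR_ge0// schur_kernel_row.
apply: (@schur_test R E p) => [|j|j n|k m].
- by rewrite mulr_ge0.
- exact: expR_gt0.
- rewrite -mulrA; apply: le_trans (ler_wpM2l M0 (row j n)).
  by rewrite mulr_sumr; apply: ler_sum => k _; rewrite mulrA ler_wpM2r ?expR_ge0.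
- rewrite -mulrA; apply: le_trans (ler_wpM2l M0 (row k m)).
  rewrite mulr_sumr; apply: ler_sum => j _; rewrite mulrA ler_wpM2r ?expR_ge0//.
  by rewrite schur_weight_sym.
Qed.

(** Up to the factor 24 the supremum of |E| / [schur_weight] dominates the operator norm, so
    entrywise approximation in this weight suffices. *)
Lemma inT_schur_lim E (M : R) : 0 <= M -> (forall j k, cabs (E j k) <= M * schur_weight j k) ->
  (forall e : R, 0 < e -> exists2 F, inT F & forall j k, cabs (E j k - F j k) <= e * schur_weight j k) ->
  inT E.
Proof.
move=> M0 EM h; have [A [bA _ AE]] := schur_weight_op M0 EM; exists A => //.
apply: TT_lim => // e e0; have e24 : 0 < e / 24 by rewrite divr_gt0.
have [F [B hB BE] EF] := h _ e24; exists B => //.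
have [D [bD De DE]] := schur_weight_op (ltW e24) EF.
have bAB : bounded_op (fun f => A f - B f) by apply: bounded_opB => //; exact: TT_bounded.
suff -> : (fun f => A f - B f) = D by move=> f; have := De f; rewrite divfK.
by apply: op_ext => // k; apply: h2_ext => j; rewrite h2coefB AE BE DE.
Qed.

(** Since j - k = ((j + 1)(k + 1))^(1/2) 2 sinh (t / 2), the kernel is t / (2 sinh (t / 2)) times
    the Hilbert weight. Half of the decay exp (- |t| / 2) is given up to absorb the factor t. *)
Lemma logmx_bound j k : cabs (logmx R j k) <= 4 * expR (- (L j + L k) / 2 - `|t j k| / 4).
Proof.
rewrite /logmx; case: eqVneq => [_|jk]; first by rewrite cabs0 mulr_ge0// expR_ge0.
rewrite cabsM cabsV cabs_natB cabs_real -normr_natB.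
wlog kj : j k jk / (k < j)%N => [hw|].
  have /orP[h|h] : ((k < j) || (j < k))%N by lia.
    exact: hw.
  have -> : `|t j k| = `|t k j| by rewrite (dln_sym R j k) normrN.
  by rewrite (distrC (j%:R)) [L j + _]addrC; apply: hw => //; rewrite eq_sym.
have t0 : 0 <= t j k by rewrite subr_ge0 lnS_le// ltnW.
have d0 : 0 < j%:R - k%:R :> R by rewrite subr_gt0 ltr_nat.
rewrite !ger0_norm// ?(ltW d0)// ler_pdivrMr//.
have dE : j%:R - k%:R = expR ((L j + L k) / 2) * (expR (t j k / 2) - expR (- (t j k / 2))).
  rewrite mulrBr -!expRD (_ : _ + t j k / 2 = L j); last by rewrite /dln; lra.
  rewrite (_ : _ - t j k / 2 = L k); last by rewrite /dln; lra.
  by rewrite !expR_lnS -[j.+1%:R]natr1 -[k.+1%:R]natr1; ring.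
rewrite dE mulrA -[4 * _ * _]mulrA -expRD.
rewrite (_ : - (L j + L k) / 2 - t j k / 4 + (L j + L k) / 2 = - (t j k / 4)); last by lra.
rewrite (_ : t j k / 2 = t j k / 4 + t j k / 4); last by lra.
rewrite opprD !expRD expRN; have := expR_ge1Dx (t j k / 4).
move: (t j k) t0 => x x0; move: (expR (x / 4)) => y y1.
have y0 : 1 <= y by lra.
rewrite -subr_ge0 (_ : _ - x = 4 * (y - (y^-1) ^+ 3) - x); last by field; lra.
have yi : y^-1 <= 1 by rewrite invf_le1//; lra.
have yi0 : 0 <= y^-1 by rewrite invr_ge0; lra.
have : (y^-1) ^+ 3 <= 1 by rewrite exprn_ile1.
lra.
Qed.

Implicit Types (phi psi : R -> R[i]).

(** All powers of t are built in, so that the class is closed under multiplication by polynomials,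
    as Taylor approximation requires. *)
Definition logmult phi : Prop :=
  forall n, inT (fun j k => (t j k ^+ n)%:C * phi (t j k) * logmx R j k).

Lemma pow_weight_le n (x : R) : `|x| ^+ n <= (n`!%:R * 16 ^+ n) * expR (`|x| / 16).
Proof.
have -> : `|x| ^+ n = 16 ^+ n * (`|x| / 16) ^+ n by rewrite -exprMn mulrC divfK.
rewrite [n`!%:R * _]mulrC -mulrA ler_wpM2l ?exprn_ge0//; apply: pow_le_expR.
by rewrite divr_ge0.
Qed.

(** Budget of exponents: 1/4 from [logmx_bound], less 1/16 for t^n and 1/16 for the growth of the
    multiplier, leaves the 1/8 of [schur_weight]. *)
Lemma logmult_kernel_bound n (B : R) j k (z : R[i]) : cabs z <= B * expR (`|t j k| / 16) ->
  cabs ((t j k ^+ n)%:C * z * logmx R j k) <= B * (4 * (n`!%:R * 16 ^+ n)) * schur_weight j k.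
Proof.
move=> zB; rewrite !cabsM cabs_real normrX.
have h1 := pow_weight_le n (t j k); have h2 := logmx_bound j k.
apply: le_trans (ler_pM _ _ (ler_pM _ _ h1 zB) h2) _; rewrite ?mulr_ge0 ?cabs_ge0 ?exprn_ge0//.
rewrite (_ : schur_weight j k = expR (`|t j k| / 16) * expR (`|t j k| / 16) * expR (- (L j + L k) / 2 - `|t j k| / 4)).
  rewrite le_eqVlt; apply/orP; left; apply/eqP; ring.
by rewrite /schur_weight -!expRD; congr expR; lra.
Qed.

Lemma logmult_lim phi (B : R) : 0 <= B -> (forall x, cabs (phi x) <= B) ->
  (forall e : R, 0 < e -> exists2 psi, logmult psi &
     forall x, cabs (phi x - psi x) <= e * expR (`|x| / 16)) -> logmult phi.
Proof.
move=> B0 phiB h n; pose K := 4 * (n`!%:R * 16 ^+ n) : R.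
have K0 : 0 < K by rewrite !mulr_gt0 ?exprn_gt0// ltr0n fact_gt0.
have w1 x : cabs (phi x) <= B * expR (`|x| / 16).
  by apply: le_trans (phiB x) _; rewrite ler_peMr// -[leLHS]expR0 ler_expR divr_ge0.
apply: (@inT_schur_lim _ (B * K)) => [|j k|e e0].
- by rewrite mulr_ge0// ltW.
- exact: logmult_kernel_bound.
have [psi hpsi hd] := h _ (divr_gt0 e0 K0).
exists (fun j k => (t j k ^+ n)%:C * psi (t j k) * logmx R j k) => [|j k]; first exact: hpsi.
rewrite -mulrBl -mulrBr; apply: le_trans (logmult_kernel_bound n (hd _)) _.
by rewrite -/K divfK ?gt_eqF.
Qed.

Lemma logmult_ext phi psi : (forall x, phi x = psi x) -> logmult phi -> logmult psi.
Proof. by move=> /funext ->. Qed.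

Lemma logmult_cst (z : R[i]) : logmult (fun=> z).
Proof. by move=> n; apply: inT_ext (inTZ z (inT_pow_logmx R n)) => j k; ring. Qed.

Lemma logmultD phi psi : logmult phi -> logmult psi -> logmult (fun x => phi x + psi x).
Proof. by move=> h1 h2 n; apply: inT_ext (inTD (h1 n) (h2 n)) => j k; ring. Qed.

Lemma logmultZ (z : R[i]) phi : logmult phi -> logmult (fun x => z * phi x).
Proof. by move=> h1 n; apply: inT_ext (inTZ z (h1 n)) => j k; ring. Qed.

Lemma logmult_pow phi i : logmult phi -> logmult (fun x => (x ^+ i)%:C * phi x).
Proof.
move=> h n; apply: inT_ext (h (n + i)%N) => j k; rewrite exprD rmorphM /=; ring.
Qed.

Lemma logmult_sum (m : nat) (phi : nat -> R -> R[i]) : (forall i, logmult (phi i)) ->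
  logmult (fun x => \sum_(i < m) phi i x).
Proof.
move=> h; elim: m => [|m ih].
  by apply: logmult_ext (logmult_cst 0) => x; rewrite big_ord0.
by apply: logmult_ext (logmultD ih (h m)) => x; rewrite big_ord_recr.
Qed.

Definition cisT m (x : R) : R[i] := \sum_(i < m) ('i * x%:C) ^+ i * ((i`!%:R : R)^-1)%:C.

Lemma imagX n : ('i : R[i]) ^+ n = (if odd n then 0 else (-1) ^+ n./2) +i* (if odd n then (-1) ^+ n./2 else 0).
Proof.
elim: n => [|n ih]; first by rewrite expr0.
rewrite exprSr ih /= uphalf_half; case: (odd n) => /=; apply/eqP; rewrite eq_complex /=; apply/andP; split; apply/eqP.
- by rewrite exprS; ring.
- by ring.
- by ring.
- by rewrite add0n; ring.
Qed.

Lemma cisT_cvg (x : R) : ctends (fun m => cisT m x) (cis x).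
Proof.
have cc := @is_cvg_series_cos_coeff R x; have cs := @is_cvg_series_sin_coeff R x.
have E m : cisT m x = series (cos_coeff x) m +i* series (sin_coeff x) m.
  rewrite /cisT /series /= !big_mkord; elim: m => [|m ih]; first by rewrite !big_ord0.
  rewrite !big_ord_recr /= ih exprMn imagX -rmorphXn /=.
  rewrite /cos_coeff /sin_coeff /= -?exprnP; case: (boolP (odd m)) => om /=.
    have -> : m.-1./2 = m./2 by case: m om {ih} => //= m; rewrite uphalf_half => /negbTE ->.
    by apply/eqP; rewrite eq_complex /=; apply/andP; split; apply/eqP; ring.
  by apply/eqP; rewrite eq_complex /=; apply/andP; split; apply/eqP; ring.
rewrite /cis !unlock; apply: ctends_ReIm.
  by under eq_fun do rewrite E.
by under eq_fun do rewrite E.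
Qed.

Lemma exp_sum_le (x : R) n : 0 <= x -> \sum_(i < n) x ^+ i * (i`!%:R)^-1 <= expR x.
Proof.
move=> x0; rewrite /expR -(big_mkord xpredT (fun i => x ^+ i * (i`!%:R)^-1)).
apply: (nondecreasing_cvgn_le _ (is_cvg_series_exp_coeff x) n).
apply/nondecreasing_seqP => m; rewrite /series /= big_nat_recr//= lerDl.
by rewrite /exp_coeff mulr_ge0 ?exprn_ge0// invr_ge0.
Qed.

(** The remainder is the sum of |x|^i / i! over i >= m, and |x|^i <= q^m (|x| / q)^i there because q
    <= 1. Exponential growth in x is traded for smallness in m. *)
Lemma cis_taylor (q x : R) m : 0 < q <= 1 ->
  cabs (cis x - cisT m x) <= q ^+ m * expR (`|x| / q).
Proof.
move=> /andP[q0 q1]; apply: (@ctends_cabs_le _ (fun n => cisT (m + n) x - cisT m x)); last first.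
  apply: ctendsB; last exact: ctends_cst.
  have := iffLR (@ctends_shift _ m _ _) (cisT_cvg x).
  by apply: ctends_ext => n; rewrite addnC.
move=> n; rewrite /cisT big_split_ord /= [X in cabs (X - _)]addrC addrK.
apply: le_trans (cabs_sum _ _ _) _.
apply: (@le_trans _ _ (q ^+ m * \sum_(i < m + n) (`|x| / q) ^+ i * (i`!%:R)^-1)); last first.
  by rewrite ler_wpM2l ?exprn_ge0 ?(ltW q0)// exp_sum_le// divr_ge0// ltW.
rewrite big_split_ord /= mulrDr; apply: ler_wpDl.
  rewrite mulr_ge0 ?exprn_ge0 ?(ltW q0)// sumr_ge0// => i _.
  by rewrite mulr_ge0 ?invr_ge0// exprn_ge0// divr_ge0// ltW.
rewrite mulr_sumr; apply: ler_sum => i _; rewrite !cabsM cabsX cabsM cabs_real.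
have -> : cabs ('i : R[i]) = 1.
  by apply/eqP; rewrite -(@eqrXn2 _ 2) ?cabs_ge0// sqr_cabs ReI ImI expr0n add0r.
rewrite mul1r cabs_real [`|_^-1|]ger0_norm ?invr_ge0// mulrA ler_wpM2r ?invr_ge0//.
rewrite expr_div_n exprD mulrA -[leLHS]mulr1.
rewrite (_ : q ^+ m * (`|x| ^+ m * `|x| ^+ i) / q ^+ (m + i) = `|x| ^+ m * `|x| ^+ i * (q ^+ i)^-1); last first.
  by rewrite exprD; field; rewrite !expf_neq0// gt_eqF.
by rewrite ler_wpM2l ?mulr_ge0 ?exprn_ge0// invf_ge1 ?exprn_gt0// exprn_ile1 ?(ltW q0).
Qed.

Lemma sin_taylor (q x : R) : 0 < q <= 1 -> `|sin x - x| <= q ^+ 2 * expR (`|x| / q).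
Proof.
move=> hq; apply: le_trans (cis_taylor x 2 hq).
have -> : sin x - x = complex.Im (cis x - cisT 2 x).
  rewrite /cisT !big_ord_recr big_ord0 /= ?invr1.
  by ring.
exact: Im_le_cabs.
Qed.

(** Taylor approximation with q = 1/2: the error grows as exp (2 |a x|), which fits into exp (|x| /
    16) because |a| <= 1/32. This is the origin of that constant. *)
Lemma logmult_cis phi (B a : R) : 0 <= B -> (forall x, cabs (phi x) <= B) -> logmult phi ->
  `|a| <= 1 / 32 -> logmult (fun x => cis (a * x) * phi x).
Proof.
move=> B0 phiB hphi a32; apply: (@logmult_lim _ B) => // [x|e e0].
  by rewrite cabsM cabs_cis mul1r.
have [m hm] : exists m, B * (1 / 2) ^+ m <= e.
  have B1 : 0 < B + 1 by rewrite ltr_wpDl.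
  have [m hm] := exists_inv_nat_lt (divr_gt0 e0 B1); exists m.
  have h2 : (1 / 2) ^+ m <= m.+1%:R^-1 :> R.
    by rewrite div1r exprVn lef_pV2 ?posrE ?exprn_gt0// -natrX ler_nat ltn_expl.
  apply: le_trans (ler_wpM2l B0 h2) _; rewrite -ler_pdivlMr ?invr_gt0// invrK.
  move: hm; rewrite ltr_pdivlMr// mulrC => hm.
  have m0 : 0 < m.+1%:R :> R by [].
  have : (B + 1) < e * m.+1%:R by rewrite -ltr_pdivrMr.
  lra.
exists (fun x => cisT m (a * x) * phi x); last first.
  move=> x; rewrite -mulrBl cabsM; have h12 : 0 < (1 / 2 : R) <= 1 by apply/andP; split; lra.
  apply: le_trans (ler_pM (cabs_ge0 _) (cabs_ge0 _) (cis_taylor (a * x) m h12) (phiB x)) _.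
  rewrite mulrAC; apply: ler_pM; rewrite ?expR_ge0 ?mulr_ge0 ?exprn_ge0//; first by rewrite mulrC.
  rewrite ler_expR normrM; have := normr_ge0 x; have := ler_wpM2r (normr_ge0 x) a32.
  by move: (`|a| * `|x|) => y; lra.
apply: (@logmult_ext (fun x => \sum_(i < m) (('i * a%:C) ^+ i * ((i`!%:R : R)^-1)%:C) * ((x ^+ i)%:C * phi x))).
  move=> x; rewrite /cisT mulr_suml; apply: eq_bigr => i _.
  have -> : ('i * (a * x)%:C) ^+ i = ('i * a%:C) ^+ i * (x ^+ i)%:C :> R[i].
    by rewrite rmorphM mulrA exprMn rmorphXn.
  by rewrite -!mulrA; congr (_ * _); rewrite mulrCA.
apply: (@logmult_sum m (fun i x => (('i * a%:C) ^+ i * ((i`!%:R : R)^-1)%:C) * ((x ^+ i)%:C * phi x))) => i.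
by apply: logmultZ; exact: logmult_pow.
Qed.

(** Boundedness is carried along because the Taylor error of [cis] uses up the whole allowance exp
    (|x| / 16), leaving no room for growth of the other factor. *)
Definition bounded_mult phi := logmult phi /\ exists2 B : R, 0 <= B & forall x, cabs (phi x) <= B.

Lemma bounded_multD phi psi : bounded_mult phi -> bounded_mult psi ->
  bounded_mult (fun x => phi x + psi x).
Proof.
move=> [h1 [B B0 hB]] [h2 [D D0 hD]]; split; first exact: logmultD.
by exists (B + D) => [|x]; [exact: addr_ge0|apply: le_trans (cabsD _ _) _; exact: lerD].
Qed.

Lemma bounded_multZ z phi : bounded_mult phi -> bounded_mult (fun x => z * phi x).
Proof.
move=> [h1 [B B0 hB]]; split; first exact: logmultZ.
by exists (cabs z * B) => [|x]; rewrite ?cabsM ?mulr_ge0 ?cabs_ge0// ler_wpM2l ?cabs_ge0.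
Qed.

Lemma bounded_mult_cis a phi : `|a| <= 1 / 32 -> bounded_mult phi ->
  bounded_mult (fun x => cis (a * x) * phi x).
Proof.
move=> a32 [h1 [B B0 hB]]; split; first exact: (logmult_cis B0 hB h1).
by exists B => // x; rewrite cabsM cabs_cis mul1r.
Qed.

Lemma bounded_mult_ext phi psi : (forall x, phi x = psi x) -> bounded_mult phi -> bounded_mult psi.
Proof. by move=> /funext ->. Qed.

Lemma bounded_mult_sin a phi : `|a| <= 1 / 32 -> bounded_mult phi ->
  bounded_mult (fun x => (sin (a * x))%:C * phi x).
Proof.
move=> a32 h; have aN : `|- a| <= 1 / 32 by rewrite normrN.
have := bounded_multZ (- 'i / 2) (bounded_multD (bounded_mult_cis a32 h) (bounded_multZ (-1) (bounded_mult_cis aN h))).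
apply: bounded_mult_ext => x; rewrite [- a * x]mulNr /cis cosN sinN mulN1r -mulrBl mulrA; congr (_ * _).
have n2 : (2 : R[i]) != 0 by rewrite pnatr_eq0.
apply: (mulfI n2); rewrite mulrA [2 * _]mulrC divfK//.
by apply/eqP; rewrite eq_complex /=; apply/andP; split; apply/eqP; ring.
Qed.

(* The Bernstein operator [\sum_k f k * 'C(n, k) v^k (1 - v)^(n - k)], in the
   form of de Casteljau's recursion. *)
Fixpoint bernstein n (f : nat -> R) (v : R) : R :=
  if n is n'.+1 then v * bernstein n' (fun k => f k.+1) v + (1 - v) * bernstein n' f v else f 0%N.

Lemma bernstein_dist n (f : nat -> R) (v z d p q : R) : 0 <= v <= 1 ->
  (forall k : nat, `|f k - z| <= p + q * (k%:R - d) ^+ 2) ->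
  `|bernstein n f v - z| <= p + q * (n%:R * v * (1 - v) + (n%:R * v - d) ^+ 2).
Proof.
move=> /andP[v0 v1]; elim: n f d => [|n ih] f d hf.
  by rewrite /= !mul0r add0r; exact: hf.
have h1 := ih f d hf.
have h2 : `|bernstein n (fun k => f k.+1) v - z| <= p + q * (n%:R * v * (1 - v) + (n%:R * v - (d - 1)) ^+ 2).
  apply: ih => k; apply: le_trans (hf k.+1) _; rewrite -natr1 le_eqVlt; apply/orP; left; apply/eqP.
  by ring.
rewrite /= (_ : _ - z = v * (bernstein n (fun k => f k.+1) v - z) + (1 - v) * (bernstein n f v - z)); last by ring.
apply: le_trans (ler_normD _ _) _; rewrite !normrM (ger0_norm v0) (@ger0_norm _ (1 - v)) ?subr_ge0//.
have h3 := ler_wpM2l v0 h2; have h4 : 0 <= 1 - v by rewrite subr_ge0.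
apply: le_trans (lerD h3 (ler_wpM2l h4 h1)) _.
rewrite -natr1 le_eqVlt; apply/orP; left; apply/eqP; ring.
Qed.

(** The recursive form uses only multiplications by v and 1 - v, both affine in sin (a x), so the
    closure properties of [bounded_mult] suffice. *)
Lemma bounded_mult_bernstein a n f : `|a| <= 1 / 32 ->
  bounded_mult (fun x => (bernstein n f ((1 + sin (a * x)) / 2))%:C).
Proof.
move=> a32; elim: n f => [|n ih] f.
  split; first exact: (logmult_cst (f 0%N)%:C).
  by exists (cabs (f 0%N)%:C) => // ; exact: cabs_ge0.
have h1 := ih (fun k => f k.+1); have h2 := ih f.
have key (y z u : R) : (2^-1)%:C * (u%:C * y%:C) + 2^-1 * y%:C + ((- 2^-1)%:C * (u%:C * z%:C) + 2^-1 * z%:C) =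
      ((1 + u) / 2 * y + (1 - (1 + u) / 2) * z)%:C.
    rewrite -(rmorph_nat (real_complex R)) -fmorphV -!rmorphM -!rmorphD /=; congr (_%:C).
    by field.
  have half z phi : bounded_mult phi ->
    bounded_mult (fun x => z%:C * ((sin (a * x))%:C * phi x) + 2^-1 * phi x).
  by move=> h; apply: bounded_multD; apply: bounded_multZ => //; exact: bounded_mult_sin.
have := bounded_multD (half (2^-1) _ h1) (half (- 2^-1) _ h2).
apply: bounded_mult_ext => x; rewrite [bernstein n.+1 _ _]/=.
  exact: key.
Qed.

Lemma amgm_div (y z d : R) : 0 < d -> 0 <= z - y * (2 * d) *+ 2 + (2 * d) ^+ 2 -> y <= d + z / (4 * d).
Proof.
move=> d0 h; have -> : d + z / (4 * d) = (4 * (d * d) + z) / (4 * d) by field; rewrite gt_eqF.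
rewrite ler_pdivlMr ?mulr_gt0// (_ : y * (4 * d) = 4 * (y * d)); last by ring.
by rewrite (_ : _ + _ = z - 4 * (y * d) + 4 * (d * d)) in h; [lra|ring].
Qed.

(** sin (a x) stays in [-1, 1], where Bernstein polynomials approximate [psi] uniformly. The
    Lipschitz bound is first weakened through y <= d + y^2 / (4 d) to the quadratic form that
    [bernstein_dist] accepts. *)
Lemma logmult_lipschitz_sin (psi : R -> R) (a K B : R) : `|a| <= 1 / 32 -> 0 <= K -> 0 <= B ->
  (forall x, `|psi x| <= B) -> (forall x y, `|psi x - psi y| <= K * `|x - y|) ->
  logmult (fun x => (psi (sin (a * x)))%:C).
Proof.
move=> a32 K0 B0 psiB psiK; apply: (@logmult_lim _ B) => // [x|e e0].
  by rewrite cabs_real psiB.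
(* The constant term of the majorant costs 2 K d, and its variance term at most K d once 1 / N <
   d^2. *)
pose d := e / (4 * (K + 1)); have d0 : 0 < d by rewrite divr_gt0// mulr_gt0// ltr_wpDl.
have [n nd] := exists_inv_nat_lt (exprn_gt0 2 d0).
pose N := n.+1; pose f k := psi (2 * (k%:R / N%:R) - 1).
exists (fun x => (bernstein N f ((1 + sin (a * x)) / 2))%:C).
  by have [] := bounded_mult_bernstein N f a32.
move=> x; rewrite -rmorphB cabs_real; set u := sin _; set v := (1 + u) / 2.
have uv : u = 2 * v - 1 by rewrite /v; field.
have v01 : 0 <= v <= 1.
  have := sin_geN1 (a * x); have := sin_le1 (a * x); rewrite -/u /v => h1 h2; apply/andP; split; lra.
have N0 : 0 < N%:R :> R by [].
have hf k : `|f k - psi u| <= 2 * K * d + (2 * K / (4 * d * N%:R ^+ 2)) * (k%:R - N%:R * v) ^+ 2.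
  apply: le_trans (psiK _ _) _; rewrite uv.
  have -> : 2 * (k%:R / N%:R) - 1 - (2 * v - 1) = 2 * ((k%:R - N%:R * v) / N%:R).
    by field; rewrite gt_eqF.
  set w := (k%:R - N%:R * v).
  have -> : 2 * K * d + 2 * K / (4 * d * N%:R ^+ 2) * w ^+ 2 = K * (2 * (d + (w / N%:R) ^+ 2 / (4 * d))).
    by field; rewrite !gt_eqF.
  rewrite ler_wpM2l// normrM (@ger0_norm _ 2)// ler_wpM2l//.
  have := sqr_ge0 (`|w / N%:R| - 2 * d); rewrite sqrrB real_normK ?num_real//.
  move: (`|w / N%:R| : R) ((w / N%:R) ^+ 2 : R) => y z h.
  exact: amgm_div.
have := bernstein_dist N v01 hf; rewrite distrC subrr expr0n addr0 => /le_trans; apply.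
apply: (@le_trans _ _ e); last by rewrite ler_peMr ?(ltW e0)// -[leLHS]expR0 ler_expR divr_ge0.
have v4 : v * (1 - v) <= 1 by nra.
have vv0 : 0 <= v * (1 - v) by nra.
rewrite (_ : 2 * K / (4 * d * N%:R ^+ 2) * (N%:R * v * (1 - v)) = K * (v * (1 - v) * (N%:R^-1 / d) / 2)); last first.
  by field; rewrite !gt_eqF.
have nd1 : N%:R^-1 / d <= d by rewrite ler_pdivrMr// -expr2 ltW.
have nd0 : 0 <= N%:R^-1 / d :> R by rewrite divr_ge0 ?invr_ge0// ltW.
have : v * (1 - v) * (N%:R^-1 / d) <= d by apply: le_trans nd1; rewrite ler_piMl.
move=> h; have : K * (v * (1 - v) * (N%:R^-1 / d) / 2) <= K * d by rewrite ler_wpM2l//; lra.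
have E : e = 4 * (K * d) + 4 * d by rewrite /d; field; rewrite gt_eqF// ltr_wpDl.
have : 0 <= K * d by rewrite mulr_ge0// ltW.
rewrite (_ : 2 * K * d = 2 * (K * d)); last by ring.
by move: (K * d) E (K * (_ * _ / 2)) => y E z; lra.
Qed.

(** [psi x] is replaced by [psi (sin (a x) / a)]. For large x the arguments are far apart, but
    [sin_taylor] with q = 32 a bounds the change by 32^2 K a exp (|x| / 32), which is small in the
    weight as a tends to 0. *)
Lemma logmult_lipschitz (psi : R -> R) (K B : R) : 0 <= K -> 0 <= B ->
  (forall x, `|psi x| <= B) -> (forall x y, `|psi x - psi y| <= K * `|x - y|) ->
  logmult (fun x => (psi x)%:C).
Proof.
move=> K0 B0 psiB psiK; apply: (@logmult_lim _ B) => // [x|e e0].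
  by rewrite cabs_real psiB.
pose a := Num.min (1 / 32) (e / (32 ^+ 2 * (K + 1))).
have k1 : 0 < 32 ^+ 2 * (K + 1) by apply: mulr_gt0; [exact: exprn_gt0|exact: ltr_wpDl].
have a0 : 0 < a by rewrite lt_min; apply/andP; split; rewrite divr_gt0.
have a32 : a <= 1 / 32 by rewrite ge_min lexx.
have ae : a * (32 ^+ 2 * (K + 1)) <= e by rewrite -ler_pdivlMr// ge_min lexx orbT.
exists (fun x => (psi (sin (a * x) / a))%:C).
  apply: (@logmult_lipschitz_sin (fun u => psi (u / a)) a (K / a) B) => //.
  - by rewrite ger0_norm// ltW.
  - by rewrite divr_ge0// ltW.
  - move=> x y; apply: le_trans (psiK _ _) _.
    by rewrite -mulrBl normrM (@ger0_norm _ a^-1) ?invr_ge0 ?(ltW a0)// mulrCA [leRHS]mulrC.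
move=> x; rewrite -rmorphB cabs_real; apply: le_trans (psiK _ _) _.
have q1 : 0 < 32 * a <= 1 by apply/andP; split; lra.
have := sin_taylor (a * x) q1.
have -> : `|a * x| / (32 * a) = `|x| / 32.
  by rewrite normrM ger0_norm ?(ltW a0)//; field; rewrite gt_eqF.
have -> : `|x - sin (a * x) / a| = `|sin (a * x) - a * x| / a.
  rewrite distrC -[X in _ = _ * X](@ger0_norm _ a^-1) ?invr_ge0 ?(ltW a0)// -normrM; congr `|_|.
  by field; rewrite gt_eqF.
have E : expR (`|x| / 32) <= expR (`|x| / 16) by rewrite ler_expR; have := normr_ge0 x; lra.
move=> h; apply: (@le_trans _ _ (K * ((32 * a) ^+ 2 * expR (`|x| / 16) / a))).
  rewrite ler_wpM2l// ler_wpM2r ?invr_ge0 ?(ltW a0)//; apply: le_trans h _.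
  by rewrite ler_wpM2l ?sqr_ge0.
rewrite (_ : K * _ = (a * (32 ^+ 2 * K)) * expR (`|x| / 16)); last by field; rewrite gt_eqF.
rewrite ler_wpM2r ?expR_ge0//; apply: le_trans ae; rewrite ler_wpM2l ?(ltW a0)// ler_wpM2l//.
by rewrite lerDl.
Qed.

End SchurKernel.

(** * Approximation of the Cesaro matrix by Lipschitz multipliers *)

Section CesaroInToeplitz.
Variable R : realType.
Local Notation H := (H2 R).
Local Notation t := (dln R).

Lemma max_dist (a x y : R) : `|Num.max x a - Num.max y a| <= `|x - y|.
Proof.
wlog xy : x y / x <= y => [hw|].
  have [/hw//|/ltW h] := leP x y; by rewrite distrC [`|x - y|]distrC; exact: hw.
rewrite [leLHS]distrC [leRHS]distrC !ger0_norm ?subr_ge0//; last first.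
  by rewrite ge_max !le_max xy lexx !orbT.
have [xa|ax] := leP x a; have [ya|ay] := leP y a; lra.
Qed.

Lemma expRN_dist (x y : R) : 0 <= x -> 0 <= y -> `|expR (- x) - expR (- y)| <= `|x - y|.
Proof.
wlog xy : x y / x <= y => [hw|x0 y0].
  have [/hw//|/ltW h x0 y0] := leP x y; by rewrite distrC [`|x - y|]distrC; exact: hw.
rewrite [leRHS]distrC !ger0_norm ?subr_ge0//; last by rewrite ler_expR lerN2.
have -> : - y = - x + - (y - x) by ring.
rewrite expRD; have e1 : expR (- x) <= 1 by rewrite -[leRHS]expR0 ler_expR oppr_le0.
have e0 := expR_gt0 (- x); have h := expR_ge1Dx (- (y - x)).
have yx : 0 <= y - x by rewrite subr_ge0.
move: (expR (- x)) (expR (- (y - x))) (y - x) e1 e0 h yx => p q d; nra.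
Qed.

(** A Lipschitz replacement for the jump of mu at 0: it equals mu for x >= eta and vanishes for x <=
    0. *)
Definition mu_trunc (eta x : R) : R := (1 - expR (- Num.max x 0)) / Num.max x eta.

Lemma mu_trunc_logmult (eta : R) : 0 < eta <= 1 -> logmult (fun x => (mu_trunc eta x)%:C).
Proof.
move=> /andP[e0 e1]; have mx x : eta <= Num.max x eta by rewrite le_max lexx orbT.
have m0 x : 0 < Num.max x eta by exact: lt_le_trans (mx x).
have x0 (x : R) : 0 <= Num.max x 0 by rewrite le_max lexx orbT.
have n1 (x : R) : 0 <= 1 - expR (- Num.max x 0) <= 1.
  rewrite subr_ge0 lerBlDr lerDl expR_ge0 andbT -[leRHS]expR0 ler_expR oppr_le0//.
have ei x : (Num.max x eta)^-1 <= eta^-1 by rewrite lef_pV2 ?posrE.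
apply: (@logmult_lipschitz _ _ (eta^-1 + eta^-1 ^+ 2) eta^-1).
- by rewrite addr_ge0 ?exprn_ge0 ?invr_ge0 ?(ltW e0).
- by rewrite invr_ge0 ltW.
- move=> x; have /andP[h1 h2] := n1 x; rewrite ger0_norm; last by rewrite divr_ge0 ?(ltW (m0 x)).
  by rewrite /mu_trunc -[leRHS]mul1r; apply: ler_pM => //; rewrite invr_ge0 ltW.
move=> x y; rewrite /mu_trunc; have /andP[h1 h2] := n1 y.
have d1 := expRN_dist (x0 y) (x0 x); have d2 := max_dist 0 y x; have d3 := max_dist eta y x.
set p := expR (- Num.max x 0) in d1 *; set q := expR (- Num.max y 0) in h1 h2 d1 *.
have -> : (1 - p) / Num.max x eta - (1 - q) / Num.max y eta =
    (q - p) * (Num.max x eta)^-1 + (1 - q) * ((Num.max y eta - Num.max x eta) * ((Num.max x eta)^-1 * (Num.max y eta)^-1)).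
  by have := m0 x; have := m0 y; move: (Num.max x eta) (Num.max y eta) => a b b0 a0; field; rewrite !gt_eqF.
apply: le_trans (ler_normD _ _) _; rewrite [X in _ <= X]mulrDl !normrM; apply: lerD.
  rewrite mulrC; apply: ler_pM => //; first by rewrite ger0_norm ?invr_ge0 ?(ltW (m0 x)).
  by rewrite [leRHS]distrC; apply: le_trans d1 d2.
rewrite (ger0_norm h1) (@ger0_norm _ (Num.max x eta)^-1) ?invr_ge0 ?(ltW (m0 x))//.
rewrite (@ger0_norm _ (Num.max y eta)^-1) ?invr_ge0 ?(ltW (m0 y))// [leRHS]mulrC -[leRHS]mul1r.
apply: ler_pM => //; first by rewrite !mulr_ge0 ?invr_ge0 ?(ltW (m0 _)).
apply: ler_pM => //; first by rewrite mulr_ge0 ?invr_ge0 ?(ltW (m0 _)).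
  by rewrite [leRHS]distrC.
by rewrite expr2; apply: ler_pM; rewrite ?invr_ge0 ?(ltW (m0 _)).
Qed.

(** For j > k, 1 - exp (- t) = (j - k) / (j + 1), so the denominator of [logmx] cancels and leaves 1
    / (j + 1) times the truncation factor. *)
Lemma mu_trunc_logmx (eta : R) j k : 0 < eta ->
  (mu_trunc eta (t j k))%:C * logmx R j k =
  if (k < j)%N then ((j.+1%:R)^-1 * (t j k / Num.max (t j k) eta))%:C else 0.
Proof.
move=> e0; rewrite /logmx; case: ltngtP => [jk|kj|->].
- rewrite /mu_trunc max_l; last by rewrite subr_ge0 lnS_le// ltnW.
  have E : 1 - expR (- t j k) = (j%:R - k%:R) / j.+1%:R.
    rewrite /dln opprB expRD expRN !expR_lnS.
    have J : j.+1%:R = j%:R + 1 :> R by rewrite natr1.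
    have K : k.+1%:R = k%:R + 1 :> R by rewrite natr1.
    by rewrite K J; field; rewrite -J pnatr_eq0.
  rewrite E; have d0 : j%:R - k%:R != 0 :> R[i] by rewrite subr_eq0 eqr_nat gt_eqF.
  have -> : (j%:R - k%:R : R[i]) = (j%:R - k%:R : R)%:C by rewrite rmorphB !rmorph_nat.
  rewrite -fmorphV -!rmorphM; congr (_%:C).
  have m0 : 0 < Num.max (t j k) eta by rewrite lt_max e0 orbT.
  have d1 : j%:R - k%:R != 0 :> R by rewrite subr_eq0 eqr_nat gt_eqF.
  have J0 : j.+1%:R != 0 :> R by rewrite pnatr_eq0.
  have key (m x d y : R) : m != 0 -> x != 0 -> d != 0 -> d / x / m * (y / d) = x^-1 * (y / m).
    by move=> m1 x1 d2; field; rewrite m1 x1 d2.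
  by apply: key => //; rewrite gt_eqF.
- rewrite /mu_trunc max_r; last by rewrite subr_le0 lnS_le// ltnW.
  by rewrite oppr0 expR0 subrr mul0r rmorph0 mul0r.
- by rewrite mulr0.
Qed.

Lemma count_le (r : R) n : 0 <= r -> \sum_(i < n) (i.+1%:R < r)%R%:R <= r.
Proof.
move=> r0; suff h : \sum_(i < n) (i.+1%:R < r)%R%:R <= Num.min r n%:R.
  by apply: le_trans h _; rewrite ge_min lexx.
elim: n => [|n ih]; first by rewrite big_ord0 le_min r0 lexx.
rewrite big_ord_recr /=; move: ih; rewrite !le_min => /andP[h1 h2]; case: ltP => nr.
  rewrite -natr1 lerD2r h2 andbT; apply: le_trans (ltW nr); rewrite -natr1 lerD2r; exact: h2.
by rewrite addr0 h1 /= (le_trans h2)// ler_nat.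
Qed.

Lemma cesaro_in_toeplitz (C : H -> H) : is_cesaro C -> toeplitz_algebra C.
Proof.
move=> [bC CE]; apply: TT_lim => // e e0.
(* eta <= 1/2 turns j - k < eta (j + 1) into j - k < 2 eta (k + 1), which the column sums need; the
   Schur bound is then 2 eta <= e. *)
pose eta := Num.min (1 / 2) (e / 2).
have eta0 : 0 < eta by rewrite lt_min; apply/andP; split; rewrite divr_gt0.
have eta2 : eta <= 1 / 2 by rewrite ge_min lexx.
have etae0 : eta <= e / 2 by rewrite ge_min lexx orbT.
have etae : 2 * eta <= e by lra.
have hm : inT (fun j k => (mu_trunc eta (t j k))%:C * logmx R j k).
  have eta1 : 0 < eta <= 1 by rewrite eta0 /=; lra.
  by apply: inT_ext (mu_trunc_logmult eta1 0) => j k; rewrite expr0 mul1r.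
have hd : inT (fun j k => if j == k then ((j.+1%:R : R)^-1)%:C else 0).
  apply: (@inT_diag R (fun j => ((j.+1%:R : R)^-1)%:C)) => d /exists_inv_nat_lt[N hN].
  exists N => n Nn; rewrite subr0 cabs_real ger0_norm ?invr_ge0//; apply: le_lt_trans hN.
  by rewrite lef_pV2 ?posrE// ler_nat.
have [B hB BE] := inTD hm hd; exists B => //.
(* The error lives where 0 < t < eta. As (j - k) / (j + 1) = 1 - exp (- t) <= t, this forces j - k <
   eta (j + 1), so a row has at most eta (j + 1) entries of size at most 1 / (j + 1). *)
pose E j k : R[i] := if (k < j)%N then ((j.+1%:R)^-1 * (1 - t j k / Num.max (t j k) eta))%:C else 0.
have Ele j k : (k < j)%N -> cabs (E j k) <= (j.+1%:R)^-1 * ((j - k)%N%:R < eta * j.+1%:R)%R%:R.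
  move=> kj; rewrite /E kj cabs_real normrM (@ger0_norm _ (j.+1%:R)^-1) ?invr_ge0//.
  rewrite ler_wpM2l ?invr_ge0//; have t0 : 0 <= t j k by rewrite subr_ge0 lnS_le// ltnW.
  have [et|te] := leP eta (t j k).
    rewrite divff; last by rewrite gt_eqF// (lt_le_trans eta0).
    by rewrite subrr normr0 ler0n.
  have -> : ((j - k)%N%:R < eta * j.+1%:R :> R).
    have h := expR_ge1Dx (- t j k); rewrite /dln opprB expRD expRN !expR_lnS in h.
    have j0 : 0 < j.+1%:R :> R by [].
    rewrite ler_pdivlMr// in h; rewrite natrB 1?ltnW//.
    apply: (@le_lt_trans _ _ (t j k * j.+1%:R)); last by rewrite ltr_pM2r.
    by move: h; rewrite /dln -[k.+1%:R]natr1 -[X in _ - X <= _]addr0 -[j.+1%:R]natr1; lra.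
  rewrite ger0_norm; first by rewrite lerBlDr lerDl divr_ge0// ltW.
  by rewrite subr_ge0 ler_pdivrMr// mul1r ltW.
have E0 j k : ~~ (k < j)%N -> cabs (E j k) = 0 by rewrite /E => /negbTE ->; rewrite cabs0.
have row j n : \sum_(k < n) cabs (E j k) * 1 <= 2 * eta * 1.
  rewrite mulr1; apply: (@le_trans _ _ eta); last by lra.
  apply: (@le_trans _ _ (\sum_(k < j) cabs (E j k))).
    under eq_bigr do rewrite mulr1.
    have [nj|jn] := leqP n j.
      rewrite (big_ord_widen _ (fun k => cabs (E j k)) nj) big_mkcond; apply: ler_sum => k _.
      by case: ifP => _ //; exact: cabs_ge0.
    rewrite [leRHS](big_ord_widen _ (fun k => cabs (E j k)) (ltnW jn)) [leRHS]big_mkcond.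
    by apply: ler_sum => k _; case: ifPn => // /E0 ->.
  apply: (@le_trans _ _ (\sum_(k < j) (j.+1%:R)^-1 * ((j - k)%N%:R < eta * j.+1%:R)%R%:R)).
    by apply: ler_sum => k _; exact: Ele.
  rewrite -mulr_sumr ler_pdivrMl// mulrC.
  rewrite (reindex_inj rev_ord_inj) /=.
  apply: le_trans (count_le j _); last by rewrite mulr_ge0// ltW.
  rewrite le_eqVlt; apply/orP; left; apply/eqP; apply: eq_bigr => i _.
  by rewrite subKn.
have col k m : \sum_(j < m) cabs (E j k) * 1 <= 2 * eta * 1.
  rewrite mulr1; under eq_bigr do rewrite mulr1.
  have k0 : 0 < k.+1%:R :> R by [].
  apply: (@le_trans _ _ (\sum_(0 <= j < maxn m k.+1) cabs (E j k))).
    rewrite big_mkord (big_ord_widen _ (fun j => cabs (E j k)) (leq_maxl m k.+1)) big_mkcond.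
    by apply: ler_sum => j _; case: ifP => _ //; exact: cabs_ge0.
  rewrite (@big_cat_nat _ _ _ k.+1)//= ?leq_maxr// big_nat_cond big1 ?add0r; last first.
    by move=> j /andP[/andP[_ jk] _]; rewrite E0// -leqNgt -ltnS.
  rewrite -{1}[k.+1]add0n big_addn big_mkord.
  apply: (@le_trans _ _ (\sum_(i < maxn m k.+1 - k.+1) (k.+1%:R)^-1 * (i.+1%:R < 2 * eta * k.+1%:R)%R%:R)).
    apply: ler_sum => i _; apply: le_trans (Ele _ _ _) _; first by rewrite addnS ltnS leq_addl.
    apply: ler_pM; rewrite ?invr_ge0//; first by rewrite lef_pV2 ?posrE// ler_nat; lia.
    rewrite ler_nat; have -> : (i + k.+1 - k)%N = i.+1 by lia.
    case: (ltP i.+1%:R (eta * _)) => // h; rewrite (_ : (_ < _ = true)%R)//.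
    move: h; have -> : (i + k.+1).+1%:R = i.+1%:R + k.+1%:R :> R by rewrite -natrD; congr (_%:R); lia.
    have i0 : 0 <= i.+1%:R :> R by [].
    move: (i.+1%:R : R) (k.+1%:R : R) i0 => x y x0 h; apply/idP; nra.
  rewrite -mulr_sumr ler_pdivrMl// mulrC; apply: count_le.
  by rewrite !mulr_ge0// ltW.
have [||||D [bD De DE]] := @schur_test R E (fun=> 1) (2 * eta).
- by rewrite mulr_ge0// ltW.
- by [].
- exact: row.
- exact: col.
have bCB : bounded_op (fun f => C f - B f) by apply: bounded_opB => //; exact: TT_bounded.
suff -> : (fun f => C f - B f) = D.
  by move=> f; apply: le_trans (De f) _; rewrite ler_wpM2r ?h2norm_ge0.
apply: op_ext => // k; apply: h2_ext => j; rewrite h2coefB CE BE DE mu_trunc_logmx// /E.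
case: ltngtP => [jk|kj|_]; rewrite ?addr0 ?add0r ?subrr ?oppr0//.
by rewrite -rmorphB mulrBr mulr1.
Qed.

End CesaroInToeplitz.

(** * The commutator ideal *)

Section VanishingIntegral.
Variable R : realType.
Local Notation mu := (@lebesgue_measure R).

Lemma Rintegral_le_length (f : R -> R) (a b M : R) : a < b ->
  mu.-integrable `[a, b] (EFin \o f) -> (forall x, a <= x <= b -> `|f x| <= M) ->
  `|\int[mu]_(x in `[a, b]) f x| <= M * (b - a).
Proof.
move=> ab fi fM; have cM : {in `[a, b], continuous (fun=> M : R)} by move=> x _; exact: cst_continuous.
have dM x : x \in `[a, b] -> is_derive x 1 (fun y => M * y) M.
  by move=> _; have := derZ M (is_derive_id x 1); rewrite mulr1.
apply: le_trans (le_normr_Rintegral _ fi) _; first exact: measurable_itv.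
rewrite mulrBr -(Rintegral_FTC ab dM cM); apply: le_Rintegral => //.
- exact: (integrable_norm fi).
- exact: integrable_itv_continuous.
Qed.

(** The primitive is controlled at the ends only through its smallness nearby, as needed for
    [powsym], which oscillates there. The fundamental theorem is used on [a + h, b - h], and the end
    pieces cost at most 2 M h. *)
Lemma Rintegral_eq0 (f F : R -> R) (a b M : R) : a < b ->
  mu.-integrable `[a, b] (EFin \o f) -> (forall x, a <= x <= b -> `|f x| <= M) ->
  (forall x, a < x < b -> is_derive x 1 F (f x)) -> (forall x, a < x < b -> {for x, continuous f}) ->
  (forall e : R, 0 < e -> exists2 d : R, 0 < d &
     forall x, a < x < b -> x < a + d \/ b - d < x -> `|F x| <= e) ->
  \int[mu]_(x in `[a, b]) f x = 0.
Proof.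
move=> ab fi fM dF cf F0.
have M0 : 0 <= M by apply: le_trans (fM a _); rewrite ?lexx ?(ltW ab).
suff h e : 0 < e -> `|\int[mu]_(x in `[a, b]) f x| <= e.
  apply/eqP; rewrite -normr_eq0 eq_le normr_ge0 andbT; apply/ler_addgt0Pr => e e0.
  by rewrite add0r h.
move=> e0; have e40 : 0 < e / 4 by rewrite divr_gt0.
have [d d0 Fd] := F0 _ e40; have M1 : 0 < M + 1 by rewrite ltr_wpDl.
pose h := Num.min (d / 2) (Num.min ((b - a) / 4) (e / 4 / (M + 1))).
have h0 : 0 < h by rewrite !lt_min !divr_gt0 ?subr_gt0.
have hd : h < d.
  by apply: le_lt_trans (_ : _ <= d / 2) _; rewrite ?ge_min ?lexx// ltr_pdivrMr// ltr_pMr// ltr1n.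
have hab : h <= (b - a) / 4 by rewrite !ge_min lexx orbT.
have hM : M * h <= e / 4.
  apply: (@le_trans _ _ ((M + 1) * h)); first by rewrite ler_wpM2r ?(ltW h0)// lerDl.
  by rewrite mulrC -ler_pdivlMr// !ge_min lexx !orbT.
have ax : a < a + h by rewrite ltrDl.
have xy : a + h < b - h by lra.
have yb : b - h < b by rewrite gtrBl.
have sub (u v : R) : a <= u -> v <= b -> mu.-integrable `[u, v] (EFin \o f).
  move=> au vb; apply: integrableS fi; [exact: measurable_itv|exact: measurable_itv|].
  by move=> x; rewrite /= !in_itv /= => /andP[ux xv]; rewrite (le_trans au ux) (le_trans xv vb).
have fMs (u v : R) : a <= u -> v <= b -> forall x, u <= x <= v -> `|f x| <= M.
  by move=> au vb x /andP[ux xv]; apply: fM; rewrite (le_trans au ux) (le_trans xv vb).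
have half (u v w : R) : a <= u -> u < v -> v < w -> w <= b ->
    \int[mu]_(x in `[u, w]) f x = \int[mu]_(x in `[u, v]) f x + \int[mu]_(x in `[v, w]) f x.
  move=> au uv vw wb; have iw := sub u w au wb.
  have := @Rintegral_itvB R f (BLeft u) (BRight w) v iw; rewrite !bnd_simp => /(_ (ltW uv) (ltW vw)) E.
  rewrite -[LHS](subrK (\int[mu]_(x in `[u, v]) f x)) E addrC; congr (_ + _).
  rewrite Rintegral_itv_obnd_cbnd//; apply: integrableS iw; [exact: measurable_itv|exact: measurable_itv|].
  by move=> x; rewrite /= !in_itv /= => /andP[vx ->]; rewrite (ltW (lt_trans uv vx)).
rewrite (half a (a + h) b)// ?lexx//; last exact: lt_trans xy yb.
rewrite (half (a + h) (b - h) b)// ?(ltW ax)//.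
have -> : \int[mu]_(x in `[a + h, b - h]) f x = F (b - h) - F (a + h).
  have inner x : x \in `[a + h, b - h] -> a < x < b.
    by rewrite in_itv /= => /andP[x1 x2]; rewrite (lt_le_trans ax x1) (le_lt_trans x2 yb).
  by apply: Rintegral_FTC => // x /inner; [exact: dF|exact: cf].
have i1 := Rintegral_le_length ax (sub _ _ (lexx a) (ltW (lt_trans xy yb))) (fMs _ _ (lexx a) (ltW (lt_trans xy yb))).
have i2 := Rintegral_le_length yb (sub _ _ (ltW (lt_trans ax xy)) (lexx b)) (fMs _ _ (ltW (lt_trans ax xy)) (lexx b)).
have f1 : `|F (a + h)| <= e / 4.
  by apply: Fd; [rewrite ax (lt_trans xy yb)|left; rewrite ltrD2l].
have f2 : `|F (b - h)| <= e / 4.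
  by apply: Fd; [rewrite yb (lt_trans ax xy)|right; rewrite ltrD2l ltrN2].
rewrite (_ : a + h - a = h) in i1; last by ring.
rewrite (_ : b - (b - h) = h) in i2; last by ring.
move: i1 i2 f1 f2; rewrite !ler_norml => /andP[? ?] /andP[? ?] /andP[? ?] /andP[? ?].
by apply/andP; split; lra.
Qed.

End VanishingIntegral.

(** * Fourier coefficients of the symbol (1 - z)^(i s) *)

Section PowerSymbol.
Variable R : realType.
Variable s : R.
Hypothesis s_small : `|s| <= 1 / 256.
Local Notation circle := (@circle R).
Local Notation mu := (@lebesgue_measure R).

(* The boundary values of [(1 - z)^(i s)] at [z = cis t], as [1 - z] has modulus
   [2 sin (t / 2)] and argument [(t - pi) / 2]. *)
Definition powsym (t : R) : R[i] :=
  (expR (s * (pi - t) / 2))%:C * cis (s * ln (2 * sin (t / 2))).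

Let pi2 : 0 < 2 * pi :> R. Proof. by rewrite mulr_gt0// pi_gt0. Qed.

Let sin_half_der (t : R) : is_derive t 1 (fun y => sin (y / 2)) (cos (t / 2) * 2^-1).
Proof.
have dh : is_derive t 1 (fun y => y / 2) (2^-1 : R).
  have := derZ (2^-1) (is_derive_id t 1); rewrite mulr1.
  by rewrite (_ : (fun y => _ * y) = fun y => y / 2)//; apply/funext => y; rewrite mulrC.
exact: (@der_comp R sin (fun y => y / 2) t _ _ (is_derive_sin (t / 2)) dh).
Qed.

Lemma powsym_meas : cmeas powsym.
Proof.
have c : continuous (fun t : R => sin (t / 2)).
  by move=> t; apply: differentiable_continuous; apply/derivable1_diffP; have [] := sin_half_der t.
have ml : measurable_fun circle (fun t : R => s * ln (2 * sin (t / 2))).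
  apply: measurable_funM; first exact: measurable_cst.
  apply: (measurableT_comp (@measurable_ln R)); apply: measurable_funM; first exact: measurable_cst.
  apply: measurable_funTS; apply: continuous_measurable_fun; exact: c.
apply: cmeasM.
  apply: cmeas_continuous => t; last exact: cst_continuous.
  apply: (@continuous_comp _ _ _ (fun t => s * (pi - t) / 2) expR); last exact: continuous_expR.
  by apply: cvgMl; apply: cvgMr; apply: cvgB; [exact: cvg_cst|exact: cvg_id].
split; rewrite /cis /=.
  by apply: (measurableT_comp _ ml); apply: continuous_measurable_fun; exact: continuous_cos.
by apply: (measurableT_comp _ ml); apply: continuous_measurable_fun; exact: continuous_sin.
Qed.

Lemma cabs_powsym (t : R) : cabs (powsym t) = expR (s * (pi - t) / 2).
Proof. by rewrite /powsym cabsM cabs_cis mulr1 cabs_real ger0_norm ?expR_ge0. Qed.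

Lemma powsym_exp_bound (t : R) : circle t -> `|s * (pi - t) / 2| <= 1 / 128.
Proof.
rewrite /circle /= in_itv /= => /andP[t0 t2].
have p4 := @pihalf_lt2 R; have pt : `|(pi - t) / 2| <= 2 by rewrite ler_norml; apply/andP; split; lra.
rewrite -mulrA normrM; apply: le_trans (ler_pM _ _ s_small pt) _ => //; lra.
Qed.

Lemma powsym_bound (t : R) : circle t -> cabs (powsym t) <= 21 / 20.
Proof.
move=> ct; rewrite cabs_powsym; have := powsym_exp_bound ct; rewrite ler_norml => /andP[_ h].
apply: (@le_trans _ _ (expR (1 / 128))); first by rewrite ler_expR.
rewrite -[1 / 128]opprK expRN; have := expR_ge1Dx (- (1 / 128) : R); have := expR_gt0 (- (1 / 128) : R).
move: (expR _) => x x0 x1; rewrite -(ler_pM2l x0) divff ?gt_eqF//; lra.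
Qed.

Let w (r : R) (t : R) : R[i] := cis (- r * t).

Definition pow_fourier (r : R) : R[i] := avg (fun t => powsym t * w r t).

Let cmeas_w r : cmeas (w r).
Proof.
have cr : continuous (fun t => - r * t : R) by move=> t; apply: cvgMr; exact: cvg_id.
apply: cmeas_continuous => t.
  by apply: (@continuous_comp _ _ _ (fun t => - r * t) cos); [exact: cr|exact: continuous_cos].
by apply: (@continuous_comp _ _ _ (fun t => - r * t) sin); [exact: cr|exact: continuous_sin].
Qed.

Lemma pow_avgable r : avgable (fun t => powsym t * w r t).
Proof.
apply: (avgable_dom (g := fun=> 21 / 20)); [|move=> t ct|exact: rint_cst].
  by apply: cmeasM; [exact: powsym_meas|exact: cmeas_w].
by rewrite cabsM cabs_cis mulr1 powsym_bound.
Qed.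

Let sin_half_gt0 (t : R) : 0 < t < 2 * pi -> 0 < sin (t / 2).
Proof. by move=> /andP[t0 t2]; apply: sin_gt0_pi; apply/andP; split; lra. Qed.

Let cos_double (t : R) : cos t = cos (t / 2) ^+ 2 - sin (t / 2) ^+ 2.
Proof. by rewrite {1}[t]splitr cosD -!expr2. Qed.

Let sin_double (t : R) : sin t = 2 * sin (t / 2) * cos (t / 2).
Proof. by rewrite {1}[t]splitr sinD; ring. Qed.

Lemma powsym_der (t : R) : 0 < t < 2 * pi ->
  cder powsym t (powsym t * ((- s / 2)%:C + 'i * (s * (cos (t / 2) / (2 * sin (t / 2))))%:C)).
Proof.
move=> tI; have s0 := sin_half_gt0 tI.
have d1 : is_derive t 1 (fun y => s * (pi - y) / 2) (- s / 2).
  have := derZ (s / 2) (derB (is_derive_cst pi t 1) (is_derive_id t 1)).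
  rewrite (_ : (fun y => _) = fun y => s * (pi - y) / 2); last by apply/funext => y; ring.
  by congr is_derive; ring.
have d2 := sin_half_der t.
have s20 : 0 < 2 * sin (t / 2) by rewrite mulr_gt0.
have d3 := derZ s (@der_comp R (@ln R) (fun y => 2 * sin (y / 2)) t _ _ (is_derive1_ln s20) (derZ 2 d2)).
have := cderM (cder_real (@der_comp R expR (fun y => s * (pi - y) / 2) t _ _ (is_derive_expR _) d1)) (cder_cis d3).
rewrite -/powsym; apply: cder_eq => //; rewrite /powsym.
have -> : (expR (s * (pi - t) / 2) * (- s / 2))%:C = (expR (s * (pi - t) / 2))%:C * (- s / 2)%:C by rewrite rmorphM.
have -> : (2 * sin (t / 2))^-1 * (2 * (cos (t / 2) * 2^-1)) = cos (t / 2) / (2 * sin (t / 2)).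
  by field; rewrite gt_eqF.
by ring.
Qed.

(** With z = cis t this is d/dt (1 - z)^(i s) = s z (1 - z)^(i s - 1); the second factor is the
    logarithmic derivative found in [powsym_der]. *)
Lemma powsym_ode (t : R) : 0 < t < 2 * pi ->
  (1 - cis t) * ((- s / 2)%:C + 'i * (s * (cos (t / 2) / (2 * sin (t / 2))))%:C) = s%:C * cis t.
Proof.
move=> tI; have s0 := sin_half_gt0 tI; rewrite /cis (cos_double t) (sin_double t).
have := cos2Dsin2 (t / 2); move: (cos (t / 2)) (sin (t / 2)) s0 => c p p0 E.
have Ec : c ^+ 2 = 1 - p ^+ 2 by rewrite -E; ring.
apply/eqP; rewrite eq_complex /= Ec; apply/andP; split; apply/eqP.
  transitivity (s * (c ^+ 2 - p ^+ 2)); last by rewrite Ec; ring.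
  by field; rewrite gt_eqF.
by field; rewrite gt_eqF.
Qed.

Lemma cder_cont (Phi : R -> R[i]) t d : cder Phi t d ->
  {for t, continuous (fun y => complex.Re (Phi y))} /\ {for t, continuous (fun y => complex.Im (Phi y))}.
Proof.
by move=> [[h1 _] [h2 _]]; split; apply: differentiable_continuous; exact/derivable1_diffP.
Qed.

(** The Taylor bound with m = 1 and q = |x| gives exp (1) |x|. *)
Lemma one_sub_cis_le (x : R) : 0 < `|x| <= 1 -> cabs (1 - cis x) <= 4 * `|x|.
Proof.
move=> hx; have := cis_taylor x 1 hx; rewrite cabs_distC.
have -> : cisT 1 x = 1.
  rewrite /cisT big_ord1; apply/eqP; rewrite eq_complex /= ?fact0 ?invr1.
  by apply/andP; split; apply/eqP; ring.
case/andP: hx => x0 _; rewrite expr1 divff ?gt_eqF// => /le_trans; apply.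
rewrite mulrC ler_wpM2r//; have := expR_ge1Dx (- (1 / 2) : R); have := expR_gt0 (- (1 / 2) : R).
have -> : expR (1 : R) = (expR (- (1 / 2) : R))^-1 ^+ 2.
  by rewrite -expRN opprK -expRM_natl; congr expR; lra.
move: (expR _) => y y0 y1; have : y^-1 <= 2 by rewrite invf_ple ?posrE//; lra.
have : 0 <= y^-1 by rewrite invr_ge0 ltW.
move: (y^-1) => z z0 z2; nra.
Qed.

Let psi (r : R) (t : R) : R[i] :=
  - 'i * (r%:C * (powsym t * w r t) - ((r - 1)%:C - 'i * s%:C) * (powsym t * w (r - 1) t)).

(** The factor 1 - z removes the singularity at z = 1: by [powsym_ode] the derivative is a bounded
    combination of h z^(-r) and h z^(1-r). *)
Let psi_der r (t : R) : 0 < t < 2 * pi -> cder (fun y => (1 - cis y) * powsym y * w r y) t (psi r t).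
Proof.
move=> tI; have d1 : cder (fun y => 1 - cis y) t (- ('i * cis t)).
  have [a b] := cder_cis (is_derive_id t 1); rewrite rmorph1 mulr1 in a b.
  split.
    have := derB (is_derive_cst (1 : R) t 1) a.
    rewrite (_ : (fun y => _) = (fun y => complex.Re (1 - cis y))); last by apply/funext => y; rewrite ReB.
    by congr is_derive; rewrite sub0r; case: ('i * cis t).
  have := derB (is_derive_cst (0 : R) t 1) b.
  rewrite (_ : (fun y => _) = (fun y => complex.Im (1 - cis y))); last by apply/funext => y; rewrite ImB.
  by congr is_derive; rewrite sub0r; case: ('i * cis t).
have d2 : is_derive t 1 (fun y => - r * y) (- r) by have := derZ (- r) (is_derive_id t 1); rewrite mulr1.
have := cderM (cderM d1 (powsym_der tI)) (cder_cis d2).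
apply: cder_eq => //; have o := powsym_ode tI.
set D := (- s / 2)%:C + _ in o *; rewrite -/(w r t).
have -> : (1 - cis t) * (powsym t * D) = s%:C * cis t * powsym t by rewrite -o; ring.
have w1 : w (r - 1) t = cis t * w r t by rewrite /w -cisD; congr cis; ring.
rewrite /psi w1 rmorphN rmorphB rmorph1.
have ii : 'i * 'i = -1 :> R[i] by rewrite -expr2 sqrCi.
rewrite (_ : - 'i * _ = - 'i * (r%:C * (powsym t * w r t) - (r%:C - 1) * (powsym t * (cis t * w r t)))
   - ('i * 'i) * s%:C * (powsym t * (cis t * w r t))); last by ring.
rewrite ii; ring.
Qed.

(** (1 - z) h z^(-r) tends to 0 at both ends of the circle, so its derivative [psi] has average 0;
    this is the binomial recursion for the coefficients of (1 - z)^(i s). *)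
Lemma pow_fourier_rec r : r%:C * pow_fourier r = ((r - 1)%:C - 'i * s%:C) * pow_fourier (r - 1).
Proof.
pose K : R := (`|r| + (`|r - 1| + `|s|)) * (21 / 20).
have c1 : cabs ('i : R[i]) = 1.
  by apply/eqP; rewrite -(@eqrXn2 _ 2) ?cabs_ge0// sqr_cabs ReI ImI expr0n add0r.
have psiK t : circle t -> cabs (psi r t) <= K.
  move=> ct; have hb := powsym_bound ct; rewrite /psi cabsM cabsN c1 mul1r.
  apply: le_trans (cabsB _ _) _; rewrite /K [X in _ <= X]mulrDl; apply: lerD.
    by rewrite (cabsM r%:C) cabs_real cabsM cabs_cis mulr1; apply: ler_wpM2l.
  rewrite (cabsM ((r - 1)%:C - 'i * s%:C)) (cabsM (powsym t)) cabs_cis mulr1; apply: ler_pM; rewrite ?cabs_ge0//.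
  by apply: le_trans (cabsB _ _) _; rewrite cabsM c1 mul1r !cabs_real.
have a1 := avgableZ r%:C (pow_avgable r).
have a2 := avgableZ (- ((r - 1)%:C - 'i * s%:C)) (pow_avgable (r - 1)).
have psia : avgable (psi r).
  have := avgableZ (- 'i) (avgableD a1 a2).
  by rewrite (_ : (fun t => _) = psi r)//; apply/funext => t; rewrite /psi; ring.
have E : avg (psi r) = - 'i * (r%:C * pow_fourier r - ((r - 1)%:C - 'i * s%:C) * pow_fourier (r - 1)).
  rewrite -[- (((r - 1)%:C - 'i * s%:C) * _)]mulNr.
  rewrite -(avgZ r%:C (pow_avgable r)) -(avgZ _ (pow_avgable (r - 1))).
  rewrite -avgD// -avgZ; last exact: avgableD.
  by apply: eq_avg => t _; rewrite /psi; ring.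
pose Phi y := (1 - cis y) * powsym y * w r y.
have small (e : R) : 0 < e -> exists2 d : R, 0 < d & forall x, 0 < x < 2 * pi -> x < 0 + d \/ 2 * pi - d < x ->
    cabs (Phi x) <= e.
  move=> e0; exists (Num.min 1 (e / 5)); first by rewrite lt_min ltr01 divr_gt0.
  move=> x xI hx; have cx : circle x.
    by case/andP: xI => x0 x2; rewrite /circle /= in_itv /= !ltW.
  rewrite /Phi (cabsM ((1 - cis x) * powsym x)) (cabsM (1 - cis x) (powsym x)) cabs_cis mulr1; have hb := powsym_bound cx.
  have h4 : cabs (1 - cis x) <= 4 * (e / 5).
    case/andP: xI => x0 x2; case: hx; rewrite ?add0r.
      rewrite lt_min => /andP[x1 xe]; apply: le_trans (one_sub_cis_le _) _.
        by rewrite normr_gt0 gt_eqF//= ger0_norm ltW.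
      by rewrite ger0_norm ?(ltW x0)// ler_wpM2l// ltW.
    rewrite ltrBlDr -ltrBlDl lt_min => /andP[x1 xe].
    have -> : cis x = cis (- (2 * pi - x)).
      by rewrite opprB cisD -cis_conj -[2 * pi]mul1r (cis_2pin R 1) rmorph1 mulr1.
    have y0 : 0 < 2 * pi - x by rewrite subr_gt0.
    apply: le_trans (one_sub_cis_le _) _; rewrite normrN ger0_norm ?(ltW y0)//.
      by rewrite y0 ltW.
    by rewrite ler_wpM2l// ltW.
  apply: le_trans (ler_pM (cabs_ge0 _) (cabs_ge0 _) h4 hb) _; lra.
have avg0 : avg (psi r) = 0.
  case: psia => pR pI; rewrite /avg.
  have itv t : 0 < t < 2 * pi -> circle t.
    by case/andP => t0 t2; rewrite /circle /= in_itv /= !ltW.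
  have psic t : 0 < t < 2 * pi ->
      {for t, continuous (fun y => complex.Re (psi r y))} /\ {for t, continuous (fun y => complex.Im (psi r y))}.
    move=> tI; have dw q : cder (w q) t ('i * (- q)%:C * cis (- q * t)).
      by apply: cder_cis; have := derZ (- q) (is_derive_id t 1); rewrite mulr1.
    have cst c : cder (fun=> c) t 0 by split; exact: is_derive_cst.
    have dd c q := cderM (cst c) (cderM (powsym_der tI) (dw q)).
    have add Phi1 Phi2 x1 x2 : cder Phi1 t x1 -> cder Phi2 t x2 -> cder (fun y => Phi1 y + Phi2 y) t (x1 + x2).
      move=> [p1 p2] [q1 q2]; split.
        have := derD p1 q1; congr is_derive; last by case: x1 x2 {p1 p2 q1 q2} => ? ? [].
        by apply/funext => y; case: (Phi1 y) (Phi2 y) => ? ? [].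
      have := derD p2 q2; congr is_derive; last by case: x1 x2 {p1 p2 q1 q2} => ? ? [].
      by apply/funext => y; case: (Phi1 y) (Phi2 y) => ? ? [].
    have pE : (fun y => - 'i * (r%:C * (powsym y * w r y) +
        - ((r - 1)%:C - 'i * s%:C) * (powsym y * w (r - 1) y))) = psi r.
      by apply/funext => y; rewrite /psi; ring.
    rewrite -pE.
    exact: (cder_cont (cderM (cst (- 'i)) (add _ _ _ _ (dd r%:C r) (dd (- ((r - 1)%:C - 'i * s%:C)) (r - 1))))).
  have z1 : \int[mu]_(t in circle) complex.Re (psi r t) = 0.
    apply: (@Rintegral_eq0 R _ (fun y => complex.Re (Phi y)) 0 (2 * pi) K pi2 pR).
    - by move=> x xI; apply: le_trans (Re_le_cabs _) (psiK _ _); rewrite /circle /= in_itv.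
    - by move=> x xI; have [] := psi_der r xI.
    - by move=> x xI; have [] := psic x xI.
    - move=> e /small[d d0 hd]; exists d => // x xI hx.
      by apply: le_trans (Re_le_cabs _) (hd x xI hx).
  have z2 : \int[mu]_(t in circle) complex.Im (psi r t) = 0.
    apply: (@Rintegral_eq0 R _ (fun y => complex.Im (Phi y)) 0 (2 * pi) K pi2 pI).
    - by move=> x xI; apply: le_trans (Im_le_cabs _) (psiK _ _); rewrite /circle /= in_itv.
    - by move=> x xI; have [] := psi_der r xI.
    - by move=> x xI; have [] := psic x xI.
    - move=> e /small[d d0 hd]; exists d => // x xI hx.
      by apply: le_trans (Im_le_cabs _) (hd x xI hx).
  by rewrite z1 z2 mulr0.
move: E; rewrite avg0 => /esym/eqP; rewrite mulf_eq0 oppr_eq0 (negbTE (neq0Ci _)) /= subr_eq0.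
by move/eqP.
Qed.

(** Where 2 sin (t / 2) >= 1/16 the logarithm is at most 4 in modulus, so the phase is tiny and the
    real part exceeds 9/10. Near z = 1 the phase is uncontrolled, but (1 + cos t) / 2 is close to 1
    and the left side is below - 21/20, which [powsym_bound] allows. *)
Lemma Re_powsym_ge (t : R) : circle t -> 9 / 10 - 2 * ((1 + cos t) / 2) ^+ 2 <= complex.Re (powsym t).
Proof.
move=> ct; have := powsym_exp_bound ct; rewrite ler_norml => /andP[hE1 hE2].
have RE : complex.Re (powsym t) = expR (s * (pi - t) / 2) * cos (s * ln (2 * sin (t / 2))).
  by rewrite /powsym /cis /=; ring.
have s0 : 0 <= sin (t / 2).
  move: ct; rewrite /circle /= in_itv /= => /andP[t0 t2]; apply: sin_ge0_pi; apply/andP; split; lra.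
have s1 : sin (t / 2) <= 1 by exact: sin_le1.
have cE : (1 + cos t) / 2 = 1 - sin (t / 2) ^+ 2.
  rewrite cos_double; have := cos2Dsin2 (t / 2); move: (cos _ ^+ 2) (sin _ ^+ 2) => x y; lra.
have [big|small] := leP (1 / 16) (2 * sin (t / 2)); last first.
  have b := powsym_bound ct; have := le_trans (Re_le_cabs _) b; rewrite ler_norml => /andP[h _].
  apply: le_trans h; rewrite cE; move: (sin _) s0 small => x x0 x1.
  have : x ^+ 2 <= 1 / 1024 by nra.
  move: (x ^+ 2) (sqr_ge0 x) => y y0 y1; nra.
have lnb : `|ln (2 * sin (t / 2))| <= 4.
  have p0 : 0 < 2 * sin (t / 2) by apply: lt_le_trans big; rewrite divr_gt0.
  have l2 : ln (2 : R) <= 1 by have := @le_ln1Dx R 1; rewrite (_ : 1 + 1 = 2 :> R)//; apply; lra.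
  rewrite ler_norml; apply/andP; split.
    apply: (@le_trans _ _ (ln (1 / 16 : R))); last by rewrite ler_ln ?posrE.
    have -> : 1 / 16 = (2 ^+ 4)^-1 :> R by rewrite div1r -natrX.
    by rewrite lnV ?posrE ?exprn_gt0// lnXn// -mulr_natl; lra.
  apply: (@le_trans _ _ (ln (2 : R))); last by lra.
  by rewrite ler_ln ?posrE//; lra.
have yb : `|s * ln (2 * sin (t / 2))| <= 1 / 64.
  rewrite normrM; apply: le_trans (ler_pM _ _ s_small lnb) _ => //; lra.
have cosb : 15 / 16 <= cos (s * ln (2 * sin (t / 2))).
  move: (s * ln _) yb => y yb; have [->|y0] := eqVneq y 0; first by rewrite cos0; lra.
  have hy : 0 < `|y| <= 1 by apply/andP; split; [rewrite normr_gt0|lra].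
  have := le_trans (Re_le_cabs _) (one_sub_cis_le hy).
  have -> : complex.Re (1 - cis y) = 1 - cos y by rewrite ReB.
  by rewrite ler_norml => /andP[_]; move: yb; move: (`|y| : R) => z; lra.
have e1 : 127 / 128 <= expR (s * (pi - t) / 2).
  by apply: le_trans (expR_ge1Dx _); lra.
rewrite RE; apply: (@le_trans _ _ (9 / 10)); first by rewrite gerBl mulr_ge0// sqr_ge0.
apply: (@le_trans _ _ ((127 / 128) * (15 / 16))); first by lra.
by apply: ler_pM => //; lra.
Qed.

(** The mean of ((1 + cos t) / 2)^2 is the squared norm of ((1 + z) / 2)^2, with coefficients 1/4,
    1/2, 1/4, that is 3/8; so the real part of the mean is at least 9/10 - 3/4. Non-vanishing
    suffices, since [inT_pow] divides by this mean. *)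
Lemma pow_fourier0_neq0 : pow_fourier 0 != 0.
Proof.
have E : pow_fourier 0 = avg powsym.
  by apply: eq_avg => t _; rewrite /w oppr0 mul0r cis0 mulr1.
have [iR _] : avgable powsym.
  by have := pow_avgable 0; rewrite (_ : (fun t => _) = powsym)//; apply/funext => t; rewrite /w oppr0 mul0r cis0 mulr1.
pose a k : R[i] := if k == 1%N then 1 / 2 else 1 / 4.
have nE t : cabs (tpoly 3 a t) ^+ 2 = ((1 + cos t) / 2) ^+ 2.
  have -> : tpoly 3 a t = ((1 + cis t) / 2) ^+ 2.
    by rewrite /tpoly !big_ord_recr big_ord0 /= /a /=; field.
  rewrite cabsX; congr (_ ^+ 2).
  rewrite cabsM exprMn cabsV cabs_nat sqr_cabs ReD.
  have -> : complex.Im (1 + cis t) = sin t by rewrite /= add0r.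
  have := cos2Dsin2 t; rewrite /=; move: (cos t) (sin t) => x y h.
  by rewrite (_ : (1 + x) ^+ 2 + y ^+ 2 = 2 * (1 + x)); [field|rewrite -[in RHS](mulr1 2); lra].
have [_ iP] := tpoly_sqint 3 a.
have {}iP : rint (fun t : R => ((1 + cos t) / 2) ^+ 2).
  by rewrite (_ : (fun t => _) = fun t => cabs (tpoly 3 a t) ^+ 2)//; apply/funext => t; rewrite nE.
have P38 : (2 * pi)^-1 * \int[mu]_(t in circle) ((1 + cos t) / 2) ^+ 2 = 3 / 8.
  have := nrm2_tpoly 3 a; rewrite /nrm2; under eq_Rintegral do rewrite nE.
  have aE k : cabs (a k) = if k == 1%N then 1 / 2 else 1 / 4 :> R.
    by rewrite /a; case: ifP => _; rewrite cabsM cabsV cabs1 cabs_nat.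
  by move=> ->; rewrite !big_ord_recr big_ord0 !aE /=; field.
have c9 : (2 * pi)^-1 * \int[mu]_(t in circle) (9 / 10) = 9 / 10 :> R.
  by have := congr1 (fun z => complex.Re z) (avg_cst ((9 / 10 : R)%:C)).
have pos : 0 < (2 * pi)^-1 :> R by rewrite invr_gt0.
have h : (2 * pi)^-1 * \int[mu]_(t in circle) (9 / 10 + (- 2) * ((1 + cos t) / 2) ^+ 2) <=
    complex.Re (avg powsym).
  rewrite /avg /= ler_pM2l//; apply: le_Rintegral => //.
  - exact: measurable_itv.
  - by apply: rintD; [exact: rint_cst|exact: rintZ].
  - by move=> t ct; rewrite mulNr; exact: Re_powsym_ge.
have hI : \int[mu]_(t in circle) (9 / 10 + (- 2) * ((1 + cos t) / 2) ^+ 2) =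
    \int[mu]_(t in circle) (9 / 10) + (- 2) * \int[mu]_(t in circle) ((1 + cos t) / 2) ^+ 2.
  rewrite RintegralD; [|exact: measurable_itv|exact: rint_cst|exact: rintZ].
  by congr (_ + _); apply: RintegralZl => //; exact: measurable_itv.
rewrite hI in h.
rewrite mulrDr c9 mulrCA P38 in h.
by rewrite E; apply: contraTneq h => ->; rewrite -ltNge /=; lra.
Qed.

(* The Taylor coefficients of [(1 - z)^(i s)]. *)
Definition pow_coef (n : nat) : R[i] := \prod_(i < n) ((i%:R - 'i * s%:C) / i.+1%:R).

Lemma pow_fourier_nat n : pow_fourier n%:R = pow_fourier 0 * pow_coef n.
Proof.
elim: n => [|n ih]; first by rewrite /pow_coef big_ord0 mulr1.
have := pow_fourier_rec n.+1%:R; rewrite -[n.+1%:R]natr1 addrK ih /pow_coef big_ord_recr /= natr1.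
have n0 : n.+1%:R != 0 :> R[i] by rewrite pnatr_eq0.
rewrite !rmorph_nat => h; apply: (mulfI n0); rewrite h; move: n0; move: (\prod_(_ < _) _) => x n0.
by field.
Qed.

(** At r = 0 the recursion reads 0 = (- 1 - i s) times the coefficient at - 1, and further down the
    factors r - 1 - i s keep a negative real part. Analyticity of the symbol is thus read off the
    recursion. *)
Lemma pow_fourier_neg n : pow_fourier (- n.+1%:R) = 0.
Proof.
elim: n => [|n ih].
  have := pow_fourier_rec 0; rewrite rmorph0 mul0r sub0r => /esym/eqP; rewrite mulf_eq0 => /orP[/eqP h|/eqP //].
  have := congr1 (fun z => complex.Re z) h; rewrite /= => h1; exfalso.
  suff : (1 : R) = 0 by move/eqP; rewrite oner_eq0.
  by move: h1; lra.
have := pow_fourier_rec (- n.+1%:R); rewrite ih mulr0 => /esym/eqP; rewrite mulf_eq0.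
have -> : - n.+1%:R - 1 = - n.+2%:R :> R by rewrite -[n.+2%:R]natr1; ring.
move=> /orP[/eqP h|/eqP //]; have := congr1 (fun z => complex.Re z) h; rewrite /= => h1; exfalso.
have : 0 < n.+2%:R :> R by []. by move: h1; move: (n.+2%:R : R) => x; lra.
Qed.

Lemma inT_pow : inT (fun j k => if (k <= j)%N then pow_coef (j - k) else 0).
Proof.
have M0 : 0 <= 21 / 20 :> R by rewrite divr_ge0.
have bs := csym_bsym powsym_meas powsym_bound.
have hT : inT (fun j k => fcoef (csym powsym) j k) by have [T hT TE] := TT_sym M0 bs; exists T.
apply: inT_ext (inTZ (pow_fourier 0)^-1 hT) => j k; have p0 := pow_fourier0_neq0.
rewrite (fcoef_csym _ _ powsym_meas powsym_bound) -/(pow_fourier (j%:R - k%:R)).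
case: leqP => h.
  by rewrite -natrB// pow_fourier_nat mulKf.
have -> : j%:R - k%:R = - (k - j.+1)%N.+1%:R :> R.
  by rewrite -subSn// subSS natrB ?opprB// ltnW.
by rewrite pow_fourier_neg mulr0.
Qed.

End PowerSymbol.

(** * Commutator identity and descent from the square *)

Section CommutatorIdeal.
Variable R : realType.
Local Notation H := (H2 R).
Local Notation TT := (@toeplitz_algebra R).
Implicit Types (A B V W S : H -> H) (f : H).

Lemma coef_lower_toeplitz V (a : nat -> R[i]) f j : bounded_op V ->
  (forall j k, V (h2e R k) j = if (k <= j)%N then a (j - k)%N else 0) ->
  V f j = \sum_(k < j.+1) a (j - k)%N * f k.
Proof.
move=> bV VE; apply: ctends_unique (coef_op f j bV) _.
apply: (@ctends_eventually _ (fun=> \sum_(k < j.+1) a (j - k)%N * f k) _ _ j.+1); last exact: ctends_cst.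
move=> n jn; rewrite (big_ord_widen _ (fun k => a (j - k)%N * f k) jn) big_mkcond /=.
by apply: eq_bigr => k _; rewrite VE ltnS; case: ifP; rewrite ?mulr0// mulrC.
Qed.

Lemma pow_coef0 (s : R) : pow_coef s 0 = 1.
Proof. by rewrite /pow_coef big_ord0. Qed.

Lemma pow_coef_rec (s : R) n : n.+1%:R * pow_coef s n.+1 = (n%:R - 'i * s%:C) * pow_coef s n.
Proof.
rewrite /pow_coef big_ord_recr /=; have n0 : n.+1%:R != 0 :> R[i] by rewrite pnatr_eq0.
by rewrite mulrCA [n.+1%:R * (_ / _)]mulrC divfK// mulrC.
Qed.

(** The coefficients of (1 - z)^(- i s) (1 - z)^(i s) = 1. The coefficient recursions give (m + 1)
    g_(m+1) = m g_m, so all g vanish from index 1 on. *)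
Lemma pow_coef_conv (s : R) n : \sum_(i < n.+1) pow_coef (- s) (n - i) * pow_coef s i = (n == 0%N)%:R.
Proof.
pose g n := \sum_(i < n.+1) pow_coef (- s) (n - i) * pow_coef s i; rewrite -/(g n).
have step m : m.+1%:R * g m.+1 = m%:R * g m.
  have -> : m.+1%:R * g m.+1 =
      \sum_(i < m.+2) (m.+1 - i)%N%:R * pow_coef (- s) (m.+1 - i) * pow_coef s i +
      \sum_(i < m.+2) pow_coef (- s) (m.+1 - i) * (i%:R * pow_coef s i).
    rewrite /g mulr_sumr -big_split /=; apply: eq_bigr => -[i /= im] _.
    by rewrite natrB//; ring.
  rewrite big_ord_recr /= subnn mul0r mul0r addr0 [X in _ + X]big_ord_recl /= mul0r mulr0 add0r.
  rewrite -big_split /= /g mulr_sumr; apply: eq_bigr => -[i /= im] _; rewrite /bump leq0n add1n subSS.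
  rewrite subSn// !pow_coef_rec natrB// rmorphN; ring.
case: n => [|n]; first by rewrite /g big_ord1 /= !pow_coef0 mulr1.
change (g n.+1 = 0); apply/eqP; elim: n => [|n ih].
  by have /eqP := step 0%N; rewrite mul0r mulf_eq0 pnatr_eq0.
by have /eqP := step n.+1; rewrite (eqP ih) mulr0 mulf_eq0 pnatr_eq0.
Qed.

Definition is_pow s V : Prop := bounded_op V /\
  forall j k, V (h2e R k) j = if (k <= j)%N then pow_coef s (j - k) else 0.

Lemma pow_mul_inv s V W : is_pow s V -> is_pow (- s) W -> W \o V = id.
Proof.
move=> [bV VE] [bW WE]; apply: op_ext; [exact: bounded_op_comp|exact: bounded_op_id|move=> k].
apply: h2_ext => j; rewrite /= (coef_lower_toeplitz _ _ bW WE) coef_h2e.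
under eq_bigr do rewrite VE.
rewrite -(big_mkord xpredT (fun m => pow_coef (- s) (j - m) * (if (k <= m)%N then pow_coef s (m - k) else 0))).
have /orP[jk|kj] : ((j < k) || (k <= j))%N by lia.
  rewrite big_nat big1 ?ltn_eqF// => m /andP[_ mj].
  by rewrite (_ : (k <= m)%N = false) ?mulr0//; apply/negbTE; lia.
rewrite (@big_cat_nat _ _ _ k) ?(leqW kj)//= big_nat big1 ?add0r => [|m /andP[_ mk]]; last first.
  by rewrite leqNgt mk mulr0.
rewrite -{1}[k]add0n big_addn subSn// big_mkord.
rewrite (eq_bigr (fun i : 'I_(j - k).+1 => pow_coef (- s) (j - k - i) * pow_coef s i)).
  by rewrite pow_coef_conv subn_eq0 eqn_leq kj andbT.
by move=> i _; rewrite leq_addl addnK addnC subnDA.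
Qed.

Definition is_shift S : Prop := bounded_op S /\ forall j k, S (h2e R k) j = (j == k.+1)%:R.

Lemma shift_coef S f j : is_shift S -> S f j = if j is i.+1 then f i else 0.
Proof.
move=> [bS SE]; have := coef_op f j bS; case: j => [|j] h; apply: ctends_unique h _.
  apply: ctends_ext (ctends_cst 0) => n; rewrite big1// => k _.
  by rewrite SE mulr0.
apply: (@ctends_eventually _ (fun=> f j) _ _ j.+1); last exact: ctends_cst.
move=> n jn; rewrite (bigD1 (Ordinal jn)) //= SE eqxx mulr1 big1 ?addr0// => k kj.
by rewrite SE eqSS eq_sym (_ : (nat_of_ord k == j) = false) ?mulr0//; apply/negbTE.
Qed.

Lemma shift_adj_mul S Sa : is_shift S -> bounded_op Sa -> is_adjoint S Sa -> Sa \o S = id.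
Proof.
move=> [bS SE] bSa adj; apply: op_ext; [exact: bounded_op_comp|exact: bounded_op_id|move=> k].
have Sk : S (h2e R k) = h2e R k.+1 by apply: h2_ext => j; rewrite SE coef_h2e.
by rewrite /= Sk; apply: h2_ext => j; rewrite (coef_adjoint _ _ adj) SE conj_bool coef_h2e eqSS eq_sym.
Qed.

Section Cesaro.
Variable C : H -> H.
Hypothesis cC : is_cesaro C.

Let bC : bounded_op C. Proof. by case: cC. Qed.
Let lC : linear C. Proof. by case: bC. Qed.

Lemma cesaro_coef_mul f j : j.+1%:R * C f j = \sum_(k < j.+1) f k.
Proof.
by rewrite (cesaro_coef cC) natrC mulrA divff ?mul1r// pnatr_eq0.
Qed.

(* With [w = C f], the equations [f_k = (k + 1) w_k - k w_(k - 1)] and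
   [n a_n = (n - 1 - i s) a_(n - 1)] give
   [(j + 1) (V w)_j - j (V w)_(j - 1) = (V f)_j - i s (V S w)_j]. *)
Lemma cesaro_pow_commutator s V S : is_pow s V -> is_shift S -> forall f,
  C (V f) - V (C f) = ('i * s%:C) *: C (V (S (C f))).
Proof.
move=> [bV VE] hS f; set w := C f.
have Vc g j : V g j = \sum_(k < j.+1) pow_coef s (j - k) * g k := coef_lower_toeplitz g j bV VE.
have w0 : w 0%N = f 0%N by have := cesaro_coef_mul f 0; rewrite big_ord1 mul1r.
have wS k : k.+2%:R * w k.+1 = f k.+1 + k.+1%:R * w k.
  by rewrite /w !cesaro_coef_mul big_ord_recr /= addrC.
have VS j : V (S w) j.+1 = V w j.
  rewrite !Vc big_ord_recl (shift_coef _ _ hS) mulr0 add0r; apply: eq_bigr => k _.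
  by rewrite (shift_coef _ _ hS) /= /bump leq0n add1n subSS.
have VS0 : V (S w) 0%N = 0 by rewrite Vc big_ord1 (shift_coef _ _ hS) mulr0.
have step j : j.+2%:R * V w j.+1 = V f j.+1 + (j.+1%:R - 'i * s%:C) * V w j.
  have -> : j.+2%:R * V w j.+1 =
      \sum_(k < j.+2) (j.+1 - k)%N%:R * pow_coef s (j.+1 - k) * w k +
      \sum_(k < j.+2) pow_coef s (j.+1 - k) * (k.+1%:R * w k).
    rewrite Vc mulr_sumr -big_split /=; apply: eq_bigr => -[k /= kj] _.
    by rewrite natrB// -!natr1; ring.
  have -> : \sum_(k < j.+2) (j.+1 - k)%N%:R * pow_coef s (j.+1 - k) * w k =
      \sum_(k < j.+1) (j%:R - k%:R - 'i * s%:C) * pow_coef s (j - k) * w k.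
    rewrite big_ord_recr /= subnn mul0r mul0r addr0; apply: eq_bigr => -[k /= kj] _.
    by rewrite subSn// pow_coef_rec natrB.
  have -> : \sum_(k < j.+2) pow_coef s (j.+1 - k) * (k.+1%:R * w k) =
      V f j.+1 + \sum_(k < j.+1) pow_coef s (j - k) * (k.+1%:R * w k).
    have t0 : pow_coef s (j.+1 - 0) * (1%:R * w 0%N) = pow_coef s (j.+1 - 0) * f 0%N by rewrite mul1r w0.
    rewrite [LHS]big_ord_recl [X in _ = X + _]Vc [X in _ = X + _]big_ord_recl -addrA; congr (_ + _); first exact: t0.
    rewrite -big_split; by apply: eq_bigr => -[k kj] _; rewrite /= /bump leq0n add1n subSS wS mulrDr.
  rewrite addrCA; congr (_ + _); rewrite -big_split /= Vc mulr_sumr; apply: eq_bigr => -[k /= kj] _.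
  by rewrite -!natr1; ring.
have key j : j.+1%:R * V w j = \sum_(k < j.+1) (V f k - 'i * s%:C * V (S w) k).
  elim: j => [|j ih]; first by rewrite big_ord1 VS0 mulr0 subr0 mul1r !Vc !big_ord1 w0.
  by rewrite big_ord_recr /= -ih VS step; ring.
apply: h2_ext => j; have n0 : j.+1%:R != 0 :> R[i] by rewrite pnatr_eq0.
rewrite h2coefB h2coefZ; apply: (mulfI n0).
rewrite mulrBr cesaro_coef_mul key mulrCA cesaro_coef_mul mulr_sumr -sumrB.
by apply: eq_bigr => k _; rewrite opprB addrC subrK.
Qed.

Let U f := f - C f.

Lemma iter_one_sub_cesaro_bound n : opbound (iter n U) 1.
Proof.
have [D [bD DE]] := inv_nat_diag_op R; have [Cs bCs adjC] := adjoint_exists bC.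
have hU := one_sub_cesaro_bound cC bCs adjC bD DE.
elim: n => [|n ih] f; first by rewrite mul1r.
by rewrite iterS; apply: le_trans (hU _) _; rewrite mul1r ih.
Qed.

(** id - U^n = C (id + U + ... + U^(n-1)), since id - U = C. *)
Lemma one_sub_iter_factor n : TT C ->
  exists2 Q, TT Q & forall f, C (Q f) = f - iter n U f.
Proof.
move=> hC; elim: n => [|n [Q hQ QE]].
  by exists (fun=> 0) => [|f]; [exact: TT0|rewrite lin0// subrr].
have hU : TT U.
  rewrite (_ : U = id \+ (fun f => (-1) *: C f)); last by apply/funext => f; rewrite /U /= scaleN1r.
  by apply: TTD; [exact: TT_id|exact: TTZ].
exists ((Q \o U) \+ id) => [|f]; first by apply: TTD; [exact: TT_comp|exact: TT_id].
have Uf : U f + C f = f by rewrite /U subrK.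
transitivity (C (Q (U f)) + C f); first by rewrite -linD.
by rewrite QE -iterSr addrAC Uf.
Qed.

(** Sum id - U^k = C P_k over k < n and multiply by C = id - U; the powers telescope to n C - (id -
    U^n). *)
Lemma cesaro_abel_factor n : TT C ->
  exists2 Q, TT Q & forall f, C (C (Q f)) = n%:R *: C f - (f - iter n U f).
Proof.
move=> hC; elim: n => [|n [Q hQ QE]].
  by exists (fun=> 0) => [|f]; [exact: TT0|rewrite !lin0// scale0r subrr subr0].
have [P hP PE] := one_sub_iter_factor n hC.
exists (Q \+ P) => [|f]; first exact: TTD.
have key (a b c d e : H) : a - (b - c) + (d - e) = a + d - (b - (c - e)).
  by apply: h2_ext => j; rewrite !(h2coefD, h2coefN); ring.
have US : iter n.+1 U f = iter n U f - C (iter n U f) by [].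
transitivity (C (C (Q f)) + C (C (P f))); first by rewrite -linD// -linD.
have nS : n.+1%:R *: C f = n%:R *: C f + C f by rewrite !scaler_nat mulrSr.
by rewrite QE PE (linB f (iter n U f) lC) US nS key.
Qed.

Lemma cesaro_sqr_ideal (I : set (H -> H)) : TT C -> closed_ideal TT I -> I (C \o C) -> I C.
Proof.
move=> hC [IT _ IZ IM Inc] h; apply: (norm_closed_opbound Inc _ bC).
  by move=> A /IT; exact: TT_bounded.
move=> e e0; have [n hn] : exists n : nat, n.+1%:R^-1 < e / 2 by apply: exists_inv_nat_lt; rewrite divr_gt0.
have [Q hQ QE] := cesaro_abel_factor n.+1 hC.
exists (fun f => (n.+1%:R)^-1 *: (C \o C \o Q) f); first by apply: IZ; have [] := IM _ _ hQ h.
have n0 : n.+1%:R != 0 :> R[i] by rewrite pnatr_eq0.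
move=> f; have -> : C f - n.+1%:R^-1 *: (C \o C \o Q) f = (n.+1%:R)^-1 *: (f - iter n.+1 U f).
  by rewrite /= QE scalerBr scalerA mulVf// scale1r opprB addrC subrK.
rewrite h2normZ -natrC cabs_real ger0_norm ?invr_ge0//.
have h2 : h2norm (f - iter n.+1 U f) <= 2 * h2norm f.
  apply: le_trans (h2normB _ _) _; have := iter_one_sub_cesaro_bound n.+1 f; rewrite mul1r; lra.
apply: le_trans (_ : _ <= e / 2 * (2 * h2norm f)) _; last by rewrite mulrA divfK.
by apply: ler_pM; rewrite ?invr_ge0 ?h2norm_ge0// ltW.
Qed.

Theorem cesaro_in_commutator_ideal : commutator_ideal TT C.
Proof.
move=> I [cI hI]; have hC := cesaro_in_toeplitz cC.
apply: (cesaro_sqr_ideal hC cI); case: cI => IT [I0 ID] IZ IM Inc.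
have h0 : 0 < 1 / 256 :> R by lra.
have [s [s0 s1 sn0]] : exists s : R, [/\ `|s| <= 1 / 256, `|- s| <= 1 / 256 & 'i * s%:C != 0].
  exists (1 / 256); rewrite normrN (ger0_norm (ltW h0)); split; [exact: lexx|exact: lexx|].
  by rewrite mulf_neq0 ?neq0Ci//; apply/eqP => -[] h; rewrite h ltxx in h0.
have [V hV VE] := inT_pow s0; have [W hW WE] := inT_pow s1; have [S hS SE] := shift_exists R.
have pV : is_pow s V by split; [exact: TT_bounded|].
have pW : is_pow (- s) W by split; [exact: TT_bounded|].
have pS : is_shift S by split; [exact: TT_bounded|].
have [Sa bSa adjS] := adjoint_exists (TT_bounded hS).
have hSa := TT_adj hS bSa adjS.
have comm A B : TT A -> TT B -> I ((A \o B) \- (B \o A)) by move=> hA hB; apply: hI; exists A, B.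
have h1 : I (C \o (V \o S \o C)).
  have := IZ ('i * s%:C)^-1 _ (comm _ _ hC hV); congr I; apply/funext => f /=.
  by rewrite (cesaro_pow_commutator pV pS) scalerA mulVf// scale1r.
(* C V S C and V S C C differ by the commutator of [C] and V S, multiplied on the right by [C]. *)
have h2 : I (V \o S \o (C \o C)).
  have [_ h] := IM _ _ hC (comm _ _ hC (TT_comp hV hS)).
  have := ID _ _ h1 (IZ (-1) _ h); congr I; apply/funext => f /=.
  by rewrite scaleN1r opprB addrC subrK.
(* S^* W is a left inverse of V S inside the algebra. *)
have [h3 _] := IM _ _ (TT_comp hSa hW) h2.
move: h3; congr I; apply/funext => f /=.
have WV := congr1 (fun F => F (S (C (C f)))) (pow_mul_inv pV pW); rewrite /= in WV.
have SS := congr1 (fun F => F (C (C f))) (shift_adj_mul pS bSa adjS); rewrite /= in SS.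
by rewrite WV SS.
Qed.

End Cesaro.

End CommutatorIdeal.

Local Open Scope complex_scope.

Theorem corollary10p2 (R : realType) (C Gamma : H2 R -> H2 R)
  (C_bounded : bounded_op C)
  (C_basis : forall k : nat,
    \sum_(k <= j < N) ((j.+1%:R : R[i])^-1 *: h2e R j) @[N --> \oo] --> C (h2e R k))
  (Gamma_bounded : bounded_op Gamma)
  (Gamma_matrix : forall j k : nat,
    h2ip (Gamma (h2e R k)) (h2e R j) = ((j + k + 1)%:R : R[i])^-1) :
  [/\ commutator_ideal (@toeplitz_algebra R) C,
      essnorm C = 2,
      spec_ess C = [set w : R[i] | `|w - 1| = 1],
      essnorm Gamma = pi &
      spec_ess Gamma = [set x%:C | x in `[0, (pi : R)]]].
Proof.
have cC := cesaro_of_basis C_bounded C_basis.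
have hG := hilbert_of_matrix Gamma_bounded Gamma_matrix.
split.
- exact: cesaro_in_commutator_ideal.
- exact: cesaro_essnorm.
- exact: cesaro_spec_ess.
- exact: hilbert_essnorm.
- exact: hilbert_spec_ess.
Qed.
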